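(* Let $d\ge1$ and let $1\le p,q,r,s\le\infty$ satisfy $$\frac1q\ge\left|\frac1r-\frac12\right|.$$ There is a constant $C>0$ such that for all $a\in W(L^p,L^q)(\mathbb{R}^{2d})$ and all $\varphi_1,\varphi_2\in M^1(\mathbb{R}^d)$ the localization operator $A_a^{\varphi_1,\varphi_2}$ is bounded on $W(L^r,L^s)(\mathbb{R}^d)$, with $$\|A_a^{\varphi_1,\varphi_2}\|_{B(W(L^r,L^s))}\le C\,\|a\|_{W(L^p,L^q)}\,\|\varphi_1\|_{M^1}\,\|\varphi_2\|_{M^1}.$$
   Context: STFT: $V_\varphi f(x,\omega)=\int_{\mathbb{R}^d} f(t)\,\overline{\varphi(t-x)}\,e^{-2\pi i\omega t}\,dt$, $(x,\omega)\in\mathbb{R}^{2d}$. Localization operator: with $T_xf(t)=f(t-x)$, $M_\omega f(t)=e^{2\pi i\omega t}f(t)$, the operator with symbol $a$ and windows $\varphi_1,\varphi_2$ is formally $A_a^{\varphi_1,\varphi_2}f(t)=\int_{\mathbb{R}^{2d}}a(x,\omega)V_{\varphi_1}f(x,\omega)M_\omega T_x\varphi_2(t)\,dx\,d\omega$. It is interpreted weakly: $\langle A_a^{\varphi_1,\varphi_2}f,g\rangle=\int_{\mathbb{R}^{2d}}a(x,\omega)\,V_{\varphi_1}f(x,\omega)\,\overline{V_{\varphi_2}g(x,\omega)}\,dx\,d\omega$ for $f$ in the domain space and $g\in\mathcal{S}(\mathbb{R}^d)$ (the integral converges absolutely for the symbols, windows and functions considered here), where $\langle\cdot,\cdot\rangle$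 extends the inner product $\langle f,g\rangle=\int f\bar g$ of $L^2$. $B(X)$ is the space of bounded linear operators on $X$ with operator norm. Wiener amalgam space: $W(L^p,L^q)(\mathbb{R}^n)$ is the space of measurable functions $f$ on $\mathbb{R}^n$ with finite norm $\|f\|_{W(L^p,L^q)}=\Big(\sum_{k\in\mathbb{Z}^n}\|f\,\chi_{k+[0,1)^n}\|_{L^p}^q\Big)^{1/q}$ (supremum over $k$ if $q=\infty$). Modulation space $M^1(\mathbb{R}^d)$: for a fixed nonzero $\gamma\in\mathcal{S}(\mathbb{R}^d)$, the space of tempered distributions $\varphi$ with $\|\varphi\|_{M^1}=\|V_\gamma \varphi\|_{L^1(\mathbb{R}^{2d})}<\infty$; different $\gamma$ give equivalent norms. *)

(* Defs.v *)
From HB Require Import structures.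
From mathcomp Require Import all_boot all_order all_algebra.
From mathcomp Require Import all_classical all_reals all_analysis.
From mathcomp Require Import complex.
Set Implicit Arguments.
Unset Strict Implicit.
Unset Printing Implicit Defensive.
Import Order.TTheory GRing.Theory Num.Theory.
Import numFieldNormedType.Exports.
Local Open Scope classical_set_scope.
Local Open Scope ring_scope.

(* R^n as a measurable space: n-tuples with the product of the Borel
   sigma-algebras. Functions are only ever compared up to null sets, so working
   with Borel instead of Lebesgue measurable functions loses nothing. *)
Notation Rn R n := (n.-tuple (measurableTypeR R)).

Lemma sigma_finite_product (d1 d2 : measure_display) (T1 : measurableType d1)
    (T2 : measurableType d2) (R : realType)
    (m1 : {sigma_finite_measure set T1 -> \bar R})
    (m2 : {sigma_finite_measure set T2 -> \bar R}) :
  sigma_finite setT (m1 \x m2)%E.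
Proof.
have /sigma_finiteP[F [TF ndF Foo]] := sigma_finiteT m1.
have /sigma_finiteP[G [TG ndG Goo]] := sigma_finiteT m2.
exists (fun n => F n `*` G n).
  rewrite -setXTT TF TG predeqE => -[x y]; split.
    move=> [/= [n _ Fnx] [k _ Gky]]; exists (maxn n k) => //; split.
    - by move: x Fnx; exact/subsetPset/ndF/leq_maxl.
    - by move: y Gky; exact/subsetPset/ndG/leq_maxr.
  by move=> [n _ []/= ? ?]; split; exists n.
move=> k; have [? ?] := Foo k; have [? ?] := Goo k.
split; first exact: measurableX.
by rewrite product_measure1E// lte_mul_pinfty// ge0_fin_numE.
Qed.

Section lebesgue_measure_Rn_succ.
Context (R : realType) (n : nat).
Variable m : {sigma_finite_measure set (Rn R n) -> \bar R}.

Definition consRn (z : measurableTypeR R * Rn R n) : Rn R n.+1 :=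
  [the n.+1.-tuple _ of z.1 :: z.2].

Definition unconsRn (t : Rn R n.+1) : measurableTypeR R * Rn R n :=
  (tnth t ord0, [tuple of behead t]).

Lemma measurable_consRn : measurable_fun setT consRn.
Proof. by apply: measurable_cons. Qed.

Lemma measurable_unconsRn : measurable_fun setT unconsRn.
Proof.
apply: measurable_fun_pair; first exact: measurable_tnth.
exact: measurable_behead.
Qed.

Lemma consRnK : cancel consRn unconsRn.
Proof. by case=> x t; congr pair; apply: val_inj. Qed.

Let lebesgue1 : {sigma_finite_measure set (measurableTypeR R) -> \bar R} :=
  lebesgue_measure.

Definition lebesgue_succ : set (Rn R n.+1) -> \bar R :=
  pushforward (lebesgue1 \x m)%E consRn.

Let lebesgue_succ0 : lebesgue_succ set0 = 0%E.
Proof. by rewrite /lebesgue_succ /pushforward preimage_set0 measure0. Qed.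

Let lebesgue_succ_ge0 A : (0 <= lebesgue_succ A)%E.
Proof. by rewrite /lebesgue_succ /pushforward; exact: measure_ge0. Qed.

Let lebesgue_succ_sigma_additive : semi_sigma_additive lebesgue_succ.
Proof.
move=> F mF tF mUF; rewrite /lebesgue_succ /pushforward preimage_bigcup.
apply: measure_semi_sigma_additive.
- by move=> k; rewrite -[X in measurable X]setTI; exact: measurable_consRn.
- apply/trivIsetP => /= i j _ _ ij; rewrite -preimage_setI.
  by move/trivIsetP : tF => /(_ _ _ _ _ ij) ->//; rewrite preimage_set0.
- by rewrite -preimage_bigcup -[X in measurable X]setTI;
    exact: measurable_consRn.
Qed.

HB.instance Definition _ := isMeasure.Build _ _ _ lebesgue_succ
  lebesgue_succ0 lebesgue_succ_ge0 lebesgue_succ_sigma_additive.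

Let lebesgue_succ_sigma_finite : sigma_finite setT lebesgue_succ.
Proof.
have [F FT mF] := sigma_finite_product lebesgue1 m.
exists (fun k => unconsRn @^-1` F k).
  by rewrite -preimage_bigcup -FT preimage_setT.
move=> k; split.
  rewrite -[X in measurable X]setTI; apply: measurable_unconsRn => //.
  exact: (mF k).1.
rewrite /lebesgue_succ /pushforward -comp_preimage.
by rewrite (_ : unconsRn \o consRn = id) ?preimage_id;
  [exact: (mF k).2|exact/funext/consRnK].
Qed.

HB.instance Definition _ := Measure_isSigmaFinite.Build _ _ _ lebesgue_succ
  lebesgue_succ_sigma_finite.

Definition lebesgue_measure_succ :
  {sigma_finite_measure set (Rn R n.+1) -> \bar R} := lebesgue_succ.

End lebesgue_measure_Rn_succ.

Fixpoint lebesgue_Rn (R : realType) (n : nat) :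
    {sigma_finite_measure set (Rn R n) -> \bar R} :=
  match n with
  | 0 => dirac ([tuple] : Rn R 0)
  | k.+1 => lebesgue_measure_succ (lebesgue_Rn R k)
  end.
Arguments lebesgue_Rn : clear implicits.

Section complex_valued.
Context (dT : measure_display) (T : measurableType dT) (R : realType).
Variable mu : {measure set T -> \bar R}.
Implicit Types f : T -> R[i].

Definition cmeasurable f :=
  measurable_fun setT (fun x => complex.Re (f x)) /\
  measurable_fun setT (fun x => complex.Im (f x)).

Definition cintegrable f :=
  mu.-integrable setT (fun x => (complex.Re (f x))%:E) /\
  mu.-integrable setT (fun x => (complex.Im (f x))%:E).

Definition cintegral f : R[i] :=
  Complex (\int[mu]_x complex.Re (f x)) (\int[mu]_x complex.Im (f x)).

Definition cLnorm (p : \bar R) f : \bar R :=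
  Lnorm mu p (fun x => (Normc.normc (f x))%:E).

End complex_valued.

Section Rn_operations.
Context (R : realType) (n : nat).
Implicit Types (x w t : Rn R n) (f : Rn R n -> R[i]).

Definition coord x (i : 'I_n) : R := tnth x i.

Definition subRn t x : Rn R n := [tuple (coord t i - coord x i : measurableTypeR R) | i < n].

Definition dotRn x w : R := \sum_(i < n) coord x i * coord w i.

(* e^{i theta} *)
Definition expi (theta : R) : R[i] := Complex (cos theta) (sin theta).

Definition translation x f : Rn R n -> R[i] := fun t => f (subRn t x).

Definition modulation w f : Rn R n -> R[i] :=
  fun t => expi (2 * pi * dotRn w t) * f t.

Definition inner f g : R[i] :=
  cintegral (lebesgue_Rn R n) (fun t => f t * conjc (g t)).

(* A point z = (x, w) of phase space R^{2n} lists first x, then w. *)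
Definition posn (z : Rn R (n + n)) : Rn R n :=
  [tuple tnth z (lshift n i) | i < n].

Definition freq (z : Rn R (n + n)) : Rn R n :=
  [tuple tnth z (rshift n i) | i < n].

End Rn_operations.

Section wiener_amalgam.
Context (R : realType) (n : nat).
Implicit Types (f : Rn R n -> R[i]) (p q : \bar R).

Definition cube (k : n.-tuple int) : set (Rn R n) :=
  [set x | forall i : 'I_n,
    (tnth k i)%:~R <= coord x i < (tnth k i)%:~R + 1].

Definition local_norm p f (k : n.-tuple int) : \bar R :=
  cLnorm (lebesgue_Rn R n) p (fun x => f x * (\1_(cube k) x)%:C%C).

Definition amalgam_norm p q f : \bar R :=
  match q with
  | q'%:E => (\esum_(k in [set: n.-tuple int]) local_norm p f k `^ q') `^ q'^-1
  | _ => ereal_sup (range (local_norm p f))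
  end%E.

Definition amalgam p q : set (Rn R n -> R[i]) :=
  [set f | cmeasurable f /\ (amalgam_norm p q f < +oo)%E].

(* Operators act on functions, whereas the elements of W(L^p, L^q) are classes
   modulo null sets. Linearity up to null sets together with a finite operator
   norm makes A well defined on classes: if f = g almost everywhere then
   A f = A g almost everywhere. *)
Definition amalgam_opnorm p q (A : (Rn R n -> R[i]) -> (Rn R n -> R[i])) :=
  ereal_sup [set amalgam_norm p q (A f) |
    f in [set f | amalgam p q f /\ (amalgam_norm p q f <= 1)%E]].

Definition amalgam_bounded_operator p q
    (A : (Rn R n -> R[i]) -> (Rn R n -> R[i])) :=
  [/\ forall f, amalgam p q f -> amalgam p q (A f),
      forall (c : R[i]) f g, amalgam p q f -> amalgam p q g ->
        {ae lebesgue_Rn R n, forall x,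
          A (fun t => c * f t + g t) x = c * A f x + A g x} &
      (amalgam_opnorm p q A < +oo)%E].

End wiener_amalgam.

Section schwartz.
Context (R : realType) (n : nat).
Implicit Types (f psi : Rn R n -> R[i]) (u : (Rn R n -> R[i]) -> R[i]).

(* The measurable structure lives on tuples and the normed structure on row
   vectors; the following two maps identify them. *)
Definition tuple_of_row (v : 'rV[R]_n) : Rn R n := [tuple v ord0 i | i < n].

Definition row_of_tuple (x : Rn R n) : 'rV[R]_n := \row_(i < n) coord x i.

Definition has_partial (i : 'I_n) f (x : Rn R n) :=
  derivable (fun v => complex.Re (f (tuple_of_row v)))
    (row_of_tuple x) (delta_mx ord0 i) /\
  derivable (fun v => complex.Im (f (tuple_of_row v)))
    (row_of_tuple x) (delta_mx ord0 i).

Definition partial (i : 'I_n) f : Rn R n -> R[i] := fun x =>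
  Complex
    ('D_(delta_mx ord0 i) (fun v => complex.Re (f (tuple_of_row v)))
       (row_of_tuple x))
    ('D_(delta_mx ord0 i) (fun v => complex.Im (f (tuple_of_row v)))
       (row_of_tuple x)).

Definition partials (beta : seq 'I_n) f : Rn R n -> R[i] :=
  foldr partial f beta.

Definition weighted_partial (alpha : {ffun 'I_n -> nat}) (beta : seq 'I_n) f
    (x : Rn R n) : R :=
  `|\prod_(i < n) coord x i ^+ alpha i| * Normc.normc (partials beta f x).

(* Continuity of the iterated partial derivatives need not be required: they
   are Lipschitz, their own partial derivatives being bounded. *)
Definition schwartz : set (Rn R n -> R[i]) :=
  [set f | (forall beta i x, has_partial i (partials beta f) x) /\
    forall alpha beta, exists M : R,
      forall x, weighted_partial alpha beta f x <= M].

(* M bounds the seminorms sup |x^alpha d^beta psi| with |alpha|, |beta| <= N *)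
Definition seminorms_le (N : nat) psi (M : R) :=
  forall (alpha : {ffun 'I_n -> nat}) (beta : seq 'I_n),
    (\sum_(i < n) alpha i <= N)%N -> (size beta <= N)%N ->
    forall x, weighted_partial alpha beta psi x <= M.

(* Only the values of u on Schwartz functions are meaningful. *)
Definition tempered_distribution u :=
  (forall (c : R[i]) psi1 psi2, schwartz psi1 -> schwartz psi2 ->
    u (fun t => c * psi1 t + psi2 t) = c * u psi1 + u psi2) /\
  exists (N : nat) (C : R), forall psi M, schwartz psi ->
    seminorms_le N psi M -> Normc.normc (u psi) <= C * M.

(* u is the distribution psi |-> int phi psi *)
Definition represents (phi : Rn R n -> R[i]) u :=
  cmeasurable phi /\
  forall psi, schwartz psi ->
    cintegrable (lebesgue_Rn R n) (fun t => phi t * psi t) /\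
    u psi = cintegral (lebesgue_Rn R n) (fun t => phi t * psi t).

End schwartz.

Section time_frequency.
Context (R : realType) (d : nat).
Implicit Types (f g phi gamma : Rn R d -> R[i]) (u : (Rn R d -> R[i]) -> R[i]).
Implicit Types (x w : Rn R d) (z : Rn R (d + d)).

Definition stft_integrand phi f x w : Rn R d -> R[i] := fun t =>
  f t * conjc (phi (subRn t x)) * expi (- (2 * pi * dotRn w t)).

Definition stft phi f x w : R[i] :=
  cintegral (lebesgue_Rn R d) (stft_integrand phi f x w).

(* V_gamma u (x, w) = <u, M_w T_x gamma> with the sesquilinear pairing, that is
   the value of the linear functional u at the conjugate of M_w T_x gamma. *)
Definition stft_distribution gamma u x w : R[i] :=
  u (fun t => conjc (modulation w (translation x gamma) t)).

Definition M1_norm gamma u : \bar R :=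
  cLnorm (lebesgue_Rn R (d + d)) 1
    (fun z => stft_distribution gamma u (posn z) (freq z)).

Definition M1 gamma : set ((Rn R d -> R[i]) -> R[i]) :=
  [set u | tempered_distribution u /\ (M1_norm gamma u < +oo)%E].

Definition localization_integrand (a : Rn R (d + d) -> R[i]) phi1 phi2 f g :
    Rn R (d + d) -> R[i] := fun z =>
  a z * stft phi1 f (posn z) (freq z) * conjc (stft phi2 g (posn z) (freq z)).

(* A is the operator A_a^{phi1, phi2} on X, in the weak sense. The integrals of
   the library are total, so their absolute convergence is stated explicitly. *)
Definition is_localization_operator (a : Rn R (d + d) -> R[i]) phi1 phi2
    (X : set (Rn R d -> R[i])) (A : (Rn R d -> R[i]) -> (Rn R d -> R[i])) :=
  forall f g, X f -> schwartz g ->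
  [/\ forall x w, cintegrable (lebesgue_Rn R d) (stft_integrand phi1 f x w),
      forall x w, cintegrable (lebesgue_Rn R d) (stft_integrand phi2 g x w),
      cintegrable (lebesgue_Rn R (d + d))
        (localization_integrand a phi1 phi2 f g),
      cintegrable (lebesgue_Rn R d) (fun t => A f t * conjc (g t)) &
      inner (A f) g = cintegral (lebesgue_Rn R (d + d))
        (localization_integrand a phi1 phi2 f g)].

End time_frequency.

(* Main.v *)
(* Let psi_F(tau) be the L^rho norm of F on the cube tau + [-2, 2]^d. The key is
   the bound, with rho1 = min(r, 2) and rho2 = min(r', 2),
     int |a V_phi1 f V_phi2 g| <=
       C |a| int int Phi1(z1) Phi2(z2) int psi_f(tau + x1) psi_g(tau + x2) dtau dz1 dz2,
   where Phi_i, a translate of |V_gamma phi_i|, is integrable and x_i is the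
   position of z_i. A reproducing formula, whose averages absorb phi_i into Phi_i,
   reduces the left-hand side to a compactly supported window. For such a window
   |V f(x, .)| is governed, uniformly for x near tau, by the Fourier transform of f
   cut off near tau, so that Hausdorff-Young and Hoelder in the frequency variable
   give the bound; the condition on q says that the reciprocals of q and of the
   conjugates of rho1, rho2 add up to at least 1. Since the bound is continuous on
   a weighted L^2 space of functions g, a density A f represents the form. Testing
   against g supported in one cube yields its local L^r norm by duality, as an
   average of psi_f over translations; such averages preserve l^s norms. *)
Require Import Defs.
From HB Require Import structures.
From mathcomp Require Import all_boot all_order all_algebra.
From mathcomp Require Import all_classical all_reals all_analysis.
From mathcomp Require Import measurable_realfun.
From mathcomp Require Import complex.
From mathcomp Require Import ring lra.
Set Implicit Arguments.
Unset Strict Implicit.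
Unset Printing Implicit Defensive.
Import Order.TTheory GRing.Theory Num.Theory.
Import numFieldNormedType.Exports.
Local Open Scope classical_set_scope.
Local Open Scope ring_scope.

(** Hausdorff-Young stops at exponent 2, so one of [f], [g] is measured locally in L^2 and the other
    in L^min(r, r'); this costs nothing on cubes of measure one. The reciprocals of the two
    conjugate exponents then fall short of 1 by exactly |1/r - 1/2|, and the symbol has to supply
    the rest. When r or s is infinite there is no convenient dense class on which to define A and
    extend it. Hence A f is constructed for each f separately as a density, and its linearity is
    recovered afterwards from the uniqueness of densities. The test functions are those dominated by
    a multiple of [weight]: they include the Schwartz functions, on which the operator is defined,
    and the bounded functions on one cube, on which duality is carried out. The compactly supported
    window is a product of tents, whose Fourier transform is explicit and integrable, so that
    inversion in L^1 suffices. Only some constant is wanted, so sharp inequalities are replaced by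
    pointwise ones losing a factor 2. Those need strictly positive parameters; this explains the
    separate treatment of zero norms and the shift by [e] in [le_shifted_product]. *)

Notation normc := Normc.normc.

(** * Complex-valued functions and integrals *)

Section normc_theory.
Context {R : realType}.
Implicit Types (z : R[i]) (a b : R).

Lemma normc_ge0 z : 0 <= normc z.
Proof. by case: z => a b; exact: sqrtr_ge0. Qed.

Lemma normc_Re z : `|complex.Re z| <= normc z.
Proof.
case: z => a b /=; rewrite -sqrtr_sqr ler_wsqrtr//.
by rewrite lerDl sqr_ge0.
Qed.

Lemma normc_Im z : `|complex.Im z| <= normc z.
Proof.
case: z => a b /=; rewrite -sqrtr_sqr ler_wsqrtr//.
by rewrite lerDr sqr_ge0.
Qed.

Lemma normc_le_ReIm z : normc z <= `|complex.Re z| + `|complex.Im z|.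
Proof.
case: z => a b /=; rewrite -[leRHS]ger0_norm ?addr_ge0// -sqrtr_sqr ler_wsqrtr//.
rewrite sqrrD !real_normK ?num_real// -addrA lerD2l lerDr.
by rewrite mulrn_wge0// mulr_ge0.
Qed.

Lemma normc_sqr z : normc z ^+ 2 = complex.Re z ^+ 2 + complex.Im z ^+ 2.
Proof. by case: z => a b /=; rewrite sqr_sqrtr// addr_ge0 ?sqr_ge0. Qed.

Lemma normcJ z : normc (conjc z) = normc z.
Proof. by case: z => a b /=; rewrite sqrrN. Qed.

Lemma normc_real a : normc a%:C%C = `|a|.
Proof. by rewrite /= expr0n/= addr0 sqrtr_sqr. Qed.

Lemma normc_expi a : normc (expi a) = 1.
Proof. by rewrite /= cos2Dsin2 sqrtr1. Qed.

Lemma expiD a b : expi (a + b) = expi a * expi b.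
Proof.
rewrite /expi /GRing.mul/=; congr Complex.
  by rewrite cosD.
by rewrite sinD [RHS]addrC mulrC [X in _ + X]mulrC mulrC.
Qed.

Lemma conjc_expi a : conjc (expi a) = expi (- a).
Proof. by rewrite /expi /= cosN sinN. Qed.

Lemma expi0 : expi (0 : R) = 1.
Proof. by rewrite /expi cos0 sin0. Qed.

Lemma ReM z1 z2 : complex.Re (z1 * z2) =
  complex.Re z1 * complex.Re z2 - complex.Im z1 * complex.Im z2.
Proof. by case: z1 => a b; case: z2. Qed.

Lemma ImM z1 z2 : complex.Im (z1 * z2) =
  complex.Re z1 * complex.Im z2 + complex.Im z1 * complex.Re z2.
Proof. by case: z1 => a b; case: z2. Qed.

Lemma ReD z1 z2 : complex.Re (z1 + z2) = complex.Re z1 + complex.Re z2.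
Proof. by case: z1 => a b; case: z2. Qed.

Lemma ImD z1 z2 : complex.Im (z1 + z2) = complex.Im z1 + complex.Im z2.
Proof. by case: z1 => a b; case: z2. Qed.

Lemma ReJ z : complex.Re (conjc z) = complex.Re z. Proof. by case: z. Qed.
Lemma ImJ z : complex.Im (conjc z) = - complex.Im z. Proof. by case: z. Qed.

Lemma ReN z : complex.Re (- z) = - complex.Re z. Proof. by case: z. Qed.
Lemma ImN z : complex.Im (- z) = - complex.Im z. Proof. by case: z. Qed.

Lemma complex_eq z1 z2 : complex.Re z1 = complex.Re z2 ->
  complex.Im z1 = complex.Im z2 -> z1 = z2.
Proof. by case: z1 => a b; case: z2 => c d/= -> ->. Qed.

Lemma conjcM z1 z2 : conjc (z1 * z2) = conjc z1 * conjc z2.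
Proof. exact: rmorphM. Qed.

Lemma conjcD z1 z2 : conjc (z1 + z2) = conjc z1 + conjc z2.
Proof. exact: rmorphD. Qed.

End normc_theory.

Section nonneg_integral.
Local Open Scope ereal_scope.
Context d (T : measurableType d) (R : realType).
Variable mu : {measure set T -> \bar R}.

(* No measurability is needed, the integral of a nonnegative function being a
   supremum over the simple functions below it. *)
Lemma ge0_le_integralT (f g : T -> \bar R) : (forall x, 0 <= f x) ->
  (forall x, f x <= g x) -> \int[mu]_x f x <= \int[mu]_x g x.
Proof.
move=> f0 fg.
have g0 x : 0 <= g x by exact: le_trans (f0 x) (fg x).
rewrite [leLHS]ge0_integralTE// [leRHS]ge0_integralTE//.
apply: ge_ereal_sup => _ [h /= hf <-]; apply: ereal_sup_ubound.
by exists h => //= x; exact: le_trans (hf x) (fg x).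
Qed.

End nonneg_integral.

Section tonelli.
Local Open Scope ereal_scope.
Context d1 d2 (T1 : measurableType d1) (T2 : measurableType d2) (R : realType).
Variable m1 : {sigma_finite_measure set T1 -> \bar R}.
Variable m2 : {sigma_finite_measure set T2 -> \bar R}.

Lemma integral_swap (F : T1 -> T2 -> \bar R) :
  measurable_fun setT (fun z : T1 * T2 => F z.1 z.2) -> (forall x y, 0 <= F x y) ->
  \int[m1]_x \int[m2]_y F x y = \int[m2]_y \int[m1]_x F x y.
Proof.
by move=> mF F0; exact: (@fubini_tonelli _ _ _ _ _ m1 m2 (fun z : T1 * T2 => F z.1 z.2)).
Qed.

Lemma measurable_integral (F : T1 -> T2 -> \bar R) :
  measurable_fun setT (fun z : T1 * T2 => F z.1 z.2) -> (forall x y, 0 <= F x y) ->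
  measurable_fun setT (fun x => \int[m2]_y F x y).
Proof.
move=> mF F0.
exact: (@measurable_fun_fubini_tonelli_F _ _ _ _ _ m2 (fun z : T1 * T2 => F z.1 z.2)).
Qed.

End tonelli.

Section curry.
Context (d1 d2 d3 : measure_display).
Context (T1 : measurableType d1) (T2 : measurableType d2).
Context (T3 : measurableType d3) (F : T1 -> T2 -> T3).
Hypothesis mF : measurable_fun setT (fun z : T1 * T2 => F z.1 z.2).

Lemma measurable_curry1 x : measurable_fun setT (F x).
Proof.
apply: (measurableT_comp mF (g := fun y => (x, y))).
exact: pair1_measurable.
Qed.

Lemma measurable_curry2 y : measurable_fun setT (F ^~ y).
Proof.
apply: (measurableT_comp mF (g := fun x => (x, y))).
exact: pair2_measurable.
Qed.

End curry.


Section complex_measurable.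
Context d (T : measurableType d) (R : realType).
Implicit Types f g : T -> R[i].

Lemma cmeasurable_cst c : cmeasurable (fun _ : T => c : R[i]).
Proof. by split; exact: measurable_cst. Qed.

Lemma cmeasurableD f g : cmeasurable f -> cmeasurable g ->
  cmeasurable (fun x => f x + g x).
Proof.
move=> [f1 f2] [g1 g2]; split.
  under eq_fun do rewrite ReD; exact: measurable_funD.
under eq_fun do rewrite ImD; exact: measurable_funD.
Qed.

Lemma cmeasurableM f g : cmeasurable f -> cmeasurable g ->
  cmeasurable (fun x => f x * g x).
Proof.
move=> [f1 f2] [g1 g2]; split.
  by under eq_fun do rewrite ReM; apply: measurable_funB; apply: measurable_funM.
by under eq_fun do rewrite ImM; apply: measurable_funD; apply: measurable_funM.
Qed.

Lemma cmeasurableJ f : cmeasurable f -> cmeasurable (fun x => conjc (f x)).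
Proof.
move=> [f1 f2]; split; first by under eq_fun do rewrite ReJ.
by under eq_fun do rewrite ImJ; exact: measurableT_comp.
Qed.

Lemma cmeasurable_real (h : T -> R) : measurable_fun setT h ->
  cmeasurable (fun x => (h x)%:C%C).
Proof. by move=> mh; split => //=; exact: measurable_cst. Qed.

Lemma cmeasurable_expi (h : T -> R) : measurable_fun setT h ->
  cmeasurable (fun x => expi (h x)).
Proof.
move=> mh; split => /=; apply: measurableT_comp => //.
  by apply: continuous_measurable_fun; exact: continuous_cos.
by apply: continuous_measurable_fun; exact: continuous_sin.
Qed.

Lemma measurable_normc f : cmeasurable f ->
  measurable_fun setT (fun x => normc (f x)).
Proof.
move=> [f1 f2].
rewrite (_ : (fun _ => _) = fun x => Num.sqrt (complex.Re (f x) ^+ 2 +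
    complex.Im (f x) ^+ 2)); last by apply/funext => x; case: (f x).
apply: (measurableT_comp (f := @Num.sqrt R)).
  by apply: continuous_measurable_fun => x; exact: sqrt_continuous.
by apply: measurable_funD; apply: measurable_funX.
Qed.

Lemma measurable_normcE f : cmeasurable f ->
  measurable_fun setT (fun x => (normc (f x))%:E).
Proof. by move=> mf; apply/measurable_EFinP; exact: measurable_normc. Qed.

Lemma cmeasurable_comp d' (T' : measurableType d') (h : T' -> T) f :
  cmeasurable f -> measurable_fun setT h -> cmeasurable (fun x => f (h x)).
Proof.
move=> [f1 f2] mh; split.
  exact: (measurableT_comp f1 mh).
exact: (measurableT_comp f2 mh).
Qed.

Lemma cmeasurable_indic (A : set T) : measurable A ->
  cmeasurable (fun x => (\1_A x)%:C%C : R[i]).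
Proof. by move=> mA; apply: cmeasurable_real. Qed.

End complex_measurable.

Section complex_integral.
Context d (T : measurableType d) (R : realType).
Variable mu : {measure set T -> \bar R}.
Implicit Types f g : T -> R[i].

Lemma cintegrableP f : cintegrable mu f <->
  cmeasurable f /\ (\int[mu]_x (normc (f x))%:E < +oo)%E.
Proof.
split=> [[/integrableP[m1 i1] /integrableP[m2 i2]]|[[m1 m2] i]].
- have m : cmeasurable f by split; exact/measurable_EFinP.
  split=> //; apply: (@le_lt_trans _ _ (\int[mu]_x
      (`|(complex.Re (f x))%:E| + `|(complex.Im (f x))%:E|))%E).
    apply: ge0_le_integralT => x; first by rewrite lee_fin normc_ge0.
    by rewrite lee_fin; exact: normc_le_ReIm.
  rewrite ge0_integralD//; last 2 first.
    by apply: measurableT_comp.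
    by apply: measurableT_comp.
  exact: lte_add_pinfty.
- split; apply/integrableP; split; try exact/measurable_EFinP.
    apply: le_lt_trans i; apply: ge0_le_integralT => // x.
    by rewrite lee_fin normc_Re.
  apply: le_lt_trans i; apply: ge0_le_integralT => // x.
  by rewrite lee_fin normc_Im.
Qed.

Lemma cintegrable_meas f : cintegrable mu f -> cmeasurable f.
Proof. by move/cintegrableP => []. Qed.

Lemma cintegrable_lty f : cintegrable mu f ->
  (\int[mu]_x (normc (f x))%:E < +oo)%E.
Proof. by move/cintegrableP => []. Qed.

Lemma cintegrable_le f (h : T -> \bar R) : cmeasurable f ->
  (forall x, (normc (f x))%:E <= h x)%E -> (\int[mu]_x h x < +oo)%E ->
  cintegrable mu f.
Proof.
move=> mf fh hoo; apply/cintegrableP; split=> //; apply: le_lt_trans hoo.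
by apply: ge0_le_integralT => // x; rewrite lee_fin normc_ge0.
Qed.

Lemma cintegrableD f g : cintegrable mu f -> cintegrable mu g ->
  cintegrable mu (fun x => f x + g x).
Proof.
move=> [f1 f2] [g1 g2]; split.
  under eq_fun do rewrite ReD EFinD; exact: integrableD.
under eq_fun do rewrite ImD EFinD; exact: integrableD.
Qed.

Lemma cintegralD f g : cintegrable mu f -> cintegrable mu g ->
  cintegral mu (fun x => f x + g x) = cintegral mu f + cintegral mu g.
Proof.
move=> [f1 f2] [g1 g2]; apply: complex_eq; rewrite ?ReD ?ImD/=.
  by under eq_Rintegral do rewrite ReD; exact: RintegralD.
by under eq_Rintegral do rewrite ImD; exact: RintegralD.
Qed.

Lemma cintegrableZl c f : cintegrable mu f -> cintegrable mu (fun x => c * f x).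
Proof.
move=> [f1 f2]; split.
  under eq_fun do rewrite ReM EFinB !EFinM; apply: integrableB => //;
  exact: integrableZl.
under eq_fun do rewrite ImM EFinD !EFinM; apply: integrableD => //;
exact: integrableZl.
Qed.

Lemma cintegralZl c f : cintegrable mu f ->
  cintegral mu (fun x => c * f x) = c * cintegral mu f.
Proof.
have iM (a : R) (h : T -> R) : mu.-integrable setT (EFin \o h) ->
    mu.-integrable setT (EFin \o (fun x => a * h x)).
  by move=> ih; rewrite /comp; under eq_fun do rewrite EFinM; exact: integrableZl.
move=> [f1 f2]; apply: complex_eq; rewrite ?ReM ?ImM/=.
  under eq_Rintegral do rewrite ReM; rewrite RintegralB//; try exact: iM.
  by rewrite !RintegralZl.
under eq_Rintegral do rewrite ImM; rewrite RintegralD//; try exact: iM.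
by rewrite !RintegralZl.
Qed.

Lemma cintegrableJ f : cintegrable mu f -> cintegrable mu (fun x => conjc (f x)).
Proof.
move=> [f1 f2]; split; first by under eq_fun do rewrite ReJ.
under eq_fun do rewrite ImJ EFinN.
exact: (integrableN f2).
Qed.

Lemma cintegralJ f : cintegrable mu f ->
  cintegral mu (fun x => conjc (f x)) = conjc (cintegral mu f).
Proof.
move=> [f1 f2]; rewrite /cintegral/=; congr Complex.
  by under eq_Rintegral do rewrite ReJ.
under eq_Rintegral do rewrite ImJ -mulN1r.
by rewrite RintegralZl// mulN1r.
Qed.

Lemma eq_cintegral f g : f =1 g -> cintegral mu f = cintegral mu g.
Proof. by move=> /funext ->. Qed.

Lemma ae_eq_cintegral f g : cmeasurable f -> cmeasurable g ->
  {ae mu, forall x, f x = g x} -> cintegral mu f = cintegral mu g.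
Proof.
move=> [f1 f2] [g1 g2] fg; rewrite /cintegral/Rintegral; congr Complex; congr fine.
  apply: ae_eq_integral => //; try exact/measurable_EFinP.
  by apply: filterS fg => x /= ->.
apply: ae_eq_integral => //; try exact/measurable_EFinP.
by apply: filterS fg => x /= ->.
Qed.

Lemma ae_eq_cintegrable f g : cmeasurable g -> cintegrable mu f ->
  {ae mu, forall x, f x = g x} -> cintegrable mu g.
Proof.
move=> mg [f1 f2] fg; have [m1 m2] := cintegrable_meas (conj f1 f2).
apply/cintegrableP; split=> //.
rewrite -(ge0_ae_eq_integral (f := fun x => (normc (f x))%:E))//.
- by have /cintegrableP[] : cintegrable mu f by [].
- exact: measurable_normcE.
- exact: measurable_normcE.
- by move=> x _; rewrite lee_fin normc_ge0.
- by move=> x _; rewrite lee_fin normc_ge0.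
- by apply: filterS fg => x /= ->.
Qed.

Lemma cintegral_real (h : T -> R) :
  cintegral mu (fun x => (h x)%:C%C) = (\int[mu]_x h x)%:C%C.
Proof.
by rewrite /cintegral; congr Complex; rewrite /= /Rintegral integral0.
Qed.

(* Multiplying by the conjugate of the integral reduces to the real part. *)
Lemma normc_cintegral f : cintegrable mu f ->
  ((normc (cintegral mu f))%:E <= \int[mu]_x (normc (f x))%:E)%E.
Proof.
move=> fi; have [mf foo] := (cintegrableP f).1 fi.
set I := cintegral mu f.
have [I0|I0] := eqVneq (normc I) 0.
  by rewrite I0; apply: integral_ge0 => x _; rewrite lee_fin normc_ge0.
have Ipos : 0 < normc I by rewrite lt_neqAle eq_sym I0 normc_ge0.
have nfin : (\int[mu]_x (normc (f x))%:E)%E \is a fin_num.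
  by rewrite ge0_fin_numE// integral_ge0// => x _; rewrite lee_fin normc_ge0.
have ni : mu.-integrable setT (EFin \o (fun x => normc (f x))).
  apply/integrableP; split; first exact: measurable_normcE.
  by under eq_integral do rewrite gee0_abs ?lee_fin ?normc_ge0//.
suff : normc I <= \int[mu]_x normc (f x).
  by rewrite -lee_fin fineK.
rewrite -(ler_pM2l Ipos) -expr2 normc_sqr.
have -> : complex.Re I ^+ 2 + complex.Im I ^+ 2 =
    complex.Re (cintegral mu (fun x => conjc I * f x)).
  by rewrite cintegralZl// -/I ReM ReJ ImJ; ring.
rewrite -RintegralZl//; apply: le_Rintegral => //.
- by case: (cintegrableZl (conjc I) fi).
- by rewrite /comp; under eq_fun do rewrite EFinM; exact: integrableZl.
move=> x _; rewrite -(normcJ I) -Normc.normcM.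
exact: le_trans (ler_norm _) (normc_Re _).
Qed.

End complex_integral.

Section complex_fubini.
Context d1 d2 (T1 : measurableType d1) (T2 : measurableType d2) (R : realType).
Variable m1 : {sigma_finite_measure set T1 -> \bar R}.
Variable m2 : {sigma_finite_measure set T2 -> \bar R}.
Variable F : T1 -> T2 -> R[i].
Hypothesis mF : cmeasurable (fun z : T1 * T2 => F z.1 z.2).

(** Tonelli is applied to the positive and the negative part separately, so that no integrability of
    the sections enters. *)
Let measurable_Rintegral (h : T1 * T2 -> R) : measurable_fun setT h ->
  measurable_fun setT (fun x => \int[m2]_y h (x, y)).
Proof.
move=> mh; rewrite /Rintegral.
apply: (measurableT_comp (f := fine)) => //.
under eq_fun do rewrite integralE; apply: emeasurable_funB.
  rewrite (_ : (fun x => _) = fubini_F m2 (EFin \o h)^\+%E).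
    apply: measurable_fun_fubini_tonelli_F => //.
    by apply: measurable_funepos; exact/measurable_EFinP.
  by apply/funext => x; apply: eq_integral => y _; rewrite !funeposE.
rewrite (_ : (fun x => _) = fubini_F m2 (EFin \o h)^\-%E).
  apply: measurable_fun_fubini_tonelli_F => //.
  by apply: measurable_funeneg; exact/measurable_EFinP.
by apply/funext => x; apply: eq_integral => y _; rewrite !funenegE.
Qed.

Lemma cmeasurable_cintegral : cmeasurable (fun x => cintegral m2 (F x)).
Proof.
by case: mF => f1 f2; split; rewrite /cintegral/=;
  [exact: (measurable_Rintegral f1)|exact: (measurable_Rintegral f2)].
Qed.

Lemma cmeasurable_curry1 x : cmeasurable (F x).
Proof.
case: mF => f1 f2; split.
  exact: (@measurable_curry1 _ _ _ _ _ _ (fun x y => complex.Re (F x y)) f1).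
exact: (@measurable_curry1 _ _ _ _ _ _ (fun x y => complex.Im (F x y)) f2).
Qed.

Hypothesis iF : (\int[m1]_x \int[m2]_y (normc (F x y))%:E < +oo)%E.

Lemma cintegrable_prod : cintegrable (m1 \x m2)%E (fun z : T1 * T2 => F z.1 z.2).
Proof.
apply/cintegrableP; split=> //.
rewrite fubini_tonelli1//; first exact: measurable_normcE.
by move=> z; rewrite lee_fin normc_ge0.
Qed.

Lemma ae_cintegrable_curry : {ae m1, forall x, cintegrable m2 (F x)}.
Proof.
have [/ae_integrable1 i1 /ae_integrable1 i2] := cintegrable_prod.
by apply: filterS2 i1 i2 => x ? ?; split.
Qed.

Lemma cintegrable_cintegral : cintegrable m1 (fun x => cintegral m2 (F x)).
Proof.
have /cintegrableP[m i] := cintegrable_prod.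
apply/cintegrableP; split; first exact: cmeasurable_cintegral.
apply: le_lt_trans iF; apply: ae_ge0_le_integral => //.
- by move=> x _; rewrite lee_fin normc_ge0.
- exact/measurable_normcE/cmeasurable_cintegral.
- by move=> x _; apply: integral_ge0 => y _; rewrite lee_fin normc_ge0.
- apply: (@measurable_integral _ _ _ _ _ m2 (fun x y => (normc (F x y))%:E)).
    exact: measurable_normcE.
  by move=> x y; rewrite lee_fin normc_ge0.
- apply: filterS ae_cintegrable_curry => x ix _; exact: normc_cintegral.
Qed.

(** [Rintegral] takes the finite part of the inner integral, which is its true value only where the
    section is integrable. Fubini provides this almost everywhere, which is enough under the outer
    integral. *)
Let ae_fine_Rintegral d3 d4 (T3 : measurableType d3) (T4 : measurableType d4)
    (n3 : {sigma_finite_measure set T3 -> \bar R})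
    (n4 : {sigma_finite_measure set T4 -> \bar R}) (h : T3 -> T4 -> R) :
  measurable_fun setT (fun x => \int[n4]_y (h x y)%:E)%E ->
  {ae n3, forall x, n4.-integrable setT (EFin \o h x)} ->
  \int[n3]_x \int[n4]_y h x y = fine (\int[n3]_x \int[n4]_y (h x y)%:E)%E.
Proof.
move=> mh ih; rewrite {1}/Rintegral; congr fine.
apply: ae_eq_integral => //.
  apply/measurable_EFinP; rewrite /Rintegral.
  exact: (measurableT_comp (f := fine)).
apply: filterS ih => x ix _.
by rewrite /Rintegral fineK//; exact: integrable_fin_num.
Qed.

Lemma cintegral_prod : cintegral (m1 \x m2)%E (fun z => F z.1 z.2) =
  cintegral m1 (fun x => cintegral m2 (F x)).
Proof.
have [i1 i2] := cintegrable_prod.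
have S (h : T1 -> T2 -> R) :
    (m1 \x m2)%E.-integrable setT (EFin \o (fun z => h z.1 z.2)) ->
    \int[(m1 \x m2)%E]_z h z.1 z.2 = \int[m1]_x \int[m2]_y h x y.
  move=> ih; rewrite (ae_fine_Rintegral (measurable_fubini_F ih))//.
    by rewrite /Rintegral -(integral12_prod_meas1 ih).
  exact: (ae_integrable1 ih).
rewrite /cintegral; congr Complex.
  exact: (S (fun x y => complex.Re (F x y))).
exact: (S (fun x y => complex.Im (F x y))).
Qed.

Lemma cintegral_swap : cintegral m1 (fun x => cintegral m2 (F x)) =
  cintegral m2 (fun y => cintegral m1 (F ^~ y)).
Proof.
rewrite -cintegral_prod; have [i1 i2] := cintegrable_prod.
have S (h : T1 -> T2 -> R) :
    (m1 \x m2)%E.-integrable setT (EFin \o (fun z => h z.1 z.2)) ->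
    \int[(m1 \x m2)%E]_z h z.1 z.2 = \int[m2]_y \int[m1]_x h x y.
  move=> ih; rewrite (@ae_fine_Rintegral _ _ _ _ m2 m1 (fun y x => h x y)).
  - by rewrite /Rintegral -(integral21_prod_meas1 ih).
  - exact: (measurable_fubini_G ih).
  - exact: (ae_integrable2 ih).
rewrite /cintegral; congr Complex.
  exact: (S (fun x y => complex.Re (F x y))).
exact: (S (fun x y => complex.Im (F x y))).
Qed.

End complex_fubini.

Section change_of_variables.
Context d1 d2 (T1 : measurableType d1) (T2 : measurableType d2) (R : realType).
Variables (m1 : {measure set T1 -> \bar R}) (m2 : {measure set T2 -> \bar R}).
Variable phi : T1 -> T2.
Hypothesis preserving : forall F : T2 -> \bar R, measurable_fun setT F ->
  (forall x, 0 <= F x)%E -> (\int[m1]_x F (phi x) = \int[m2]_y F y)%E.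
Hypothesis mphi : measurable_fun setT phi.

(** Invariance is assumed for nonnegative functions only, the form in which Tonelli proves it on
    products; positive and negative parts do the rest. *)
Lemma preserving_integral (F : T2 -> \bar R) : measurable_fun setT F ->
  (\int[m1]_x F (phi x) = \int[m2]_y F y)%E.
Proof.
move=> mF; rewrite [LHS]integralE [RHS]integralE.
rewrite -!preserving//; try exact: measurable_funepos; try exact: measurable_funeneg.
by congr (_ - _)%E; apply: eq_integral => x _; rewrite ?funeposE ?funenegE.
Qed.

Lemma preserving_cintegral (f : T2 -> R[i]) : cmeasurable f ->
  cintegral m1 (fun x => f (phi x)) = cintegral m2 f.
Proof.
move=> [f1 f2]; rewrite /cintegral /Rintegral; congr Complex; congr fine.
  rewrite (preserving_integral (F := fun y => (complex.Re (f y))%:E))//.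
  exact/measurable_EFinP.
rewrite (preserving_integral (F := fun y => (complex.Im (f y))%:E))//.
exact/measurable_EFinP.
Qed.

Lemma preserving_cintegrable (f : T2 -> R[i]) :
  cintegrable m2 f -> cintegrable m1 (fun x => f (phi x)).
Proof.
move=> /cintegrableP[mf foo]; apply/cintegrableP; split.
  exact: cmeasurable_comp.
rewrite (preserving (F := fun y => (normc (f y))%:E))//.
  exact: measurable_normcE.
by move=> y; rewrite lee_fin normc_ge0.
Qed.

End change_of_variables.
Notation coord := Defs.coord.

(** * Lebesgue measure on R^n *)

Section Rn_structure.
Context {R : realType}.

Definition leb : {sigma_finite_measure set (measurableTypeR R) -> \bar R} :=
  lebesgue_measure.

Lemma integral_Rn0 (F : Rn R 0 -> \bar R) : measurable_fun setT F ->
  (\int[lebesgue_Rn R 0]_t F t = F [tuple])%E.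
Proof. by move=> mF; rewrite /= integral_dirac// diracT mul1e. Qed.

Lemma ge0_integral_RnS n (F : Rn R n.+1 -> \bar R) :
  measurable_fun setT F -> (forall t, 0 <= F t)%E ->
  (\int[lebesgue_Rn R n.+1]_t F t =
   \int[leb]_x \int[lebesgue_Rn R n]_t F (consRn (x, t)))%E.
Proof.
move=> mF F0.
transitivity (\int[pushforward (leb \x lebesgue_Rn R n)%E (@consRn R n)]_t F t)%E.
  by [].
rewrite ge0_integral_pushforward//; last exact: measurable_consRn.
rewrite preimage_setT fubini_tonelli1//.
  by apply: measurableT_comp => //; exact: measurable_consRn.
by move=> z; exact: F0.
Qed.

Lemma cintegral_Rn0 (F : Rn R 0 -> R[i]) : cmeasurable F ->
  cintegral (lebesgue_Rn R 0) F = F [tuple].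
Proof.
move=> [m1 m2]; rewrite /cintegral /Rintegral !integral_Rn0.
- by case: (F _).
- exact/measurable_EFinP.
- exact/measurable_EFinP.
Qed.

Lemma cintegral_RnS n (F : Rn R n.+1 -> R[i]) :
  cintegrable (lebesgue_Rn R n.+1) F ->
  cintegral (lebesgue_Rn R n.+1) F =
  cintegral leb (fun x => cintegral (lebesgue_Rn R n) (fun t => F (consRn (x, t)))).
Proof.
move=> iF; have [mF Foo] := (cintegrableP _ _).1 iF.
have pres (G : Rn R n.+1 -> \bar R) : measurable_fun setT G ->
    (forall x, 0 <= G x)%E ->
    (\int[leb \x lebesgue_Rn R n]_z G (consRn z) = \int[lebesgue_Rn R n.+1]_t G t)%E.
  move=> mG G0; rewrite ge0_integral_RnS// fubini_tonelli1//.
  by apply: measurableT_comp => //; exact: measurable_consRn.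
rewrite -(preserving_cintegral pres)//.
have /= -> := (@cintegral_prod _ _ _ _ _ leb (lebesgue_Rn R n)
  (fun x t => F (consRn (x, t))) _ _) => //.
- rewrite (_ : (fun _ => _) = fun z => F (consRn z)); last by apply/funext => -[].
  by apply: cmeasurable_comp => //; exact: measurable_consRn.
- rewrite -(@ge0_integral_RnS n (fun t => (normc (F t))%:E))//.
    exact: measurable_normcE.
  by move=> t; rewrite lee_fin normc_ge0.
Qed.

Lemma coord_cons0 n (x : R) (t : Rn R n) : coord (consRn (x, t)) ord0 = x.
Proof. by []. Qed.

Lemma coord_consS n x (t : Rn R n) i : coord (consRn (x, t)) (lift ord0 i) = coord t i.
Proof. by rewrite /coord /consRn tnthS. Qed.

Lemma consRn_surj n (t : Rn R n.+1) : t = consRn (unconsRn t).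
Proof. by apply: val_inj => /=; case/tupleP: t => x t. Qed.

Lemma measurable_coord n (i : 'I_n) : measurable_fun setT (fun t : Rn R n => coord t i : R).
Proof. exact: measurable_tnth. Qed.

Lemma measurable_mktuple d (T : measurableType d) n (f : 'I_n -> T -> measurableTypeR R) :
  (forall i, measurable_fun setT (f i)) ->
  measurable_fun setT (fun x => [tuple f i x | i < n] : Rn R n).
Proof.
move=> mf; apply/measurable_fun_tnthP => i.
rewrite (_ : _ \o _ = f i)//.
by apply/funext => x /=; rewrite tnth_mktuple.
Qed.

Lemma coord_ext n (x y : Rn R n) : (forall i, coord x i = coord y i) -> x = y.
Proof. by move=> xy; apply: eq_from_tnth. Qed.

End Rn_structure.

Section affine.
Context {R : realType}.
Implicit Types e c : R.

(** With [e = 1] or [e = -1] these are the translations and the point reflections. The difference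
    [t - x] is of the first kind in [t] and of the second in [x], so one invariance lemma serves
    both variables of a convolution. *)
Definition affRn n e (c t : Rn R n) : Rn R n :=
  [tuple (e * coord t i + coord c i : measurableTypeR R) | i < n].

Lemma coord_aff n e (c t : Rn R n) i : coord (affRn e c t) i = e * coord t i + coord c i.
Proof. by rewrite {1}/coord tnth_mktuple. Qed.

Lemma measurable_affRn n e (c : Rn R n) : measurable_fun setT (affRn e c).
Proof.
apply: measurable_mktuple => i.
by apply: measurable_funD => //; apply: measurable_funM => //; exact: measurable_coord.
Qed.

Lemma affRn_cons n e (c : Rn R n.+1) x (t : Rn R n) :
  affRn e c (consRn (x, t)) =
  consRn (e * x + coord c ord0, affRn e (unconsRn c).2 t).
Proof.
apply: coord_ext => i; rewrite coord_aff.
case: (unliftP ord0 i) => [j|] -> //.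
rewrite !coord_consS coord_aff; congr (_ + _).
by rewrite {1}(consRn_surj c) coord_consS.
Qed.

Lemma lebesgue_affine e c (A : set (measurableTypeR R)) : e = 1 \/ e = -1 ->
  measurable A ->
  pushforward (@leb R) (fun x => e * x + c : measurableTypeR R) A = leb A.
Proof.
move=> e1 mA.
have mf : measurable_fun setT (fun x : measurableTypeR R => e * x + c : measurableTypeR R).
  by apply: measurable_funD => //; apply: measurable_funM.
have e2 : e * e = 1 by case: e1 => ->; rewrite ?mulr1 ?mulrNN ?mulr1.
pose p : {mfun measurableTypeR R >-> measurableTypeR R} :=
  HB.pack (fun x => e * x + c : measurableTypeR R)
    (isMeasurableFun.Build _ _ _ _ _ mf).
suff : lebesgue_measure A = pushforward leb p A by [].
apply: lebesgue_measure_unique => // _ [[a b]] _ <-.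
(* A reflection moves the closed end of the interval to the other side, so the preimage has two
   shapes; the length is the same. *)
pose B := if e == 1 then `]a - c, b - c] else `[c - b, c - a[.
have pB : (fun x : R => e * x + c) @^-1` `]a, b]%classic = [set` B].
  rewrite /B; apply/seteqP; case: e1 => ->.
    by rewrite eqxx; split => x /=; rewrite !in_itv/= => /andP[? ?];
      apply/andP; split; lra.
  have -> : (-1 == 1 :> R) = false by apply/eqP => ?; lra.
  by split => x /=; rewrite !in_itv/= => /andP[? ?]; apply/andP; split; lra.
transitivity (lebesgue_measure [set` B]); last by rewrite -pB.
rewrite /B; case: ifPn => _; rewrite !lebesgue_measure_itv/= !lte_fin.
  by rewrite ltrD2r -!EFinD; congr (if _ then _ else _); congr EFin; ring.
by rewrite ltrD2l ltrN2 -!EFinD; congr (if _ then _ else _); congr EFin; ring.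
Qed.

Lemma integral_affine e c (F : measurableTypeR R -> \bar R) : e = 1 \/ e = -1 ->
  measurable_fun setT F -> (forall t, 0 <= F t)%E ->
  (\int[leb]_x F (e * x + c)%R = \int[leb]_x F x)%E.
Proof.
move=> e1 mF F0.
have mf : measurable_fun setT (fun x : measurableTypeR R => e * x + c : measurableTypeR R).
  by apply: measurable_funD => //; apply: measurable_funM.
have := ge0_integral_pushforward mf leb (measurableT) mF (fun y _ => F0 y).
rewrite preimage_setT /= => <-.
by apply: eq_measure_integral => A mA _; exact: lebesgue_affine.
Qed.

Lemma integral_affRn n e (c : Rn R n) F : e = 1 \/ e = -1 ->
  measurable_fun setT F -> (forall t, 0 <= F t)%E ->
  (\int[lebesgue_Rn R n]_t F (affRn e c t) = \int[lebesgue_Rn R n]_t F t)%E.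
Proof.
move=> e1; elim: n => [|n IH] in c F *; move=> mF F0.
  rewrite !integral_Rn0//.
    by congr F; apply: coord_ext => -[].
  by apply: measurableT_comp => //; exact: measurable_affRn.
rewrite (ge0_integral_RnS mF F0).
rewrite (ge0_integral_RnS (measurableT_comp mF (measurable_affRn e c)) (fun t => F0 _)).
have mcons : measurable_fun setT (fun z : measurableTypeR R * Rn R n =>
    F (consRn (z.1, z.2))).
  by apply: (measurableT_comp mF); under eq_fun do rewrite -surjective_pairing;
    exact: measurable_consRn.
have mx := @measurable_curry1 _ _ _ _ _ _ (fun x t => F (consRn (x, t))) mcons.
rewrite -(@integral_affine e (coord c ord0)
    (fun x => \int[lebesgue_Rn R n]_t F (consRn (x, t)))%E e1).
- apply: eq_integral => x _.
  rewrite -(IH (unconsRn c).2 _ (mx (e * x + coord c ord0)) (fun t => F0 _)).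
  by apply: eq_integral => t _; rewrite /comp affRn_cons.
- apply: (@measurable_integral _ _ _ _ _ (lebesgue_Rn R n)
    (fun x t => F (consRn (x, t))) mcons) => x y; exact: F0.
- by move=> x; apply: integral_ge0 => t _; exact: F0.
Qed.

Definition addRn n (t x : Rn R n) : Rn R n :=
  [tuple (coord t i + coord x i : measurableTypeR R) | i < n].

Lemma coord_sub n (t x : Rn R n) i : coord (subRn t x) i = coord t i - coord x i.
Proof. by rewrite {1}/coord tnth_mktuple. Qed.

Lemma coord_add n (t x : Rn R n) i : coord (addRn t x) i = coord t i + coord x i.
Proof. by rewrite {1}/coord tnth_mktuple. Qed.

Definition oppRn n (x : Rn R n) : Rn R n :=
  [tuple (- coord x i : measurableTypeR R) | i < n].

Lemma coord_opp n (x : Rn R n) i : coord (oppRn x) i = - coord x i.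
Proof. by rewrite {1}/coord tnth_mktuple. Qed.

Lemma subRnE n (t x : Rn R n) : subRn t x = affRn 1 (oppRn x) t.
Proof. by apply: coord_ext => i; rewrite coord_sub coord_aff coord_opp mul1r. Qed.

Lemma subRnEr n (t x : Rn R n) : subRn t x = affRn (-1) t x.
Proof. by apply: coord_ext => i; rewrite coord_sub coord_aff mulN1r addrC. Qed.

Lemma addRnE n (t x : Rn R n) : addRn t x = affRn 1 x t.
Proof. by apply: coord_ext => i; rewrite coord_add coord_aff mul1r. Qed.

Lemma addRnC n (t x : Rn R n) : addRn t x = addRn x t.
Proof. by apply: coord_ext => i; rewrite !coord_add addrC. Qed.

Section preserving.
Context n (F : Rn R n -> \bar R).
Hypothesis mF : measurable_fun setT F.
Hypothesis F0 : forall t, (0 <= F t)%E.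

Lemma integral_subl x :
  (\int[lebesgue_Rn R n]_t F (subRn t x) = \int[lebesgue_Rn R n]_t F t)%E.
Proof.
rewrite -(@integral_affRn n 1 (oppRn x) F)//; last by left.
by apply: eq_integral => t _; rewrite subRnE.
Qed.

Lemma integral_subr t :
  (\int[lebesgue_Rn R n]_x F (subRn t x) = \int[lebesgue_Rn R n]_x F x)%E.
Proof.
rewrite -(@integral_affRn n (-1) t F)//; last by right.
by apply: eq_integral => x _; rewrite subRnEr.
Qed.

Lemma integral_addl x :
  (\int[lebesgue_Rn R n]_t F (addRn t x) = \int[lebesgue_Rn R n]_t F t)%E.
Proof.
rewrite -(@integral_affRn n 1 x F)//; last by left.
by apply: eq_integral => t _; rewrite addRnE.
Qed.

End preserving.

Section joint_measurability.
Context d (T : measurableType d) n (f g : T -> Rn R n).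
Hypothesis mf : measurable_fun setT f.
Hypothesis mg : measurable_fun setT g.

Lemma measurable_subRn : measurable_fun setT (fun x => subRn (f x) (g x)).
Proof.
apply: measurable_mktuple => i; apply: measurable_funB;
  exact: (measurableT_comp (measurable_coord i)).
Qed.

Lemma measurable_addRn : measurable_fun setT (fun x => addRn (f x) (g x)).
Proof.
apply: measurable_mktuple => i; apply: measurable_funD;
  exact: (measurableT_comp (measurable_coord i)).
Qed.

Lemma measurable_dotRn : measurable_fun setT (fun x => dotRn (f x) (g x) : R).
Proof.
apply: measurable_sum => i; apply: measurable_funM;
  exact: (measurableT_comp (measurable_coord i)).
Qed.

End joint_measurability.

End affine.

Section phase_space.
Context {R : realType}.

Definition catRn m n (x : Rn R m) (y : Rn R n) : Rn R (m + n) := [tuple of x ++ y].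

Lemma coord_catl m n (x : Rn R m) (y : Rn R n) i : coord (catRn x y) (lshift n i) = coord x i.
Proof. by rewrite /coord /catRn tnth_lshift. Qed.

Lemma coord_catr m n (x : Rn R m) (y : Rn R n) i : coord (catRn x y) (rshift m i) = coord y i.
Proof. by rewrite /coord /catRn tnth_rshift. Qed.

Lemma posn_cat n (x y : Rn R n) : posn (catRn x y) = x.
Proof. by apply: coord_ext => i; rewrite {1}/coord tnth_mktuple; exact: coord_catl. Qed.

Lemma freq_cat n (x y : Rn R n) : freq (catRn x y) = y.
Proof. by apply: coord_ext => i; rewrite {1}/coord tnth_mktuple; exact: coord_catr. Qed.

Lemma coord_posn n (z : Rn R (n + n)) i : coord (posn z) i = coord z (lshift n i).
Proof. by rewrite {1}/coord tnth_mktuple. Qed.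

Lemma coord_freq n (z : Rn R (n + n)) i : coord (freq z) i = coord z (rshift n i).
Proof. by rewrite {1}/coord tnth_mktuple. Qed.

Lemma measurable_catRn m n :
  measurable_fun setT (fun z : Rn R m * Rn R n => catRn z.1 z.2).
Proof.
apply/measurable_fun_tnthP => i; rewrite -(fintype.splitK i); case: (fintype.split i) => j /=.
  rewrite (_ : _ \o _ = fun z : Rn R m * Rn R n => coord z.1 j).
    exact: (measurableT_comp (measurable_coord j)).
  by apply/funext => z /=; exact: coord_catl.
rewrite (_ : _ \o _ = fun z : Rn R m * Rn R n => coord z.2 j).
  exact: (measurableT_comp (measurable_coord j)).
by apply/funext => z /=; exact: coord_catr.
Qed.

Lemma measurable_posn n : measurable_fun setT (@posn R n).
Proof. by apply: measurable_mktuple => i; exact: measurable_tnth. Qed.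

Lemma measurable_freq n : measurable_fun setT (@freq R n).
Proof. by apply: measurable_mktuple => i; exact: measurable_tnth. Qed.

Lemma integral_cat m n (F : Rn R (m + n) -> \bar R) :
  measurable_fun setT F -> (forall t, 0 <= F t)%E ->
  (\int[lebesgue_Rn R (m + n)]_z F z =
   \int[lebesgue_Rn R m]_x \int[lebesgue_Rn R n]_y F (catRn x y))%E.
Proof.
elim: m => [|m IH] in F *; move=> mF F0.
  rewrite integral_Rn0; first by apply: eq_integral => t _; congr F; exact: val_inj.
  apply: (@measurable_integral _ _ _ _ _ (lebesgue_Rn R n)
    (fun (x : Rn R 0) y => F (catRn x y))) => //.
  by apply: measurableT_comp => //; exact: (@measurable_catRn 0 n).
have mcons : measurable_fun setT (fun z : measurableTypeR R * Rn R (m + n) =>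
    F (consRn (z.1, z.2))).
  by apply: (measurableT_comp mF); under eq_fun do rewrite -surjective_pairing;
    exact: measurable_consRn.
rewrite (@ge0_integral_RnS _ (m + n) F)// ge0_integral_RnS; last 2 first.
- apply: (@measurable_integral _ _ _ _ _ (lebesgue_Rn R n)
    (fun (x : Rn R m.+1) y => F (catRn x y))) => //.
  by apply: measurableT_comp => //; exact: (@measurable_catRn m.+1 n).
- by move=> t; exact: integral_ge0.
apply: eq_integral => x _.
have mx := @measurable_curry1 _ _ _ _ _ _ (fun x t => F (consRn (x, t))) mcons x.
apply: etrans (IH (fun t => F (consRn (x, t))) mx (fun t => F0 _)) _.
by apply: eq_integral => t _; apply: eq_integral => y _; congr F; exact: val_inj.
Qed.

Lemma integral_phase n (G : Rn R n -> Rn R n -> \bar R) :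
  measurable_fun setT (fun z : Rn R n * Rn R n => G z.1 z.2) ->
  (forall x y, 0 <= G x y)%E ->
  (\int[lebesgue_Rn R (n + n)]_z G (posn z) (freq z) =
   \int[lebesgue_Rn R n]_x \int[lebesgue_Rn R n]_y G x y)%E.
Proof.
move=> mG G0.
have mF : measurable_fun setT (fun z : Rn R (n + n) => G (posn z) (freq z)).
  apply: (measurableT_comp mG (g := fun z => (posn z, freq z))).
  by apply: measurable_fun_pair; [exact: measurable_posn|exact: measurable_freq].
apply: etrans (integral_cat mF (fun t => G0 _ _)) _.
by apply: eq_integral => x _; apply: eq_integral => y _; rewrite posn_cat freq_cat.
Qed.

End phase_space.

Section tensor_product.
Context {R : realType}.

Lemma cintegral_tensor n (f : 'I_n -> measurableTypeR R -> R[i]) :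
  (forall i, cintegrable leb (f i)) ->
  cintegrable (lebesgue_Rn R n) (fun t => \prod_(i < n) f i (coord t i)) /\
  cintegral (lebesgue_Rn R n) (fun t => \prod_(i < n) f i (coord t i)) =
  \prod_(i < n) cintegral leb (f i).
Proof.
elim: n => [|n IH] in f *; move=> fi.
  under eq_fun do rewrite big_ord0; rewrite big_ord0; split.
    apply/cintegrableP; split; first exact: cmeasurable_cst.
    by rewrite integral_Rn0//= expr0n/= addr0 expr1n sqrtr1 ltry.
  by rewrite cintegral_Rn0//; exact: cmeasurable_cst.
have [IHi IHE] := IH (fun i => f (lift ord0 i)) (fun i => fi _).
have mp : cmeasurable (fun t : Rn R n.+1 => \prod_(i < n.+1) f i (coord t i)).
  elim: (index_enum _) => [|i s mIH].
    by under eq_fun do rewrite big_nil; exact: cmeasurable_cst.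
  under eq_fun do rewrite big_cons; apply: cmeasurableM => //.
  apply: (cmeasurable_comp (h := fun t : Rn R n.+1 => coord t i)).
    exact: cintegrable_meas (fi i).
  exact: measurable_coord.
have ip : cintegrable (lebesgue_Rn R n.+1)
    (fun t : Rn R n.+1 => \prod_(i < n.+1) f i (coord t i)).
  apply/cintegrableP; split=> //.
  rewrite (@ge0_integral_RnS _ n
    (fun t => (normc (\prod_(i < n.+1) f i (coord t i)))%:E)); last 2 first.
    exact: measurable_normcE.
    by move=> t; rewrite lee_fin normc_ge0.
  under eq_integral => x _.
    under eq_integral => t _.
      rewrite big_ord_recl Normc.normcM EFinM coord_cons0.
      under eq_bigr do rewrite coord_consS.
      over.
    rewrite ge0_integralZl//; last 3 first.
    - exact/measurable_normcE/cintegrable_meas/IHi.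
    - by move=> t _; rewrite lee_fin normc_ge0.
    - by rewrite lee_fin normc_ge0.
    over.
  rewrite ge0_integralZr//; last 3 first.
  - exact/measurable_normcE/cintegrable_meas/fi.
  - by move=> t _; rewrite lee_fin normc_ge0.
  - by apply: integral_ge0 => t _; rewrite lee_fin normc_ge0.
  have /cintegrable_lty fi0 := fi ord0; have /cintegrable_lty IHi0 := IHi.
  apply: lte_mul_pinfty => //.
    by apply: integral_ge0 => t _; rewrite lee_fin normc_ge0.
  rewrite ge0_fin_numE//.
  by apply: integral_ge0 => t _; rewrite lee_fin normc_ge0.
split=> //; rewrite cintegral_RnS// big_ord_recl -IHE.
under eq_cintegral => x.
  under eq_cintegral => t.
    rewrite big_ord_recl coord_cons0.
    under eq_bigr do rewrite coord_consS.
    over.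
  rewrite cintegralZl// mulrC.
  over.
by rewrite cintegralZl// mulrC.
Qed.

End tensor_product.

(** * The Poisson kernel *)

Section one_dimensional.
Context {R : realType}.
Implicit Types (e b t x : R).

Lemma is_derive_scale c x : is_derive x 1 (fun y : R => c * y) c.
Proof.
have := is_deriveZ c (is_derive_id x (1 : R)).
by rewrite /GRing.scale/= mulr1.
Qed.

Lemma is_derive_shift s x : is_derive x 1 (fun y : R => y - s) 1.
Proof.
have := is_deriveB (is_derive_id x (1 : R)) (is_derive_cst s x (1 : R)).
by rewrite subr0.
Qed.

Lemma is_derive_mul (f g : R -> R) x df dg :
  is_derive x 1 f df -> is_derive x 1 g dg ->
  is_derive x 1 (fun y => f y * g y) (f x * dg + g x * df).
Proof. by move=> hf hg; have := is_deriveM hf hg. Qed.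

Lemma is_derive_add (f g : R -> R) x df dg :
  is_derive x 1 f df -> is_derive x 1 g dg ->
  is_derive x 1 (fun y => f y + g y) (df + dg).
Proof. by move=> hf hg; have := is_deriveD hf hg. Qed.

Lemma is_derive_continuous (f df : R -> R) :
  (forall x, is_derive x 1 f (df x)) -> continuous f.
Proof.
move=> h x; apply: differentiable_continuous; apply/derivable1_diffP.
by have [] := h x.
Qed.

Lemma FTC2 (f F : R -> R) a b : a <= b -> continuous f ->
  (forall x, is_derive x 1 F (f x)) ->
  (\int[leb]_(x in `[a, b]) (f x)%:E = (F b - F a)%:E)%E.
Proof.
move=> ab cf dF; have cF := is_derive_continuous dF.
move: ab; rewrite le_eqVlt => /predU1P[->|ab].
  by rewrite set_itv1 integral_set1 subrr.
rewrite (continuous_FTC2 (F := F) ab)//.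
- exact: continuous_subspaceT.
- split.
  + by move=> x _; have [] := dF x.
  + by apply: cvg_at_right_filter; exact: cF.
  + by apply: cvg_at_left_filter; exact: cF.
- by move=> x _; rewrite derive1E; apply: derive_val.
Qed.

(** The integrand [f] contains [|x|] in some uses and then coincides with an elementary derivative
    on the positive half-line only; [g] is that derivative, defined everywhere. *)
Lemma FTC2_even (f F g : R -> R) l : continuous f -> (forall x, 0 <= f x) ->
  (forall x, f (- x) = f x) ->
  (forall x, is_derive x 1 F (g x)) -> (forall x, 0 <= x -> g x = f x) ->
  F x @[x --> +oo] --> l ->
  (\int[leb]_x (f x)%:E = (2 * (l - F 0))%:E)%E.
Proof.
move=> cf f0 fN dF gf Fl; have cF := is_derive_continuous dF.
rewrite ge0_symfun_integralT//; last by move=> x /=; rewrite fN.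
rewrite (_ : [set x | 0 <= x] = `[0, +oo[%classic); last first.
  by apply/seteqP; split => x /=; rewrite in_itv/= andbT.
rewrite (ge0_continuous_FTC2y (F := F) (l := l))//.
- exact: continuous_subspaceT.
- by apply: cvg_at_right_filter; exact: cF.
- move=> x; rewrite in_itv/= andbT => x0.
  by rewrite derive1E -gf ?ltW//; apply: derive_val.
Qed.

Lemma continuous_exp_cos e b :
  continuous (fun x => expR (- (e * `|x|)) * (1 + cos (b * x))).
Proof.
move=> x; apply: cvgM.
  apply: (continuous_comp (f := fun x => - (e * `|x|)) (g := expR)); last exact: continuous_expR.
  apply: cvgN; apply: cvgM; first exact: cvg_cst.
  exact: norm_continuous.
apply: cvgD; first exact: cvg_cst.
apply: (continuous_comp (f := fun x => b * x) (g := cos)); last exact: continuous_cos.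
by apply: cvgM; [exact: cvg_cst|exact: cvg_id].
Qed.

Lemma integral_exp_cos e b : 0 < e ->
  (\int[leb]_x (expR (- (e * `|x|)) * (1 + cos (b * x)))%:E =
   (2 / e + 2 * e / (e ^+ 2 + b ^+ 2))%:E)%E.
Proof.
move=> e0; have eb0 : 0 < e ^+ 2 + b ^+ 2.
  by rewrite ltr_pwDl ?sqr_ge0// exprn_gt0.
(* [F] is the antiderivative of [exp (- e x) * (1 + cos (b x))]; the summand [- e^-1] accounts for
   the constant 1. *)
pose G x := (b * sin (b * x) + - e * cos (b * x)) / (e ^+ 2 + b ^+ 2) - e^-1.
pose F x := expR (- e * x) * G x.
have dF x : is_derive x 1 F (expR (- e * x) * (1 + cos (b * x))).
  have d1 := is_derive_scale (- e) x; have d2 := is_derive_scale b x.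
  have d3 := is_derive1_comp (is_derive_expR (- e * x)) d1.
  have d4 := is_derive1_comp (is_derive_sin (b * x)) d2.
  have d5 := is_derive1_comp (is_derive_cos (b * x)) d2.
  have d6 := is_derive_add (is_derive_mul (is_derive_cst b x 1) d4)
    (is_derive_mul (is_derive_cst (- e) x 1) d5).
  have d7 := is_derive_add (is_derive_mul d6 (is_derive_cst (e ^+ 2 + b ^+ 2)^-1 x 1))
    (is_derive_cst (- e^-1) x 1).
  have d8 := is_derive_mul d3 d7.
  apply: (is_derive_eq d8); rewrite /cst /=.
  by field; rewrite !gt_eqF.
have FG x : 0 <= x -> `|F x| <= expR (- (e * x)) * (2 * (`|b| + e) / (e ^+ 2 + b ^+ 2) + e^-1).
  move=> x0; rewrite /F normrM ger0_norm ?expR_ge0// mulNr ler_wpM2l ?expR_ge0//.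
  rewrite (le_trans (ler_normB _ _))// lerD//; last by rewrite ger0_norm// invr_ge0 ltW.
  have nD z : `|z / (e ^+ 2 + b ^+ 2)| = `|z| / (e ^+ 2 + b ^+ 2).
    by rewrite normrM [X in _ * X]gtr0_norm// invr_gt0.
  rewrite nD ler_pM2r ?invr_gt0//.
  rewrite (le_trans (ler_normD _ _))// !normrM normrN (gtr0_norm e0).
  have hs : `|sin (b * x)| <= 1 by rewrite ler_norml sin_geN1 sin_le1.
  have hc : `|cos (b * x)| <= 1 by rewrite ler_norml cos_geN1 cos_le1.
  have := ler_wpM2l (normr_ge0 b) hs; have := ler_wpM2l (ltW e0) hc.
  have := normr_ge0 b; lra.
have lF : F x @[x --> +oo] --> (0 : R).
  apply: norm_cvg0; pose K := 2 * (`|b| + e) / (e ^+ 2 + b ^+ 2) + e^-1.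
  have lK : (fun x => expR (- (e * x)) * K) @ +oo --> (0 : R).
    rewrite -[X in _ --> X](mul0r K); apply: cvgM; last exact: cvg_cst.
    apply: (@cvg_comp _ _ _ (fun x => e * x) (fun y => expR (- y)) _ _ _ _ (@cvgr_expR R)).
    by apply: gt0_cvgMry.
  apply: squeeze_cvgr (cvg_cst (0 : R)) lK.
  near=> x; rewrite normr_ge0 /=; apply: FG.
  by near: x; exact: nbhs_pinfty_ge.
rewrite (FTC2_even (F := F) (g := fun x => expR (- e * x) * (1 + cos (b * x))) (l := 0)).
- congr EFin; rewrite /F /G !mulr0 expR0 sin0 cos0.
  by field; rewrite !gt_eqF.
- exact: continuous_exp_cos.
- by move=> x; rewrite mulr_ge0 ?expR_ge0// -lerBlDl sub0r cos_geN1.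
- by move=> x; rewrite normrN mulrN cosN.
- by move=> x x0; rewrite ger0_norm// mulNr.
- exact: lF.
Unshelve. all: by end_near. Qed.

(* Adding the constant 1 to the cosine makes the integrand nonnegative. *)
Lemma cintegral_even (h : R -> R) (A : R -> R) b : measurable_fun setT h ->
  (forall x, 0 <= h x) -> (forall x, h (- x) = h x) ->
  (forall c, \int[leb]_x (h x * (1 + cos (c * x)))%:E = (A c)%:E)%E ->
  cintegrable leb (fun x : measurableTypeR R => (h x)%:C%C * expi (b * x)) /\
  cintegral leb (fun x : measurableTypeR R => (h x)%:C%C * expi (b * x)) =
    (A b - 2^-1 * A 0)%:C%C.
Proof.
move=> mh h0 hN hA; pose k c x := h x * (1 + cos (c * x)).
have mk c : measurable_fun setT (k c).
  apply: measurable_funM => //; apply: measurable_funD => //.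
  apply: (measurableT_comp (f := cos)); last exact: measurable_funM.
  by apply: continuous_measurable_fun; exact: continuous_cos.
have k0 c x : 0 <= k c x by rewrite mulr_ge0// -lerBlDl sub0r cos_geN1.
have ik c : leb.-integrable setT (EFin \o k c).
  apply/integrableP; split; first by apply/measurable_EFinP; exact: mk.
  by under eq_integral do rewrite gee0_abs ?lee_fin//; rewrite hA ltry.
have Ek c : \int[leb]_x k c x = A c by rewrite /Rintegral hA.
have ab x : normc ((h x)%:C%C * expi (b * x)) = h x.
  by rewrite Normc.normcM normc_expi mulr1 normc_real ger0_norm.
have iF : cintegrable leb (fun x : measurableTypeR R => (h x)%:C%C * expi (b * x)).
  apply: (cintegrable_le (h := fun x : measurableTypeR R => (k 0 x)%:E)).
  - apply: cmeasurableM; last by apply: cmeasurable_expi; exact: measurable_funM.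
    exact: cmeasurable_real.
  - by move=> x; rewrite ab lee_fin /k mul0r cos0 ler_peMr//; lra.
  - by rewrite hA ltry.
split=> //.
(* Reflecting the variable conjugates the character and fixes [h], so the integral equals its own
   conjugate and is real. *)
have J : cintegral leb (fun x : measurableTypeR R => (h x)%:C%C * expi (b * x)) =
    conjc (cintegral leb (fun x : measurableTypeR R => (h x)%:C%C * expi (b * x))).
  rewrite -cintegralJ//.
  have pres (F : measurableTypeR R -> \bar R) : measurable_fun setT F ->
      (forall x, 0 <= F x)%E -> (\int[leb]_x F (-1 * x + 0)%R = \int[leb]_x F x)%E.
    by move=> mF F0; apply: integral_affine => //; right.
  rewrite -[LHS](preserving_cintegral pres); last exact: cintegrable_meas iF.
  apply: eq_cintegral => x; rewrite conjcM conjc_expi addr0 mulN1r mulrN.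
  by rewrite hN conjc_real.
apply: complex_eq; last first.
  have N0 a : a = - a -> a = 0 :> R by lra.
  by apply: N0; rewrite -ImJ -J.
rewrite [LHS]/= [RHS]/=.
(* Since [k 0 = 2 h], half of it removes the constant that was added to the cosine. *)
transitivity (\int[leb]_x (k b x - 2^-1 * k 0 x)).
  by apply: eq_Rintegral => x _; rewrite /k !mul0r cos0; lra.
rewrite RintegralB//; last first.
  by have := integrableZl measurableT 2^-1 (ik 0); apply: eq_integrable.
by rewrite RintegralZl// !Ek.
Qed.

Definition abel e x : R[i] := (expR (- (e * `|x|)))%:C%C.

Lemma cintegral_abel e b : 0 < e ->
  cintegrable leb (fun x : measurableTypeR R => abel e x * expi (b * x)) /\
  cintegral leb (fun x : measurableTypeR R => abel e x * expi (b * x)) =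
    (2 * e / (e ^+ 2 + b ^+ 2))%:C%C.
Proof.
move=> e0.
have [|||c|iF ->] := @cintegral_even (fun x => expR (- (e * `|x|)))
  (fun c => 2 / e + 2 * e / (e ^+ 2 + c ^+ 2)) b.
- apply: continuous_measurable_fun => x.
  apply: (continuous_comp (f := fun x => - (e * `|x|)) (g := expR)).
    apply: cvgN; apply: cvgM; first exact: cvg_cst.
    exact: norm_continuous.
  exact: continuous_expR.
- by move=> x; exact: expR_ge0.
- by move=> x; rewrite normrN.
- exact: integral_exp_cos.
split=> //; congr (_%:C%C); rewrite expr0n/= addr0; field.
by rewrite !gt_eqF// ltr_pwDl ?sqr_ge0// exprn_gt0.
Qed.

Lemma integral_oneDsqr :
  (\int[leb]_x ((1 + x ^+ 2)^-1)%:E = (pi : R)%:E)%E.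
Proof.
have p x : 0 < 1 + x ^+ 2 by rewrite ltr_pwDl ?sqr_ge0.
rewrite (FTC2_even (F := atan) (g := fun x => (1 + x ^+ 2)^-1) (l := pi / 2)).
- by rewrite atan0 subr0 mulrC divfK.
- move=> x; apply: cvgV; first by rewrite gt_eqF.
  by apply: cvgD; [exact: cvg_cst|exact: exprn_continuous].
- by move=> x; rewrite invr_ge0 ltW.
- by move=> x; rewrite sqrrN.
- by [].
- exact: cvgy_atan.
Qed.

(** The Fourier transform of [exp (- e |x|)] when the characters carry the factor [2 pi]; as a
    function of [t] it has mass one. *)
Definition poisson e t := 2 * e / (e ^+ 2 + (2 * pi * t) ^+ 2).

Lemma poisson_ge0 e t : 0 <= e -> 0 <= poisson e t.
Proof. by move=> e0; rewrite divr_ge0 ?mulr_ge0// addr_ge0// sqr_ge0. Qed.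

Lemma continuous_poisson e : 0 < e -> continuous (poisson e).
Proof.
move=> e0 x; apply: cvgM; first exact: cvg_cst.
apply: cvgV; first by rewrite gt_eqF// ltr_pwDl ?sqr_ge0// exprn_gt0.
apply: cvgD; first exact: cvg_cst.
apply: (continuous_comp (f := fun x => 2 * pi * x) (g := fun y => y ^+ 2)).
  by apply: cvgM; [exact: cvg_cst|exact: cvg_id].
exact: exprn_continuous.
Qed.

Lemma is_derive_poisson e s x : 0 < e ->
  is_derive x 1 (fun y => pi^-1 * atan (2 * pi / e * (y - s))) (poisson e (x - s)).
Proof.
move=> e0; have pi0 := pi_gt0 R.
have d1 := @is_derive1_comp _ (fun y => 2 * pi / e * y) (fun y => y - s) x _ _
  (is_derive_scale (2 * pi / e) (x - s)) (is_derive_shift s x).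
have d2 := @is_derive1_comp _ atan (fun y => 2 * pi / e * (y - s)) x _ _
  (is_derive1_atan (2 * pi / e * (x - s))) d1.
have d3 := is_derive_mul (is_derive_cst pi^-1 x 1) d2.
apply: (is_derive_eq d3); rewrite /cst /= /poisson.
move: (pi : R) pi0 => P P0; field.
by rewrite !gt_eqF//= ltr_pwDl ?sqr_ge0// exprn_gt0.
Qed.

Lemma integral_poisson e : 0 < e -> (\int[leb]_t (poisson e t)%:E = 1)%E.
Proof.
move=> e0; have pi0 := pi_gt0 R.
have dP (x : R) : is_derive x 1 (fun y => pi^-1 * atan (2 * pi / e * (y - 0)))
    (poisson e x).
  by have := is_derive_poisson 0 x e0; rewrite subr0.
rewrite (FTC2_even (F := fun y => pi^-1 * atan (2 * pi / e * (y - 0)))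
  (g := poisson e) (l := pi^-1 * (pi / 2))).
- congr EFin; rewrite subr0 mulr0 atan0.
  by move: (pi : R) pi0 => P P0; field; rewrite gt_eqF.
- exact: continuous_poisson.
- by move=> x; exact/poisson_ge0/ltW.
- by move=> x; rewrite /poisson mulrN sqrrN.
- by [].
- apply: cvgM; first exact: cvg_cst.
  apply: (@cvg_comp _ _ _ (fun y => 2 * pi / e * (y - 0)) atan _ _ _ _ (@cvgy_atan R)).
  rewrite (_ : (fun _ => _) = fun y => 2 * pi / e * y).
    by apply: gt0_cvgMry => //; rewrite divr_gt0// mulr_gt0.
  by apply/funext => y; rewrite subr0.
Qed.

Lemma integral_poisson_itv e s a b : 0 < e -> a <= b ->
  (\int[leb]_(t in `[a, b]) (poisson e (t - s))%:E =
   (pi^-1 * atan (2 * pi / e * (b - s)) - pi^-1 * atan (2 * pi / e * (a - s)))%:E)%E.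
Proof.
move=> e0 ab; have dP (x : R) := is_derive_poisson s x e0.
rewrite (FTC2 (F := fun y => pi^-1 * atan (2 * pi / e * (y - s))))//.
move=> x; apply: (continuous_comp (f := fun x => x - s) (g := poisson e)).
  by apply: cvgB; [exact: cvg_id|exact: cvg_cst].
exact: continuous_poisson.
Qed.

Lemma sin_le_id_sqr x : sin x ^+ 2 <= x ^+ 2.
Proof.
(* Integrating [1 - cos] and [1 + cos], both nonnegative, from 0 to [y] bounds [sin y] from above
   and from below. *)
have P (y : R) : 0 <= y -> `|sin y| <= y.
  move=> y0; have d1 (z : R) : is_derive z 1 (fun u : R => u + - sin u) (1 - cos z).
    exact: (is_derive_add (is_derive_id z 1) (is_deriveN (is_derive_sin z))).
  have d2 (z : R) : is_derive z 1 (fun u : R => u + sin u) (1 + cos z).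
    exact: (is_derive_add (is_derive_id z 1) (is_derive_sin z)).
  have I1 : (0%:E <= (y + - sin y - (0 + - sin 0))%:E)%E.
    rewrite -(FTC2 (f := fun z => 1 - cos z) (F := fun u : R => u + - sin u))//.
      by apply: integral_ge0 => z _; rewrite lee_fin subr_ge0 cos_le1.
    by move=> z; apply: cvgB; [exact: cvg_cst|exact: continuous_cos].
  have I2 : (0%:E <= (y + sin y - (0 + sin 0))%:E)%E.
    rewrite -(FTC2 (f := fun z => 1 + cos z) (F := fun u : R => u + sin u))//.
      by apply: integral_ge0 => z _; rewrite lee_fin -lerBlDl sub0r cos_geN1.
    by move=> z; apply: cvgD; [exact: cvg_cst|exact: continuous_cos].
  move: I1 I2; rewrite !lee_fin sin0 ler_norml => ? ?; apply/andP; split; lra.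
rewrite -[leLHS]real_normK ?num_real// -[leRHS]real_normK ?num_real//.
rewrite ler_pXn2r ?nnegrE//; have [x0|x0] := lerP 0 x.
  by rewrite (le_trans (P _ x0))// ler_norm.
have /P : 0 <= - x by rewrite oppr_ge0 ltW.
by rewrite sinN normrN => /le_trans; apply; rewrite -normrN ler_norm.
Qed.

Definition tri e x : R := Num.max 0 (1 - `|x| / e).

Lemma tri_ge0 e x : 0 <= tri e x. Proof. by rewrite le_max lexx. Qed.

Lemma tri_le1 e x : 0 <= e -> tri e x <= 1.
Proof. by move=> e0; rewrite ge_max ler01 gerBl divr_ge0. Qed.

Lemma tri_eq0 e x : 0 < e -> e <= `|x| -> tri e x = 0.
Proof.
by move=> e0 ex; apply/max_idPl; rewrite subr_le0 ler_pdivlMr// mul1r.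
Qed.

Lemma continuous_tri e : continuous (tri e).
Proof.
have -> : tri e = fun x => 2^-1 * (`|1 - `|x| / e| + (1 - `|x| / e)).
  apply/funext => x; rewrite /tri; case: (lerP 0 (1 - `|x| / e)) => h.
    by rewrite (ger0_norm h); lra.
  by rewrite (ltr0_norm h); lra.
have cu : continuous (fun x => 1 - `|x| / e).
  move=> x; apply: cvgB; first exact: cvg_cst.
  by apply: cvgM; [exact: norm_continuous|exact: cvg_cst].
move=> x; apply: cvgM; first exact: cvg_cst.
by apply: cvgD; [apply: cvg_norm; exact: cu|exact: cu].
Qed.

(** The mass [e] of the tent plus its Fourier transform, a Fejer kernel; the kernel has the limit
    [e] at [b = 0], where the quotient is meaningless. *)
Definition tri_mass e b := if b == 0 then 2 * e else e + 2 * (1 - cos (b * e)) / (e * b ^+ 2).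

Lemma integral_tri_cos e b : 0 < e ->
  (\int[leb]_x (tri e x * (1 + cos (b * x)))%:E = (tri_mass e b)%:E)%E.
Proof.
move=> e0; have c1 y : 0 <= 1 + cos y :> R by rewrite -lerBlDl sub0r cos_geN1.
have cc : continuous (fun x => 1 + cos (b * x)).
  move=> x; apply: cvgD; first exact: cvg_cst.
  apply: (continuous_comp (f := fun x => b * x) (g := cos)); last exact: continuous_cos.
  by apply: cvgM; [exact: cvg_cst|exact: cvg_id].
rewrite ge0_symfun_integralT; last 3 first.
- by move=> x; rewrite mulr_ge0 ?tri_ge0.
- by move=> x; apply: cvgM; [exact: continuous_tri|exact: cc].
- by move=> x /=; rewrite /tri normrN mulrN cosN.
have -> : (\int[leb]_(x in [set x : R | (0 <= x)%R]) (tri e x * (1 + cos (b * x)))%:E =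
    \int[leb]_(x in `[0%R, e]) ((1 - x / e)%R * (1 + cos (b * x)))%:E)%E.
  rewrite [LHS]integral_mkcond [RHS]integral_mkcond.
  apply: eq_integral => x _; rewrite /patch.
  rewrite [X in _ = (if X then _ else _)](_ : _ = (0 <= x <= e)); last first.
    by apply/asboolP/idP; rewrite /= in_itv.
  rewrite (_ : (x \in _) = (0 <= x)); last by apply/asboolP/idP.
  case: ifPn => [x0|x0] //=; case: ifPn => [xe|].
    by rewrite /tri max_r ?ger0_norm// subr_ge0 ler_pdivrMr// mul1r.
  by rewrite -ltNge => ex; rewrite tri_eq0 ?mul0r// ger0_norm// ltW.
pose F x := if b == 0 then 2 * x + - e^-1 * (x * x) else
  x + (- (2 * e)^-1) * (x * x) + (b^-1 * (1 + - e^-1 * x) * sin (b * x)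
    + (- (e * b ^+ 2)^-1) * cos (b * x)).
have dF x : is_derive x 1 F ((1 - x / e) * (1 + cos (b * x))).
  have di := is_derive_id x (1 : R).
  have dxx := is_derive_mul di di.
  rewrite /F; have [->|b0] := eqVneq b 0.
    have d1 := is_derive_add (is_derive_mul (is_derive_cst (2 : R) x 1) di)
      (is_derive_mul (is_derive_cst (- e^-1) x 1) dxx).
    apply: (is_derive_eq d1); rewrite /cst /= mul0r cos0; field.
    by rewrite gt_eqF.
  have d2 := is_derive_scale b x.
  have d4 := is_derive1_comp (is_derive_sin (b * x)) d2.
  have d5 := is_derive1_comp (is_derive_cos (b * x)) d2.
  have d6 := is_derive_mul (is_derive_cst b^-1 x 1)
    (is_derive_add (is_derive_cst (1 : R) x 1) (is_derive_scale (- e^-1) x)).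
  have d7 := is_derive_add (is_derive_add di (is_derive_mul (is_derive_cst (- (2 * e)^-1) x 1) dxx))
    (is_derive_add (is_derive_mul d6 d4) (is_derive_mul (is_derive_cst (- (e * b ^+ 2)^-1) x 1) d5)).
  apply: (is_derive_eq d7); rewrite /cst /=; field.
  by rewrite b0 gt_eqF.
rewrite (FTC2 (F := F))//; last 2 first.
- exact: ltW.
- move=> x; apply: cvgM; last exact: cc.
  apply: cvgB; first exact: cvg_cst.
  by apply: cvgM; [exact: cvg_id|exact: cvg_cst].
rewrite -EFinM; congr EFin; rewrite /F /tri_mass; case: ifPn => [_|b0].
  by field; rewrite gt_eqF.
rewrite !mulr0 sin0 cos0; field.
by rewrite b0 gt_eqF.
Qed.

(** The constant adds two bounds for the Fejer kernel: it is at most [e] because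
    [sin x ^+ 2 <= x ^+ 2], and [b ^+ 2] times it is at most [4 / e]. The resulting quadratic decay
    is what makes the transform of the window integrable. *)
Lemma cintegral_tri e b : 0 < e ->
  cintegrable leb (fun x : measurableTypeR R => (tri e x)%:C%C * expi (b * x)) /\
  normc (cintegral leb (fun x : measurableTypeR R => (tri e x)%:C%C * expi (b * x)))
    <= (e + 4 / e) / (1 + b ^+ 2).
Proof.
move=> e0.
have [|||c|iF ->] := @cintegral_even (tri e) (tri_mass e) b.
- by apply: continuous_measurable_fun; exact: continuous_tri.
- by move=> x; exact: tri_ge0.
- by move=> x; rewrite /tri normrN.
- exact: integral_tri_cos.
split=> //; rewrite normc_real /tri_mass eqxx ler_pdivlMr; last first.
  by rewrite ltr_pwDl ?sqr_ge0.
have [->|b0] := eqVneq b 0.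
  rewrite expr0n/= addr0 mulr1 mulKf// (_ : 2 * e - e = e); last by ring.
  by rewrite ger0_norm ?lerDl ?divr_ge0// ltW.
rewrite mulKf// addrAC subrr add0r.
have eb : 0 < e * b ^+ 2 by rewrite mulr_gt0// exprn_even_gt0.
rewrite ger0_norm; last first.
  by apply: divr_ge0; [rewrite mulr_ge0// subr_ge0 cos_le1|exact: ltW].
rewrite mulrDr mulr1 lerD//.
  have := cos2Dsin2 (b * e / 2); have := cosD (b * e / 2) (b * e / 2).
  rewrite -splitr -!expr2 => -> cs.
  have s1 : 1 - (cos (b * e / 2) ^+ 2 - sin (b * e / 2) ^+ 2) = 2 * sin (b * e / 2) ^+ 2.
    by rewrite -[X in X - _]cs; ring.
  rewrite s1 ler_pdivrMr//.
  have := sin_le_id_sqr (b * e / 2); rewrite exprMn exprMn; lra.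
rewrite (_ : 2 * (1 - cos (b * e)) / (e * b ^+ 2) * b ^+ 2 = 2 * (1 - cos (b * e)) / e); last first.
  by field; rewrite b0 gt_eqF.
rewrite ler_pM2r ?invr_gt0//; have := cos_geN1 (b * e); lra.
Qed.

End one_dimensional.

(** * Half-open boxes, and functions whose integrals over boxes vanish *)

Section boxes.
Context {R : realType}.

(** Half-open like the intervals that generate the Borel sets, and stable under intersection, so
    that the boxes form a pi-system. *)
Definition box n (a b : Rn R n) : set (Rn R n) :=
  [set t | forall i, coord a i < coord t i <= coord b i].

Lemma boxE n (a b : Rn R n) : box a b =
  \bigcap_(i in [set: 'I_n]) ((fun t => coord t i) @^-1` `]coord a i, coord b i]).
Proof.
apply/seteqP; split => t /= ht i; last by have := ht i I; rewrite /= in_itv.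
by move=> _ /=; rewrite in_itv; exact: ht.
Qed.

Lemma measurable_box n (a b : Rn R n) : measurable (box a b).
Proof.
rewrite boxE; apply: fin_bigcap_measurable => // i _.
by rewrite -[X in measurable X]setTI; apply: measurable_coord.
Qed.

Lemma coord_mk n (f : 'I_n -> measurableTypeR R) i : coord [tuple f j | j < n] i = f i.
Proof. by rewrite /coord tnth_mktuple. Qed.

Lemma box_setI n (a b c e : Rn R n) : box a b `&` box c e =
  box [tuple Num.max (coord a i) (coord c i) : measurableTypeR R | i < n]
      [tuple Num.min (coord b i) (coord e i) : measurableTypeR R | i < n].
Proof.
apply/seteqP; split => t /=.
  move=> [h1 h2] i; rewrite !coord_mk.
  by rewrite gt_max le_min; move: (h1 i) (h2 i) => /andP[-> ->] /andP[-> ->].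
move=> h; split=> i; have := h i; rewrite !coord_mk gt_max le_min;
  by move=> /andP[/andP[? ?] /andP[? ?]]; apply/andP.
Qed.

Definition cstRn n (c : R) : Rn R n := [tuple c : measurableTypeR R | i < n].

Lemma coord_cst n c (i : 'I_n) : coord (cstRn n c) i = c.
Proof. exact: coord_mk. Qed.

Definition cubeN n N : set (Rn R n) := box (cstRn n (- N%:R)) (cstRn n N%:R).

Lemma in_cubeN n (t : Rn R n) : exists N, forall M, (N <= M)%N -> cubeN M t.
Proof.
exists (\sum_(i < n) (Num.truncn `|coord t i|).+1)%N => M NM i.
rewrite !coord_cst.
have : `|coord t i| < M%:R.
  rewrite (lt_le_trans (truncnS_gt _))// ler_nat (leq_trans _ NM)//.
  by rewrite (bigD1 i)//= leq_addr.
by rewrite ltr_norml => /andP[-> /ltW ->].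
Qed.

Definition boxes n : set (set (Rn R n)) := [set E | exists a b, E = box a b].

Lemma measurable_boxes n : @measurable _ (Rn R n) = <<s @boxes n >>.
Proof.
have sB := smallest_sigma_algebra setT (@boxes n).
apply/seteqP; split; last first.
  apply: smallest_sub; first exact: sigma_algebra_measurable.
  by move=> _ [a [b ->]]; exact: measurable_box.
apply: smallest_sub => // A; rewrite -bigcup_seq => -[i _ [Y mY <-]].
rewrite setTI {A}; move: Y mY; apply: smallest_sub.
  split.
  - by rewrite preimage_set0; exact: sigma_algebra0.
  - by move=> Y hY; rewrite setTD preimage_setC -setTD; exact: sigma_algebraCD.
  - by move=> F hF; rewrite preimage_bigcup; exact: sigma_algebra_bigcup.
move=> _ [[a b] _ <-] /=.
(* A condition on one coordinate is a union of boxes: the other coordinates are confined to []-N,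
   N]] and [N] grows. *)
pose A N : Rn R n := [tuple if j == i then a else - N%:R : measurableTypeR R | j < n].
pose B N : Rn R n := [tuple if j == i then b else N%:R : measurableTypeR R | j < n].
rewrite (_ : _ @^-1` _ = \bigcup_N box (A N) (B N)).
  by apply: sigma_algebra_bigcup => N; apply: sub_sigma_algebra; exists (A N), (B N).
apply/seteqP; split => t /=.
  rewrite in_itv /= => /andP[ta tb]; have [N hN] := in_cubeN t.
  exists N => // j; rewrite /A /B !coord_mk.
  case: eqVneq => [->|_]; first by rewrite /coord ta tb.
  by have := hN N (leqnn _) j; rewrite !coord_cst.
move=> [N _ /(_ i)]; rewrite /A /B !coord_mk eqxx in_itv/=.
by [].
Qed.

Lemma boxes_setI n : setI_closed (@boxes n).
Proof. by move=> _ _ [a [b ->]] [c [e ->]]; rewrite box_setI; do 2 eexists. Qed.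

Lemma integral_box_ae0 n (h : Rn R n -> R) :
  (lebesgue_Rn R n).-integrable setT (EFin \o h) ->
  (forall a b, \int[lebesgue_Rn R n]_(t in box a b) (h t)%:E = 0)%E ->
  {ae lebesgue_Rn R n, forall t, h t = 0}.
Proof.
move=> ih hb; set mu := lebesgue_Rn R n.
have mh : measurable_fun setT (EFin \o h) by exact: measurable_int ih.
have iE E : measurable E -> mu.-integrable E (EFin \o h).
  by move=> mE; apply: integrableS ih.
have P E : measurable E -> (\int[mu]_(t in E) (h t)%:E = 0)%E.
  rewrite measurable_boxes => sE.
  (* The whole space is not a box, but the induction needs its integral for complements; it is
     reached by dominated convergence along the boxes [cubeN N]. *)
  have PT : (\int[mu]_(t in setT) (h t)%:E = 0)%E.
    have := @dominated_cvg _ _ _ mu setT measurableT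
      (fun N t => (EFin \o h) t * (\1_(cubeN N) t)%:E)%E (EFin \o h) (abse \o (EFin \o h)).
    have -> : (fun N => \int[mu]_t ((EFin \o h) t * (\1_(cubeN N) t)%:E))%E = cst 0%E.
      apply/funext => N /=; rewrite -[RHS](hb (cstRn n (- N%:R)) (cstRn n N%:R)).
      rewrite [RHS]integral_mkcond; apply: eq_integral => t _.
      rewrite /patch; case: ifPn => [|].
        by rewrite inE => ?; rewrite indicE mem_set// mule1.
      by rewrite notin_setE => ?; rewrite indicE memNset// mule0.
    move=> /(_ _ _ _ _ _)/wrap[]//.
    - move=> N; apply: emeasurable_funM => //; apply/measurable_EFinP.
      by apply: measurable_indic; exact: measurable_box.
    - move=> t _; have [N hN] := in_cubeN t.
      apply: cvg_near_cst; exists N => // M /= NM.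
      by rewrite indicE mem_set ?mule1//; exact: hN.
    - by apply: integrable_abse.
    - move=> N t _; rewrite abseM /= -[leRHS]mule1; apply: lee_wpmul2l => //.
      by rewrite lee_fin indicE; case: (_ \in _); rewrite /= ?normr1 ?normr0.
    - move=> h0; apply/esym; apply: (cvg_unique _ (cvg_cst 0%E) h0) => //.
  apply: (dynkin_induction (measurable_boxes n) (@boxes_setI n)
    (P := fun E => \int[mu]_(t in E) (h t)%:E = 0)%E) sE => //.
  - by move=> _ [a [b ->]].
  - move=> S mS hS; have := PT; rewrite -(setUv S) integral_setU//=.
    + by rewrite hS add0e.
    + exact: measurableC.
    + by rewrite setUv.
    + by rewrite disj_set2E setICr.
  - move=> F mF tF hF; rewrite integral_bigcup//.
      by rewrite eseries0.
    by apply: iE; exact: bigcupT_measurable.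
have := @integral_ae_eq _ _ _ mu setT measurableT (cst 0%E) (EFin \o h) ih.
move=> /(_ _ _)/wrap[].
- exact: measurable_cst.
- by move=> E _ mE; rewrite P// integral0.
- by apply: filterS => t /= /(_ I) [].
Qed.

End boxes.

Section complex_limits.
Context {R : realType}.

Definition ccvg (u : nat -> R[i]) (l : R[i]) :=
  ((fun k => complex.Re (u k)) @ \oo --> complex.Re l) /\
  ((fun k => complex.Im (u k)) @ \oo --> complex.Im l).

Lemma ccvg_unique u l l' : ccvg u l -> ccvg u l' -> l = l'.
Proof.
by move=> [h1 h2] [h3 h4]; apply: complex_eq; [apply: cvg_unique h1 h3|
  apply: cvg_unique h2 h4].
Qed.

Lemma ccvgZ c (u : nat -> R) (l : R) : u @ \oo --> l ->
  ccvg (fun k => c * (u k)%:C%C) (c * l%:C%C).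
Proof.
move=> ul; split; rewrite ?ReM ?ImM /=; [under eq_fun do rewrite ReM /=|
  under eq_fun do rewrite ImM /=].
  by apply: cvgB; apply: cvgM => //; exact: cvg_cst.
by apply: cvgD; apply: cvgM => //; exact: cvg_cst.
Qed.

Lemma ccvgM c u l : ccvg u l -> ccvg (fun k => c * u k) (c * l).
Proof.
move=> [u1 u2]; split; rewrite ?ReM ?ImM /=; [under eq_fun do rewrite ReM /=|
  under eq_fun do rewrite ImM /=].
  by apply: cvgB; apply: cvgM => //; exact: cvg_cst.
by apply: cvgD; apply: cvgM => //; exact: cvg_cst.
Qed.

Lemma cintegral_dominated d (T : measurableType d) (mu : {measure set T -> \bar R})
    (f_ : nat -> T -> R[i]) (f g : T -> R[i]) :
  (forall k, cmeasurable (f_ k)) -> cmeasurable f -> cintegrable mu g ->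
  {ae mu, forall x, ccvg (f_^~ x) (f x)} ->
  (forall k x, normc (f_ k x) <= normc (g x)) ->
  ccvg (fun k => cintegral mu (f_ k)) (cintegral mu f).
Proof.
move=> mf_ mf ig cf fg.
have ing : mu.-integrable setT (fun x => (normc (g x))%:E).
  apply/integrableP; split; first exact/measurable_normcE/cintegrable_meas/ig.
  under eq_integral do rewrite gee0_abs ?lee_fin ?normc_ge0//.
  exact: cintegrable_lty ig.
have S (p : R[i] -> R) : (forall z, `|p z| <= normc z) ->
    (forall k, measurable_fun setT (fun x => p (f_ k x))) ->
    measurable_fun setT (fun x => p (f x)) ->
    {ae mu, forall x, (fun k => p (f_ k x)) @ \oo --> p (f x)} ->
    (fun k => \int[mu]_x p (f_ k x)) @ \oo --> \int[mu]_x p (f x).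
  move=> pn mk m c.
  have [|||//|ih _ h] := @dominated_convergence _ _ _ mu setT measurableT
    (fun k x => (p (f_ k x))%:E) (fun x => (p (f x))%:E) (fun x => (normc (g x))%:E)
    _ _ _ ing.
  - by move=> k; exact/measurable_EFinP.
  - exact/measurable_EFinP.
  - by apply: filterS c => x cx _; apply/fine_cvgP; split; [exact: nearW|].
  - by apply: aeW => x k _; rewrite lee_fin (le_trans (pn _)).
  - have : (\int[mu]_x (p (f x))%:E)%E \is a fin_num by exact: integrable_fin_num ih.
    by move=> /fineK E; rewrite -E in h; exact: fine_cvg h.
split; rewrite /cintegral /=.
  apply: (S (@complex.Re R)) => //; first exact: normc_Re.
  - by move=> k; case: (mf_ k).
  - by case: mf.
  - by apply: filterS cf => x [].
apply: (S (@complex.Im R)) => //; first exact: normc_Im.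
- by move=> k; case: (mf_ k).
- by case: mf.
- by apply: filterS cf => x [].
Qed.

End complex_limits.

Section tensor_real.
Context {R : realType}.

Lemma cintegrable_real d (T : measurableType d) (mu : {measure set T -> \bar R}) (h : T -> R) :
  mu.-integrable setT (EFin \o h) -> cintegrable mu (fun x => (h x)%:C%C).
Proof. by move=> ih; split => //=; exact: integrable0. Qed.

Lemma integral_tensor n (f : 'I_n -> measurableTypeR R -> R) (c : 'I_n -> R) :
  (forall i, measurable_fun setT (f i)) -> (forall i x, 0 <= f i x) ->
  (forall i, \int[leb]_x (f i x)%:E = (c i)%:E)%E ->
  (\int[lebesgue_Rn R n]_t (\prod_(i < n) f i (coord t i))%:E = (\prod_(i < n) c i)%:E)%E.
Proof.
move=> mf f0 fc.
have fi i : leb.-integrable setT (EFin \o f i).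
  apply/integrableP; split; first exact/measurable_EFinP.
  by under eq_integral do rewrite gee0_abs ?lee_fin//; rewrite fc ltry.
have [ip Ep] := cintegral_tensor (fun i => cintegrable_real (fi i)).
have pE (t : Rn R n) : \prod_(i < n) (f i (coord t i))%:C%C =
    (\prod_(i < n) f i (coord t i))%:C%C by rewrite rmorph_prod.
have p0 (t : Rn R n) : 0 <= \prod_(i < n) f i (coord t i) by apply: prodr_ge0.
have iRe : (lebesgue_Rn R n).-integrable setT
    (fun t => (\prod_(i < n) f i (coord t i))%:E).
  by have := ip.1; under eq_fun do rewrite pE.
rewrite -[LHS]fineK; last first.
  exact: integrable_fin_num iRe.
congr EFin; transitivity (complex.Re (\prod_(i < n) cintegral leb (fun x => (f i x)%:C%C))).
  by rewrite -Ep /=; apply: eq_Rintegral => t _; rewrite pE.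
under eq_bigr do rewrite cintegral_real /Rintegral fc /=.
by rewrite -rmorph_prod.
Qed.

Lemma normc_prod n (f : 'I_n -> R[i]) : normc (\prod_(i < n) f i) = \prod_(i < n) normc (f i).
Proof.
by elim/big_ind2: _ => [|x1 x2 y1 y2 h1 h2|//]; rewrite ?Normc.normc1// Normc.normcM h1 h2.
Qed.

Lemma expi_sum n (f : 'I_n -> R) : expi (\sum_(i < n) f i) = \prod_(i < n) expi (f i).
Proof.
elim/big_ind2: _ => [|x1 x2 y1 y2 h1 h2|//]; first by rewrite expi0.
by rewrite expiD h1 h2.
Qed.

End tensor_real.

(** * The Fourier transform *)

Section fourier_transform.
Context {R : realType} {n : nat}.
Notation mu := (lebesgue_Rn R n).
Implicit Types (f g : Rn R n -> R[i]) (w t s x : Rn R n) (e : R).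

Definition fourier f w : R[i] :=
  cintegral mu (fun t => f t * expi (- (2 * pi * dotRn w t))).

Definition ifourier f t : R[i] :=
  cintegral mu (fun w => f w * expi (2 * pi * dotRn w t)).

Lemma dotRn_sub w t s : dotRn w (subRn t s) = dotRn w t - dotRn w s.
Proof.
rewrite /dotRn -sumrB; apply: eq_bigr => i _.
by rewrite coord_sub mulrBr.
Qed.

Lemma cmeasurable_char d (T : measurableType d) (a b : T -> Rn R n) :
  measurable_fun setT a -> measurable_fun setT b ->
  cmeasurable (fun u : T => expi (2 * pi * dotRn (a u) (b u))).
Proof.
move=> ma mb; apply: cmeasurable_expi; apply: measurable_funM => //.
exact: measurable_dotRn.
Qed.

Lemma cmeasurable_charN d (T : measurableType d) (a b : T -> Rn R n) :
  measurable_fun setT a -> measurable_fun setT b ->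
  cmeasurable (fun u : T => expi (- (2 * pi * dotRn (a u) (b u)))).
Proof.
move=> ma mb; apply: cmeasurable_expi; apply: measurableT_comp => //.
by apply: measurable_funM => //; exact: measurable_dotRn.
Qed.

Lemma cintegrable_unimodular f (h : Rn R n -> R[i]) : cintegrable mu f ->
  cmeasurable h -> (forall t, normc (h t) = 1) ->
  cintegrable mu (fun t => f t * h t).
Proof.
move=> fi mh h1; apply: (cintegrable_le (h := fun t => (normc (f t))%:E)).
- by apply: cmeasurableM => //; exact: cintegrable_meas fi.
- by move=> t; rewrite Normc.normcM h1 mulr1.
- exact: cintegrable_lty.
Qed.

Lemma cintegrable_fourier f w : cintegrable mu f ->
  cintegrable mu (fun t => f t * expi (- (2 * pi * dotRn w t))).
Proof.
move=> fi; apply: cintegrable_unimodular => // [|t]; last exact: normc_expi.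
by apply: cmeasurable_charN => //; exact: measurable_cst.
Qed.

Lemma cintegrable_ifourier f t : cintegrable mu f ->
  cintegrable mu (fun w => f w * expi (2 * pi * dotRn w t)).
Proof.
move=> fi; apply: cintegrable_unimodular => // [|w]; last exact: normc_expi.
by apply: cmeasurable_char => //; exact: measurable_cst.
Qed.

Lemma cmeasurable_fourier f : cmeasurable f -> cmeasurable (fourier f).
Proof.
move=> mf; apply: (@cmeasurable_cintegral _ _ _ _ _ mu
  (fun w t => f t * expi (- (2 * pi * dotRn w t)))).
apply: cmeasurableM; first exact: cmeasurable_comp mf _.
exact: cmeasurable_charN.
Qed.

Lemma cmeasurable_ifourier f : cmeasurable f -> cmeasurable (ifourier f).
Proof.
move=> mf; apply: (@cmeasurable_cintegral _ _ _ _ _ mu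
  (fun t w => f w * expi (2 * pi * dotRn w t))).
apply: cmeasurableM; first exact: cmeasurable_comp mf _.
exact: cmeasurable_char.
Qed.

Lemma normc_fourier f w : cintegrable mu f ->
  ((normc (fourier f w))%:E <= \int[mu]_t (normc (f t))%:E)%E.
Proof.
move=> fi; apply: le_trans (normc_cintegral (cintegrable_fourier w fi)) _.
by under eq_integral do rewrite Normc.normcM normc_expi mulr1.
Qed.

Lemma normc_ifourier f t : cintegrable mu f ->
  ((normc (ifourier f t))%:E <= \int[mu]_w (normc (f w))%:E)%E.
Proof.
move=> fi; apply: le_trans (normc_cintegral (cintegrable_ifourier t fi)) _.
by under eq_integral do rewrite Normc.normcM normc_expi mulr1.
Qed.

Lemma normc_sqr_conj (z : R[i]) : (normc z ^+ 2)%:C%C = z * conjc z.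
Proof.
rewrite normc_sqr; apply: complex_eq; rewrite ?ReM ?ImM ReJ ImJ; first by rewrite /=; ring.
by rewrite /= mulrN mulrC addNr.
Qed.

(** The factor of Abel summation, with the l^1 norm of [w] so that it is a product over the
    coordinates and its transform is a product of Poisson kernels. *)
Definition abelRn e w : R := expR (- (e * \sum_(i < n) `|coord w i|)).

Definition poissonRn e t : R := \prod_(i < n) poisson e (coord t i).

Lemma abelRn_ge0 e w : 0 <= abelRn e w. Proof. exact: expR_ge0. Qed.

Lemma abelRn_le1 e w : 0 <= e -> abelRn e w <= 1.
Proof. by move=> e0; rewrite -expR0 ler_expR oppr_le0 mulr_ge0// sumr_ge0. Qed.

Lemma poissonRn_ge0 e t : 0 <= e -> 0 <= poissonRn e t.
Proof. by move=> e0; apply: prodr_ge0 => i _; exact: poisson_ge0. Qed.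

Lemma poissonRn_le e t : 0 < e -> poissonRn e t <= (2 / e) ^+ n.
Proof.
move=> e0; rewrite -[X in _ ^+ X]card_ord -prodr_const; apply: ler_prod => i _.
rewrite (poisson_ge0 _ (ltW e0))/= /poisson ler_pdivrMr; last first.
  by rewrite ltr_pwDl ?sqr_ge0// exprn_gt0.
rewrite mulrDr -[leLHS]addr0 lerD//; last first.
  by rewrite mulr_ge0 ?sqr_ge0// divr_ge0// ltW.
by rewrite expr2 mulrA divfK ?gt_eqF.
Qed.

Lemma measurable_poissonRn e : 0 < e -> measurable_fun setT (poissonRn e).
Proof.
move=> e0; apply: measurable_prod => i _.
apply: (measurableT_comp (f := poisson e)); last exact: measurable_coord.
by apply: continuous_measurable_fun; exact: continuous_poisson.
Qed.

Lemma measurable_abelRn e : measurable_fun setT (abelRn e).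
Proof.
apply: (measurableT_comp (f := expR)) => //.
apply: measurableT_comp => //; apply: measurable_funM => //.
apply: measurable_sum => i; apply: measurableT_comp => //; exact: measurable_coord.
Qed.

Lemma abelRnE e w : (abelRn e w)%:C%C = \prod_(i < n) abel e (coord w i).
Proof.
rewrite /abelRn mulr_sumr -sumrN expR_sum /abel.
by rewrite [LHS]rmorph_prod.
Qed.

Lemma ifourier_abel e t : 0 < e ->
  cintegrable mu (fun w => (abelRn e w)%:C%C * expi (2 * pi * dotRn w t)) /\
  ifourier (fun w => (abelRn e w)%:C%C) t = (poissonRn e t)%:C%C.
Proof.
move=> e0; pose f (i : 'I_n) (x : measurableTypeR R) :=
  abel e x * expi (2 * pi * coord t i * x).
have E w : (abelRn e w)%:C%C * expi (2 * pi * dotRn w t) =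
    \prod_(i < n) f i (coord w i).
  rewrite abelRnE /dotRn mulr_sumr expi_sum -big_split/=.
  by apply: eq_bigr => i _; rewrite /f; congr (_ * expi _); ring.
have fi i := cintegral_abel (2 * pi * coord t i) e0.
have [iP EP] := cintegral_tensor (fun i => (fi i).1).
split; first by under eq_fun do rewrite E.
rewrite /ifourier; under eq_cintegral do rewrite E.
rewrite EP; under eq_bigr do rewrite (fi _).2.
by rewrite -rmorph_prod.
Qed.

Lemma integral_poissonRn e : 0 < e -> (\int[mu]_t (poissonRn e t)%:E = 1)%E.
Proof.
move=> e0; rewrite (integral_tensor (f := fun _ => poisson e) (c := fun _ => 1)).
- by rewrite big1.
- by move=> _; apply: continuous_measurable_fun; exact: continuous_poisson.
- by move=> _ x; exact/poisson_ge0/ltW.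
- by move=> _; exact: integral_poisson.
Qed.

Lemma cintegrable_abel e : 0 < e -> cintegrable mu (fun w => (abelRn e w)%:C%C).
Proof.
move=> e0; have [ie _] := ifourier_abel (cstRn n 0) e0.
have -> : (fun w => (abelRn e w)%:C%C) =
    (fun w => (abelRn e w)%:C%C * expi (2 * pi * dotRn w (cstRn n 0))).
  apply/funext => w; rewrite /dotRn big1 ?mulr0 ?expi0 ?mulr1// => i _.
  by rewrite coord_cst mulr0.
exact: ie.
Qed.

(** [fourier g] alone need not be integrable; the Abel factor makes the double integral absolutely
    convergent, and exchanging the order leaves the transform of that factor. *)
Lemma fourier_abel g e t : cintegrable mu g -> 0 < e ->
  cintegral mu (fun w => fourier g w * ((abelRn e w)%:C%C * expi (2 * pi * dotRn w t))) =
  cintegral mu (fun s => g s * (poissonRn e (subRn t s))%:C%C).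
Proof.
move=> gi e0; have mg := cintegrable_meas gi.
pose F w s := g s * expi (- (2 * pi * dotRn w s)) *
  ((abelRn e w)%:C%C * expi (2 * pi * dotRn w t)).
have nF w s : normc (F w s) = abelRn e w * normc (g s).
  rewrite !Normc.normcM !normc_expi !mulr1 normc_real ger0_norm ?abelRn_ge0//.
  by rewrite mulrC.
have mF : cmeasurable (fun z : Rn R n * Rn R n => F z.1 z.2).
  apply: cmeasurableM; apply: cmeasurableM.
  - exact: cmeasurable_comp mg _.
  - exact: cmeasurable_charN.
  - apply: cmeasurable_real; apply: (measurableT_comp (f := abelRn e)) => //.
    exact: measurable_abelRn.
  - by apply: cmeasurable_char => //; exact: measurable_cst.
have iF : (\int[mu]_w \int[mu]_s (normc (F w s))%:E < +oo)%E.
  under eq_integral => w _.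
    under eq_integral do rewrite nF EFinM.
    rewrite ge0_integralZl//; last 3 first.
      exact: measurable_normcE.
      by move=> s _; rewrite lee_fin normc_ge0.
      by rewrite lee_fin abelRn_ge0.
    over.
  rewrite ge0_integralZr//; last 3 first.
  - by apply/measurable_EFinP; exact: measurable_abelRn.
  - by move=> w _; rewrite lee_fin abelRn_ge0.
  - by apply: integral_ge0 => s _; rewrite lee_fin normc_ge0.
  have gl := cintegrable_lty gi; have al := cintegrable_lty (cintegrable_abel e0).
  apply: lte_mul_pinfty => //.
  + by apply: integral_ge0 => w _; rewrite lee_fin abelRn_ge0.
  + rewrite ge0_fin_numE; last by apply: integral_ge0 => w _; rewrite lee_fin abelRn_ge0.
    apply: le_lt_trans al; apply: ge0_le_integralT => w; first by rewrite lee_fin abelRn_ge0.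
    by rewrite normc_real lee_fin ler_norm.
transitivity (cintegral mu (fun w => cintegral mu (F w))).
  apply: eq_cintegral => w; rewrite mulrC -cintegralZl; last exact: cintegrable_fourier.
  by apply: eq_cintegral => s; rewrite /F mulrC.
rewrite (cintegral_swap mF iF); apply: eq_cintegral => s.
have [ia <-] := ifourier_abel (subRn t s) e0.
rewrite -cintegralZl//; apply: eq_cintegral => w.
rewrite /F dotRn_sub mulrBr expiD; ring.
Qed.

Lemma cintegral_ge0 (h : Rn R n -> R) : measurable_fun setT h -> (forall t, 0 <= h t) ->
  (\int[mu]_t (h t)%:E < +oo)%E ->
  (\int[mu]_t (h t)%:E = (normc (cintegral mu (fun t => (h t)%:C%C)))%:E)%E.
Proof.
move=> mh h0 hoo.
have hf : (\int[mu]_t (h t)%:E)%E \is a fin_num.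
  by rewrite ge0_fin_numE// integral_ge0// => t _; rewrite lee_fin.
rewrite cintegral_real normc_real ger0_norm ?Rintegral_ge0//.
by rewrite /Rintegral fineK.
Qed.

Local Definition eps (k : nat) : R := k.+1%:R^-1.

Let eps0 k : 0 < eps k. Proof. by rewrite invr_gt0. Qed.

Lemma cvg_abelRn w : abelRn (eps k) w @[k --> \oo] --> (1 : R).
Proof.
pose S := \sum_(i < n) `|coord w i|.
have h : - (eps k * S) @[k --> \oo] --> (0 : R).
  rewrite -oppr0; apply: cvgN; rewrite -[X in _ --> X](mul0r S).
  by apply: cvgM; [exact: cvg_harmonic|exact: cvg_cst].
rewrite -expR0; apply: (cvg_comp _ _ h); exact: continuous_expR.
Qed.

(** The inequality [2 a b <= a^2 + b^2] under the integral: as [P] has mass one in either variable,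
    each square keeps only its own L^2 norm. It stands in for Young's inequality. *)
Lemma integral_convolution_le (a b P : Rn R n -> R) :
  measurable_fun setT a -> measurable_fun setT b -> measurable_fun setT P ->
  (forall t, 0 <= a t) -> (forall t, 0 <= b t) -> (forall t, 0 <= P t) ->
  (\int[mu]_t (P t)%:E = 1)%E ->
  (2%:E * \int[mu]_t \int[mu]_s (a t * (b s * P (subRn t s)))%:E <=
   \int[mu]_t (a t ^+ 2)%:E + \int[mu]_t (b t ^+ 2)%:E)%E.
Proof.
move=> ma mb mP a0 b0 P0 P1.
have mPs : measurable_fun setT (fun z : Rn R n * Rn R n => P (subRn z.1 z.2)).
  by apply: (measurableT_comp mP); exact: measurable_subRn.
have mA : measurable_fun setT (fun z : Rn R n * Rn R n => (a z.1 ^+ 2 * P (subRn z.1 z.2))%:E).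
  apply/measurable_EFinP; apply: measurable_funM => //.
  by apply: measurable_funX; exact: (measurableT_comp ma).
have mB : measurable_fun setT (fun z : Rn R n * Rn R n => (b z.2 ^+ 2 * P (subRn z.1 z.2))%:E).
  apply/measurable_EFinP; apply: measurable_funM => //.
  by apply: measurable_funX; exact: (measurableT_comp mb).
have mAB : measurable_fun setT (fun z : Rn R n * Rn R n =>
    (a z.1 * (b z.2 * P (subRn z.1 z.2)))%:E).
  apply/measurable_EFinP; apply: measurable_funM; first exact: (measurableT_comp ma).
  by apply: measurable_funM => //; exact: (measurableT_comp mb).
have A0 t s : (0 <= (a t ^+ 2 * P (subRn t s))%:E)%E by rewrite lee_fin mulr_ge0// sqr_ge0.
have B0 t s : (0 <= (b s ^+ 2 * P (subRn t s))%:E)%E by rewrite lee_fin mulr_ge0// sqr_ge0.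
have mPE : measurable_fun setT (fun t => (P t)%:E) by exact/measurable_EFinP.
have mPsE : measurable_fun setT (fun z : Rn R n * Rn R n => (P (subRn z.1 z.2))%:E).
  exact/measurable_EFinP.
have PE t : (0 <= (P t)%:E)%E by rewrite lee_fin.
have EA : (\int[mu]_t \int[mu]_s (a t ^+ 2 * P (subRn t s))%:E = \int[mu]_t (a t ^+ 2)%:E)%E.
  apply: eq_integral => t _; under eq_integral do rewrite EFinM.
  rewrite ge0_integralZl//; last 2 first.
  - exact: (@measurable_curry1 _ _ _ _ _ _ (fun t s => (P (subRn t s))%:E) mPsE).
  - by rewrite lee_fin sqr_ge0.
  by rewrite (integral_subr mPE)// P1 mule1.
have EB : (\int[mu]_t \int[mu]_s (b s ^+ 2 * P (subRn t s))%:E = \int[mu]_t (b t ^+ 2)%:E)%E.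
  rewrite (@integral_swap _ _ _ _ _ mu mu (fun t s => (b s ^+ 2 * P (subRn t s))%:E))//.
  apply: eq_integral => s _; under eq_integral do rewrite EFinM.
  rewrite ge0_integralZl//; last 2 first.
  - exact: (@measurable_curry2 _ _ _ _ _ _ (fun t s => (P (subRn t s))%:E) mPsE).
  - by rewrite lee_fin sqr_ge0.
  by rewrite (integral_subl mPE)// P1 mule1.
rewrite -EA -EB -ge0_integralD//; last 4 first.
- by move=> t _; exact: integral_ge0.
- exact: (@measurable_integral _ _ _ _ _ mu (fun t s => (a t ^+ 2 * P (subRn t s))%:E)).
- by move=> t _; exact: integral_ge0.
- exact: (@measurable_integral _ _ _ _ _ mu (fun t s => (b s ^+ 2 * P (subRn t s))%:E)).
rewrite -ge0_integralZl//; last 2 first.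
- apply: (@measurable_integral _ _ _ _ _ mu (fun t s => (a t * (b s * P (subRn t s)))%:E)) => //.
  by move=> t s; rewrite lee_fin !mulr_ge0.
- by move=> t _; apply: integral_ge0 => s _; rewrite lee_fin !mulr_ge0.
apply: ge0_le_integralT => t.
  by rewrite mule_ge0// integral_ge0// => s _; rewrite lee_fin !mulr_ge0.
rewrite -ge0_integralD//; last 2 first.
- exact: (@measurable_curry1 _ _ _ _ _ _ (fun t s => (a t ^+ 2 * P (subRn t s))%:E) mA).
- exact: (@measurable_curry1 _ _ _ _ _ _ (fun t s => (b s ^+ 2 * P (subRn t s))%:E) mB).
rewrite -ge0_integralZl//; last 2 first.
- exact: (@measurable_curry1 _ _ _ _ _ _ (fun t s => (a t * (b s * P (subRn t s)))%:E) mAB).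
- by move=> s _; rewrite lee_fin !mulr_ge0.
apply: ge0_le_integralT => s.
  by rewrite -EFinM lee_fin !mulr_ge0.
rewrite -EFinM -EFinD lee_fin -mulrDl mulrA mulrA ler_wpM2r//.
by have := sqr_ge0 (a t - b s); rewrite sqrrB -mulr_natl; lra.
Qed.

(* The Abel means of |fourier f|^2 are quadratic forms in the Poisson kernel,
   which has mass one. *)
Lemma plancherel_le f : cintegrable mu f ->
  (\int[mu]_w (normc (fourier f w) ^+ 2)%:E <= \int[mu]_t (normc (f t) ^+ 2)%:E)%E.
Proof.
move=> fi; have mf := cintegrable_meas fi; have mff := cmeasurable_fourier mf.
have foo := cintegrable_lty fi.
have fin : (\int[mu]_t (normc (f t))%:E)%E \is a fin_num.
  by rewrite ge0_fin_numE// integral_ge0// => t _; rewrite lee_fin normc_ge0.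
set S := fine (\int[mu]_t (normc (f t))%:E)%E.
have fS w : normc (fourier f w) <= S by rewrite -lee_fin fineK// normc_fourier.
pose h e w := normc (fourier f w) ^+ 2 * abelRn e w.
have h0 e w : 0 <= h e w by rewrite mulr_ge0 ?sqr_ge0 ?abelRn_ge0.
have mh e : measurable_fun setT (h e).
  apply: measurable_funM; last exact: measurable_abelRn.
  by apply: measurable_funX; exact: measurable_normc.
have key e : 0 < e -> (\int[mu]_w (h e w)%:E <= \int[mu]_t (normc (f t) ^+ 2)%:E)%E.
  move=> e0; have ai := cintegrable_abel e0.
  pose F w t := fourier f w * (abelRn e w)%:C%C *
    (conjc (f t) * expi (2 * pi * dotRn w t)).
  have nF w t : normc (F w t) = normc (fourier f w) * abelRn e w * normc (f t).
    by rewrite !Normc.normcM normc_expi normcJ mulr1 normc_real ger0_norm// abelRn_ge0.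
  have mF : cmeasurable (fun z : Rn R n * Rn R n => F z.1 z.2).
    apply: cmeasurableM; apply: cmeasurableM.
    - exact: cmeasurable_comp mff _.
    - apply: cmeasurable_real; apply: (measurableT_comp (f := abelRn e)) => //.
      exact: measurable_abelRn.
    - by apply: cmeasurableJ; exact: cmeasurable_comp mf _.
    - exact: cmeasurable_char.
  have iF : (\int[mu]_w \int[mu]_t (normc (F w t))%:E < +oo)%E.
    apply: (@le_lt_trans _ _ (\int[mu]_w ((S * S)%:E * (normc ((abelRn e w)%:C%C))%:E))%E).
      apply: ge0_le_integralT => w.
        by apply: integral_ge0 => t _; rewrite lee_fin normc_ge0.
      under eq_integral do rewrite nF EFinM.
      rewrite ge0_integralZl//; last 3 first.
      - exact: measurable_normcE.
      - by move=> t _; rewrite lee_fin normc_ge0.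
      - by rewrite lee_fin mulr_ge0 ?normc_ge0 ?abelRn_ge0.
      rewrite -(fineK fin) -!EFinM lee_fin normc_real ger0_norm ?abelRn_ge0//.
      rewrite -/S mulrAC ler_wpM2r ?abelRn_ge0// ler_wpM2r//.
      by rewrite fine_ge0// integral_ge0// => t _; rewrite lee_fin normc_ge0.
    rewrite ge0_integralZl//; last 3 first.
    - exact/measurable_normcE/cintegrable_meas/ai.
    - by move=> t _; rewrite lee_fin normc_ge0.
    - by rewrite lee_fin -expr2 sqr_ge0.
    by rewrite lte_mul_pinfty ?lee_fin -?expr2 ?sqr_ge0// cintegrable_lty.
  have E : cintegral mu (fun w => (h e w)%:C%C) =
      cintegral mu (fun t => conjc (f t) *
        cintegral mu (fun s => f s * (poissonRn e (subRn t s))%:C%C)).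
    transitivity (cintegral mu (fun w => cintegral mu (F w))).
      apply: eq_cintegral => w; rewrite cintegralZl; last first.
        apply: cintegrable_unimodular; first exact: cintegrableJ.
          by apply: cmeasurable_char => //; exact: measurable_cst.
        by move=> t; rewrite normc_expi.
      have -> : cintegral mu (fun t => conjc (f t) * expi (2 * pi * dotRn w t)) =
          conjc (fourier f w).
        rewrite -cintegralJ; last exact: cintegrable_fourier.
        by apply: eq_cintegral => t; rewrite conjcM conjc_expi opprK.
      rewrite mulrAC /h rmorphM; congr (_ * _).
      exact: normc_sqr_conj.
    rewrite (cintegral_swap mF iF); apply: eq_cintegral => t.
    rewrite -fourier_abel// -cintegralZl; last first.
      apply: (cintegrable_le (h := fun w => (S%:E * (normc ((abelRn e w)%:C%C))%:E)%E)).
      - apply: cmeasurableM => //; apply: cmeasurableM.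
          by apply: cmeasurable_real; exact: measurable_abelRn.
        by apply: cmeasurable_char => //; exact: measurable_cst.
      - by move=> w; rewrite !Normc.normcM normc_expi mulr1 -EFinM lee_fin
          ler_wpM2r ?normc_ge0.
      - have S0 : 0 <= S by rewrite fine_ge0// integral_ge0// => u _; rewrite lee_fin normc_ge0.
        rewrite ge0_integralZl//; last 2 first.
          exact/measurable_normcE/cintegrable_meas/ai.
          by move=> u _; rewrite lee_fin normc_ge0.
        by rewrite lte_mul_pinfty// cintegrable_lty.
    by apply: eq_cintegral => w; rewrite /F; ring.
  have hoo : (\int[mu]_w (h e w)%:E < +oo)%E.
    apply: (@le_lt_trans _ _ (\int[mu]_w ((S * S)%:E * (normc ((abelRn e w)%:C%C))%:E))%E).
      apply: ge0_le_integralT => w; first by rewrite lee_fin.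
      rewrite -EFinM lee_fin normc_real ger0_norm ?abelRn_ge0// /h expr2.
      by rewrite ler_wpM2r ?abelRn_ge0// ler_pM ?normc_ge0.
    rewrite ge0_integralZl//; last 3 first.
    - exact/measurable_normcE/cintegrable_meas/ai.
    - by move=> t _; rewrite lee_fin normc_ge0.
    - by rewrite lee_fin -expr2 sqr_ge0.
    by rewrite lte_mul_pinfty ?lee_fin -?expr2 ?sqr_ge0// cintegrable_lty.
  have [foo2|] := ltP (\int[mu]_t (normc (f t) ^+ 2)%:E)%E +oo%E; last first.
    by rewrite leye_eq => /eqP ->; rewrite leey.
  have mP : measurable_fun setT (fun z : Rn R n * Rn R n => poissonRn e (subRn z.1 z.2)).
    apply: (measurableT_comp (measurable_poissonRn e0)); exact: measurable_subRn.
  pose G t s := f s * (poissonRn e (subRn t s))%:C%C * conjc (f t).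
  have nG t s : normc (G t s) = normc (f t) * (normc (f s) * poissonRn e (subRn t s)).
    rewrite !Normc.normcM normcJ normc_real ger0_norm ?poissonRn_ge0 1?ltW//.
    by rewrite mulrC.
  have := integral_convolution_le (measurable_normc mf) (measurable_normc mf)
    (measurable_poissonRn e0) (fun t => normc_ge0 _) (fun t => normc_ge0 _)
    (fun t => poissonRn_ge0 t (ltW e0)) (integral_poissonRn e0).
  set J := (X in (2%:E * X)%E); set I2 := (X in (_ <= X + _)%E) => HJ0.
  have HJ : (2%:E * J <= I2 + I2)%E by exact: HJ0.
  have I2fin : I2 \is a fin_num.
    by rewrite ge0_fin_numE// integral_ge0// => t _; rewrite lee_fin sqr_ge0.
  have JI2 : (J <= I2)%E.
    (* The bound [2 J <= 2 I2] can be halved only between real numbers, so finiteness of [J] comes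
       first. *)
    have Jfin : J \is a fin_num.
      rewrite ge0_fin_numE; last first.
        by apply: integral_ge0 => t _; apply: integral_ge0 => s _;
          rewrite lee_fin !mulr_ge0 ?normc_ge0 ?poissonRn_ge0 1?ltW.
      have : (2%:E * J < +oo)%E.
        by apply: le_lt_trans HJ _; rewrite -(fineK I2fin) -EFinD ltry.
      by case: (J) => [r _|/=|//]; [exact: ltry|rewrite gt0_muley ?lte_fin].
    move: HJ; rewrite -(fineK I2fin) -(fineK Jfin) -EFinM -EFinD !lee_fin; lra.
  have mG : cmeasurable (fun z : Rn R n * Rn R n => G z.1 z.2).
    apply: cmeasurableM; last by apply: cmeasurableJ; exact: cmeasurable_comp mf _.
    by apply: cmeasurableM; [exact: cmeasurable_comp mf _|exact: cmeasurable_real].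
  have iG : (\int[mu]_t \int[mu]_s (normc (G t s))%:E < +oo)%E.
    apply: le_lt_trans (le_lt_trans JI2 foo2).
    by under eq_integral do under eq_integral do rewrite nG.
  rewrite cintegral_ge0// E; apply: le_trans JI2.
  have -> : cintegral mu (fun t => conjc (f t) *
      cintegral mu (fun s => f s * (poissonRn e (subRn t s))%:C%C)) =
      cintegral (mu \x mu)%E (fun z => G z.1 z.2).
    rewrite cintegral_prod//; apply: ae_eq_cintegral.
    - apply: cmeasurableM; first exact: cmeasurableJ.
      apply: (@cmeasurable_cintegral _ _ _ _ _ mu
        (fun t s => f s * (poissonRn e (subRn t s))%:C%C)).
      by apply: cmeasurableM; [exact: cmeasurable_comp mf _|exact: cmeasurable_real].
    - exact: cmeasurable_cintegral.
    - apply: aeW => t; rewrite -cintegralZl.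
        by apply: eq_cintegral => s; rewrite /G mulrC.
      have B := poissonRn_ge0 (cstRn n 0) (ltW e0).
      apply: (cintegrable_le (h := fun s => (((2 / e) ^+ n)%:E * (normc (f s))%:E)%E)).
      + apply: cmeasurableM => //; apply: cmeasurable_real.
        exact: (@measurable_curry1 _ _ _ _ _ _ (fun t s => poissonRn e (subRn t s)) mP).
      + move=> s; rewrite Normc.normcM normc_real (ger0_norm (poissonRn_ge0 _ (ltW e0))).
        rewrite -EFinM lee_fin mulrC ler_wpM2r ?normc_ge0//.
        exact: poissonRn_le.
      + rewrite ge0_integralZl//; last 3 first.
        * exact: measurable_normcE.
        * by move=> s _; rewrite lee_fin normc_ge0.
        * by rewrite lee_fin exprn_ge0// divr_ge0// ltW.
        by rewrite lte_mul_pinfty// lee_fin exprn_ge0// divr_ge0// ltW.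
  apply: le_trans (normc_cintegral (cintegrable_prod mG iG)) _.
  rewrite fubini_tonelli1//; last 2 first.
  - exact: measurable_normcE.
  - by move=> z; rewrite lee_fin normc_ge0.
  by rewrite /fubini_F /=; under eq_integral do under eq_integral do rewrite nG.
(* The Abel factors increase to 1 with [k], so monotone convergence applies before [|fourier f|^2]
   is known to be integrable. *)
have lim : (\int[mu]_w (h (eps k) w)%:E @[k --> \oo] -->
    \int[mu]_w (normc (fourier f w) ^+ 2)%:E)%E.
  have -> : (fun w => (normc (fourier f w) ^+ 2)%:E) =
      (fun w => limn (fun k => (h (eps k) w)%:E)).
    apply/funext => w; apply/esym/cvg_lim => //; apply/fine_cvgP; split; first exact: nearW.
    rewrite /comp/= /h -[X in _ --> X]mulr1; apply: cvgM; first exact: cvg_cst.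
    exact: cvg_abelRn.
  apply: cvg_monotone_convergence => //.
  - by move=> k; exact/measurable_EFinP.
  - by move=> k w _; rewrite lee_fin.
  - move=> w _ k m km; rewrite lee_fin ler_wpM2l ?sqr_ge0// ler_expR lerN2.
    by rewrite ler_wpM2r ?sumr_ge0// lef_pV2 ?posrE// ler_nat.
apply: (cvge_le _ lim); apply: nearW => k; exact: key.
Qed.

End fourier_transform.

(** * Fourier inversion for integrable transforms *)

Section fourier_inversion.
Context {R : realType} {n : nat}.
Notation mu := (lebesgue_Rn R n).
Implicit Types (f g : Rn R n -> R[i]) (e : R).

Lemma ReZ (a : R) (z : R[i]) : complex.Re (a%:C%C * z) = a * complex.Re z.
Proof. by rewrite ReM/= mul0r subr0. Qed.

Lemma ImZ (a : R) (z : R[i]) : complex.Im (a%:C%C * z) = a * complex.Im z.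
Proof. by rewrite ImM/= mul0r addr0. Qed.

Lemma indic_le1 (A : set (Rn R n)) t : \1_A t <= 1 :> R.
Proof. by rewrite indicE; case: (_ \in _). Qed.

Lemma cvg_prod_ord (u : nat -> 'I_n -> R) (l : 'I_n -> R) :
  (forall i, u k i @[k --> \oo] --> l i) ->
  \prod_(i < n) u k i @[k --> \oo] --> \prod_(i < n) l i.
Proof.
move=> ul; elim: (index_enum _) => [|i s IH].
  by under eq_fun do rewrite big_nil; rewrite big_nil; exact: cvg_cst.
by under eq_fun do rewrite big_cons; rewrite big_cons; exact: cvgM.
Qed.

Lemma indic_box (a b t : Rn R n) :
  \1_(box a b) t = \prod_(i < n) \1_(`]coord a i, coord b i]%classic) (coord t i) :> R.
Proof.
rewrite indicE; have [tab|tab] := boolP (t \in box a b).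
  rewrite big1// => i _; rewrite indicE mem_set//= in_itv/=.
  by move: tab; rewrite inE => /(_ i).
have : ~ forall i, coord a i < coord t i <= coord b i.
  by move: tab; rewrite notin_setE.
move=> /existsNP[i hi]; rewrite (bigD1 i)//= indicE memNset ?mul0r//=.
Qed.

(** The Poisson mass of the interval from [a] to [b] seen from [s]; as [e] tends to 0 it becomes the
    indicator of the interval, except at the end points. *)
Definition atan_diff e (a b s : R) : R :=
  pi^-1 * atan (2 * pi / e * (b - s)) - pi^-1 * atan (2 * pi / e * (a - s)).

Lemma integral_indic_poisson e (a b s : R) : 0 < e -> a <= b ->
  (\int[leb]_t (\1_(`]a, b]%classic) t * poisson e (t - s))%:E = (atan_diff e a b s)%:E)%E.
Proof.
move=> e0 ab; rewrite -integral_poisson_itv// -integral_itv_obnd_cbnd; last first.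
  apply: measurable_funTS; apply/measurable_EFinP.
  apply: (measurableT_comp (f := poisson e)).
    by apply: continuous_measurable_fun; exact: continuous_poisson.
  exact: measurable_funB.
rewrite [RHS]integral_mkcond; apply: eq_integral => t _.
rewrite /patch indicE; case: ifPn => _; first by rewrite mul1r.
by rewrite mul0r.
Qed.

Lemma integral_box_poisson e (a b s : Rn R n) : 0 < e ->
  (forall i, coord a i <= coord b i) ->
  (\int[mu]_t (\1_(box a b) t * poissonRn e (subRn t s))%:E =
   (\prod_(i < n) atan_diff e (coord a i) (coord b i) (coord s i))%:E)%E.
Proof.
move=> e0 ab.
under eq_integral do rewrite indic_box /poissonRn -big_split/=.
under eq_integral do under eq_bigr do rewrite coord_sub.
rewrite (integral_tensor (f := fun i t => \1_(`]coord a i, coord b i]%classic) t *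
  poisson e (t - coord s i)) (c := fun i => atan_diff e (coord a i) (coord b i) (coord s i)))//.
- move=> i; apply: measurable_funM; first exact: measurable_indic.
  apply: (measurableT_comp (f := poisson e)).
    by apply: continuous_measurable_fun; exact: continuous_poisson.
  exact: measurable_funB.
- by move=> i t; rewrite mulr_ge0// poisson_ge0// ltW.
- by move=> i; exact: integral_indic_poisson.
Qed.

Lemma cvg_atan_eps (c : R) : c != 0 ->
  pi^-1 * atan (2 * pi / (k.+1%:R^-1) * c) @[k --> \oo] --> (Num.sg c / 2 : R).
Proof.
have pi0 := pi_gt0 R.
have P (c' : R) : 0 < c' ->
    pi^-1 * atan (2 * pi / (k.+1%:R^-1) * c') @[k --> \oo] --> (1 / 2 : R).
  move=> c0; have -> : (1 / 2 : R) = pi^-1 * (pi / 2).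
    by move: (pi : R) pi0 => p p0; field; rewrite gt_eqF.
  apply: cvgM; first exact: cvg_cst.
  have h : 2 * pi * c' * k.+1%:R @[k --> \oo] --> +oo.
    apply/gtr0_cvgV0; first by apply: nearW => k; rewrite !mulr_gt0.
    rewrite (_ : unstable.inv_fun _ = fun k : nat => (2 * pi * c')^-1 * k.+1%:R^-1); last first.
      by apply/funext => k /=; rewrite /unstable.inv_fun invfM.
    rewrite -[X in _ --> X](mulr0 (2 * pi * c')^-1).
    by apply: cvgM; [exact: cvg_cst|exact: cvg_harmonic].
  have h3 := cvg_comp _ _ h (@cvgy_atan R).
  rewrite (_ : (fun _ => _) = atan \o (fun k : nat => 2 * pi * c' * k.+1%:R)) //.
  by apply/funext => k /=; rewrite invrK mulrAC.
move=> cn0; have [c0|c0|c0] := ltgtP c 0; last by rewrite c0 eqxx in cn0.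
  have := P (- c); rewrite oppr_gt0 => /(_ c0) h.
  rewrite ltr0_sg// mulNr (_ : (fun _ => _) = fun k : nat =>
      - (pi^-1 * atan (2 * pi / k.+1%:R^-1 * - c))); first exact: cvgN h.
  by apply/funext => k /=; rewrite mulrN atanN mulrN opprK.
by rewrite gtr0_sg//; exact: P.
Qed.

Lemma cvg_atan_diff (a b s : R) : a <= b -> s != a -> s != b ->
  atan_diff (k.+1%:R^-1) a b s @[k --> \oo] --> (\1_(`]a, b]%classic) s : R).
Proof.
move=> ab sa sb; have -> : \1_(`]a, b]%classic) s = Num.sg (b - s) / 2 - Num.sg (a - s) / 2.
  rewrite indicE; have [sab|sab] := boolP (s \in _).
    move: sab; rewrite inE/= in_itv/= => /andP[h1 h2].
    rewrite gtr0_sg ?ltr0_sg ?subr_gt0 ?subr_lt0//; last by rewrite lt_neqAle sb.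
    by rewrite mulNr opprK /=; field.
  have [bs|bs] := ltP b s.
    by rewrite !ltr0_sg ?subr_lt0// ?(le_lt_trans ab)// subrr.
  have sa' : s < a.
    rewrite ltNge; apply: contra sab => h; rewrite inE/= in_itv/= bs andbT.
    by rewrite lt_neqAle eq_sym sa.
  by rewrite !gtr0_sg ?subr_gt0// ?(lt_le_trans sa')// subrr.
by apply: cvgB; apply: cvg_atan_eps; rewrite subr_eq0 eq_sym.
Qed.

(** A product density shows that a hyperplane is null: the integrable positive weight [v] in every
    coordinate, restricted to the point [c] in coordinate [i]. Its integral is a product with a zero
    factor, whereas the density is positive on the hyperplane. *)
Lemma ae_coord_neq (c : R) (i : 'I_n) : {ae mu, forall t, coord t i != c}.
Proof.
pose v (x : R) := (1 + x ^+ 2)^-1.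
have v0 x : 0 < v x by rewrite invr_gt0 ltr_pwDl ?sqr_ge0.
have mv : measurable_fun setT v.
  apply: continuous_measurable_fun => x; apply: cvgV.
    by rewrite gt_eqF// ltr_pwDl ?sqr_ge0.
  by apply: cvgD; [exact: cvg_cst|exact: exprn_continuous].
pose f j : measurableTypeR R -> R :=
  if j == i then (fun x => \1_[set c] x * v x) else v.
have mf j : measurable_fun setT (f j).
  rewrite /f; case: ifP => _ //; apply: measurable_funM => //.
have f0 j x : 0 <= f j x.
  by rewrite /f; case: ifP => _; rewrite ?mulr_ge0// ltW.
have fc j : (\int[leb]_x (f j x)%:E = (if j == i then 0 else pi)%:E)%E.
  rewrite /f; case: ifP => _; last exact: integral_oneDsqr.
  rewrite -[RHS](@integral_set1 R (fun x => (v x)%:E) c) [RHS]integral_mkcond.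
  apply: eq_integral => x _; rewrite /patch indicE; case: ifPn => _.
    by rewrite mul1r.
  by rewrite mul0r.
have := integral_tensor mf f0 fc; rewrite (bigD1 i)//= eqxx mul0r => I0.
have mF : measurable_fun setT (fun t : Rn R n => (\prod_(j < n) f j (coord t j))%:E).
  apply/measurable_EFinP; apply: measurable_prod => j _.
  by apply: (measurableT_comp (mf j)); exact: measurable_coord.
have := (ae_eq_integral_abs mu measurableT mF).1.
move=> /(_ _)/wrap[].
  by under eq_integral do rewrite gee0_abs ?lee_fin ?prodr_ge0//.
apply: filterS => t /= /(_ I) [] /eqP/prodf_eq0[j _ /eqP fj].
apply/eqP => tc; move: fj; rewrite /f; case: ifP => [/eqP ->|_].
  by rewrite tc indicE mem_set// mul1r => /eqP; rewrite gt_eqF.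
by move/eqP; rewrite gt_eqF.
Qed.

Lemma ae_forall_ord (P : 'I_n -> Rn R n -> Prop) :
  (forall i, {ae mu, forall t, P i t}) -> {ae mu, forall t, forall i, P i t}.
Proof. by move=> h; exact: filter_forall. Qed.

Lemma normc_indic (A : set (Rn R n)) t : normc (\1_A t)%:C%C = \1_A t :> R.
Proof. by rewrite normc_real ger0_norm. Qed.

Lemma lebesgue_box_lty (a b : Rn R n) : (\int[mu]_t (\1_(box a b) t : R)%:E < +oo)%E.
Proof.
under eq_integral do rewrite indic_box.
rewrite (integral_tensor (f := fun i t => \1_(`]coord a i, coord b i]%classic) t)
  (c := fun i => fine (leb (`]coord a i, coord b i]%classic))))//.
- exact: ltry.
- by move=> i; exact: measurable_indic.
- move=> i; rewrite integral_indic//= setIT fineK//.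
  by rewrite /leb lebesgue_measure_itv/=; case: ifP.
Qed.

Lemma cintegrable_box (a b : Rn R n) f (M : R) : cmeasurable f ->
  (forall t, normc (f t) <= M) -> cintegrable mu (fun t => (\1_(box a b) t)%:C%C * f t).
Proof.
move=> mf fM; have M0 : 0 <= M := le_trans (normc_ge0 _) (fM (cstRn n 0)).
apply: (cintegrable_le (h := fun t => (M%:E * (\1_(box a b) t : R)%:E)%E)).
- apply: cmeasurableM => //; apply: cmeasurable_indic; exact: measurable_box.
- move=> t; rewrite Normc.normcM normc_indic -EFinM lee_fin mulrC.
  by rewrite ler_wpM2r.
- rewrite ge0_integralZl//.
  + by rewrite lte_mul_pinfty// lebesgue_box_lty.
  + by apply/measurable_EFinP; apply: measurable_indic; exact: measurable_box.
Qed.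

(* Abel means inserted in the inverse transform turn it into averages of g by
   Poisson kernels. *)
Lemma integral_box_ifourier g (a b : Rn R n) : cintegrable mu g ->
  cintegrable mu (fourier g) -> (forall i, coord a i <= coord b i) ->
  cintegral mu (fun t => (\1_(box a b) t)%:C%C * ifourier (fourier g) t) =
  cintegral mu (fun t => (\1_(box a b) t)%:C%C * g t).
Proof.
move=> gi hi ab; have mg := cintegrable_meas gi; have mh := cintegrable_meas hi.
have mbox : measurable (box a b) by exact: measurable_box.
pose ep (k : nat) : R := k.+1%:R^-1.
have ep0 k : 0 < ep k by rewrite invr_gt0.
pose H k t := cintegral mu (fun w => fourier g w *
  ((abelRn (ep k) w)%:C%C * expi (2 * pi * dotRn w t))).
have mB : cmeasurable (fun t => (\1_(box a b) t)%:C%C : R[i]) by exact: cmeasurable_indic.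
set M := fine (\int[mu]_w (normc (fourier g w))%:E).
have hoo := cintegrable_lty hi.
have Mfin : (\int[mu]_w (normc (fourier g w))%:E)%E \is a fin_num.
  by rewrite ge0_fin_numE// integral_ge0// => w _; rewrite lee_fin normc_ge0.
have mHk k : cmeasurable (fun z : Rn R n * Rn R n => fourier g z.2 *
    ((abelRn (ep k) z.2)%:C%C * expi (2 * pi * dotRn z.2 z.1))).
  apply: cmeasurableM; first exact: cmeasurable_comp mh _.
  apply: cmeasurableM; last exact: cmeasurable_char.
  apply: cmeasurable_real; apply: (measurableT_comp (f := abelRn (ep k))) => //.
  exact: measurable_abelRn.
have nH k t w : normc (fourier g w * ((abelRn (ep k) w)%:C%C * expi (2 * pi * dotRn w t)))
    <= normc (fourier g w).
  rewrite !Normc.normcM normc_expi mulr1 normc_real ger0_norm ?abelRn_ge0//.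
  by rewrite ler_piMr ?normc_ge0// abelRn_le1// ltW.
have mHkt k t : cmeasurable (fun w => fourier g w *
    ((abelRn (ep k) w)%:C%C * expi (2 * pi * dotRn w t))).
  exact: (@cmeasurable_curry1 _ _ _ _ _ (fun t w => fourier g w *
    ((abelRn (ep k) w)%:C%C * expi (2 * pi * dotRn w t))) (mHk k) t).
have HM k t : normc (H k t) <= M.
  rewrite -lee_fin fineK//.
  apply: le_trans (normc_cintegral (cintegrable_le (mHkt k t) _ hoo)) _.
    by move=> w; rewrite lee_fin.
  by apply: ge0_le_integralT => w; rewrite lee_fin ?normc_ge0.
have mH k : cmeasurable (H k).
  exact: (@cmeasurable_cintegral _ _ _ _ _ mu (fun t w => fourier g w *
    ((abelRn (ep k) w)%:C%C * expi (2 * pi * dotRn w t)))).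
have limH t : ccvg (fun k => H k t) (ifourier (fourier g) t).
  apply: (cintegral_dominated (g := fourier g)) => //.
    by apply: cmeasurableM => //; apply: cmeasurable_char => //; exact: measurable_cst.
  apply: aeW => w /=.
  have := ccvgZ (fourier g w * expi (2 * pi * dotRn w t)) (@cvg_abelRn R n w).
  rewrite rmorph1 mulr1; set u := fun k => _; set v := fun k => _.
  by rewrite (_ : u = v)//; apply/funext => k; rewrite /u /v -mulrA [_%:C%C * _]mulrC.
have lim1 : ccvg (fun k => cintegral mu (fun t => (\1_(box a b) t)%:C%C * H k t))
    (cintegral mu (fun t => (\1_(box a b) t)%:C%C * ifourier (fourier g) t)).
  apply: (cintegral_dominated (g := fun t => (\1_(box a b) t)%:C%C * M%:C%C)).
  - by move=> k; exact: cmeasurableM.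
  - by apply: cmeasurableM => //; exact: cmeasurable_ifourier.
  - apply: (@cintegrable_box a b _ (normc M%:C%C)) => //; exact: cmeasurable_cst.
  - by apply: aeW => t; apply: ccvgM; exact: limH.
  - move=> k t; rewrite !Normc.normcM ler_wpM2l ?normc_ge0// normc_real.
    exact: le_trans (HM _ _) (ler_norm _).
pose K k s := \prod_(i < n) atan_diff (ep k) (coord a i) (coord b i) (coord s i).
have K01 k s : 0 <= K k s <= 1.
  rewrite -!lee_fin -integral_box_poisson//; apply/andP; split.
    by apply: integral_ge0 => t _; rewrite lee_fin mulr_ge0// poissonRn_ge0// ltW.
  rewrite -(integral_poissonRn (n := n) (ep0 k)).
  rewrite -(@integral_subl R n (fun t => (poissonRn (ep k) t)%:E) _ _ s); last 2 first.
    by apply/measurable_EFinP; exact: measurable_poissonRn.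
    by move=> t; rewrite lee_fin poissonRn_ge0// ltW.
  apply: ge0_le_integralT => t; rewrite lee_fin.
    by rewrite mulr_ge0// poissonRn_ge0// ltW.
  by rewrite ler_piMl ?indic_le1// poissonRn_ge0// ltW.
have EK k : cintegral mu (fun t => (\1_(box a b) t)%:C%C * H k t) =
    cintegral mu (fun s => g s * (K k s)%:C%C).
  pose F t s := (\1_(box a b) t)%:C%C * (g s * (poissonRn (ep k) (subRn t s))%:C%C).
  have P0 t : 0 <= poissonRn (ep k) t by rewrite poissonRn_ge0// ltW.
  have nF t s : normc (F t s) = normc (g s) * (\1_(box a b) t * poissonRn (ep k) (subRn t s)).
    by rewrite !Normc.normcM normc_indic normc_real ger0_norm//; ring.
  have mP : measurable_fun setT (fun z : Rn R n * Rn R n => poissonRn (ep k) (subRn z.1 z.2)).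
    by apply: (measurableT_comp (measurable_poissonRn (ep0 k))); exact: measurable_subRn.
  have mF : cmeasurable (fun z : Rn R n * Rn R n => F z.1 z.2).
    apply: cmeasurableM; first exact: cmeasurable_comp mB _.
    by apply: cmeasurableM; [exact: cmeasurable_comp mg _|exact: cmeasurable_real].
  have iF : (\int[mu]_t \int[mu]_s (normc (F t s))%:E < +oo)%E.
    rewrite (@integral_swap _ _ _ _ _ mu mu (fun t s => (normc (F t s))%:E)); last 2 first.
      exact: measurable_normcE.
      by move=> t s; rewrite lee_fin normc_ge0.
    apply: le_lt_trans (cintegrable_lty gi); apply: ge0_le_integralT => s.
      by apply: integral_ge0 => t _; rewrite lee_fin normc_ge0.
    under eq_integral do rewrite nF EFinM.
    rewrite ge0_integralZl//; last 3 first.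
    - apply/measurable_EFinP; apply: measurable_funM; first exact: measurable_indic.
      exact: (@measurable_curry2 _ _ _ _ _ _ (fun t s => poissonRn (ep k) (subRn t s)) mP).
    - by move=> t _; rewrite lee_fin mulr_ge0.
    - by rewrite lee_fin normc_ge0.
    rewrite integral_box_poisson// -EFinM lee_fin ler_piMr ?normc_ge0//.
    by have /andP[] := K01 k s.
  transitivity (cintegral mu (fun t => cintegral mu (F t))).
    apply: eq_cintegral => t; rewrite /H fourier_abel// -cintegralZl//.
    apply: (cintegrable_le (h := fun s => (((2 / ep k) ^+ n)%:E * (normc (g s))%:E)%E)).
    - apply: cmeasurableM => //; apply: cmeasurable_real.
      exact: (@measurable_curry1 _ _ _ _ _ _ (fun t s => poissonRn (ep k) (subRn t s)) mP).
    - move=> s; rewrite Normc.normcM normc_real ger0_norm// -EFinM lee_fin mulrC.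
      by rewrite ler_wpM2r ?normc_ge0// poissonRn_le.
    - have e2 : 0 <= (2 / ep k) ^+ n by rewrite exprn_ge0// divr_ge0// ltW.
      rewrite ge0_integralZl//; last 2 first.
      + exact: measurable_normcE.
      + by move=> s _; rewrite lee_fin normc_ge0.
      by rewrite lte_mul_pinfty// cintegrable_lty.
  rewrite (cintegral_swap mF iF); apply: eq_cintegral => s.
  transitivity (cintegral mu (fun t => g s *
      (\1_(box a b) t * poissonRn (ep k) (subRn t s))%:C%C)).
    by apply: eq_cintegral => t; rewrite /F rmorphM/= mulrCA.
  rewrite cintegralZl; last first.
    apply: cintegrable_real; apply/integrableP; split.
      apply/measurable_EFinP; apply: measurable_funM; first exact: measurable_indic.
      exact: (@measurable_curry2 _ _ _ _ _ _ (fun t s => poissonRn (ep k) (subRn t s)) mP).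
    under eq_integral do rewrite gee0_abs ?lee_fin ?mulr_ge0//.
    by rewrite integral_box_poisson// ltry.
  by rewrite cintegral_real /Rintegral integral_box_poisson.
have lim2 : ccvg (fun k => cintegral mu (fun s => g s * (K k s)%:C%C))
    (cintegral mu (fun s => g s * (\1_(box a b) s)%:C%C)).
  apply: (cintegral_dominated (g := g)) => //.
  - move=> k; apply: cmeasurableM => //; apply: cmeasurable_real.
    apply: measurable_prod => i _.
    have mat (c : R) : measurable_fun setT (fun s : Rn R n =>
        pi^-1 * atan (2 * pi / ep k * (c - coord s i))).
      apply: measurable_funM => //; apply: (measurableT_comp (f := atan)).
        by apply: continuous_measurable_fun => y; exact: continuous_atan.
      apply: measurable_funM => //; apply: measurable_funB => //.
      exact: measurable_coord.
    by apply: measurable_funB; exact: mat.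
  - exact: cmeasurableM.
  (* On the boundary hyperplanes of the box the Poisson masses need not tend to the indicator; these
     are null. *)
  - have ab0 : {ae mu, forall s i, coord s i != coord a i /\ coord s i != coord b i}.
      apply: ae_forall_ord => i.
      by apply: filterS2 (ae_coord_neq (coord a i) i) (ae_coord_neq (coord b i) i) => s.
    apply: filterS ab0 => s hs; apply: ccvgZ; rewrite indic_box.
    by rewrite /K; apply: cvg_prod_ord => i; have [? ?] := hs i; exact: cvg_atan_diff.
  - move=> k s; have /andP[k0 k1] := K01 k s.
    by rewrite Normc.normcM normc_real ger0_norm// ler_piMr ?normc_ge0.
rewrite (_ : (fun k => _) = fun k => cintegral mu (fun s => g s * (K k s)%:C%C)) in lim1;
  last by apply/funext.
rewrite (ccvg_unique lim1 lim2).
by apply: eq_cintegral => s; rewrite mulrC.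
Qed.

Lemma fourier_inversion g : cintegrable mu g -> cintegrable mu (fourier g) ->
  {ae mu, forall t, g t = ifourier (fourier g) t}.
Proof.
move=> gi hi; have mg := cintegrable_meas gi.
set G := ifourier (fourier g).
have mG : cmeasurable G by apply: cmeasurable_ifourier; exact: cintegrable_meas hi.
have hoo := cintegrable_lty hi.
have Mfin : (\int[mu]_w (normc (fourier g w))%:E)%E \is a fin_num.
  by rewrite ge0_fin_numE// integral_ge0// => w _; rewrite lee_fin normc_ge0.
set M := fine (\int[mu]_w (normc (fourier g w))%:E).
have GM t : normc (G t) <= M by rewrite -lee_fin fineK// normc_ifourier.
have onbox (a b : Rn R n) : cintegral mu (fun t => (\1_(box a b) t)%:C%C * (g t - G t)) = 0.
  have igb : cintegrable mu (fun t => (\1_(box a b) t)%:C%C * g t).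
    apply: (cintegrable_le (h := fun t => (normc (g t))%:E)).
    - by apply: cmeasurableM => //; apply: cmeasurable_indic; exact: measurable_box.
    - move=> t; rewrite Normc.normcM normc_indic lee_fin.
      by rewrite ler_piMl ?normc_ge0// indic_le1.
    - exact: cintegrable_lty.
  have iGb := cintegrable_box a b mG GM.
  have [ab|/existsNP[i /negP ab]] := pselect (forall i, coord a i <= coord b i); last first.
    transitivity (cintegral mu (fun t => 0 : R[i])).
      apply: eq_cintegral => t; rewrite indicE memNset ?mul0r// => /(_ i) /andP[h1 h2].
      by move: ab; rewrite (le_trans (ltW h1) h2).
    by apply: complex_eq; rewrite /= /Rintegral integral0.
  transitivity (cintegral mu (fun t => (\1_(box a b) t)%:C%C * g t +
      (-1) * ((\1_(box a b) t)%:C%C * G t))).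
    by apply: eq_cintegral => t; ring.
  rewrite cintegralD//; last exact: cintegrableZl.
  by rewrite cintegralZl// integral_box_ifourier// mulN1r subrr.
(* [G] is bounded but perhaps not integrable, so [g - G] is cut off to [cubeN N] before the box
   criterion is used. Intersecting with another box gives a box again, so the box integrals still
   vanish. *)
have onN (N : nat) : {ae mu, forall t, (\1_(cubeN N) t)%:C%C * (g t - G t) = 0}.
  have iN : cintegrable mu (fun t => (\1_(cubeN N) t)%:C%C * (g t - G t)).
    rewrite (_ : (fun t => _) = fun t => (\1_(cubeN N) t)%:C%C * g t +
        (-1) * ((\1_(cubeN N) t)%:C%C * G t)); last by apply/funext => t; ring.
    apply: cintegrableD; last exact/cintegrableZl/(cintegrable_box _ _ mG GM).
    apply: (cintegrable_le (h := fun t => (normc (g t))%:E)).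
    - by apply: cmeasurableM => //; apply: cmeasurable_indic; exact: measurable_box.
    - move=> t; rewrite Normc.normcM normc_indic lee_fin.
      by rewrite ler_piMl ?normc_ge0// indic_le1.
    - exact: cintegrable_lty.
  have onE (a b : Rn R n) : cintegral mu (fun t => (\1_(box a b) t)%:C%C *
      ((\1_(cubeN N) t)%:C%C * (g t - G t))) = 0.
    pose A : Rn R n := [tuple Num.max (coord a i) (coord (cstRn n (- N%:R)) i)
      : measurableTypeR R | i < n].
    pose B : Rn R n := [tuple Num.min (coord b i) (coord (cstRn n N%:R) i)
      : measurableTypeR R | i < n].
    rewrite -[RHS](onbox A B).
    apply: eq_cintegral => t; rewrite -box_setI mulrA -rmorphM/=; congr (_%:C%C * _).
    by rewrite indicI.
  have [i1 i2] := iN.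
  have h1 : {ae mu, forall t, complex.Re ((\1_(cubeN N) t)%:C%C * (g t - G t)) = 0}.
    apply: integral_box_ae0 => // a b.
    have i3 : mu.-integrable (box a b) (fun t => (complex.Re ((\1_(cubeN N) t)%:C%C * (g t - G t)))%:E).
      by apply: integrableS i1 => //; exact: measurable_box.
    rewrite -[LHS]fineK; last exact: (integrable_fin_num (measurable_box a b) i3).
    congr EFin; have := congr1 (@complex.Re R) (onE a b); rewrite [X in _ = X]/= => <-.
    rewrite /cintegral/= /Rintegral [in LHS]integral_mkcond; congr fine.
    apply: eq_integral => t _; rewrite ReZ /patch (@indicE _ R (box a b)).
    by case: ifPn => _; rewrite ?mul1r ?mul0r.
  have h2 : {ae mu, forall t, complex.Im ((\1_(cubeN N) t)%:C%C * (g t - G t)) = 0}.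
    apply: integral_box_ae0 => // a b.
    have i3 : mu.-integrable (box a b) (fun t => (complex.Im ((\1_(cubeN N) t)%:C%C * (g t - G t)))%:E).
      by apply: integrableS i2 => //; exact: measurable_box.
    rewrite -[LHS]fineK; last exact: (integrable_fin_num (measurable_box a b) i3).
    congr EFin; have := congr1 (@complex.Im R) (onE a b); rewrite [X in _ = X]/= => <-.
    rewrite /cintegral/= /Rintegral [in LHS]integral_mkcond; congr fine.
    apply: eq_integral => t _; rewrite ImZ /patch (@indicE _ R (box a b)).
    by case: ifPn => _; rewrite ?mul1r ?mul0r.
  by apply: filterS2 h1 h2 => t ? ?; exact: complex_eq.
have := ae_foralln onN.
apply: filterS => t ht; have [N hN] := in_cubeN t.
have := ht N; rewrite indicE mem_set; last exact: hN.
by rewrite mul1r => /eqP; rewrite subr_eq0 => /eqP.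
Qed.

End fourier_inversion.

Section nonneg_real_integral.
Context d (T : measurableType d) (R : realType).
Variable mu : {measure set T -> \bar R}.
Implicit Types f g : T -> R.

Lemma ge0_integralZlR (c : R) f : 0 <= c -> measurable_fun setT f ->
  (forall x, 0 <= f x) ->
  (\int[mu]_x (c * f x)%:E = c%:E * \int[mu]_x (f x)%:E)%E.
Proof.
move=> c0 mf f0; rewrite -ge0_integralZl//; last by move=> x _; rewrite lee_fin.
exact/measurable_EFinP.
Qed.

Lemma ge0_integralDR f g : measurable_fun setT f -> measurable_fun setT g ->
  (forall x, 0 <= f x) -> (forall x, 0 <= g x) ->
  (\int[mu]_x (f x + g x)%:E = \int[mu]_x (f x)%:E + \int[mu]_x (g x)%:E)%E.
Proof.
move=> mf mg f0 g0.
under eq_integral do rewrite EFinD.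
by rewrite ge0_integralD//; do ?[by move=> x _; rewrite lee_fin|exact/measurable_EFinP].
Qed.

Lemma integral_geEFin0 f : (forall x, 0 <= f x) -> (0 <= \int[mu]_x (f x)%:E)%E.
Proof. by move=> f0; apply: integral_ge0 => x _; rewrite lee_fin. Qed.

Lemma ge0_le_integralR f g : (forall x, 0 <= f x) -> (forall x, f x <= g x) ->
  (\int[mu]_x (f x)%:E <= \int[mu]_x (g x)%:E)%E.
Proof. by move=> f0 fg; apply: ge0_le_integralT => x; rewrite lee_fin. Qed.

End nonneg_real_integral.

Section preserving_ae.
Context d1 d2 (T1 : measurableType d1) (T2 : measurableType d2) (R : realType).
Variables (m1 : {measure set T1 -> \bar R}) (m2 : {measure set T2 -> \bar R}).
Variable phi : T1 -> T2.
Hypothesis preserving : forall F : T2 -> \bar R, measurable_fun setT F ->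
  (forall x, 0 <= F x)%E -> (\int[m1]_x F (phi x) = \int[m2]_y F y)%E.
Hypothesis mphi : measurable_fun setT phi.

Lemma preserving_ae (P : T2 -> Prop) :
  {ae m2, forall y, P y} -> {ae m1, forall x, P (phi x)}.
Proof.
move=> [A [mA A0 PA]]; exists (phi @^-1` A); split.
- by rewrite -[X in measurable X]setTI; exact: mphi.
- have mpA : measurable (phi @^-1` A).
    by rewrite -[X in measurable X]setTI; exact: mphi.
  have mE : measurable_fun setT (EFin \o \1_A : T2 -> \bar R).
    by apply/measurable_EFinP; exact: measurable_indic.
  have E0 y : (0 <= (EFin \o \1_A : T2 -> \bar R) y)%E by rewrite /= lee_fin.
  have := preserving mE E0; rewrite [RHS](integral_indic m2 measurableT mA) (setIT A) A0 => <-.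
  by rewrite -[in LHS](setIT (phi @^-1` A)) -(integral_indic m1 measurableT mpA).
- by move=> x /= Px; apply: PA.
Qed.

End preserving_ae.

Lemma cmeasurable_flip d1 d2 (T1 : measurableType d1) (T2 : measurableType d2)
    (R : realType) (F : T1 -> T2 -> R[i]) :
  cmeasurable (fun z : T1 * T2 => F z.1 z.2) ->
  cmeasurable (fun z : T2 * T1 => F z.2 z.1).
Proof.
have sw : measurable_fun setT (fun z : T2 * T1 => (z.2, z.1)).
  by apply: measurable_fun_pair.
by move=> [m1 m2]; split; [exact: (measurableT_comp m1 sw)|exact: (measurableT_comp m2 sw)].
Qed.

(** * The short-time Fourier transform *)

Section window.
Context {R : realType} {n : nat}.
Notation mu := (lebesgue_Rn R n).
Implicit Types (F : Rn R n -> R[i]) (t u v w x : Rn R n) (e : R).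

(** It plays two roles: in frequency it majorises the transform of the window, in position it is the
    density that fixes the test functions. Both rest on its finite mass [pi ^+ n] and on its
    changing by at most a constant factor over bounded distances. *)
Definition weight t : R := \prod_(i < n) (1 + coord t i ^+ 2)^-1.

Let p1 (y : R) : 0 < 1 + y ^+ 2. Proof. by rewrite ltr_pwDl ?sqr_ge0. Qed.

Lemma weight_gt0 t : 0 < weight t.
Proof. by apply: prodr_gt0 => i _; rewrite invr_gt0. Qed.

Lemma weight_ge0 t : 0 <= weight t. Proof. exact/ltW/weight_gt0. Qed.

Lemma weight_le1 t : weight t <= 1.
Proof.
apply: prodr_ile1 => i _; rewrite invr_ge0 (ltW (p1 _))/= invf_le1 ?p1//.
by rewrite lerDl sqr_ge0.
Qed.

Lemma measurable_weight : measurable_fun setT weight.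
Proof.
apply: measurable_prod => i _.
apply: (measurableT_comp (f := fun y : R => (1 + y ^+ 2)^-1)); last exact: measurable_coord.
apply: continuous_measurable_fun => y; apply: cvgV; first by rewrite gt_eqF.
by apply: cvgD; [exact: cvg_cst|exact: exprn_continuous].
Qed.

Lemma integral_weight : (\int[mu]_t (weight t)%:E = (pi ^+ n : R)%:E)%E.
Proof.
rewrite (integral_tensor (f := fun (i : 'I_n) (y : measurableTypeR R) => (1 + y ^+ 2)^-1 : R)
   (c := fun=> pi)).
- by rewrite prodr_const card_ord.
- move=> i; apply: continuous_measurable_fun => y; apply: cvgV; first by rewrite gt_eqF.
  by apply: cvgD; [exact: cvg_cst|exact: exprn_continuous].
- by move=> i y; rewrite invr_ge0 ltW.
- by move=> i; rewrite integral_oneDsqr.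
Qed.

(** In each coordinate [u^2 <= 2 v^2 + 2 L^2], hence [1 + u^2 <= (2 + 2 L^2) (1 + v^2)]. *)
Lemma weight_slow (L : R) u v :
  (forall i, `|coord u i - coord v i| <= L) ->
  weight v <= (2 + 2 * L ^+ 2) ^+ n * weight u.
Proof.
move=> uv; have -> : (2 + 2 * L ^+ 2) ^+ n = \prod_(i < n) (2 + 2 * L ^+ 2).
  by rewrite prodr_const card_ord.
rewrite -big_split; apply: ler_prod => i _.
rewrite invr_ge0 ltW//= ler_pdivlMr// mulrC ler_pdivrMr//.
have L2 : (coord u i - coord v i) ^+ 2 <= L ^+ 2.
  rewrite -real_normK ?num_real// lerXn2r ?nnegrE//.
  exact: le_trans (normr_ge0 _) (uv i).
have := sqr_ge0 (coord u i - 2 * coord v i).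
have := sqr_ge0 (L * coord v i); rewrite exprMn.
move: L2; rewrite !sqrrB !exprMn; move: (coord u i) (coord v i) => y z; nra.
Qed.

Definition window e t : R := \prod_(i < n) tri e (coord t i).

Lemma window_ge0 e t : 0 <= window e t.
Proof. by apply: prodr_ge0 => i _; exact: tri_ge0. Qed.

Lemma window_le1 e t : 0 <= e -> window e t <= 1.
Proof. by move=> e0; apply: prodr_ile1 => i _; rewrite tri_ge0 tri_le1. Qed.

Lemma window_neq0 e t i : 0 < e -> window e t != 0 -> `|coord t i| < e.
Proof.
move=> e0; apply: contraNT; rewrite -leNgt => h.
by rewrite /window (bigD1 i)//= tri_eq0 ?mul0r.
Qed.

Lemma measurable_window e : measurable_fun setT (window e).
Proof.
apply: measurable_prod => i _.
apply: (measurableT_comp (f := tri e)); last exact: measurable_coord.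
by apply: continuous_measurable_fun; exact: continuous_tri.
Qed.

Lemma fourier_window e : 0 < e ->
  [/\ cintegrable mu (fun t => (window e t)%:C%C),
      cintegrable mu (fourier (fun t => (window e t)%:C%C)) &
      forall w, normc (fourier (fun t => (window e t)%:C%C) w) <=
        (e + 4 / e) ^+ n * weight w].
Proof.
move=> e0; have pi0 := pi_gt0 R; have pi1 : 1 <= pi :> R by have := @pi_ge2 R; lra.
pose f w (i : 'I_n) (x : measurableTypeR R) := (tri e x)%:C%C * expi (- (2 * pi * coord w i) * x).
have E w t : (window e t)%:C%C * expi (- (2 * pi * dotRn w t)) =
    \prod_(i < n) f w i (coord t i).
  rewrite /window rmorph_prod /dotRn mulr_sumr -sumrN expi_sum -big_split/=.
  by apply: eq_bigr => i _; rewrite /f; congr (_ * expi _); ring.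
have fi w i := cintegral_tri (- (2 * pi * coord w i)) e0.
have b w : normc (fourier (fun t => (window e t)%:C%C) w) <= (e + 4 / e) ^+ n * weight w.
  rewrite /fourier; under eq_cintegral do rewrite E.
  have [_ ->] := cintegral_tensor (fun i => (fi w i).1).
  rewrite normc_prod (_ : (e + 4 / e) ^+ n = \prod_(i < n) (e + 4 / e));
    last by rewrite prodr_const card_ord.
  rewrite -big_split.
  apply: ler_prod => i _; rewrite normc_ge0/=; apply: le_trans (fi w i).2 _.
  rewrite ler_pM2l; last by rewrite addr_gt0// divr_gt0.
  rewrite lef_pV2 ?posrE// lerD2l sqrrN exprMn ler_peMl ?sqr_ge0//.
  by rewrite expr_ge1//; lra.
have iw : cintegrable mu (fun t => (window e t)%:C%C).
  have [h _] := cintegral_tensor (fun i => (fi (cstRn n 0) i).1).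
  move: h; congr (cintegrable _ _); apply/funext => t.
  rewrite -[LHS]E (_ : dotRn _ _ = 0) ?mulr0 ?oppr0 ?expi0 ?mulr1//.
  by rewrite /dotRn big1// => i _; rewrite coord_cst mul0r.
split=> //; apply: (cintegrable_le (h := fun w => ((e + 4 / e) ^+ n * weight w)%:E)).
- by apply: cmeasurable_fourier; exact: cintegrable_meas iw.
- by move=> w; rewrite lee_fin.
- rewrite ge0_integralZlR ?integral_weight ?ltry//.
  + by rewrite exprn_ge0// addr_ge0 ?divr_ge0// ltW.
  + exact: measurable_weight.
  + exact: weight_ge0.
Qed.

Definition cwindow e t : R[i] := (window e t)%:C%C.

Lemma cintegrable_mul_bounded F (h : Rn R n -> R[i]) (M : R) :
  cintegrable mu F -> cmeasurable h -> (forall t, normc (h t) <= M) ->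
  cintegrable mu (fun t => F t * h t).
Proof.
move=> iF mh hM; have M0 : 0 <= M := le_trans (normc_ge0 _) (hM (cstRn n 0)).
have mF := cintegrable_meas iF.
apply: (cintegrable_le (h := fun t => (M * normc (F t))%:E)).
- exact: cmeasurableM.
- by move=> t; rewrite lee_fin Normc.normcM mulrC ler_wpM2r ?normc_ge0.
- rewrite ge0_integralZlR//; last 2 first.
  + exact: measurable_normc.
  + by move=> t; exact: normc_ge0.
  have := cintegrable_lty iF => Foo; apply: lte_mul_pinfty => //.
Qed.

Lemma cintegrable_stft_window e F x w : 0 < e -> cintegrable mu F ->
  cintegrable mu (stft_integrand (cwindow e) F x w).
Proof.
move=> e0 iF.
apply: (@cintegrable_mul_bounded _ _ 1); last by move=> t; rewrite normc_expi.
  apply: (@cintegrable_mul_bounded _ _ 1) => //.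
    apply: cmeasurableJ; apply: cmeasurable_real.
    apply: (measurableT_comp (measurable_window e)).
    by apply: measurable_subRn => //; exact: measurable_cst.
  move=> t; rewrite normcJ normc_real ger0_norm ?window_ge0//.
  by rewrite window_le1// ltW.
by apply: cmeasurable_charN => //; exact: measurable_cst.
Qed.

(* Expanding the window by Fourier inversion gives a bound on the short-time
   Fourier transform that does not depend on the position. *)
Lemma normc_stft_window e F x w : 0 < e -> cintegrable mu F ->
  ((normc (stft (cwindow e) F x w))%:E <=
   ((e + 4 / e) ^+ n)%:E *
     \int[mu]_v (weight (subRn v w) * normc (fourier F v))%:E)%E.
Proof.
move=> e0 iF; have mF := cintegrable_meas iF.
have [iw ith bth] := fourier_window e0.
set th := fourier _ in ith bth; have mth := cintegrable_meas ith.
have inv := fourier_inversion iw ith; rewrite -/th in inv.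
have msub : measurable_fun setT (fun t => subRn t x).
  by apply: measurable_subRn => //; exact: measurable_cst.
have {}inv : {ae mu, forall t, cwindow e (subRn t x) = ifourier th (subRn t x)}.
  exact: (preserving_ae (phi := fun t => subRn t x)
      (fun H mH H0 => integral_subl mH H0 x) msub inv).
pose K t v := F t * conjc (th v) * expi (- (2 * pi * dotRn v (subRn t x))) *
  expi (- (2 * pi * dotRn w t)).
have mK : cmeasurable (fun z : Rn R n * Rn R n => K z.1 z.2).
  apply: cmeasurableM; [apply: cmeasurableM; [apply: cmeasurableM|]|].
  - exact: cmeasurable_comp mF _.
  - by apply: cmeasurableJ; exact: cmeasurable_comp mth _.
  - by apply: cmeasurable_charN => //; apply: measurable_subRn.
  - by apply: cmeasurable_charN => //; exact: measurable_cst.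
have nK t v : normc (K t v) = normc (F t) * normc (th v).
  by rewrite /K !Normc.normcM !normc_expi !mulr1 normcJ.
have iK : (\int[mu]_t \int[mu]_v (normc (K t v))%:E < +oo)%E.
  under eq_integral => t _.
    under eq_integral do rewrite nK.
    rewrite ge0_integralZlR ?normc_ge0//; last 2 first.
      exact: measurable_normc.
      by move=> v; exact: normc_ge0.
    over.
  have Foo := cintegrable_lty iF; have thoo := cintegrable_lty ith.
  rewrite ge0_integralZr//; last 3 first.
  - exact: measurable_normcE.
  - by move=> t _; rewrite lee_fin normc_ge0.
  - by apply: integral_geEFin0 => v; exact: normc_ge0.
  apply: lte_mul_pinfty => //; first by apply: integral_geEFin0 => v; exact: normc_ge0.
  by rewrite ge0_fin_numE//; apply: integral_geEFin0 => v; exact: normc_ge0.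
have -> : stft (cwindow e) F x w = cintegral mu (fun t => cintegral mu (K t)).
  apply: ae_eq_cintegral.
  - exact: cintegrable_meas (cintegrable_stft_window x w e0 iF).
  - exact: cmeasurable_cintegral mK.
  - apply: filterS inv => t Et.
    rewrite /stft_integrand Et /ifourier -cintegralJ; last exact: cintegrable_ifourier.
    rewrite mulrAC -cintegralZl; last first.
      by apply: cintegrableJ; exact: cintegrable_ifourier.
    by apply: eq_cintegral => v; rewrite /K conjcM conjc_expi; ring.
rewrite (cintegral_swap mK iK).
(* For fixed [v] the integral in [t] is the transform of [F] at [v + w], up to a factor of modulus
   [|th v|]; the position [x] survives only in a phase and disappears from the bound. *)
have Kv v : K^~ v = fun t => conjc (th v) * expi (2 * pi * dotRn v x) *
    (F t * expi (- (2 * pi * dotRn (addRn v w) t))).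
  apply/funext => t; rewrite /K dotRn_sub.
  rewrite (_ : - (2 * pi * (dotRn v t - dotRn v x)) =
    2 * pi * dotRn v x - 2 * pi * dotRn v t); last by ring.
  rewrite (_ : - (2 * pi * dotRn (addRn v w) t) =
    - (2 * pi * dotRn v t) + - (2 * pi * dotRn w t)); last first.
    rewrite /dotRn -opprD -mulrDr -big_split/=; congr (- (_ * _)).
    by apply: eq_bigr => i _; rewrite coord_add mulrDl.
  by rewrite !expiD; ring.
have Ev v : normc (cintegral mu (K^~ v)) = normc (th v) * normc (fourier F (addRn v w)).
  rewrite Kv cintegralZl; last exact: cintegrable_fourier.
  by rewrite !Normc.normcM normc_expi mulr1 normcJ.
have mKs : cmeasurable (fun z : Rn R n * Rn R n => K z.2 z.1).
  exact: cmeasurable_flip.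
have iKs : (\int[mu]_v \int[mu]_t (normc (K t v))%:E < +oo)%E.
  rewrite -(@integral_swap _ _ _ _ _ mu mu (fun t v => (normc (K t v))%:E))//.
    exact: measurable_normcE.
  by move=> t v; rewrite lee_fin normc_ge0.
apply: le_trans (normc_cintegral (cintegrable_cintegral mKs iKs)) _.
have mff : measurable_fun setT (fun v => normc (fourier F v)).
  exact/measurable_normc/cmeasurable_fourier.
have madd (y : Rn R n) : measurable_fun setT (fun v => subRn v y).
  by apply: measurable_subRn => //; exact: measurable_cst.
rewrite -ge0_integralZlR; last 3 first.
- by rewrite exprn_ge0// addr_ge0 ?divr_ge0// ltW.
- apply: measurable_funM => //.
  exact: (measurableT_comp measurable_weight).
- by move=> v; rewrite mulr_ge0 ?weight_ge0 ?normc_ge0.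
rewrite -[leRHS](integral_addl _ _ w); last 2 first.
- apply/measurable_EFinP; apply: measurable_funM; first exact: measurable_cst.
  by apply: measurable_funM => //; exact: (measurableT_comp measurable_weight).
- move=> v; rewrite lee_fin !mulr_ge0 ?weight_ge0 ?normc_ge0//.
  by rewrite exprn_ge0// addr_ge0 ?divr_ge0// ltW.
apply: ge0_le_integralR => v; first exact: normc_ge0.
rewrite Ev (_ : subRn (addRn v w) w = v); last first.
  by apply: coord_ext => i; rewrite coord_sub coord_add addrK.
by rewrite mulrA ler_wpM2r ?normc_ge0.
Qed.

End window.

Lemma measurable_countable_comp d (T : measurableType d) (I : countType) (phi : T -> I) :
  (forall k, measurable [set t | phi t = k]) ->
  forall d' (T' : measurableType d') (h : I -> T'),
  measurable_fun setT (fun t => h (phi t)).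
Proof.
move=> mphi d' T' h _ B mB; rewrite setTI.
rewrite (_ : _ @^-1` B = \bigcup_k [set t | B (h k) /\ phi t = k]).
  apply: countable_bigcupT_measurable => [|k]; first exact: countableP.
  have [Bk|Bk] := pselect (B (h k)).
    by rewrite (_ : [set t | _] = [set t | phi t = k])//; apply/seteqP; split => t //= [].
  by rewrite (_ : [set t | _] = set0)//; apply/seteqP; split => t //= [].
by apply/seteqP; split => t /=; [exists (phi t)|move=> [k _ [? ->]]].
Qed.

(** * Unit cubes and their lattice *)

Section floor.
Context {R : realType} {n : nat}.
Notation mu := (lebesgue_Rn R n).
Implicit Types (t u : Rn R n) (k : n.-tuple int).

Definition floorRn t : n.-tuple int := [tuple Num.floor (coord t i) | i < n].

Lemma cubeE k : cube k = [set t | floorRn t = k].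
Proof.
apply/seteqP; split => t /=.
  move=> kt; apply: eq_from_tnth => i; rewrite tnth_mktuple.
  by apply: floor_def; rewrite intrD; exact: kt.
move=> <- i; rewrite tnth_mktuple.
by have := floor_itv (coord t i); rewrite intrD.
Qed.

Lemma measurable_cube k : measurable (cube k : set (Rn R n)).
Proof.
rewrite (_ : cube k = \bigcap_(i in [set: 'I_n])
    ((fun t => coord t i) @^-1` `[(tnth k i)%:~R, (tnth k i)%:~R + 1[)).
  apply: fin_bigcap_measurable => // i _.
  by rewrite -[X in measurable X]setTI; apply: measurable_coord.
apply/seteqP; split => t /= ht i; last by have := ht i I; rewrite /= in_itv.
by move=> _ /=; rewrite in_itv; exact: ht.
Qed.

Lemma measurable_floor d' (T' : measurableType d') (h : n.-tuple int -> T') :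
  measurable_fun setT (fun t => h (floorRn t)).
Proof.
by apply: measurable_countable_comp => k; rewrite -cubeE; exact: measurable_cube.
Qed.

Lemma floor_eq_dist t u i : floorRn t = floorRn u -> `|coord t i - coord u i| <= 1.
Proof.
move=> /(congr1 (fun k => tnth k i)); rewrite !tnth_mktuple => e.
have /andP[t1 t2] := floor_itv (coord t i); have /andP[u1 u2] := floor_itv (coord u i).
move: t1 t2 u1 u2; rewrite e intrD ler_norml => *; apply/andP; split; lra.
Qed.

(** A kernel of integral one in each variable. Inserting it averages a function over its cube, and
    Tonelli then turns cube-by-cube bounds into bounds on integrals without any lattice sum. *)
Definition same_cube t u : R := \1_(cube (floorRn u)) t.

Lemma same_cubeE t u : same_cube t u = (floorRn t == floorRn u)%:R.
Proof. by rewrite /same_cube indicE cubeE; congr (nat_of_bool _)%:R; apply/asboolP/eqP. Qed.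

Lemma same_cubeC t u : same_cube t u = same_cube u t.
Proof. by rewrite !same_cubeE eq_sym. Qed.

Lemma same_cube_ge0 t u : 0 <= same_cube t u. Proof. by rewrite same_cubeE. Qed.

Lemma measurable_same_cube d (T : measurableType d) (f g : T -> Rn R n) :
  measurable_fun setT f -> measurable_fun setT g ->
  measurable_fun setT (fun x => same_cube (f x) (g x)).
Proof.
move=> mf mg; under eq_fun do rewrite same_cubeE.
pose phi x := (floorRn (f x), floorRn (g x)).
suff mphi (k : n.-tuple int * n.-tuple int) : measurable [set x | phi x = k].
  exact: (measurable_countable_comp mphi
    (fun k : n.-tuple int * n.-tuple int => (k.1 == k.2)%:R : measurableTypeR R)).
move: k => [k l]; rewrite (_ : [set t | _] = f @^-1` (cube k) `&` g @^-1` (cube l)); last first.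
  by rewrite !cubeE /phi; apply/seteqP; split => x /= -[<- <-].
by apply: measurableI; rewrite -[X in measurable X]setTI; [apply: mf|apply: mg];
  rewrite //; exact: measurable_cube.
Qed.

Lemma integral_cube k : (\int[mu]_t (\1_(cube k) t : R)%:E = 1)%E.
Proof.
pose f (i : 'I_n) (x : measurableTypeR R) : R := \1_(`[(tnth k i)%:~R, (tnth k i)%:~R + 1[%classic) x.
transitivity (\int[mu]_t (\prod_(i < n) f i (coord t i))%:E)%E.
  apply: eq_integral => t _; congr EFin; rewrite indicE; have [/set_mem h|h] := boolP (t \in _).
    rewrite big1// => i _; rewrite /f indicE mem_set//= in_itv/=; exact: h.
  have /existsNP[i hi] : ~ forall i, (tnth k i)%:~R <= coord t i < (tnth k i)%:~R + 1.
    by move=> h'; move/negP: h; apply; rewrite inE.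
  rewrite (bigD1 i)//= /f indicE memNset ?mul0r//= in_itv/=; exact: hi.
rewrite (integral_tensor (c := fun=> 1)).
- by rewrite big1.
- by move=> i; apply: measurable_indic.
- by move=> i x; rewrite /f indicE.
- move=> i; rewrite integral_indic// setIT.
  rewrite [LHS]lebesgue_measure_itv/= lte_fin ltrDl ltr01 -EFinD.
  by congr EFin; ring.
Qed.

Lemma integral_same_cube t : (\int[mu]_u (same_cube t u)%:E = 1)%E.
Proof. by under eq_integral do rewrite same_cubeC; exact: integral_cube. Qed.

End floor.

(** * Schwartz functions *)

Section partial_derivatives.
Context {R : realType} {n : nat}.
Implicit Types (f g : Rn R n -> R[i]) (t u x w : Rn R n).

(** Along this line a partial derivative becomes the derivative at 0 of a function of one real
    variable, to which the one-dimensional rules apply. *)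
Definition lineRn (i : 'I_n) x (h : R) : Rn R n :=
  [tuple coord x j + h * (j == i)%:R : measurableTypeR R | j < n].

Lemma coord_line i x h j : coord (lineRn i x h) j = coord x j + h * (j == i)%:R.
Proof. by rewrite /lineRn coord_mk. Qed.

Lemma line0 i x : lineRn i x 0 = x.
Proof. by apply: coord_ext => j; rewrite coord_line mul0r addr0. Qed.

Lemma lineD i x h k : lineRn i (lineRn i x h) k = lineRn i x (h + k).
Proof. by apply: coord_ext => j; rewrite !coord_line mulrDl addrA. Qed.

Lemma tuple_of_line i x h :
  tuple_of_row (h *: delta_mx ord0 i + row_of_tuple x) = lineRn i x h.
Proof.
apply: coord_ext => j; rewrite coord_line /tuple_of_row coord_mk !mxE eqxx/=.
by rewrite addrC.
Qed.

Lemma row_of_tupleK : cancel (@row_of_tuple R n) (@tuple_of_row R n).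
Proof.
by move=> x; apply: coord_ext => j; rewrite /tuple_of_row coord_mk mxE.
Qed.

Let quotient (G : Rn R n -> R) i x :
  (fun h : R => h^-1 *: (((fun v => G (tuple_of_row v)) \o shift (row_of_tuple x))
     (h *: delta_mx ord0 i) - G (tuple_of_row (row_of_tuple x)))) =
  (fun h : R => h^-1 *: (((fun h => G (lineRn i x h)) \o shift 0) (h *: (1 : R)) -
     G (lineRn i x 0))).
Proof.
apply/funext => h; rewrite /= tuple_of_line row_of_tupleK line0.
by rewrite addr0 /GRing.scale/= mulr1.
Qed.

Lemma derivable_line (G : Rn R n -> R) i x :
  derivable (fun v => G (tuple_of_row v)) (row_of_tuple x) (delta_mx ord0 i) =
  derivable (fun h => G (lineRn i x h)) 0 1.
Proof. by rewrite /derivable quotient. Qed.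

Lemma derive_line (G : Rn R n -> R) i x :
  'D_(delta_mx ord0 i) (fun v => G (tuple_of_row v)) (row_of_tuple x) =
  'D_1 (fun h => G (lineRn i x h)) 0.
Proof. by rewrite /derive quotient. Qed.

Definition is_partial i f x (z : R[i]) :=
  is_derive (0 : R) 1 (fun h : R => complex.Re (f (lineRn i x h))) (complex.Re z) /\
  is_derive (0 : R) 1 (fun h : R => complex.Im (f (lineRn i x h))) (complex.Im z).

Lemma has_partial_is i f x : has_partial i f x -> is_partial i f x (partial i f x).
Proof.
rewrite /has_partial (derivable_line (fun y => complex.Re (f y))).
rewrite (derivable_line (fun y => complex.Im (f y))) => -[h1 h2].
split; rewrite /partial/=.
  by rewrite (derive_line (fun y => complex.Re (f y))); exact: derivableP.
by rewrite (derive_line (fun y => complex.Im (f y))); exact: derivableP.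
Qed.

Lemma is_partial_has i f x z : is_partial i f x z ->
  has_partial i f x /\ partial i f x = z.
Proof.
move=> [[d1 e1] [d2 e2]]; split.
  rewrite /has_partial (derivable_line (fun y => complex.Re (f y))).
  by rewrite (derivable_line (fun y => complex.Im (f y))).
rewrite /partial (derive_line (fun y => complex.Re (f y))).
by rewrite (derive_line (fun y => complex.Im (f y))) e1 e2; case: (z).
Qed.

Lemma is_partialJ i f x z : is_partial i f x z ->
  is_partial i (fun t => conjc (f t)) x (conjc z).
Proof.
move=> [h1 h2]; split; first by under eq_fun do rewrite ReJ; rewrite ReJ.
by under eq_fun do rewrite ImJ; rewrite ImJ; exact: is_deriveN.
Qed.

Lemma is_partialD i f g x z z' : is_partial i f x z -> is_partial i g x z' ->
  is_partial i (fun t => f t + g t) x (z + z').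
Proof.
move=> [h1 h2] [h3 h4]; split.
  by under eq_fun do rewrite ReD; rewrite ReD; exact: is_derive_add.
by under eq_fun do rewrite ImD; rewrite ImD; exact: is_derive_add.
Qed.

Lemma is_partialM i f g x z z' : is_partial i f x z -> is_partial i g x z' ->
  is_partial i (fun t => f t * g t) x (f x * z' + g x * z).
Proof.
move=> [h1 h2] [h3 h4]; split.
  under eq_fun do rewrite ReM.
  have := is_derive_add (is_derive_mul h1 h3) (is_deriveN (is_derive_mul h2 h4)).
  by move/is_derive_eq; apply; rewrite !line0 ReD !ReM; ring.
under eq_fun do rewrite ImM.
have := is_derive_add (is_derive_mul h1 h4) (is_derive_mul h2 h3).
by move/is_derive_eq; apply; rewrite !line0 ImD !ImM; ring.
Qed.

Lemma is_partial_cst i (c : R[i]) x : is_partial i (fun=> c) x 0.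
Proof. by split; apply: is_derive_cst. Qed.

Lemma is_partial_translation i f x t z : is_partial i f (subRn t x) z ->
  is_partial i (translation x f) t z.
Proof.
have E h : subRn (lineRn i t h) x = lineRn i (subRn t x) h.
  by apply: coord_ext => j; rewrite coord_sub !coord_line coord_sub addrAC.
by move=> [h1 h2]; split; under eq_fun do rewrite /translation E.
Qed.

Lemma is_partial_expi i w t (c : R) :
  is_partial i (fun t => expi (c * dotRn w t)) t
    (Complex 0 (c * coord w i) * expi (c * dotRn w t)).
Proof.
have E h : c * dotRn w (lineRn i t h) = c * coord w i * h + c * dotRn w t.
  rewrite /dotRn (eq_bigr (fun j => coord w j * coord t j + coord w j * (h * (j == i)%:R))); last first.
    by move=> j _; rewrite coord_line mulrDr.
  rewrite big_split/= mulrDr addrC; congr (_ + _).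
  rewrite (bigD1 i)//= big1 ?addr0 ?eqxx; first by rewrite mulr1; ring.
  by move=> j /negbTE ->; rewrite !mulr0.
have d1 : is_derive (0 : R) 1 (fun h : R => c * coord w i * h + c * dotRn w t) (c * coord w i).
  have := is_derive_add (is_derive_scale (c * coord w i) (0 : R))
    (is_derive_cst (c * dotRn w t) (0 : R) 1).
  by move/is_derive_eq; apply; rewrite addr0.
have e0 : c * coord w i * 0 + c * dotRn w t = c * dotRn w t by rewrite mulr0 add0r.
split.
  under eq_fun do rewrite E.
  have d2 := @is_derive1_comp _ cos _ 0 _ _ (is_derive_cos _) d1.
  by apply: (is_derive_eq d2); rewrite e0/=; ring.
under eq_fun do rewrite E.
have d2 := @is_derive1_comp _ sin _ 0 _ _ (is_derive_sin _) d1.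
by apply: (is_derive_eq d2); rewrite e0/=; ring.
Qed.

End partial_derivatives.

(** * Decay, closure properties and measurability of Schwartz functions *)

Section schwartz_closure.
Context {R : realType} {n : nat}.
Implicit Types (f g : Rn R n -> R[i]) (t u x w : Rn R n) (i : 'I_n) (b : seq 'I_n).

Lemma schwartz_is_partial f b i x : schwartz f ->
  is_partial i (partials b f) x (partials (i :: b) f x).
Proof. by move=> [h _]; apply: has_partial_is. Qed.

(** The seminorms carry monomials, the weight carries factors [1 + x_i^2]. At a given point the two
    are comparable for the monomial with exponent [2 N] in the coordinates of modulus at least 1 and
    exponent 0 in the others, at a cost of [2 ^+ N] per coordinate. Only finitely many monomials
    [al c] arise, so their bounds can be added. *)
Lemma schwartz_decay f (N : nat) b : schwartz f ->
  exists M : R, forall x, normc (partials b f x) <= M * weight x ^+ N.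
Proof.
move=> [_ hf]; pose al (c : {ffun 'I_n -> bool}) : {ffun 'I_n -> nat} :=
  [ffun i => (c i * (N + N))%N].
have /choice[M hM] : forall c, exists M : R, forall x, weighted_partial (al c) b f x <= M.
  by move=> c; exact: hf.
have p1 (y : R) : 0 < 1 + y ^+ 2 by rewrite ltr_pwDl ?sqr_ge0.
exists (\sum_c 2 ^+ (N * n) * `|M c|) => x.
pose c : {ffun 'I_n -> bool} := [ffun i => 1 <= coord x i ^+ 2].
have w0 : 0 < weight x ^+ N by rewrite exprn_gt0// weight_gt0.
rewrite -ler_pdivrMr//; apply: le_trans (_ : 2 ^+ (N * n) * `|M c| <= _); last first.
  rewrite (bigD1 c)//= lerDl; apply: sumr_ge0 => e _.
  by rewrite mulr_ge0.
apply: le_trans (_ : 2 ^+ (N * n) * weighted_partial (al c) b f x <= _); last first.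
  by rewrite ler_pM2l ?exprn_gt0//; apply: le_trans (hM c x) (ler_norm _).
rewrite /weighted_partial mulrA mulrC ler_wpM2r ?normc_ge0//.
rewrite /weight -prodrXl -prodfV (_ : 2 ^+ (N * n) = \prod_(i < n) (2 ^+ N : R)); last first.
  by rewrite prodr_const card_ord -exprM.
rewrite normr_prod -big_split/=; apply: ler_prod => i _.
rewrite !invr_ge0 exprn_ge0 ?invr_ge0 ?(ltW (p1 _))//= exprVn invrK.
rewrite /al /c !ffunE; have [h|h] := lerP 1 (coord x i ^+ 2).
  have -> : `|coord x i ^+ (true * (N + N))| = (coord x i ^+ 2) ^+ N.
    by rewrite mul1n addnn -mul2n exprM normrX ger0_norm ?sqr_ge0.
  rewrite -exprMn; apply: lerXn2r.
  - by rewrite nnegrE ltW.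
  - by rewrite nnegrE; apply: mulr_ge0 => //; exact: sqr_ge0.
  by rewrite mulr_natl mulr2n lerD2r.
rewrite mul0n expr0 normr1 mulr1 lerXn2r ?nnegrE//; first exact/ltW.
by move: h; lra.
Qed.

Lemma schwartzI f :
  (forall b i x, has_partial i (partials b f) x) ->
  (forall (N : nat) b, exists M : R, forall x, normc (partials b f x) <= M * weight x ^+ N) ->
  schwartz f.
Proof.
move=> h1 h2; split=> // al b.
have [M hM] := h2 (\sum_i al i)%N b; exists M => x.
have p1 (y : R) : 0 < 1 + y ^+ 2 by rewrite ltr_pwDl ?sqr_ge0.
rewrite /weighted_partial; set N := (\sum_i al i)%N.
have w0 : 0 < weight x ^+ N by rewrite exprn_gt0// weight_gt0.
apply: le_trans (_ : (weight x ^+ N)^-1 * normc (partials b f x) <= _); last first.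
  by rewrite mulrC ler_pdivrMr.
rewrite ler_wpM2r ?normc_ge0// normr_prod /weight -prodrXl -prodfV.
apply: ler_prod => i _; rewrite normr_ge0/= exprVn invrK normrX.
have l1 : `|coord x i| <= 1 + coord x i ^+ 2.
  by rewrite ler_norml; have := sqr_ge0 (coord x i - 1); have := sqr_ge0 (coord x i + 1);
    rewrite sqrrB sqrrD !expr1n !mulr1 => *; apply/andP; split; lra.
apply: le_trans (_ : (1 + coord x i ^+ 2) ^+ al i <= _).
  by rewrite lerXn2r ?nnegrE// ltW.
apply: ler_weXn2l; first by rewrite lerDl sqr_ge0.
by rewrite /N (bigD1 i)//= leq_addr.
Qed.

Lemma schwartz_partial f i : schwartz f -> schwartz (partial i f).
Proof.
move=> [h1 h2]; have E b : partials b (partial i f) = partials (rcons b i) f.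
  by rewrite /partials foldr_rcons.
split=> [b j x|al b]; first by rewrite E; exact: h1.
by have [M hM] := h2 al (rcons b i); exists M => x; rewrite /weighted_partial E; exact: hM.
Qed.

Lemma partialsJ f b : schwartz f ->
  partials b (fun t => conjc (f t)) = fun t => conjc (partials b f t).
Proof.
move=> sf; elim: b => //= i b ->; apply/funext => x.
by have [] := is_partial_has (is_partialJ (schwartz_is_partial b i x sf)).
Qed.

Lemma schwartzJ f : schwartz f -> schwartz (fun t => conjc (f t)).
Proof.
move=> sf; apply: schwartzI => [b i x|N b].
  rewrite partialsJ//.
  by have [] := is_partial_has (is_partialJ (schwartz_is_partial b i x sf)).
have [M hM] := schwartz_decay N b sf; exists M => x.
by rewrite partialsJ// normcJ.
Qed.

Let is_partial_lin f g c b i x : schwartz f -> schwartz g ->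
  is_partial i (fun t => c * partials b f t + partials b g t) x
    (c * partials (i :: b) f x + partials (i :: b) g x).
Proof.
move=> sf sg; apply: is_partialD; last exact: schwartz_is_partial.
have := is_partialM (is_partial_cst i c x) (schwartz_is_partial b i x sf).
by rewrite mulr0 addr0.
Qed.

Lemma partials_lin f g c b : schwartz f -> schwartz g ->
  partials b (fun t => c * f t + g t) =
  fun t => c * partials b f t + partials b g t.
Proof.
move=> sf sg; elim: b => //= i b ->; apply/funext => x.
by have [] := is_partial_has (is_partial_lin c b i x sf sg).
Qed.

Lemma schwartz_lin f g c : schwartz f -> schwartz g ->
  schwartz (fun t => c * f t + g t).
Proof.
move=> sf sg; apply: schwartzI => [b i x|N b].
  rewrite partials_lin//.
  by have [] := is_partial_has (is_partial_lin c b i x sf sg).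
have [M hM] := schwartz_decay N b sf; have [M' hM'] := schwartz_decay N b sg.
exists (normc c * M + M') => x; rewrite partials_lin//.
rewrite (le_trans (le_normcD _ _))// mulrDl Normc.normcM -mulrA.
by apply: lerD => //; rewrite ler_wpM2l ?normc_ge0.
Qed.

Lemma partials_translation f x b : schwartz f ->
  partials b (translation x f) = translation x (partials b f).
Proof.
move=> sf; elim: b => //= i b ->; apply/funext => t.
by have [] := is_partial_has (is_partial_translation (schwartz_is_partial b i (subRn t x) sf)).
Qed.

Lemma schwartz_translation f x : schwartz f -> schwartz (translation x f).
Proof.
move=> sf; apply: schwartzI => [b i t|N b].
  rewrite partials_translation//.
  by have [] := is_partial_has (is_partial_translation (schwartz_is_partial b i (subRn t x) sf)).
have [M hM] := schwartz_decay N b sf.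
pose L := \sum_(i < n) `|coord x i|; pose K := (2 + 2 * L ^+ 2) ^+ n.
exists (`|M| * K ^+ N) => t; rewrite partials_translation// /translation.
apply: le_trans (hM _) _; apply: le_trans (_ : `|M| * weight (subRn t x) ^+ N <= _).
  by rewrite ler_wpM2r ?ler_norm// exprn_ge0// weight_ge0.
rewrite -mulrA ler_wpM2l// -exprMn; apply: lerXn2r; rewrite ?nnegrE ?weight_ge0//.
  by rewrite mulr_ge0 ?weight_ge0// exprn_ge0// addr_ge0// mulr_ge0// sqr_ge0.
apply: weight_slow => i; rewrite coord_sub opprB addrC subrK.
by rewrite /L (bigD1 i)//= lerDl sumr_ge0.
Qed.

Let is_partial_char f c w i t : schwartz f ->
  is_partial i (fun t => expi (c * dotRn w t) * f t) t
    (expi (c * dotRn w t) * (Complex 0 (c * coord w i) * f t + partial i f t)).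
Proof.
move=> sf; have := is_partialM (is_partial_expi i w t c) (schwartz_is_partial [::] i t sf).
by congr is_partial; rewrite /=; ring.
Qed.

Lemma schwartz_char f c w : schwartz f ->
  schwartz (fun t => expi (c * dotRn w t) * f t).
Proof.
move=> sf.
(* Differentiating a modulated Schwartz function yields a modulated Schwartz function, so the
   induction needs to know only that some [g] exists. *)
have E b : exists2 g, schwartz g &
    partials b (fun t => expi (c * dotRn w t) * f t) = fun t => expi (c * dotRn w t) * g t.
  elim: b => [|i b [g sg Eg]]; first by exists f.
  exists (fun t => Complex 0 (c * coord w i) * g t + partial i g t).
    by apply: schwartz_lin => //; exact: schwartz_partial.
  apply/funext => t; rewrite /= Eg.
  by have [] := is_partial_has (is_partial_char c w i t sg).
apply: schwartzI => [b i x|N b]; have [g sg Eg] := E b.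
  by rewrite Eg; have [] := is_partial_has (is_partial_char c w i x sg).
have [M hM] := schwartz_decay N [::] sg; exists M => x.
by rewrite Eg Normc.normcM normc_expi mul1r; exact: hM.
Qed.

Lemma schwartz_atom f x w : schwartz f ->
  schwartz (fun t => conjc (modulation w (translation x f) t)).
Proof.
move=> sf; apply: schwartzJ; rewrite /modulation.
by apply: schwartz_char; exact: schwartz_translation.
Qed.

Let real_lipschitz (h dh : R -> R) (M y : R) :
  (forall z : R, is_derive z 1 h (dh z)) -> (forall z, `|dh z| <= M) ->
  `|h y - h 0| <= M * `|y|.
Proof.
move=> hd hM; have ch := is_derive_continuous hd.
have [y0|y0|->] := ltgtP y 0.
- have [c _ Ec] := MVT y0 (fun z _ => hd z) (continuous_subspaceT ch).
  rewrite distrC Ec normrM sub0r normrN ler_wpM2r//; exact: hM.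
- have [c _ ->] := MVT y0 (fun z _ => hd z) (continuous_subspaceT ch).
  rewrite subr0 normrM ler_wpM2r//; exact: hM.
- by rewrite subrr normr0 mulr0.
Qed.

Let is_derive_at0 (h : R -> R) (z l : R) :
  is_derive (0 : R) (1 : R) (fun k : R => h (z + k)) l -> is_derive z (1 : R) h l.
Proof.
move=> [d1 d2]; have Q : (fun k : R => k^-1 *: ((h \o shift z) (k *: (1 : R)) - h z)) =
    (fun k : R => k^-1 *: (((fun k => h (z + k)) \o shift 0) (k *: (1 : R)) - h (z + 0))).
  by apply/funext => k; rewrite /= !addr0 [z + _]addrC.
by split; rewrite /derivable /derive Q.
Qed.

Lemma schwartz_lipschitz f : schwartz f ->
  exists M : R, forall x y, normc (f x - f y) <= M * \sum_(i < n) `|coord x i - coord y i|.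
Proof.
move=> sf.
have /choice[Mi hMi] : forall i, exists M : R, forall x, normc (partial i f x) <= M.
  move=> i; have [M hM] := schwartz_decay 0 [:: i] sf.
  by exists M => x; have := hM x; rewrite expr0 mulr1.
pose M := \sum_(i < n) `|Mi i|.
have bM i x : normc (partial i f x) <= M.
  rewrite (le_trans (hMi i x))// (le_trans (ler_norm _))// /M (bigD1 i)//= lerDl.
  by rewrite sumr_ge0.
have line i x y : normc (f (lineRn i x y) - f x) <= (M + M) * `|y|.
  have D z : is_partial i f (lineRn i x z) (partial i f (lineRn i x z)).
    exact: (schwartz_is_partial [::] i (lineRn i x z) sf).
  have d1 (z : R) : is_derive z (1 : R) (fun y : R => complex.Re (f (lineRn i x y)))
      (complex.Re (partial i f (lineRn i x z))).
    have [h _] := D z; apply: (@is_derive_at0 (fun y : R => complex.Re (f (lineRn i x y)))).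
    have -> // : (fun k : R => complex.Re (f (lineRn i x (z + k)))) =
      fun k : R => complex.Re (f (lineRn i (lineRn i x z) k)).
    by apply/funext => k; rewrite lineD.
  have d2 (z : R) : is_derive z (1 : R) (fun y : R => complex.Im (f (lineRn i x y)))
      (complex.Im (partial i f (lineRn i x z))).
    have [_ h] := D z; apply: (@is_derive_at0 (fun y : R => complex.Im (f (lineRn i x y)))).
    have -> // : (fun k : R => complex.Im (f (lineRn i x (z + k)))) =
      fun k : R => complex.Im (f (lineRn i (lineRn i x z) k)).
    by apply/funext => k; rewrite lineD.
  rewrite (le_trans (normc_le_ReIm _))// mulrDl; apply: lerD.
    rewrite ReD ReN -[in X in _ - X](line0 i x); apply: real_lipschitz d1 _ => z.
    exact: le_trans (normc_Re _) (bM _ _).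
  rewrite ImD ImN -[in X in _ - X](line0 i x); apply: real_lipschitz d2 _ => z.
  exact: le_trans (normc_Im _) (bM _ _).
(* The mean value theorem is applied to real and imaginary parts separately, each contributing
   [M]. *)
exists (M + M) => x y.
(* A path from [y] to [x] changing one coordinate at a time: the first [k] coordinates are already
   those of [x]. *)
pose hyb k : Rn R n := [tuple (if (i < k)%N then coord x i else coord y i : measurableTypeR R) | i < n].
have steps k : (k <= n)%N ->
    normc (f (hyb k) - f y) <= (M + M) * \sum_(i < n | (i < k)%N) `|coord x i - coord y i|.
  elim: k => [_|k IH kn].
    rewrite big1// mulr0 (_ : hyb 0%N = y) ?subrr ?Normc.normc0//.
    by apply: coord_ext => i; rewrite /hyb coord_mk.
  pose j := Ordinal kn.
  have -> : hyb k.+1 = lineRn j (hyb k) (coord x j - coord y j).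
    apply: coord_ext => i; rewrite coord_line /hyb !coord_mk ltnS leq_eqVlt.
    rewrite -[(i == k :> nat)]/(i == j); case: eqVneq => [->|_] /=.
      by rewrite ltnn mulr1 addrC subrK.
    by rewrite mulr0 addr0.
  rewrite (bigD1 j)//= mulrDr -[X in normc X](subrKA (f (hyb k))).
  rewrite (le_trans (le_normcD _ _))//; apply: lerD; first exact: line.
  rewrite (le_trans (IH (ltnW kn)))// le_eqVlt; apply/orP; left; apply/eqP; congr (_ * _).
  apply: eq_bigl => i; rewrite [in RHS]ltnS [in RHS]leq_eqVlt -[(i == k :> nat)]/(i == j).
  by case: eqVneq => [->|_] /=; rewrite ?ltnn ?andbT.
have := steps n (leqnn n); rewrite (_ : hyb n = x); last first.
  by apply: coord_ext => i; rewrite /hyb coord_mk ltn_ord.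
by under eq_bigl do rewrite ltn_ord.
Qed.

(** Only the Lipschitz bound is used. Rounding the argument to the grid of mesh [1 / (k+1)] makes
    the function factor through the countable lattice, hence measurable whatever its values, and
    these functions converge pointwise. *)
Lemma schwartz_measurable f : schwartz f -> cmeasurable f.
Proof.
move=> /schwartz_lipschitz[M hM].
pose q (k : nat) t : Rn R n :=
  [tuple (Num.floor (k.+1%:R * coord t i))%:~R / k.+1%:R : measurableTypeR R | i < n].
have qE k t i : `|coord (q k t) i - coord t i| <= k.+1%:R^-1.
  rewrite /q coord_mk; have /andP[h1 h2] := floor_itv (k.+1%:R * coord t i).
  have k0 : 0 < k.+1%:R :> R by rewrite ltr0n.
  rewrite (_ : _ - _ = ((Num.floor (k.+1%:R * coord t i))%:~R - k.+1%:R * coord t i) /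
      k.+1%:R); last first.
    by rewrite mulrBl [k.+1%:R * _]mulrC mulfK// gt_eqF.
  rewrite normrM [X in _ * X]gtr0_norm ?invr_gt0// ler_piMl ?invr_ge0 ?ler0n//.
  by rewrite ler_norml; move: h2; rewrite intrD; move: h1 => *; apply/andP; split; lra.
have mq (h : Rn R n -> R) k : measurable_fun setT (fun t => h (q k t)).
  have E t : q k t = [tuple (tnth (floorRn (affRn k.+1%:R (cstRn n 0) t)) i)%:~R / k.+1%:R
      : measurableTypeR R | i < n].
    by apply: coord_ext => i; rewrite /q !coord_mk tnth_mktuple coord_aff coord_cst addr0.
  under eq_fun do rewrite E.
  apply: (measurableT_comp (f := fun t : Rn R n => h [tuple (tnth (floorRn t) i)%:~R / k.+1%:R
    : measurableTypeR R | i < n]) (g := affRn k.+1%:R (cstRn n 0))); last exact: measurable_affRn.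
  exact: (measurable_floor (fun l : n.-tuple int => h [tuple (tnth l i)%:~R / k.+1%:R
    : measurableTypeR R | i < n] : measurableTypeR R)).
have lim (h : R[i] -> R) : (forall z z', `|h z - h z'| <= normc (z - z')) ->
    measurable_fun setT (fun t => h (f t)).
  move=> hh; apply: (measurable_fun_cvg (h := fun k t => h (f (q k t)))).
    by move=> k; exact: (mq (fun t => h (f t))).
  move=> t _.
  apply/subr_cvg0; apply: norm_cvg0.
  apply: (squeeze_cvgr (f := fun=> 0) (h := fun k => `|M| * n%:R * k.+1%:R^-1)).
  - near=> k; rewrite normr_ge0/= (le_trans (hh _ _))// (le_trans (hM _ _))//.
    apply: le_trans (_ : `|M| * \sum_(i < n) `|coord (q k t) i - coord t i| <= _).
      by rewrite ler_wpM2r ?ler_norm// sumr_ge0.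
    rewrite -mulrA ler_wpM2l// mulr_natl -[X in _ *+ X](card_ord n) -sumr_const.
    by apply: ler_sum => i _; exact: qE.
  - exact: cvg_cst.
  - rewrite -[X in _ --> X](mulr0 (`|M| * n%:R)); apply: cvgM; first exact: cvg_cst.
    exact: cvg_harmonic.
by split; apply: lim => z z'; [rewrite -ReN -ReD; exact: normc_Re|rewrite -ImN -ImD; exact: normc_Im].
Unshelve. all: by end_near. Qed.

End schwartz_closure.

Lemma integral_eq0_ae d (T : measurableType d) (R : realType)
    (mu : {measure set T -> \bar R}) (f : T -> \bar R) :
  measurable_fun setT f -> (forall x, 0 <= f x)%E -> (\int[mu]_x f x = 0)%E ->
  {ae mu, forall x, f x = 0%E}.
Proof.
move=> mf f0 i0; have : (\int[mu]_x `|f x| = 0)%E.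
  by under eq_integral do rewrite gee0_abs//.
by move/(ae_eq_integral_abs mu measurableT mf); apply: filterS => x; apply.
Qed.

(** * Change of window *)

Section ae_swap.
Context d1 d2 (T1 : measurableType d1) (T2 : measurableType d2) (R : realType).
Variable m1 : {sigma_finite_measure set T1 -> \bar R}.
Variable m2 : {sigma_finite_measure set T2 -> \bar R}.

(** The iterated integral of [|F - G|] vanishes in one order, hence by Tonelli in the other. *)
Lemma ae_swap (F G : T1 -> T2 -> R[i]) :
  cmeasurable (fun z : T1 * T2 => F z.1 z.2) ->
  cmeasurable (fun z : T1 * T2 => G z.1 z.2) ->
  {ae m1, forall x, {ae m2, forall y, F x y = G x y}} ->
  {ae m2, forall y, {ae m1, forall x, F x y = G x y}}.
Proof.
move=> mF mG FG; pose D x y := normc (F x y - G x y).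
have mD : measurable_fun setT (fun z : T1 * T2 => (D z.1 z.2)%:E).
  apply: measurable_normcE; have := cmeasurableD mF (cmeasurableM (cmeasurable_cst _ (-1)) mG).
  by under eq_fun do rewrite mulN1r.
have D0 x y : (0 <= (D x y)%:E)%E by rewrite lee_fin normc_ge0.
have mD2 y : measurable_fun setT (fun x => (D x y)%:E).
  exact: (@measurable_curry2 _ _ _ _ _ _ (fun x y => (D x y)%:E) mD).
have mI1 := @measurable_integral _ _ _ _ _ m2 (fun x y => (D x y)%:E) mD D0.
have i1 : (\int[m1]_x \int[m2]_y (D x y)%:E = 0)%E.
  rewrite -[RHS](integral0 m1 setT); apply: ae_eq_integral => //.
  apply: filterS FG => x FGx _; rewrite -[RHS](integral0 m2 setT).
  apply: ae_eq_integral => //.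
    exact: (@measurable_curry1 _ _ _ _ _ _ (fun x y => (D x y)%:E) mD).
  by apply: filterS FGx => y E _; rewrite /D E subrr Normc.normc0.
rewrite (@integral_swap _ _ _ _ _ m1 m2 (fun x y => (D x y)%:E) mD D0) in i1.
have mI2 : measurable_fun setT (fun y => \int[m1]_x (D x y)%:E)%E.
  apply: (@measurable_integral _ _ _ _ _ m1 (fun y x => (D x y)%:E)) => //.
  have sw : measurable_fun setT (fun z : T2 * T1 => (z.2, z.1)) by exact: measurable_fun_pair.
  exact: (measurableT_comp mD sw).
have := integral_eq0_ae mI2 (fun y => integral_ge0 _ (fun x _ => D0 x y)) i1.
apply: filterS => y iy; have := integral_eq0_ae (mD2 y) (fun x => D0 x y) iy.
apply: filterS => x [/Normc.eq0_normc/eqP]; rewrite subr_eq0 => /eqP //.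
Qed.

End ae_swap.

Section reproducing_formula.
Context {R : realType} {n : nat}.
Notation mu := (lebesgue_Rn R n).
Notation mu2 := (lebesgue_Rn R (n + n)).
Implicit Types (f phi gamma : Rn R n -> R[i]) (t s x y w b : Rn R n) (z : Rn R (n + n)) (e : R).

Lemma cintegral_phase (F : Rn R (n + n) -> R[i]) : cintegrable mu2 F ->
  cintegral mu2 F = cintegral mu (fun y => cintegral mu (fun w => F (catRn y w))).
Proof.
move=> iF; have mF := cintegrable_meas iF.
have pres (H : Rn R (n + n) -> \bar R) : measurable_fun setT H -> (forall z, 0 <= H z)%E ->
    (\int[(mu \x mu)%E]_z H (catRn z.1 z.2) = \int[mu2]_y H y)%E.
  move=> mH H0; rewrite integral_cat// fubini_tonelli1//.
  apply: (measurableT_comp (f := H) (g := fun z : Rn R n * Rn R n => catRn z.1 z.2)) => //.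
  exact: measurable_catRn.
rewrite -(preserving_cintegral pres mF).
rewrite (@cintegral_prod _ _ _ _ _ mu mu (fun y w => F (catRn y w)))//.
  apply: (cmeasurable_comp mF (h := fun z : Rn R n * Rn R n => catRn z.1 z.2)).
  exact: measurable_catRn.
rewrite -(integral_cat (F := fun z => (normc (F z))%:E))//.
- exact: cintegrable_lty.
- exact: measurable_normcE.
- by move=> z; rewrite lee_fin normc_ge0.
Qed.

Lemma stft_distribution_fourier phi gamma u y w : schwartz gamma -> represents phi u ->
  stft_distribution gamma u y w =
    fourier (fun t => phi t * conjc (translation y gamma t)) w.
Proof.
move=> sg [mphi rep]; rewrite /stft_distribution (rep _ (schwartz_atom y w sg)).2.
by apply: eq_cintegral => t; rewrite /modulation conjcM conjc_expi; ring.
Qed.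

Lemma cintegrable_translate phi gamma u y : schwartz gamma -> represents phi u ->
  cintegrable mu (fun t => phi t * conjc (translation y gamma t)).
Proof.
by move=> sg [mphi rep]; apply: (rep _ _).1; apply/schwartzJ/schwartz_translation.
Qed.

Lemma cmeasurable_stft_distribution phi gamma u : schwartz gamma -> represents phi u ->
  cmeasurable (fun z : Rn R n * Rn R n => stft_distribution gamma u z.1 z.2).
Proof.
move=> sg rep; have [mphi _] := rep; have mg := schwartz_measurable sg.
under eq_fun do rewrite (stft_distribution_fourier _ _ sg rep).
apply: (@cmeasurable_cintegral _ _ _ _ _ mu (fun (z : Rn R n * Rn R n) t =>
  phi t * conjc (translation z.1 gamma t) * expi (- (2 * pi * dotRn z.2 t)))).
apply: cmeasurableM; first apply: cmeasurableM.
- exact: (cmeasurable_comp mphi).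
- apply: cmeasurableJ; apply: (cmeasurable_comp mg
    (h := fun z : Rn R n * Rn R n * Rn R n => subRn z.2 z.1.1)).
  by apply: measurable_subRn => //; exact: measurableT_comp.
- by apply: cmeasurable_charN => //; exact: measurableT_comp.
Qed.

Definition stft_dist gamma u z : R[i] := stft_distribution gamma u (posn z) (freq z).

Lemma cmeasurable_stft_dist phi gamma u : schwartz gamma -> represents phi u ->
  cmeasurable (stft_dist gamma u).
Proof.
move=> sg rep; apply: (cmeasurable_comp (cmeasurable_stft_distribution sg rep)
  (h := fun z => (posn z, freq z))).
by apply: measurable_fun_pair; [exact: measurable_posn|exact: measurable_freq].
Qed.

Lemma integral_window e : 0 < e -> (\int[mu]_t (window e t)%:E = (e ^+ n)%:E)%E.
Proof.
move=> e0; rewrite /window (integral_tensor (f := fun=> tri e) (c := fun=> e)).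
- by rewrite prodr_const card_ord.
- by move=> i; apply: continuous_measurable_fun; exact: continuous_tri.
- by move=> i x; exact: tri_ge0.
- move=> i; have := integral_tri_cos 0 e0; rewrite /tri_mass eqxx.
  under eq_integral do rewrite mul0r cos0 mulrC.
  rewrite ge0_integralZlR//; last 2 first.
  + by apply: continuous_measurable_fun; exact: continuous_tri.
  + by move=> x; exact: tri_ge0.
  rewrite [X in _ = X]EFinM => /(congr1 (mule 2^-1%:E)).
  rewrite !muleA -!EFinM (_ : 2^-1 * (1 + 1) = 1) ?mul1e; last by field.
  by rewrite mul1r.
Qed.

(** The inner product of the window centred at [b] with [gamma]. It is the factor in front of [phi]
    in the reproducing formula, and must therefore be nonzero. *)
Definition pairing e b gamma : R[i] :=
  cintegral mu (fun s => conjc (gamma s) * cwindow e (subRn s b)).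

(** On a small window around [b] the function [gamma] stays within [|gamma b| / 2] of [gamma b], so
    it cannot integrate to zero there. The requirement [e <= 1] keeps the window inside the local
    norms used later. *)
Lemma window_pairing_neq0 gamma b : schwartz gamma -> gamma b != 0 ->
  exists e, [/\ 0 < e, e <= 1 & pairing e b gamma != 0].
Proof.
move=> sg gb0; have mg := schwartz_measurable sg.
have [M hM] := schwartz_lipschitz sg.
have gb : 0 < normc (gamma b).
  by rewrite lt_neqAle normc_ge0 andbT eq_sym; apply: contra gb0 => /eqP/Normc.eq0_normc ->.
(* On the support of the window every coordinate moves by less than [e], so the Lipschitz bound is
   at most [|M| n e]; adding 1 keeps the denominator positive. *)
pose e := Num.min 1 (normc (gamma b) / (2 * (`|M| * n%:R + 1))).
have Mn : 0 < `|M| * n%:R + 1 by rewrite ltr_wpDl ?mulr_ge0.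
have e0 : 0 < e by rewrite lt_min ltr01 divr_gt0// mulr_gt0.
have e1 : e <= 1 by rewrite ge_min lexx.
have eM : `|M| * (n%:R * e) <= normc (gamma b) / 2.
  apply: le_trans (_ : (`|M| * n%:R + 1) * e <= _).
    by rewrite mulrA ler_wpM2r ?lerDl// ltW.
  rewrite mulrC -ler_pdivlMr// -mulrA -invfM ge_min.
  by apply/orP; right.
exists e; split=> //; apply/eqP => p0.
have msub : measurable_fun setT (fun s => subRn s b).
  by apply: measurable_subRn => //; exact: measurable_cst.
have mw : cmeasurable (fun s => cwindow e (subRn s b)).
  by apply: cmeasurable_real; exact: (measurableT_comp (measurable_window e)).
have iw : cintegrable mu (fun s => cwindow e (subRn s b)).
  apply: (preserving_cintegrable (m2 := mu)) => // [H mH H0|].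
    exact: integral_subl.
  by have [] := fourier_window (n := n) e0.
have Ew : cintegral mu (fun s => cwindow e (subRn s b)) = (e ^+ n)%:C%C.
  rewrite cintegral_real /Rintegral (integral_subl (F := fun s => (window e s)%:E)).
  - by rewrite integral_window.
  - by apply/measurable_EFinP; exact: measurable_window.
  - by move=> s; rewrite lee_fin window_ge0.
have i1 : cintegrable mu (fun s => conjc (gamma b) * cwindow e (subRn s b)) := cintegrableZl _ iw.
pose D s := (conjc (gamma s) - conjc (gamma b)) * cwindow e (subRn s b).
have nD s : normc (D s) <= normc (gamma b) / 2 * window e (subRn s b).
  rewrite Normc.normcM normc_real ger0_norm ?window_ge0//.
  have [->|w0] := eqVneq (window e (subRn s b)) 0; first by rewrite !mulr0.
  rewrite ler_wpM2r ?window_ge0//.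
  rewrite (_ : conjc _ - _ = conjc (gamma s - gamma b)); last first.
    by rewrite conjcD; case: (gamma b) => ? ?; congr (_ + _); apply: complex_eq.
  rewrite normcJ (le_trans (hM _ _))//; apply: le_trans eM.
  apply: le_trans (_ : `|M| * \sum_(i < n) `|coord s i - coord b i| <= _).
    by rewrite ler_wpM2r ?ler_norm// sumr_ge0.
  rewrite ler_wpM2l// mulr_natl -[X in _ *+ X](card_ord n) -sumr_const.
  by apply: ler_sum => i _; rewrite -coord_sub; apply/ltW/window_neq0.
have mD : cmeasurable D.
  apply: cmeasurableM mw; rewrite (_ : (fun s => _) = fun s => conjc (gamma s) + (- conjc (gamma b)))//.
  by apply: cmeasurableD; [exact: cmeasurableJ|exact: cmeasurable_cst].
have bD : (\int[mu]_s (normc (D s))%:E <= (normc (gamma b) / 2 * e ^+ n)%:E)%E.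
  apply: (@le_trans _ _ (\int[mu]_s (normc (gamma b) / 2 * window e (subRn s b))%:E)%E).
    by apply: ge0_le_integralR => // s; exact: normc_ge0.
  rewrite (integral_subl (F := fun s => (normc (gamma b) / 2 * window e s)%:E)).
  - rewrite ge0_integralZlR ?integral_window ?EFinM ?divr_ge0 ?normc_ge0//.
    + exact: measurable_window.
    + exact: window_ge0.
  - by apply/measurable_EFinP; apply: measurable_funM => //; exact: measurable_window.
  - by move=> s; rewrite lee_fin mulr_ge0 ?window_ge0// divr_ge0 ?normc_ge0.
have iD : cintegrable mu D.
  by apply/cintegrableP; split=> //; apply: le_lt_trans bD _; rewrite ltry.
have : pairing e b gamma = conjc (gamma b) * (e ^+ n)%:C%C + cintegral mu D.
  rewrite -Ew -cintegralZl// -cintegralD//; apply: eq_cintegral => s.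
  by rewrite /D mulrBl addrC subrK.
rewrite p0 => /esym/eqP; rewrite addr_eq0 => /eqP/(congr1 (@Normc.normc R)).
rewrite Normc.normcM normcN normcJ normc_real (gtr0_norm (exprn_gt0 _ e0)) => E.
have := le_trans (normc_cintegral iD) bD; rewrite -E lee_fin.
rewrite ler_pM2r ?exprn_gt0//; lra.
Qed.


Lemma cmeasurable_stft_at phi f : cmeasurable phi -> cmeasurable f ->
  cmeasurable (fun z => stft phi f (posn z) (freq z)).
Proof.
move=> mphi mf.
apply: (@cmeasurable_cintegral _ _ _ _ _ mu (fun z t => stft_integrand phi f (posn z) (freq z) t)).
have mp : measurable_fun setT (fun z : Rn R (n + n) * Rn R n => posn z.1).
  by apply: measurableT_comp => //; exact: measurable_posn.
have mq : measurable_fun setT (fun z : Rn R (n + n) * Rn R n => freq z.1).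
  by apply: measurableT_comp => //; exact: measurable_freq.
apply: cmeasurableM; last exact: cmeasurable_charN.
apply: cmeasurableM; first exact: (cmeasurable_comp mf).
apply: cmeasurableJ; apply: (cmeasurable_comp mphi
  (h := fun z : Rn R (n + n) * Rn R n => subRn z.2 (posn z.1))).
exact: measurable_subRn.
Qed.

Lemma cmeasurable_cwindow e : cmeasurable (cwindow e : Rn R n -> R[i]).
Proof. by apply: cmeasurable_real; exact: measurable_window. Qed.

(** For almost every [y] inversion recovers [phi t * conjc (gamma (t - y))] from its transform, the
    short-time transform at [y]. Multiplying by the window at [t - y - b] and integrating over [y]
    turns the factor next to [phi t] into the constant [pairing e b gamma]. *)
Lemma reproducing gamma u phi e b : schwartz gamma -> represents phi u -> 0 < e ->
  (\int[mu2]_z (normc (stft_dist gamma u z))%:E < +oo)%E ->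
  {ae mu, forall t, pairing e b gamma * phi t =
    cintegral mu2 (fun z => stft_dist gamma u z * expi (2 * pi * dotRn (freq z) t) *
      cwindow e (subRn (subRn t (posn z)) b))}.
Proof.
move=> sg rep e0 iV; have [mphi _] := rep; have mg := schwartz_measurable sg.
pose V y w := stft_distribution gamma u y w.
have mV : cmeasurable (fun z : Rn R n * Rn R n => V z.1 z.2).
  exact: cmeasurable_stft_distribution rep.
have iV2 : (\int[mu]_y \int[mu]_w (normc (V y w))%:E < +oo)%E.
  rewrite -(integral_phase (G := fun y w => (normc (V y w))%:E))//.
    exact: measurable_normcE.
  by move=> y w; rewrite lee_fin normc_ge0.
have h1 := ae_cintegrable_curry mV iV2.
pose G y t := phi t * conjc (translation y gamma t).
have mG : cmeasurable (fun z : Rn R n * Rn R n => G z.1 z.2).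
  apply: cmeasurableM; first exact: (cmeasurable_comp mphi).
  apply: cmeasurableJ; apply: (cmeasurable_comp mg
    (h := fun z : Rn R n * Rn R n => subRn z.2 z.1)).
  exact: measurable_subRn.
have mF : cmeasurable (fun z : Rn R n * Rn R n => ifourier (V z.1) z.2).
  apply: (@cmeasurable_cintegral _ _ _ _ _ mu (fun (z : Rn R n * Rn R n) w =>
    V z.1 w * expi (2 * pi * dotRn w z.2))).
  apply: cmeasurableM.
    apply: (cmeasurable_comp mV (h := fun z : Rn R n * Rn R n * Rn R n => (z.1.1, z.2))).
    by apply: measurable_fun_pair => //; exact: measurableT_comp.
  by apply: cmeasurable_char => //; exact: measurableT_comp.
have GF : {ae mu, forall y, {ae mu, forall t, G y t = ifourier (V y) t}}.
  apply: filterS h1 => y iy.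
  have Vy : V y = fourier (G y).
    by apply/funext => w; exact: stft_distribution_fourier.
  rewrite Vy in iy *.
  by apply: fourier_inversion iy; exact: cintegrable_translate rep.
(* Inversion holds for almost every [y] at almost every [t]; integrating over [y] needs the two
   quantifiers exchanged. *)
have {}GF := ae_swap mG mF GF.
pose H s := conjc (gamma s) * cwindow e (subRn s b).
have iH : cintegrable mu H.
  have [M hM] := schwartz_decay 0 [::] sg.
  have iw : cintegrable mu (fun s => cwindow e (subRn s b)).
    apply: (preserving_cintegrable (m2 := mu)) => //.
    - by move=> h mh h0; exact: integral_subl.
    - by apply: measurable_subRn => //; exact: measurable_cst.
    - by have [] := fourier_window (n := n) e0.
  have := cintegrable_mul_bounded (M := M) iw (cmeasurableJ mg).
  move=> /(_ _)/wrap[t|]; first by rewrite normcJ; have := hM t; rewrite expr0 mulr1.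
  by congr (cintegrable _ _); apply/funext => t; rewrite mulrC.
have msub t : measurable_fun setT (fun y => subRn t y).
  by apply: measurable_subRn => //; exact: measurable_cst.
apply: filterS GF => t ht.
have pres (h : Rn R n -> \bar R) : measurable_fun setT h -> (forall x, 0 <= h x)%E ->
    (\int[mu]_y h (subRn t y) = \int[mu]_y h y)%E.
  by move=> mh h0; exact: integral_subr.
rewrite /pairing -(preserving_cintegral pres (cintegrable_meas iH)) mulrC.
have iHt := preserving_cintegrable pres (msub t) iH.
rewrite -cintegralZl//.
have mK : cmeasurable (fun z => stft_dist gamma u z * expi (2 * pi * dotRn (freq z) t) *
      cwindow e (subRn (subRn t (posn z)) b)).
  apply: cmeasurableM; first apply: cmeasurableM.
  - exact: cmeasurable_stft_dist rep.
  - by apply: cmeasurable_char; [exact: measurable_freq|exact: measurable_cst].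
  - apply: (cmeasurable_comp (cmeasurable_cwindow e) (h := fun z => subRn (subRn t (posn z)) b)).
    apply: measurable_subRn; last exact: measurable_cst.
    by apply: measurable_subRn; [exact: measurable_cst|exact: measurable_posn].
rewrite cintegral_phase; last first.
  apply: cintegrable_le mK _ iV => z.
  rewrite !Normc.normcM normc_expi mulr1 normc_real ger0_norm ?window_ge0// lee_fin.
  by rewrite ler_piMr ?normc_ge0// window_le1// ltW.
apply: ae_eq_cintegral.
- exact: cintegrable_meas (cintegrableZl _ iHt).
- apply: (@cmeasurable_cintegral _ _ _ _ _ mu (fun y w => stft_dist gamma u (catRn y w) *
    expi (2 * pi * dotRn (freq (catRn y w)) t) * cwindow e (subRn (subRn t (posn (catRn y w))) b))).
  apply: (cmeasurable_comp mK (h := fun z : Rn R n * Rn R n => catRn z.1 z.2)).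
  exact: measurable_catRn.
- apply: filterS2 h1 ht => y iy E; rewrite /H mulrA -/(translation y gamma t) -/(G y t) E.
  rewrite mulrC /ifourier -cintegralZl; last exact: cintegrable_ifourier.
  by apply: eq_cintegral => w; rewrite /stft_dist posn_cat freq_cat mulrC.
Qed.

Definition window_bounded e f := exists K : R, forall s,
  (\int[mu]_t (normc (f t) * window e (subRn t s))%:E <= K%:E)%E.

Lemma cintegrable_window_bounded e f x w : 0 < e -> cmeasurable f -> window_bounded e f ->
  cintegrable mu (stft_integrand (cwindow e) f x w).
Proof.
move=> e0 mf [K hK]; apply: (cintegrable_le (h := fun t => (normc (f t) * window e (subRn t x))%:E)).
- apply: cmeasurableM; first apply: cmeasurableM => //.
    apply: cmeasurableJ; apply: (cmeasurable_comp (cmeasurable_cwindow e)).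
    by apply: measurable_subRn => //; exact: measurable_cst.
  by apply: cmeasurable_charN => //; exact: measurable_cst.
- move=> t; rewrite !Normc.normcM normc_expi mulr1 normcJ normc_real.
  by rewrite ger0_norm ?window_ge0.
- by apply: le_lt_trans (hK x) _; rewrite ltry.
Qed.

(* The short-time Fourier transform with window [phi] is controlled by the one
   with the compactly supported window, averaged with the density [Phi]. *)
Definition dominated e phi (Phi : Rn R (n + n) -> R) :=
  [/\ cmeasurable phi, measurable_fun setT Phi, forall z, 0 <= Phi z &
    forall f, cmeasurable f -> window_bounded e f ->
      (forall x w, cintegrable mu (stft_integrand phi f x w)) /\
      forall z0, ((normc (stft phi f (posn z0) (freq z0)))%:E <=
        \int[mu2]_z (Phi z * normc (stft (cwindow e) f (posn (addRn z0 z)) (freq (addRn z0 z))))%:E)%E].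

(** Inserting the reproducing formula for the window into the short-time transform of [f] gives an
    integral over [z] of transforms of [f] with the tent window, at the point displaced by [z] and
    by [b] in position, with coefficient [stft_dist gamma u z] up to conjugation and phase. The
    shift by [b] is moved into the density. *)
Lemma represents_dominated gamma u phi e b :
  schwartz gamma -> represents phi u -> 0 < e -> pairing e b gamma != 0 ->
  (\int[mu2]_z (normc (stft_dist gamma u z))%:E < +oo)%E ->
  dominated e phi (fun z => (normc (pairing e b gamma))^-1 *
    normc (stft_dist gamma u (subRn z (catRn b (cstRn n 0))))).
Proof.
move=> sg rep e0 c0 iV; have [mphi _] := rep; have mV := cmeasurable_stft_dist sg rep.
set c := pairing e b gamma in c0 *; set B := catRn b _.
have nc : 0 < normc c.
  by rewrite lt_neqAle normc_ge0 andbT eq_sym; apply: contra c0 => /eqP/Normc.eq0_normc ->.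
have msub m (y : Rn R m) : measurable_fun setT (fun t : Rn R m => subRn t y).
  by apply: measurable_subRn => //; exact: measurable_cst.
have mPhi : measurable_fun setT (fun z => (normc c)^-1 * normc (stft_dist gamma u (subRn z B))).
  apply: measurable_funM => //; apply: measurable_normc.
  by apply: (cmeasurable_comp mV); exact: msub.
split=> // [z|f mf fK]; first by rewrite mulr_ge0 ?normc_ge0// invr_ge0 ltW.
have rpr := reproducing b sg rep e0 iV; rewrite -/c in rpr.
pose L x w t z := f t * conjc (stft_dist gamma u z) * expi (- (2 * pi * dotRn (freq z) (subRn t x))) *
  cwindow e (subRn (subRn (subRn t x) (posn z)) b) * expi (- (2 * pi * dotRn w t)).
have subE t x z : subRn (subRn (subRn t x) (posn z)) b = subRn t (addRn (addRn x (posn z)) b).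
  by apply: coord_ext => i; rewrite !coord_sub !coord_add !opprD !addrA.
have LE x w t z : L x w t z = conjc (stft_dist gamma u z) * expi (2 * pi * dotRn (freq z) x) *
    stft_integrand (cwindow e) f (addRn (addRn x (posn z)) b) (addRn w (freq z)) t.
  rewrite /L /stft_integrand subE dotRn_sub.
  rewrite (_ : - (2 * pi * (dotRn (freq z) t - dotRn (freq z) x)) =
    2 * pi * dotRn (freq z) x - 2 * pi * dotRn (freq z) t); last by ring.
  rewrite (_ : - (2 * pi * dotRn (addRn w (freq z)) t) =
    - (2 * pi * dotRn (freq z) t) + - (2 * pi * dotRn w t)); last first.
    rewrite /dotRn -opprD -mulrDr -big_split/=; congr (- (_ * _)).
    by apply: eq_bigr => i _; rewrite coord_add mulrDl addrC.
  rewrite !expiD /cwindow conjc_real; ring.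
have nL x w t z : normc (L x w t z) = normc (stft_dist gamma u z) *
    (normc (f t) * window e (subRn t (addRn (addRn x (posn z)) b))).
  rewrite /L subE !Normc.normcM !normc_expi !mulr1 normcJ normc_real ger0_norm ?window_ge0//.
  by rewrite [X in X * _]mulrC mulrA.
have mL x w : cmeasurable (fun q : Rn R n * Rn R (n + n) => L x w q.1 q.2).
  have mp : measurable_fun setT (fun q : Rn R n * Rn R (n + n) => posn q.2).
    by apply: measurableT_comp => //; exact: measurable_posn.
  have mq : measurable_fun setT (fun q : Rn R n * Rn R (n + n) => freq q.2).
    by apply: measurableT_comp => //; exact: measurable_freq.
  have m1 : measurable_fun setT (fun q : Rn R n * Rn R (n + n) => subRn q.1 x).
    by apply: measurable_subRn => //; exact: measurable_cst.
  apply: cmeasurableM;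
    first (apply: cmeasurableM; first (apply: cmeasurableM; first apply: cmeasurableM)).
  - exact: (cmeasurable_comp mf).
  - by apply: cmeasurableJ; exact: (cmeasurable_comp mV).
  - exact: cmeasurable_charN.
  - apply: (cmeasurable_comp (cmeasurable_cwindow e)
      (h := fun q : Rn R n * Rn R (n + n) => subRn (subRn (subRn q.1 x) (posn q.2)) b)).
    apply: measurable_subRn; last exact: measurable_cst.
    exact: measurable_subRn.
  - by apply: cmeasurable_charN => //; exact: measurable_cst.
have fK' := fK; have [K hK] := fK'.
have K0 : 0 <= K.
  rewrite -lee_fin; apply: le_trans (hK b); apply: integral_geEFin0 => t.
  by rewrite mulr_ge0 ?normc_ge0 ?window_ge0.
have mfw s : measurable_fun setT (fun t => normc (f t) * window e (subRn t s)).
  apply: measurable_funM; first exact: measurable_normc.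
  exact: (measurableT_comp (measurable_window e) (msub _ s)).
have fw0 s t : 0 <= normc (f t) * window e (subRn t s).
  by rewrite mulr_ge0 ?normc_ge0 ?window_ge0.
have iL x w : (\int[mu]_t \int[mu2]_z (normc (L x w t z))%:E < +oo)%E.
  rewrite (@integral_swap _ _ _ _ _ mu mu2 (fun t z => (normc (L x w t z))%:E)); last 2 first.
  - exact: measurable_normcE.
  - by move=> t z; rewrite lee_fin normc_ge0.
  apply: (@le_lt_trans _ _ (\int[mu2]_z (K * normc (stft_dist gamma u z))%:E)%E).
    apply: ge0_le_integralT => z; first by apply: integral_geEFin0 => t; exact: normc_ge0.
    under eq_integral do rewrite nL.
    rewrite ge0_integralZlR ?normc_ge0// mulrC EFinM.
    by rewrite lee_wpmul2l ?lee_fin ?normc_ge0.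
  rewrite ge0_integralZlR//; last 2 first.
  - exact: measurable_normc.
  - by move=> z; exact: normc_ge0.
  by apply: lte_mul_pinfty.
have mI x w : cmeasurable (stft_integrand phi f x w).
  apply: cmeasurableM; first apply: cmeasurableM => //.
    by apply: cmeasurableJ; exact: (cmeasurable_comp mphi (msub _ x)).
  by apply: cmeasurable_charN => //; exact: measurable_cst.
have ae_rep x w : {ae mu, forall t, (conjc c)^-1 * cintegral mu2 (L x w t) = stft_integrand phi f x w t}.
  have : {ae mu, forall t, c * phi (subRn t x) =
      cintegral mu2 (fun z => stft_dist gamma u z * expi (2 * pi * dotRn (freq z) (subRn t x)) *
      cwindow e (subRn (subRn (subRn t x) (posn z)) b))}.
    by apply: (preserving_ae (phi := fun t => subRn t x) _ (msub _ x) rpr) => H mH H0;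
      exact: integral_subl.
  have iLt := ae_cintegrable_curry (mL x w) (iL x w).
  apply: filterS2 iLt => t it Et.
  (* Conjugation passes through an integral only if the integrand is integrable. What is known
     integrable carries the factor [f t], which can be divided out only where it is nonzero. *)
  have [ft0|ft0] := eqVneq (f t) 0.
    rewrite /stft_integrand ft0 !mul0r (_ : cintegral _ _ = 0) ?mulr0//.
    transitivity (cintegral mu2 (fun z => 0 : R[i])).
      by apply: eq_cintegral => z; rewrite /L ft0 !mul0r.
    by apply: complex_eq; rewrite /= /Rintegral integral0.
  set K' := fun z => _ in Et.
  have EL z : L x w t z = f t * expi (- (2 * pi * dotRn w t)) * conjc (K' z).
    by rewrite /L /K' !conjcM conjc_expi /cwindow conjc_real; ring.
  have e1 : f t * expi (- (2 * pi * dotRn w t)) != 0.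
    apply: mulf_neq0 => //; apply/eqP => /(congr1 (@Normc.normc R)).
    by rewrite normc_expi Normc.normc0 => /eqP; rewrite oner_eq0.
  have iK' : cintegrable mu2 K'.
    have := cintegrableJ (cintegrableZl (f t * expi (- (2 * pi * dotRn w t)))^-1 it).
    congr (cintegrable _ _); apply/funext => z; rewrite EL mulKf//.
    by case: (K' z) => ? ?; rewrite /= opprK.
  rewrite (eq_cintegral _ EL) cintegralZl; last exact: cintegrableJ.
  rewrite cintegralJ// -Et conjcM /stft_integrand.
  have cc0 : conjc c != 0.
    by apply: contra c0 => /eqP h; apply/eqP/Normc.eq0_normc; rewrite -normcJ h Normc.normc0.
  by rewrite mulrCA mulKf// mulrAC.
have iM x w := cintegrable_cintegral (mL x w) (iL x w).
split=> [x w|z0].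
  exact: ae_eq_cintegrable (mI x w) (cintegrableZl _ (iM x w)) (ae_rep x w).
set x := posn z0; set w := freq z0.
have -> : stft phi f x w = (conjc c)^-1 * cintegral mu2 (fun z => cintegral mu (L x w ^~ z)).
  rewrite -(cintegral_swap (mL x w) (iL x w)) -cintegralZl//; apply: ae_eq_cintegral => //.
  - exact: cintegrable_meas (cintegrableZl _ (iM x w)).
  - by apply: filterS (ae_rep x w).
have iLs : (\int[mu2]_z \int[mu]_t (normc (L x w t z))%:E < +oo)%E.
  rewrite -(@integral_swap _ _ _ _ _ mu mu2 (fun t z => (normc (L x w t z))%:E))//.
    exact: measurable_normcE.
  by move=> t z; rewrite lee_fin normc_ge0.
have nI z : normc (cintegral mu (L x w ^~ z)) = normc (stft_dist gamma u z) *
    normc (stft (cwindow e) f (addRn (addRn x (posn z)) b) (addRn w (freq z))).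
  rewrite (eq_cintegral _ (fun t => LE x w t z)) cintegralZl; last exact: cintegrable_window_bounded.
  by rewrite !Normc.normcM normc_expi mulr1 normcJ.
have ncJ : normc (conjc c)^-1 = (normc c)^-1.
  apply: (mulIf (x := normc c)); first by rewrite gt_eqF.
  rewrite [RHS]mulVf ?gt_eqF// -[normc c]normcJ -Normc.normcM mulVf ?Normc.normc1//.
  by apply: contra c0 => /eqP h; apply/eqP/Normc.eq0_normc; rewrite -normcJ h Normc.normc0.
rewrite Normc.normcM ncJ EFinM.
have mS : cmeasurable (fun z => stft (cwindow e) f (posn (addRn z0 z)) (freq (addRn z0 z))).
  apply: (cmeasurable_comp (cmeasurable_stft_at (cmeasurable_cwindow e) mf)).
  by apply: measurable_addRn => //; exact: measurable_cst.
(* Substituting [z + B] undoes the shift inside the density and makes the displacement by [b]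
   explicit in the transform of [f]. *)
rewrite -[leRHS](integral_addl _ _ B); last 2 first.
- by apply/measurable_EFinP; apply: measurable_funM => //; exact: measurable_normc.
- by move=> z; rewrite lee_fin mulr_ge0 ?normc_ge0// mulr_ge0 ?normc_ge0// invr_ge0 ltW.
have -> : (\int[mu2]_z ((normc c)^-1 * normc (stft_dist gamma u (subRn (addRn z B) B)) *
     normc (stft (cwindow e) f (posn (addRn z0 (addRn z B))) (freq (addRn z0 (addRn z B)))))%:E =
   \int[mu2]_z ((normc c)^-1 * normc (cintegral mu (L x w ^~ z)))%:E)%E.
  apply: eq_integral => z _; congr EFin; rewrite nI mulrA.
  rewrite (_ : subRn (addRn z B) B = z); last first.
    by apply: coord_ext => i; rewrite coord_sub coord_add addrK.
  have -> : posn (addRn z0 (addRn z B)) = addRn (addRn x (posn z)) b.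
    apply: coord_ext => i; rewrite coord_posn !coord_add !coord_posn.
    by rewrite /B coord_catl addrA.
  have -> // : freq (addRn z0 (addRn z B)) = addRn w (freq z).
  apply: coord_ext => i; rewrite coord_freq !coord_add !coord_freq.
  by rewrite /B coord_catr coord_cst addr0.
have mcI : cmeasurable (fun z => cintegral mu (L x w ^~ z)).
  exact: (@cmeasurable_cintegral _ _ _ _ _ mu (fun z t => L x w t z) (cmeasurable_flip (mL x w))).
rewrite ge0_integralZlR//; last 3 first.
- by rewrite invr_ge0 ltW.
- exact: measurable_normc.
- by move=> z; exact: normc_ge0.
apply: lee_wpmul2l; first by rewrite lee_fin invr_ge0 ltW.
apply: normc_cintegral.
exact: (@cintegrable_cintegral _ _ _ _ _ mu2 mu (fun z t => L x w t z) (cmeasurable_flip (mL x w)) iLs).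
Qed.

End reproducing_formula.

(** * Jensen, Hoelder and Hausdorff-Young inequalities *)

Section real_powers.
Context {R : realType}.
Implicit Types a b c r x y : R.

Lemma powR_le r a b : 0 <= r -> 0 <= a -> a <= b -> a `^ r <= b `^ r.
Proof. by move=> r0 a0 ab; rewrite ge0_ler_powR ?nnegrE// (le_trans a0). Qed.

Lemma powRK r a : r != 0 -> 0 <= a -> (a `^ r^-1) `^ r = a.
Proof. by move=> r0 a0; rewrite -powRrM mulVf// powRr1. Qed.

Lemma powRVK r a : r != 0 -> 0 <= a -> (a `^ r) `^ r^-1 = a.
Proof. by move=> r0 a0; rewrite -powRrM mulfV// powRr1. Qed.

Lemma measurable_funPR d (T : measurableType d) (f : T -> R) r :
  measurable_fun setT f -> measurable_fun setT (fun t => f t `^ r).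
Proof. by move=> mf; exact: (measurableT_comp (measurable_powR r) mf). Qed.

Lemma le_add_scaled_powR r c x : 1 <= r -> 0 < c -> 0 <= x -> x <= c + c * (x / c) `^ r.
Proof.
move=> r1 c0 x0; have [xc|cx] := lerP x c.
  by rewrite (le_trans xc)// lerDl mulr_ge0 ?powR_ge0// ltW.
have h : x / c <= (x / c) `^ r by rewrite le1r_powR// ler_pdivlMr// mul1r ltW.
have xE : c * (x / c) = x by rewrite mulrC divfK// gt_eqF.
by have := ler_wpM2l (ltW c0) h; rewrite xE; lra.
Qed.

Lemma powR_div r x c : 0 <= x -> 0 < c -> (x / c) `^ r = x `^ r / c `^ r.
Proof.
move=> x0 c0; rewrite powRM ?invr_ge0 ?(ltW c0)//; congr (_ * _).
by rewrite -(powR_inv1 (ltW c0)) -powRrM mulN1r powRN.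
Qed.

(** With [M] the right-hand side, each factor is at most [M ^ e_i]; hence the product is at most [M]
    raised to the sum of the exponents, which is at most [M] when [M <= 1]. An exponent [e_i = 0]
    stands for a supremum norm and contributes the bound 1, and the sum of the [e_i] may exceed
    1. *)
Lemma holder3 (e x : 'I_3 -> R) : (forall i, 0 <= e i) -> 1 <= \sum_i e i ->
  (forall i, 0 <= x i <= 1) ->
  \prod_i x i <= \sum_(i | 0 < e i) x i `^ (e i)^-1.
Proof.
move=> e0 e1 x01; set M := \sum_(i | _) _.
have M0 : 0 <= M by apply: sumr_ge0 => i _; exact: powR_ge0.
have p1 : \prod_i x i <= 1 by apply: prodr_ile1 => i _; exact: x01.
have [M1|M1] := lerP 1 M; first exact: le_trans M1.
have xM i : x i <= M `^ e i.
  have [->|ei] := eqVneq (e i) 0; first by rewrite powRr0; have /andP[] := x01 i.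
  have ei0 : 0 < e i by rewrite lt_neqAle eq_sym ei e0.
  have /andP[xi0 _] := x01 i; rewrite -[leLHS](powRK (r := e i))//.
  apply: powR_le => //; first exact: powR_ge0.
  by rewrite /M (bigD1 i)//= lerDl sumr_ge0// => j _; exact: powR_ge0.
have [M00|M00] := eqVneq M 0.
  have [i ei0] : exists i, 0 < e i.
    apply/not_existsP => h; move: e1; rewrite big1 ?ler10// => i _.
    by apply/eqP; rewrite eq_le e0 andbT leNgt; apply/negP/h.
  have := xM i; rewrite M00 powR0 ?gt_eqF// => xi0.
  rewrite (bigD1 i)//= (_ : x i = 0) ?mul0r//.
  by apply/eqP; rewrite eq_le xi0; have /andP[] := x01 i.
have Mp : 0 < M by rewrite lt_neqAle eq_sym M00.
apply: (@le_trans _ _ (\prod_i M `^ e i)).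
  by apply: ler_prod => i _; rewrite xM andbT; have /andP[] := x01 i.
rewrite !big_ord_recl big_ord0 mulr1 -!powRD ?M00 ?implybT//.
rewrite -[leRHS]powRr1//; apply: ger_powR; first by rewrite Mp ltW.
by move: e1; rewrite !big_ord_recl big_ord0 addr0.
Qed.

End real_powers.

Section weak_jensen.
Context d (T : measurableType d) (R : realType).
Variable mu : {measure set T -> \bar R}.
Variables (Phi psi : T -> R).
Hypotheses (mPhi : measurable_fun setT Phi) (Phi0 : forall x, 0 <= Phi x).
Hypotheses (mpsi : measurable_fun setT psi) (psi0 : forall x, 0 <= psi x).

(* From x <= Y + Y (x / Y) ^ s, which costs a factor 2 over Jensen's inequality. *)
Lemma weak_jensen (m Y s : R) : 1 <= s -> 0 < Y -> 0 <= m ->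
  (\int[mu]_x (Phi x)%:E <= m%:E)%E ->
  (\int[mu]_x (Phi x * psi x `^ s)%:E <= (m * Y `^ s)%:E)%E ->
  (\int[mu]_x (Phi x * psi x)%:E <= (2 * m * Y)%:E)%E.
Proof.
move=> s1 Y0 m0 im is'; have mps := measurable_funPR s mpsi.
pose C := Y / Y `^ s; have C0 : 0 <= C by rewrite divr_ge0 ?powR_ge0// ltW.
have key x : Phi x * psi x <= Y * Phi x + C * (Phi x * psi x `^ s).
  rewrite mulrCA -[Y * _]mulrC -mulrDr ler_wpM2l//.
  rewrite (le_trans (le_add_scaled_powR s1 Y0 (psi0 x)))// lerD2l /C.
  by rewrite powR_div// le_eqVlt; apply/orP; left; apply/eqP; ring.
apply: (@le_trans _ _ (\int[mu]_x (Y * Phi x + C * (Phi x * psi x `^ s))%:E)%E).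
  by apply: ge0_le_integralR => // x; rewrite mulr_ge0.
rewrite ge0_integralDR; last 4 first.
- exact: measurable_funM.
- by apply: measurable_funM => //; exact: measurable_funM.
- by move=> x; rewrite mulr_ge0// ltW.
- by move=> x; apply: mulr_ge0 => //; rewrite mulr_ge0 ?powR_ge0.
rewrite !ge0_integralZlR ?(ltW Y0)//; last 2 first.
- exact: measurable_funM.
- by move=> x; rewrite mulr_ge0 ?powR_ge0.
apply: (@le_trans _ _ (Y%:E * m%:E + C%:E * (m * Y `^ s)%:E)%E).
  by apply: leeD; apply: lee_wpmul2l => //; rewrite lee_fin// ltW.
rewrite -!EFinM -EFinD lee_fin /C (_ : Y / Y `^ s * (m * Y `^ s) = Y * m); first by lra.
by rewrite mulrCA -mulrA mulVf ?gt_eqF ?powR_gt0// mulr1 mulrC.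
Qed.

Lemma weak_jensen_powR (m s I : R) : 1 <= s -> 0 < m -> 0 <= I ->
  (\int[mu]_x (Phi x)%:E <= m%:E)%E ->
  (I%:E <= \int[mu]_x (Phi x * psi x)%:E)%E ->
  ((I `^ s)%:E <= ((2 * m) `^ s / m)%:E * \int[mu]_x (Phi x * psi x `^ s)%:E)%E.
Proof.
move=> s1 m0 I0 im iI; have s0 : s != 0 by rewrite gt_eqF// (lt_le_trans ltr01).
have c0 : 0 < (2 * m) `^ s / m by rewrite divr_gt0// powR_gt0// mulr_gt0.
have Z0 : (0 <= \int[mu]_x (Phi x * psi x `^ s)%:E)%E.
  by apply: integral_geEFin0 => x; rewrite mulr_ge0 ?powR_ge0.
case E : (\int[mu]_x (Phi x * psi x `^ s)%:E)%E Z0 => [z| |] //= Z0; last first.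
  by rewrite gt0_muley ?lte_fin// leey.
rewrite -EFinM lee_fin; rewrite lee_fin in Z0.
apply/ler_addgt0Pr => e e0.
(* Chosen with [m Y^s] equal to [z] plus a small term, which keeps [Y] positive when [z = 0] and is
   scaled to make the final error exactly [e]. *)
pose Y := ((z + m / (2 * m) `^ s * e) / m) `^ s^-1.
have q0 : 0 < (z + m / (2 * m) `^ s * e) / m.
  by rewrite divr_gt0// ltr_wpDl// mulr_gt0// divr_gt0// powR_gt0// mulr_gt0.
have Y0 : 0 < Y by rewrite powR_gt0.
have YE : m * Y `^ s = z + m / (2 * m) `^ s * e.
  by rewrite /Y powRK ?ltW// mulrC divfK// gt_eqF.
have := weak_jensen s1 Y0 (ltW m0) im; rewrite E YE lee_fin.
move=> /(_ _)/wrap[|h].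
  by rewrite lerDl ltW// mulr_gt0// divr_gt0// powR_gt0// mulr_gt0.
have := le_trans iI h; rewrite lee_fin => IY.
have := powR_le (le_trans ler01 s1) I0 IY; rewrite powRM ?mulr_ge0 ?(ltW m0) ?(ltW Y0)//.
move=> /le_trans; apply; rewrite -(ler_pM2l m0) mulrCA YE.
have k0 : 0 < (2 * m) `^ s by rewrite powR_gt0// mulr_gt0.
rewrite le_eqVlt; apply/orP; left; apply/eqP; field.
by rewrite !gt_eqF.
Qed.

End weak_jensen.

(** * The Hausdorff-Young inequality *)

Section hausdorff_young.
Context {R : realType} {n : nat}.
Notation mu := (lebesgue_Rn R n).
Implicit Types (F : Rn R n -> R[i]) (t w : Rn R n).

Lemma half_powR_lt1 (a : R) : 0 < a -> 0 < 1 - 2^-1 `^ a.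
Proof.
move=> a0; have h : 2^-1 < 1 :> R by rewrite invf_lt1// ltr1n.
have := gt0_ltr_powR a0 _ _ h; rewrite !nnegrE powR1 subr_gt0; apply => //.
Qed.

(** The powers of [min (t_j, Y)] telescope, and each decrement is at least [1 - 2^-a] times the
    summand. This sums the geometric series without locating its first term. *)
Lemma dyadic_sum (S a Y : R) (N : nat) : 0 < S -> 0 < a -> 0 <= Y ->
  \sum_(0 <= j < N) (if S / 2 ^+ j <= Y then (S / 2 ^+ j) `^ a else 0) <=
    Y `^ a / (1 - 2^-1 `^ a).
Proof.
move=> S0 a0 Y0; pose t j : R := S / 2 ^+ j.
have t0 j : 0 < t j by rewrite divr_gt0// exprn_gt0.
have q1 := half_powR_lt1 a0.
pose b j := Num.min (t j) Y `^ a.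
have tS j : t j.+1 = t j * 2^-1 by rewrite /t exprS invfM mulrA mulrAC.
have step j : (if t j <= Y then t j `^ a else 0) * (1 - 2^-1 `^ a) <= b j - b j.+1.
  have tle : t j.+1 <= t j by rewrite tS ler_piMr ?(ltW (t0 _))// invf_le1// ler1n.
  rewrite /b; case: ifPn => [tY|].
    rewrite (min_idPl tY) (min_idPl (le_trans tle tY)) mulrBr mulr1 tS.
    by rewrite powRM// ltW.
  rewrite -ltNge => Yt; rewrite mul0r subr_ge0; apply: powR_le; rewrite ?(ltW a0)//.
    by rewrite le_min Y0 andbT ltW.
  by rewrite (min_idPr (ltW Yt)) ge_min lexx orbT.
rewrite ler_pdivlMr// mulr_suml.
apply: le_trans (ler_sum _ (fun j _ => step j)) _.
rewrite (_ : \sum_(0 <= j < N) (b j - b j.+1) = b 0%N - b N); last first.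
  rewrite -[RHS]opprB -(telescope_sumr b (leq0n N)) -sumrN.
  by apply: eq_bigr => j _; rewrite opprB.
apply: le_trans (_ : b 0%N <= _); first by rewrite gerBl powR_ge0.
apply: powR_le; first exact: ltW.
  by rewrite le_min Y0 andbT ltW.
by rewrite ge_min lexx orbT.
Qed.

Lemma dyadic_level (S v : R) : 0 < v -> v <= S ->
  exists j : nat, S / 2 ^+ j.+1 < v <= S / 2 ^+ j.
Proof.
move=> v0 vS; have S0 : 0 < S := lt_le_trans v0 vS.
have ex : exists j, S / 2 ^+ j.+1 < v.
  have [m hm] : exists m : nat, S / v < m%:R.
    by exists (Num.truncn (S / v)).+1; exact: truncnS_gt.
  exists m; rewrite ltr_pdivrMr ?exprn_gt0// mulrC -ltr_pdivrMr//.
  apply: lt_trans hm _; rewrite -natrX ltr_nat.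
  by rewrite (ltn_trans (ltnSn m))// ltn_expl.
have := ex_minnP ex; case=> j hj jmin; exists j; rewrite hj /=.
case: j => [|j] in hj jmin *; first by rewrite expr0 divr1.
by rewrite leNgt; apply/negP => /jmin; rewrite ltnn.
Qed.

(* Marcinkiewicz interpolation between the trivial bound and Plancherel's: at
   height |fourier F| ~ t the large values of F are negligible. *)
Lemma hausdorff_young (rho : R) : 1 < rho -> rho <= 2 ->
  exists2 C : R, 0 < C & forall F (X : R), cintegrable mu F -> 0 <= X ->
    (\int[mu]_t (normc (F t) `^ rho)%:E <= X%:E)%E ->
    (\int[mu]_w (normc (fourier F w) `^ (rho / (rho - 1)))%:E <= (C * X `^ (rho - 1)^-1)%:E)%E.
Proof.
move=> r1 r2; have r10 : 0 < rho - 1 by rewrite subr_gt0.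
move: r2; rewrite le_eqVlt => /predU1P[->|r2].
  exists 1 => // F X iF X0 FX.
  have -> : 2 - 1 = 1 :> R by lra.
  have e1 : 2 / 1 = 2 :> R by rewrite divr1.
  rewrite e1 invr1 mul1r (powRr1 X0); apply: le_trans FX.
  under eq_integral do rewrite powR_mulrn ?normc_ge0//.
  under [in leRHS]eq_integral do rewrite powR_mulrn ?normc_ge0//.
  exact: plancherel_le.
(* The exponent [p] exceeds 2 here: two of its powers are left to Plancherel, the remaining [a] are
   counted by dyadic levels. *)
set p := rho / (rho - 1); pose a := p - 2.
have aE : a = (2 - rho) / (rho - 1) by rewrite /a /p; field; rewrite gt_eqF.
have a0 : 0 < a by rewrite aE divr_gt0// subr_gt0.
have p0 : 0 < p by rewrite divr_gt0// (lt_trans ltr01).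
have q1 := half_powR_lt1 a0.
pose C := 4 * (8 `^ a / (1 - 2^-1 `^ a)).
have C0 : 0 < C by rewrite mulr_gt0// divr_gt0// powR_gt0.
exists C => // F X iF X0 FX; have mF := cintegrable_meas iF.
have mnF := measurable_normc mF.
have Foo := cintegrable_lty iF.
have F1 : (0 <= \int[mu]_t (normc (F t))%:E)%E by apply: integral_geEFin0 => t; exact: normc_ge0.
(* An upper bound for the transform, hence the top dyadic level; adding 1 keeps it positive. *)
pose S := fine (\int[mu]_t (normc (F t))%:E)%E + 1.
have SE : (\int[mu]_t (normc (F t))%:E <= S%:E)%E.
  by rewrite /S EFinD fineK ?ge0_fin_numE// leeDl// lee_fin.
have S0 : 0 < S by rewrite /S ltr_wpDl// fine_ge0.
have hS w : normc (fourier F w) <= S.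
  by rewrite -lee_fin (le_trans (normc_fourier w iF)).
have mff : measurable_fun setT (fun w => normc (fourier F w)).
  exact/measurable_normc/cmeasurable_fourier.
have [XX0|XX0] := eqVneq X 0.
  have F0 : {ae mu, forall t, (normc (F t) `^ rho)%:E = 0%E}.
    apply: integral_eq0_ae.
    - by apply/measurable_EFinP; exact: measurable_funPR.
    - by move=> t; rewrite lee_fin powR_ge0.
    - by apply/eqP; rewrite eq_le -[X in (_ <= X)%E]/(0%:E) -XX0 FX/=
        integral_geEFin0// => t; exact: powR_ge0.
  have i0 : (\int[mu]_t (normc (F t))%:E = 0)%E.
    rewrite -[RHS](integral0 mu setT); apply: ae_eq_integral => //; first exact/measurable_EFinP.
    by apply: filterS F0 => t [/powR_eq0_eq0 ->].
  under eq_integral => w _.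
    rewrite (_ : normc (fourier F w) = 0); last first.
      apply/eqP; rewrite eq_le normc_ge0 andbT -lee_fin.
      by rewrite (le_trans (normc_fourier w iF))// i0.
    rewrite powR0 ?gt_eqF//.
    over.
  by rewrite integral0 lee_fin mulr_ge0 ?powR_ge0 ?ltW.
have Xp : 0 < X by rewrite lt_neqAle eq_sym XX0.
pose t_ (j : nat) : R := S / 2 ^+ j.
have t0 j : 0 < t_ j by rewrite divr_gt0// exprn_gt0.
(* Off [B j] one has [|F| <= t_j / (8 X) * |F|^rho], so the discarded part has L^1 norm, and hence
   transform, at most [t_j / 8]. *)
pose B j : set (Rn R n) := [set t | t_ j * normc (F t) `^ (rho - 1) <= 8 * X].
have mB j : measurable (B j).
  rewrite -[B j]setTI; apply: measurable_fun_le => //.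
  by apply: measurable_funM => //; exact: measurable_funPR.
pose f_ j t := (\1_(B j) t)%:C%C * F t.
have nf j t : normc (f_ j t) = \1_(B j) t * normc (F t).
  by rewrite Normc.normcM normc_indic.
have if_ j : cintegrable mu (f_ j).
  apply: (cintegrable_le (h := fun t => (normc (F t))%:E)) => //.
    by apply: cmeasurableM => //; exact: cmeasurable_indic.
  by move=> t; rewrite nf lee_fin ler_piMl ?normc_ge0// indic_le1.
have far j w : normc (fourier F w) <= normc (fourier (f_ j) w) + t_ j / 8.
  pose g t := F t + (-1) * f_ j t.
  have ig : cintegrable mu g by apply: cintegrableD => //; exact: cintegrableZl.
  have -> : fourier F w = fourier (f_ j) w + fourier g w.
    rewrite /fourier -cintegralD; [|exact: cintegrable_fourier..].
    by apply: eq_cintegral => t; rewrite /g; ring.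
  apply: le_trans (le_normcD _ _) _; rewrite lerD2l -lee_fin.
  apply: le_trans (normc_fourier w ig) _.
  apply: (@le_trans _ _ (\int[mu]_t (t_ j / 8 / X * normc (F t) `^ rho)%:E)%E).
    apply: ge0_le_integralR => t; first exact: normc_ge0.
    rewrite /g /f_ indicE; case: (boolP (t \in B j)) => [|/negP tB].
      by rewrite mul1r mulN1r subrr Normc.normc0 mulr_ge0 ?powR_ge0// !divr_ge0// ltW.
    have : 8 * X < t_ j * normc (F t) `^ (rho - 1).
      by rewrite ltNge; apply/negP => h; apply: tB; rewrite inE.
    move=> h; rewrite mul0r mulr0 addr0 -(mulr_powRB1 (normc_ge0 _) (lt_trans ltr01 r1)).
    rewrite mulrCA -[leLHS]mulr1 ler_wpM2l ?normc_ge0//.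
    rewrite (_ : t_ j / 8 / X * _ = t_ j * normc (F t) `^ (rho - 1) / (8 * X)); last first.
      by field; rewrite gt_eqF.
    by rewrite ler_pdivlMr ?mulr_gt0// mul1r ltW.
  rewrite ge0_integralZlR; last 3 first.
  - by rewrite !divr_ge0// ltW.
  - exact: measurable_funPR.
  - by move=> t; exact: powR_ge0.
  apply: (@le_trans _ _ ((t_ j / 8 / X)%:E * X%:E)%E).
    by apply: lee_wpmul2l => //; rewrite lee_fin !divr_ge0// ltW.
  by rewrite -EFinM divfK// gt_eqF.
pose u j w := t_ j `^ a * normc (fourier (f_ j) w) ^+ 2.
have u0 j w : 0 <= u j w by rewrite mulr_ge0 ?powR_ge0 ?sqr_ge0.
have mu_ j : measurable_fun setT (fun w => (u j w)%:E).
  apply/measurable_EFinP; apply: measurable_funM => //; apply: measurable_funX.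
  exact/measurable_normc/cmeasurable_fourier/cintegrable_meas/if_.
(* At the level with [t_j / 2 < v <= t_j] the discarded part contributes less than [v / 4], so the
   transform of [f_ j] is at least [v / 2]. Squaring gives the factor 4. *)
have low w : ((normc (fourier F w) `^ p)%:E <= 4%:E * \sum_(0 <= j <oo) (u j w)%:E)%E.
  set v := normc (fourier F w).
  have [->|v0] := eqVneq v 0.
    rewrite powR0 ?gt_eqF// mule_ge0// nneseries_ge0// => j _ _.
    by rewrite lee_fin.
  have vp : 0 < v by rewrite lt_neqAle eq_sym v0 normc_ge0.
  have [j /andP[j1 j2]] := dyadic_level vp (hS w).
  apply: (@le_trans _ _ (4%:E * (u j w)%:E)%E); last first.
    apply: lee_wpmul2l => //.
    apply: le_trans (nneseries_lim_ge j.+1 _); last by move=> k _ _; rewrite lee_fin.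
    rewrite big_nat_recr//= leeDr// sume_ge0// => k _; by rewrite lee_fin.
  rewrite -EFinM lee_fin (_ : p = a + 2); last by rewrite /a subrK.
  rewrite powRD ?v0 ?implybT// mulrCA (powR_mulrn 2 (ltW vp)).
  have vt : v <= t_ j by [].
  apply: ler_pM; rewrite ?powR_ge0 ?sqr_ge0//; first by apply: powR_le => //; exact: ltW.
  have l1 : v <= 2 * normc (fourier (f_ j) w).
    have := far j w; rewrite -/v.
    move: j1; rewrite exprS invfM mulrCA => j1.
    have : t_ j < 2 * v by rewrite /t_; lra.
    by move=> *; lra.
  have := @lerXn2r _ 2 v (2 * normc (fourier (f_ j) w)).
  rewrite !nnegrE (ltW vp) mulr_ge0 ?normc_ge0// => /(_ isT isT l1).
  by rewrite exprMn; lra.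
apply: (@le_trans _ _ (\int[mu]_w (4%:E * \sum_(0 <= j <oo) (u j w)%:E))%E).
  by apply: ge0_le_integralT => // w; rewrite lee_fin powR_ge0.
have msum : measurable_fun setT (fun w => \sum_(0 <= j <oo) (u j w)%:E)%E.
  by apply: ge0_emeasurable_sum => // j w _ _; rewrite lee_fin.
rewrite ge0_integralZl//; last first.
  by move=> w _; apply: nneseries_ge0 => j _ _; rewrite lee_fin.
rewrite integral_nneseries//; last by move=> j w _; rewrite lee_fin.
pose U j t := t_ j `^ a * normc (f_ j t) ^+ 2.
have U0 j t : 0 <= U j t by rewrite mulr_ge0 ?powR_ge0 ?sqr_ge0.
have mU j : measurable_fun setT (fun t => (U j t)%:E).
  apply/measurable_EFinP; apply: measurable_funM => //; apply: measurable_funX.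
  exact/measurable_normc/cintegrable_meas/if_.
apply: (@le_trans _ _ (4%:E * \sum_(0 <= j <oo) (\int[mu]_t (U j t)%:E))%E).
  apply: lee_wpmul2l => //; apply: lee_nneseries => j _.
    by move=> _; apply: integral_geEFin0 => w.
  rewrite !ge0_integralZlR ?powR_ge0//; last 4 first.
  - apply: measurable_funX; exact/measurable_normc/cintegrable_meas/if_.
  - by move=> t; exact: sqr_ge0.
  - apply: measurable_funX; exact/measurable_normc/cmeasurable_fourier/cintegrable_meas/if_.
  - by move=> t; exact: sqr_ge0.
  apply: lee_wpmul2l; first by rewrite lee_fin powR_ge0.
  exact: plancherel_le.
rewrite -integral_nneseries//; last by move=> j w _; rewrite lee_fin.
(* Once Plancherel has removed the transform, for fixed [t] only the levels with
   [t_j <= 8 X / |F t|^(rho - 1)] remain, and their powers sum geometrically to [D * |F t|^rho]. *)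
pose D := (8 * X) `^ a / (1 - 2^-1 `^ a).
have D0 : 0 <= D by rewrite divr_ge0 ?powR_ge0// ltW.
apply: (@le_trans _ _ (4%:E * \int[mu]_t (D * normc (F t) `^ rho)%:E)%E).
  apply: lee_wpmul2l => //; apply: ge0_le_integralT => t.
    by apply: nneseries_ge0 => j _ _; rewrite lee_fin.
  apply: lime_le; first by apply: is_cvg_nneseries => j _ _; rewrite lee_fin.
  apply: nearW => N; rewrite sumEFin lee_fin.
  have [F0|F0] := eqVneq (normc (F t)) 0.
    rewrite big1 => [|j _]; first by apply: mulr_ge0 => //; exact: powR_ge0.
    by rewrite /U nf F0 mulr0 expr0n/= mulr0.
  have Fp : 0 < normc (F t) by rewrite lt_neqAle eq_sym F0 normc_ge0.
  have Fr : 0 < normc (F t) `^ (rho - 1) by rewrite powR_gt0.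
  pose Y := 8 * X / normc (F t) `^ (rho - 1).
  have Y0 : 0 <= Y by rewrite divr_ge0 ?powR_ge0// mulr_ge0// ltW.
  have UE j : U j t = (if S / 2 ^+ j <= Y then (S / 2 ^+ j) `^ a else 0) * normc (F t) ^+ 2.
    rewrite /U nf indicE (_ : (t \in B j) = (S / 2 ^+ j <= Y)).
      by case: ifP => _; rewrite ?mul1r// mul0r expr0n/= !mulr0 mul0r.
    by rewrite /Y ler_pdivlMr//; apply/asboolP/idP.
  under eq_bigr do rewrite UE.
  rewrite -mulr_suml; apply: le_trans (ler_wpM2r (sqr_ge0 _) (dyadic_sum N S0 a0 Y0)) _.
  rewrite le_eqVlt; apply/orP; left; apply/eqP.
  rewrite /D /Y powR_div ?mulr_ge0// ?(ltW Xp)//.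
  have : normc (F t) ^+ 2 = normc (F t) `^ rho * (normc (F t) `^ (rho - 1)) `^ a.
    rewrite -powRrM -powRD ?F0 ?implybT// -powR_mulrn ?normc_ge0//; congr (_ `^ _).
    by rewrite aE; field; rewrite gt_eqF.
  move=> ->; have := powR_gt0 a Fr => k; field.
  by rewrite !gt_eqF.
rewrite ge0_integralZlR//; last 2 first.
- exact: measurable_funPR.
- by move=> t; exact: powR_ge0.
apply: (@le_trans _ _ (4%:E * (D%:E * X%:E))%E).
  by apply: lee_wpmul2l => //; apply: lee_wpmul2l.
rewrite -!EFinM lee_fin /D powRM ?(ltW Xp)// le_eqVlt; apply/orP; left; apply/eqP.
have -> : X `^ (rho - 1)^-1 = X `^ a * X.
  rewrite -[X in _ * X](powRr1 X0) -powRD ?XX0 ?implybT//; congr (_ `^ _).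
  by rewrite aE; field; rewrite gt_eqF.
by rewrite /C; ring.
Qed.

End hausdorff_young.

(** * The trilinear estimate *)

Section proximity.
Context {R : realType} {n : nat}.
Notation mu := (lebesgue_Rn R n).
Implicit Types (f : Rn R n -> R[i]) (t s u x y : Rn R n) (L rho : R).

Definition near L t s : bool := [forall i, `|coord t i - coord s i| <= L].

Definition ball_ind L t s : R := (near L t s)%:R.

Lemma nearP L t s : reflect (forall i, `|coord t i - coord s i| <= L) (near L t s).
Proof. exact: forallP. Qed.

Lemma nearC L t s : near L t s = near L s t.
Proof. by apply: eq_forallb => i; rewrite distrC. Qed.

Lemma near_trans L L' t s u : near L t s -> near L' s u -> near (L + L') t u.
Proof.
move=> /nearP h /nearP h'; apply/nearP => i.
by rewrite (le_trans (ler_distD (coord s i) _ _))// lerD.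
Qed.

Lemma same_cube_near t s : floorRn t = floorRn s -> near 1 t s.
Proof. by move=> ts; apply/nearP => i; exact: floor_eq_dist. Qed.

Lemma ball_ind_ge0 L t s : 0 <= ball_ind L t s. Proof. by []. Qed.

Lemma ball_ind_le1 L t s : ball_ind L t s <= 1.
Proof. by rewrite /ball_ind; case: near. Qed.

Lemma ball_indE L t s :
  ball_ind L t s = \prod_(i < n) \1_(`[- L, L]%classic) (coord t i - coord s i).
Proof.
have E i : \1_(`[- L, L]%classic) (coord t i - coord s i) =
    (`|coord t i - coord s i| <= L)%R%:R :> R.
  rewrite indicE; congr (nat_of_bool _)%:R.
  by apply/asboolP/idP; rewrite /= in_itv/= ler_norml.
rewrite /ball_ind; case: (boolP (near L t s)) => [/nearP h|].
  by rewrite big1// => i _; rewrite E h.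
rewrite negb_forall => /existsP[i hi].
by rewrite (bigD1 i)//= E (negbTE hi) mul0r.
Qed.

Lemma measurable_ball_ind d (T : measurableType d) L (g h : T -> Rn R n) :
  measurable_fun setT g -> measurable_fun setT h ->
  measurable_fun setT (fun z => ball_ind L (g z) (h z)).
Proof.
move=> mg mh; under eq_fun do rewrite ball_indE.
have mI : measurable_fun setT (fun y : measurableTypeR R => \1_(`[- L, L]%classic) y : R).
  exact: measurable_indic.
apply: measurable_prod => i _; apply: (measurableT_comp mI).
by apply: measurable_funB; apply: (measurableT_comp (measurable_coord i)).
Qed.

Lemma integral_ball L s : 0 <= L -> (\int[mu]_t (ball_ind L t s)%:E = ((2 * L) ^+ n)%:E)%E.
Proof.
move=> L0; under eq_integral do rewrite ball_indE.
rewrite (integral_tensor (f := fun (i : 'I_n) (x : measurableTypeR R) =>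
  \1_(`[- L, L]%classic) (x - coord s i)) (c := fun=> 2 * L)).
- by rewrite prodr_const card_ord.
- have mI : measurable_fun setT (fun y : measurableTypeR R => \1_(`[- L, L]%classic) y : R).
    exact: measurable_indic.
  move=> i; apply: (measurableT_comp mI).
  exact: measurable_funB.
- by move=> i x; rewrite indicE.
- move=> i; transitivity (\int[leb]_x (\1_(`[- L, L]%classic) (1 * x + - coord s i))%:E)%E.
    by apply: eq_integral => x _; rewrite mul1r.
  rewrite (@integral_affine R 1 (- coord s i)
    (fun x : measurableTypeR R => (\1_(`[- L, L]%classic) x)%:E)); last 3 first.
  + by left.
  + by apply/measurable_EFinP; exact: measurable_indic.
  + by move=> x; rewrite lee_fin indicE.
  rewrite integral_indic// setIT [LHS]lebesgue_measure_itv/= lte_fin.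
  case: ltP => [_|]; first by rewrite -EFinD; congr EFin; lra.
  by move=> h; congr EFin; lra.
Qed.

Definition local_mass rho L f s : \bar R :=
  (\int[mu]_t (ball_ind L t s * normc (f t) `^ rho)%:E)%E.

Lemma local_mass_ge0 rho L f s : (0 <= local_mass rho L f s)%E.
Proof.
by apply: integral_geEFin0 => t; rewrite mulr_ge0 ?powR_ge0 ?ball_ind_ge0.
Qed.

Lemma measurable_local_mass rho L f : cmeasurable f ->
  measurable_fun setT (local_mass rho L f).
Proof.
move=> mf; apply: (@measurable_integral _ _ _ _ _ mu (fun s t =>
  (ball_ind L t s * normc (f t) `^ rho)%:E)) => [|s t].
  apply/measurable_EFinP; apply: measurable_funM.
    exact: measurable_ball_ind.
  apply: measurable_funPR; apply: (measurableT_comp (measurable_normc mf)).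
  exact: measurable_snd.
by rewrite lee_fin mulr_ge0 ?powR_ge0 ?ball_ind_ge0.
Qed.

Definition locally_bounded rho f :=
  cmeasurable f /\ exists K : R, forall s, (local_mass rho 2 f s <= K%:E)%E.

Definition psi rho f s : R := fine (local_mass rho 2 f s) `^ rho^-1.

Lemma psi_ge0 rho f s : 0 <= psi rho f s. Proof. exact: powR_ge0. Qed.

Lemma measurable_psi rho f : cmeasurable f -> measurable_fun setT (psi rho f).
Proof.
move=> mf; apply: measurable_funPR; apply: (measurableT_comp (f := fine)) => //.
exact: measurable_local_mass.
Qed.

Lemma local_mass_fin rho f s : locally_bounded rho f -> local_mass rho 2 f s \is a fin_num.
Proof.
move=> [_ [K hK]]; rewrite ge0_fin_numE ?local_mass_ge0//.
by apply: le_lt_trans (hK s) _; rewrite ltry.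
Qed.

Lemma psiE rho f s : 0 < rho -> locally_bounded rho f ->
  local_mass rho 2 f s = (psi rho f s `^ rho)%:E.
Proof.
move=> r0 lf; rewrite /psi powRK ?gt_eqF// ?fine_ge0 ?local_mass_ge0//.
by rewrite fineK// local_mass_fin.
Qed.

Lemma local_L1_le rho f s (Y : R) : 1 <= rho -> cmeasurable f -> 0 < Y ->
  (local_mass rho 2 f s <= (Y `^ rho)%:E)%E ->
  (\int[mu]_t (ball_ind 2 t s * normc (f t))%:E <= (2 * 4 ^+ n * Y)%:E)%E.
Proof.
move=> r1 mf Y0 fY; apply: (@weak_jensen _ _ R mu (fun t => ball_ind 2 t s) (fun t => normc (f t))
  _ _ _ _ (4 ^+ n) Y rho) => //.
- by apply: measurable_ball_ind => //; exact: measurable_cst.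
- exact: measurable_normc.
- by move=> t; exact: normc_ge0.
- by rewrite integral_ball// lee_fin (_ : 2 * 2 = 4 :> R)//; lra.
- apply: le_trans fY _; rewrite lee_fin ler_peMl ?powR_ge0//.
  by rewrite exprn_ege1// ler1n.
Qed.

Lemma locally_bounded_window rho e f : 1 <= rho -> 0 < e -> e <= 1 ->
  locally_bounded rho f -> window_bounded e f.
Proof.
move=> r1 e0 e1 [mf [K hK]]; have r0 : rho != 0 by rewrite gt_eqF// (lt_le_trans ltr01).
pose Y := (`|K| + 1) `^ rho^-1.
have Y0 : 0 < Y by rewrite powR_gt0// ltr_wpDl.
exists (2 * 4 ^+ n * Y) => s; apply: le_trans (@local_L1_le rho f s Y r1 mf Y0 _); last first.
  apply: le_trans (hK s) _; rewrite lee_fin /Y powRK//.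
  by have := ler_norm K; lra.
apply: ge0_le_integralR => t; first by rewrite mulr_ge0 ?normc_ge0 ?window_ge0.
rewrite mulrC ler_wpM2r ?normc_ge0//.
have [->|w0] := eqVneq (window e (subRn t s)) 0; first exact: ball_ind_ge0.
rewrite /ball_ind (_ : near 2 t s) ?window_le1 ?(ltW e0)//.
apply/nearP => i; have := window_neq0 i e0 w0; rewrite coord_sub => h.
by have := ltW h; lra.
Qed.

End proximity.

(** * A majorant in frequency, uniform in position *)

Section frequency_majorant.
Context {R : realType} {n : nat}.
Notation mu := (lebesgue_Rn R n).
Implicit Types (f : Rn R n -> R[i]) (t s u x y w v : Rn R n).

Lemma integral_weight_conv (h : Rn R n -> R) v : measurable_fun setT h -> (forall w, 0 <= h w) ->
  (\int[mu]_w (weight (subRn v w) * h v)%:E = (pi ^+ n)%:E * (h v)%:E)%E.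
Proof.
move=> mh h0; under eq_integral do rewrite mulrC.
rewrite ge0_integralZlR//; last 2 first.
- apply: (measurableT_comp measurable_weight).
  by apply: measurable_subRn => //; exact: measurable_cst.
- by move=> w; exact: weight_ge0.
rewrite (integral_subr (F := fun w => (weight w)%:E)).
- by rewrite integral_weight muleC.
- by apply/measurable_EFinP; exact: measurable_weight.
- by move=> w; rewrite lee_fin weight_ge0.
Qed.

(** The function [G] depends on [s] alone and controls all [x] near [s] and all [w] near [w'] at
    once. For such [x] the window sees only the ball of radius 2 around [s], so [f] may be cut off
    there; the bound by the transform of the cut-off function is free of [x], and moving the
    frequency by one changes the weight by at most [4 ^+ n]. Hausdorff-Young and averaging against
    the weight then give the norm of [G]. *)
Lemma frequency_majorant (e rho : R) : 0 < e -> e <= 1 -> 1 <= rho -> rho <= 2 ->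
  exists2 C : R, 0 < C & forall f (Y : R) s, cmeasurable f -> 0 <= Y ->
    (local_mass rho 2 f s <= (Y `^ rho)%:E)%E ->
    exists G : Rn R n -> R, [/\ measurable_fun setT G, forall w, 0 <= G w <= C * Y,
      (1 < rho -> (\int[mu]_w (G w `^ (rho / (rho - 1)))%:E <= ((C * Y) `^ (rho / (rho - 1)))%:E)%E) &
      forall x w w', near 1 x s -> near 1 w w' -> normc (stft (cwindow e) f x w) <= G w'].
Proof.
move=> e0 e1 r1 r2.
have [C1 C10 hy] : exists2 C1 : R, 0 < C1 & (1 < rho -> forall F (X : R), cintegrable mu F -> 0 <= X ->
    (\int[mu]_t (normc (F t) `^ rho)%:E <= X%:E)%E ->
    (\int[mu]_w (normc (fourier F w) `^ (rho / (rho - 1)))%:E <= (C1 * X `^ (rho - 1)^-1)%:E)%E).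
  have [r1'|_] := boolP (1 < rho); last by exists 1.
  by have [C1 C10 hC1] := @hausdorff_young R n rho r1' r2; exists C1.
have pi0 : 0 < pi ^+ n :> R by rewrite exprn_gt0// pi_gt0.
pose c0 : R := (e + 4 / e) ^+ n * 4 ^+ n.
have c00 : 0 < c0 by rewrite mulr_gt0 ?exprn_gt0// addr_gt0// divr_gt0.
pose p := rho / (rho - 1).
(* [Ca] serves the supremum bound, where [2 * 4 ^+ n] bounds the L^1 norm on the ball of radius 2;
   [Cb] serves the integral bound, with [2 * pi ^+ n] from the averaging and [C1] from
   Hausdorff-Young. *)
pose Ca := c0 * (pi ^+ n * (2 * 4 ^+ n)).
pose Cb := c0 * ((2 * pi ^+ n) * C1 `^ p^-1).
have Ca0 : 0 < Ca by rewrite /Ca; do 3 (apply: mulr_gt0 => //); rewrite exprn_gt0.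
have Cb0 : 0 < Cb by rewrite /Cb; do 2 (apply: mulr_gt0 => //); [exact: mulr_gt0|exact: powR_gt0].
exists (Ca + Cb); first exact: addr_gt0.
move=> f Y s mf Y0 fY.
have r0 : 0 < rho by rewrite (lt_le_trans ltr01).
pose F t := (ball_ind 2 t s)%:C%C * f t.
have mb : measurable_fun setT (fun t => ball_ind 2 t s : R).
  by apply: measurable_ball_ind => //; exact: measurable_cst.
have mF : cmeasurable F by apply: cmeasurableM => //; exact: cmeasurable_real.
have nF t : normc (F t) = ball_ind 2 t s * normc (f t).
  by rewrite Normc.normcM normc_real ger0_norm ?ball_ind_ge0.
have nFr t : normc (F t) `^ rho = ball_ind 2 t s * normc (f t) `^ rho.
  rewrite nF /ball_ind; case: near; rewrite ?mul1r// !mul0r powR0// gt_eqF//.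
have cutF x w : near 1 x s -> stft (cwindow e) f x w = stft (cwindow e) F x w.
  move=> xs; apply: eq_cintegral => t; rewrite /stft_integrand /F.
  case: (boolP (near 2 t s)) => ts; first by rewrite /ball_ind ts mul1r.
  rewrite /cwindow (_ : window e (subRn t x) = 0) ?conjc_real ?mulr0 ?mul0r//.
  apply/eqP/negP => /negP w0; move/negP: ts; apply.
  rewrite (_ : 2 = 1 + 1 :> R)//; apply: near_trans xs; apply/nearP => i.
  have := window_neq0 i e0 w0; rewrite coord_sub => h.
  by have := ltW h; lra.
(* The passage from L^rho to L^1 on the ball assumes a positive bound; for [Y = 0] the function
   vanishes almost everywhere there and [G = 0] works. *)
move: Y0; rewrite le_eqVlt => /predU1P[Y0|Y0].
  have J0 : (\int[mu]_t (normc (F t) `^ rho)%:E = 0)%E.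
    apply/eqP; rewrite eq_le (integral_geEFin0 mu (fun t => powR_ge0 _ _)) andbT.
    under eq_integral do rewrite nFr.
    by apply: le_trans fY _; rewrite -Y0 powR0 ?gt_eqF.
  have F0 : {ae mu, forall t, (normc (F t) `^ rho)%:E = 0%E}.
    apply: integral_eq0_ae => //.
      by apply/measurable_EFinP; apply: measurable_funPR; exact: measurable_normc.
    by move=> t; rewrite lee_fin powR_ge0.
  exists (fun=> 0); split.
  - exact: measurable_cst.
  - by move=> w; rewrite -Y0 mulr0 lexx.
  - move=> r1'; have p0 : p != 0 by rewrite /p mulf_neq0 ?invr_neq0// gt_eqF// subr_gt0.
    by rewrite -Y0 mulr0 powR0// integral0.
  - move=> x w w' xs _; rewrite (cutF _ _ xs).
    rewrite (_ : stft _ _ _ _ = 0) ?Normc.normc0//.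
    transitivity (cintegral mu (fun=> 0 : R[i])); last first.
      by apply: complex_eq; rewrite /= /Rintegral integral0.
    apply: ae_eq_cintegral; [|exact: cmeasurable_cst|].
      apply: cmeasurableM; first apply: cmeasurableM => //.
        apply: cmeasurableJ; apply: (cmeasurable_comp (cmeasurable_cwindow e)).
        by apply: measurable_subRn => //; exact: measurable_cst.
      by apply: cmeasurable_charN => //; exact: measurable_cst.
    apply: filterS F0 => t [/powR_eq0_eq0/Normc.eq0_normc E].
    by rewrite /stft_integrand E !mul0r.
have F1 := local_L1_le r1 mf Y0 fY.
have iF : cintegrable mu F.
  apply/cintegrableP; split=> //; under eq_integral do rewrite nF.
  by apply: le_lt_trans F1 _; rewrite ltry.
have hS w : normc (fourier F w) <= 2 * 4 ^+ n * Y.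
  rewrite -lee_fin; apply: le_trans (normc_fourier w iF) _.
  by under eq_integral do rewrite nF.
have mff : measurable_fun setT (fun w => normc (fourier F w)).
  exact/measurable_normc/cmeasurable_fourier.
pose g w : \bar R := (\int[mu]_v (weight (subRn v w) * normc (fourier F v))%:E)%E.
have mW : measurable_fun setT (fun z : Rn R n * Rn R n => weight (subRn z.2 z.1)).
  by apply: (measurableT_comp measurable_weight); exact: measurable_subRn.
have mWw w : measurable_fun setT (fun v => weight (subRn v w)).
  apply: (measurableT_comp measurable_weight).
  by apply: measurable_subRn => //; exact: measurable_cst.
have g0 w : (0 <= g w)%E.
  by apply: integral_geEFin0 => v; rewrite mulr_ge0 ?weight_ge0 ?normc_ge0.
have mg : measurable_fun setT g.
  apply: (@measurable_integral _ _ _ _ _ mu (fun w v => (weight (subRn v w) * normc (fourier F v))%:E)).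
    apply/measurable_EFinP; apply: measurable_funM => //.
    exact: (measurableT_comp mff measurable_snd).
  by move=> w v; rewrite lee_fin mulr_ge0 ?weight_ge0 ?normc_ge0.
have iW w : (\int[mu]_v (weight (subRn v w))%:E = (pi ^+ n)%:E)%E.
  rewrite (integral_subl (F := fun v => (weight v)%:E)).
  - exact: integral_weight.
  - by apply/measurable_EFinP; exact: measurable_weight.
  - by move=> v; rewrite lee_fin weight_ge0.
have gS w : (g w <= (pi ^+ n * (2 * 4 ^+ n * Y))%:E)%E.
  apply: (@le_trans _ _ (\int[mu]_v (2 * 4 ^+ n * Y * weight (subRn v w))%:E)%E).
    apply: ge0_le_integralR => v; first by rewrite mulr_ge0 ?weight_ge0 ?normc_ge0.
    by rewrite mulrC ler_wpM2r ?weight_ge0.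
  rewrite ge0_integralZlR//; last 2 first.
  - by rewrite !mulr_ge0 ?exprn_ge0// ltW.
  - by move=> v; exact: weight_ge0.
  by rewrite iW -EFinM mulrC.
have gfin w : g w \is a fin_num.
  by rewrite ge0_fin_numE//; apply: le_lt_trans (gS w) _; rewrite ltry.
exists (fun w => c0 * fine (g w)); split.
- apply: measurable_funM => //; exact: (measurableT_comp (f := fine)).
- move=> w; rewrite mulr_ge0 ?fine_ge0 ?(ltW c00)//=.
  apply: le_trans (_ : Ca * Y <= _); last by rewrite ler_wpM2r ?(ltW Y0)// lerDl ltW.
  rewrite /Ca -mulrA; apply: ler_wpM2l; first exact: ltW.
  rewrite -lee_fin fineK//; apply: le_trans (gS w) _; rewrite lee_fin.
  by rewrite -[leRHS]mulrA.
- move=> r1'; rewrite -/p.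
  have r10 : 0 < rho - 1 by rewrite subr_gt0.
  have p1 : 1 <= p by rewrite ler_pdivlMr// mul1r lerBlDr lerDl.
  have p0 : 0 < p by rewrite (lt_le_trans ltr01).
  have FX : (\int[mu]_t (normc (F t) `^ rho)%:E <= (Y `^ rho)%:E)%E.
    by under eq_integral do rewrite nFr.
  have hyF := hy r1' F _ iF (powR_ge0 _ _) FX; rewrite -/p -powRrM -/p in hyF.
  have mffp : measurable_fun setT (fun v => normc (fourier F v) `^ p) by exact: measurable_funPR.
  apply: (@le_trans _ _ (\int[mu]_w ((c0 `^ p * ((2 * pi ^+ n) `^ p / pi ^+ n))%:E *
      \int[mu]_v (weight (subRn v w) * normc (fourier F v) `^ p)%:E))%E).
    apply: ge0_le_integralT => w; first by rewrite lee_fin powR_ge0.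
    rewrite powRM ?fine_ge0 ?(ltW c00)// EFinM EFinM -muleA.
    apply: lee_wpmul2l; first by rewrite lee_fin powR_ge0.
    apply: weak_jensen_powR => //.
    - by move=> v; exact: weight_ge0.
    - by move=> v; exact: normc_ge0.
    - exact: fine_ge0.
    - by rewrite iW.
    - by rewrite fineK.
  rewrite ge0_integralZl//; last 3 first.
  + apply: (@measurable_integral _ _ _ _ _ mu (fun w v =>
      (weight (subRn v w) * normc (fourier F v) `^ p)%:E)).
      apply/measurable_EFinP; apply: measurable_funM => //.
      exact: (measurableT_comp mffp measurable_snd).
    by move=> w v; rewrite lee_fin mulr_ge0 ?weight_ge0 ?powR_ge0.
  + by move=> w _; apply: integral_geEFin0 => v; rewrite mulr_ge0 ?weight_ge0 ?powR_ge0.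
  + by rewrite lee_fin mulr_ge0 ?powR_ge0// divr_ge0 ?powR_ge0// ltW.
  rewrite (@integral_swap _ _ _ _ _ mu mu (fun w v =>
      (weight (subRn v w) * normc (fourier F v) `^ p)%:E)); last 2 first.
  + apply/measurable_EFinP; apply: measurable_funM => //.
    exact: (measurableT_comp mffp measurable_snd).
  + by move=> w v; rewrite lee_fin mulr_ge0 ?weight_ge0 ?powR_ge0.
  under eq_integral do rewrite (integral_weight_conv _ mffp (fun v => powR_ge0 _ _)).
  rewrite ge0_integralZl//; last 3 first.
  + exact/measurable_EFinP.
  + by move=> v _; rewrite lee_fin powR_ge0.
  + by rewrite lee_fin ltW.
  apply: (@le_trans _ _ ((c0 `^ p * ((2 * pi ^+ n) `^ p / pi ^+ n))%:E *
      ((pi ^+ n)%:E * (C1 * Y `^ p)%:E))%E).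
    apply: lee_wpmul2l; first by rewrite lee_fin mulr_ge0 ?powR_ge0// divr_ge0 ?powR_ge0// ltW.
    by apply: lee_wpmul2l => //; rewrite lee_fin ltW.
  rewrite -!EFinM lee_fin; apply: le_trans (_ : (Cb * Y) `^ p <= _); last first.
    apply: powR_le; [exact: ltW|by rewrite mulr_ge0 ?ltW|].
    by rewrite ler_wpM2r ?(ltW Y0)// lerDr ltW.
  have pi20 : 0 <= 2 * pi ^+ n :> R by rewrite mulr_ge0// ltW.
  rewrite /Cb (powRM _ (ltW Cb0) (ltW Y0)) (powRM _ (ltW c00)); last first.
    by rewrite mulr_ge0 ?powR_ge0.
  rewrite (powRM _ pi20 (powR_ge0 _ _)).
  rewrite powRK ?(ltW C10) ?gt_eqF// le_eqVlt; apply/orP; left; apply/eqP; field.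
  by rewrite gt_eqF.
- move=> x w w' xs ww'; rewrite (cutF _ _ xs) -lee_fin.
  apply: le_trans (normc_stft_window x w e0 iF) _.
  rewrite EFinM fineK// /g /c0 EFinM -muleA.
  apply: lee_wpmul2l; first by rewrite lee_fin exprn_ge0// addr_ge0 ?divr_ge0// ltW.
  rewrite -ge0_integralZlR ?exprn_ge0//; last 2 first.
  + exact: measurable_funM.
  + by move=> v; rewrite mulr_ge0 ?weight_ge0 ?normc_ge0.
  apply: ge0_le_integralR => v; first by rewrite mulr_ge0 ?weight_ge0 ?normc_ge0.
  rewrite mulrA ler_wpM2r ?normc_ge0//.
  have := @weight_slow R n 1 (subRn v w') (subRn v w); rewrite expr1n mulr1.
  rewrite (_ : 2 + 2 = 4 :> R); last by lra.
  apply=> i; rewrite !coord_sub opprB addrC addrA subrK.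
  by move/nearP: ww' => /(_ i); rewrite addrC.
Qed.

End frequency_majorant.

(** * The trilinear form and its bounds *)

Section trilinear.
Context {R : realType} {n : nat}.
Notation mu := (lebesgue_Rn R n).
Notation mu2 := (lebesgue_Rn R (n + n)).
Implicit Types (f g phi : Rn R n -> R[i]) (a : Rn R (n + n) -> R[i]).
Implicit Types (t s w tau : Rn R n) (z : Rn R (n + n)) (e rho iq A : R).

Lemma measurable_catRn_r tau : measurable_fun setT (fun w : Rn R n => catRn tau w).
Proof.
have pr : measurable_fun setT (fun w : Rn R n => (tau, w)).
  by apply: measurable_fun_pair => //; exact: measurable_cst.
by have := measurableT_comp (measurable_catRn (R := R) (m := n) (n := n)) pr.
Qed.

Lemma holder3_integral (e X : 'I_3 -> R) (x : 'I_3 -> Rn R n -> R) :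
  (forall i, 0 <= e i) -> 1 <= \sum_i e i -> (forall i, measurable_fun setT (x i)) ->
  (forall i t, 0 <= x i t <= X i) ->
  (forall i, 0 < e i -> (\int[mu]_t (x i t `^ (e i)^-1)%:E <= (X i `^ (e i)^-1)%:E)%E) ->
  (\int[mu]_t (\prod_i x i t)%:E <= (3 * \prod_i X i)%:E)%E.
Proof.
move=> e0 e1 mx xX ix.
have X0 i : 0 <= X i by have /andP[/le_trans] := xX i (cstRn n 0); apply.
(* If some bound is zero the product vanishes; otherwise division by the bounds normalises all
   factors to values between 0 and 1. *)
have [[i Xi0]|/forallNP Xi] := pselect (exists i, X i = 0).
  under eq_integral => t _.
    rewrite (bigD1 i)//= (_ : x i t = 0) ?mul0r; last first.
      by apply/eqP; rewrite eq_le -[X in _ <= X]Xi0 andbC; exact: xX.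
    over.
  by rewrite integral0 lee_fin mulr_ge0// prodr_ge0.
have Xp i : 0 < X i by rewrite lt_neqAle eq_sym X0 andbT; apply/eqP/Xi.
pose y i t := x i t / X i.
have y01 i t : 0 <= y i t <= 1.
  have /andP[h1 h2] := xX i t.
  by rewrite /y divr_ge0//= ler_pdivrMr// mul1r.
have my i : measurable_fun setT (fun t => y i t `^ (e i)^-1).
  by apply: measurable_funPR; apply: measurable_funM.
have XP : 0 <= \prod_i X i by apply: prodr_ge0.
pose K i t := if 0 < e i then y i t `^ (e i)^-1 else 0.
have mK i : measurable_fun setT (K i).
  by rewrite /K; case: (0 < e i) => //; exact: measurable_cst.
have K0 i t : 0 <= K i t by rewrite /K; case: ifP => // _; exact: powR_ge0.
apply: (@le_trans _ _ (\int[mu]_t (\prod_i X i * \sum_i K i t)%:E)%E).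
  apply: ge0_le_integralR => t; first by apply: prodr_ge0 => i _; have /andP[] := xX i t.
  rewrite (_ : \prod_i x i t = \prod_i X i * \prod_i y i t).
    by apply: ler_wpM2l => //; rewrite -big_mkcond; apply: holder3.
  by rewrite -big_split; apply: eq_bigr => i _; rewrite /y /= mulrC divfK// gt_eqF.
rewrite ge0_integralZlR//; last 2 first.
- exact: (measurable_sum _ mK).
- by move=> t; apply: sumr_ge0 => i _.
rewrite [leRHS]EFinM muleC; apply: lee_wpmul2r; first by rewrite lee_fin.
under eq_integral do rewrite -sumEFin.
rewrite ge0_integral_sum//; last 2 first.
- by move=> i; exact/measurable_EFinP.
- by move=> i t _; rewrite lee_fin.
apply: (@le_trans _ _ (\sum_(i < 3) 1%:E)%E); last by rewrite sumEFin lee_fin sumr_const card_ord.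
apply: lee_sum => i _; rewrite /K; have [ei|ei] := boolP (0 < e i); last first.
  by rewrite integral0 lee_fin.
have p0 := powR_gt0 (e i)^-1 (Xp i).
have yE t : y i t `^ (e i)^-1 = (X i `^ (e i)^-1)^-1 * x i t `^ (e i)^-1.
  by rewrite /y powR_div 1?mulrC//; have /andP[] := xX i t.
under eq_integral do rewrite yE.
rewrite ge0_integralZlR ?invr_ge0 ?powR_ge0//; last 2 first.
- exact: measurable_funPR.
- by move=> t; exact: powR_ge0.
rewrite -[X in (_ <= X%:E)%E](mulVf (lt0r_neq0 p0)) EFinM; apply: lee_wpmul2l.
  by rewrite lee_fin invr_ge0 powR_ge0.
exact: ix.
Qed.

Lemma trilinear_holder (e1 e2 e3 X1 X2 X3 : R) (x1 x2 x3 : Rn R n -> R) :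
  0 <= e1 -> 0 <= e2 -> 0 <= e3 -> 1 <= e1 + (e2 + e3) ->
  measurable_fun setT x1 -> measurable_fun setT x2 -> measurable_fun setT x3 ->
  (forall t, 0 <= x1 t <= X1) -> (forall t, 0 <= x2 t <= X2) -> (forall t, 0 <= x3 t <= X3) ->
  (0 < e1 -> (\int[mu]_t (x1 t `^ e1^-1)%:E <= (X1 `^ e1^-1)%:E)%E) ->
  (0 < e2 -> (\int[mu]_t (x2 t `^ e2^-1)%:E <= (X2 `^ e2^-1)%:E)%E) ->
  (0 < e3 -> (\int[mu]_t (x3 t `^ e3^-1)%:E <= (X3 `^ e3^-1)%:E)%E) ->
  (\int[mu]_t (x1 t * (x2 t * x3 t))%:E <= (3 * (X1 * (X2 * X3)))%:E)%E.
Proof.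
move=> e10 e20 e30 e m1 m2 m3 b1 b2 b3 i1 i2 i3.
pose ee (i : 'I_3) := nth 0 [:: e1; e2; e3] i.
pose XX (i : 'I_3) := nth 0 [:: X1; X2; X3] i.
pose xx (i : 'I_3) := nth (fun=> 0) [:: x1; x2; x3] i.
have pX : \prod_i XX i = X1 * (X2 * X3) by rewrite !big_ord_recl big_ord0 mulr1.
have px t : \prod_i xx i t = x1 t * (x2 t * x3 t) by rewrite !big_ord_recl big_ord0 mulr1.
rewrite -pX; under eq_integral do rewrite -px.
apply: (@holder3_integral ee).
- by case=> [[|[|[|]]]].
- by rewrite !big_ord_recl big_ord0 addr0.
- by case=> [[|[|[|]]]].
- by case=> [[|[|[|]]]].
- by case=> [[|[|[|]]]].
Qed.

(* alpha k bounds the L^1 norm of a on the cube k, and iq is the reciprocal of q,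
   0 encoding infinity; the l^q norm is taken in the frequency variable alone. *)
Definition symbol_bound iq a A := cmeasurable a /\ exists alpha : (n + n).-tuple int -> R,
  [/\ forall k, (\int[mu2]_z (\1_(cube k) z * normc (a z))%:E <= (alpha k)%:E)%E,
      forall k, 0 <= alpha k <= A &
      0 < iq -> forall tau,
        (\int[mu]_w (alpha (floorRn (catRn tau w)) `^ iq^-1)%:E <= (A `^ iq^-1)%:E)%E].

(** On a unit cube around [(tau, w)] both transforms are bounded by their frequency majorants, so
    only the L^1 norm of the symbol on that cube remains. Hoelder in [w] then applies with
    reciprocal exponents [iq], [1 - 1/rho1], [1 - 1/rho2], whose sum is at least 1 by hypothesis;
    the position [tau] is left unintegrated. *)
Lemma cell_estimate e rho1 rho2 iq : 0 < e -> e <= 1 -> 1 <= rho1 -> rho1 <= 2 ->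
  1 <= rho2 -> rho2 <= 2 -> 0 <= iq -> rho1^-1 + rho2^-1 - 1 <= iq ->
  exists2 C : R, 0 < C & forall a A f g z1 z2, symbol_bound iq a A ->
    locally_bounded rho1 f -> locally_bounded rho2 g ->
    (\int[mu2]_z (normc (a z) *
        (normc (stft (cwindow e) f (posn (addRn z z1)) (freq (addRn z z1))) *
         normc (stft (cwindow e) g (posn (addRn z z2)) (freq (addRn z z2)))))%:E <=
     \int[mu]_tau (C * A * (psi rho1 f (addRn tau (posn z1)) * psi rho2 g (addRn tau (posn z2))))%:E)%E.
Proof.
move=> e0 e1 r11 r12 r21 r22 iq0 ciq.
have [C1 C10 hC1] := @frequency_majorant R n e rho1 e0 e1 r11 r12.
have [C2 C20 hC2] := @frequency_majorant R n e rho2 e0 e1 r21 r22.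
exists (3 * (C1 * C2)); first by rewrite !mulr_gt0.
move=> a A f g z1 z2 [ma [alpha [ha alA alq]]] lf lg.
have [mf _] := lf; have [mg _] := lg.
have mS (h : Rn R n -> R[i]) z' : cmeasurable h ->
    measurable_fun setT (fun z => normc (stft (cwindow e) h (posn (addRn z z')) (freq (addRn z z')))).
  move=> mh; apply: measurable_normc.
  apply: (cmeasurable_comp (cmeasurable_stft_at (cmeasurable_cwindow e) mh)).
  by apply: measurable_addRn => //; exact: measurable_cst.
pose Sf z := normc (stft (cwindow e) f (posn (addRn z z1)) (freq (addRn z z1))).
pose Sg z := normc (stft (cwindow e) g (posn (addRn z z2)) (freq (addRn z z2))).
rewrite -[leLHS]/(\int[mu2]_z (normc (a z) * (Sf z * Sg z))%:E)%E.
pose h z := normc (a z) * (Sf z * Sg z).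
have mh : measurable_fun setT h.
  by apply: measurable_funM; [exact: measurable_normc|apply: measurable_funM; exact: mS].
have h0 z : 0 <= h z by rewrite !mulr_ge0 ?normc_ge0.
have mJ : measurable_fun setT (fun q : Rn R (n + n) * Rn R (n + n) => (same_cube q.1 q.2 * h q.1)%:E).
  apply/measurable_EFinP; apply: measurable_funM; first exact: measurable_same_cube.
  exact: (measurableT_comp mh measurable_fst).
have J0 z z' : (0 <= (same_cube z z' * h z)%:E)%E by rewrite lee_fin mulr_ge0 ?same_cube_ge0.
(* The averaging over cubes: integrating the new variable last replaces a sum over cubes by an
   integral in which position and frequency separate. *)
have -> : (\int[mu2]_z (normc (a z) * (Sf z * Sg z))%:E =
    \int[mu2]_z \int[mu2]_z' (same_cube z z' * h z)%:E)%E.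
  apply: eq_integral => z _; under eq_integral do rewrite mulrC.
  rewrite ge0_integralZlR//; first by rewrite integral_same_cube mule1.
  by apply: measurable_same_cube => //; exact: measurable_cst.
rewrite (@integral_swap _ _ _ _ _ mu2 mu2 (fun z z' => (same_cube z z' * h z)%:E))//.
rewrite integral_cat; last 2 first.
- apply: (@measurable_integral _ _ _ _ _ mu2 (fun z' z => (same_cube z z' * h z)%:E)); last first.
    by move=> z' z; exact: J0.
  apply/measurable_EFinP; apply: measurable_funM.
    exact: measurable_same_cube measurable_snd measurable_fst.
  exact: (measurableT_comp mh measurable_snd).
- by move=> z'; apply: integral_ge0.
apply: ge0_le_integralT => tau.
  by apply: integral_ge0 => w _; apply: integral_ge0.
set Y1 := psi rho1 f _; set Y2 := psi rho2 g _.
have r10 : 0 < rho1 by rewrite (lt_le_trans ltr01).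
have r20 : 0 < rho2 by rewrite (lt_le_trans ltr01).
have [|G1 [mG1 bG1 iG1 hG1]] := hC1 f Y1 (addRn tau (posn z1)) mf (psi_ge0 _ _ _).
  by rewrite psiE.
have [|G2 [mG2 bG2 iG2 hG2]] := hC2 g Y2 (addRn tau (posn z2)) mg (psi_ge0 _ _ _).
  by rewrite psiE.
pose x1 w := alpha (floorRn (catRn tau w)).
pose x2 w := G1 (addRn w (freq z1)); pose x3 w := G2 (addRn w (freq z2)).
have madd (u : Rn R n) : measurable_fun setT (fun w : Rn R n => addRn w u).
  by apply: measurable_addRn => //; exact: measurable_cst.
apply: (@le_trans _ _ (\int[mu]_w (x1 w * (x2 w * x3 w))%:E)%E).
  apply: ge0_le_integralT => w; first by apply: integral_ge0.
  have /andP[G10 _] := bG1 (addRn w (freq z1)); have /andP[G20 _] := bG2 (addRn w (freq z2)).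
  apply: (@le_trans _ _ (\int[mu2]_z
      (x2 w * x3 w * (\1_(cube (floorRn (catRn tau w))) z * normc (a z)))%:E)%E).
    apply: ge0_le_integralR => z; first by rewrite mulr_ge0 ?same_cube_ge0.
    rewrite /same_cube /h [leRHS]mulrCA.
    have [zc|zc] := boolP (z \in cube (floorRn (catRn tau w))); last first.
      by rewrite indicE (negbTE zc) !mul0r.
    rewrite ler_wpM2l// mulrC ler_wpM2r ?normc_ge0//.
    have zn : near 1 z (catRn tau w).
      by apply: same_cube_near; move: zc; rewrite inE cubeE.
    have pn z' : near 1 (posn (addRn z z')) (addRn tau (posn z')).
      apply/nearP => i; rewrite coord_posn !coord_add coord_posn opprD addrACA subrr addr0.
      by have /nearP/(_ (lshift n i)) := zn; rewrite coord_catl.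
    have fn z' : near 1 (freq (addRn z z')) (addRn w (freq z')).
      apply/nearP => i; rewrite coord_freq !coord_add coord_freq opprD addrACA subrr addr0.
      by have /nearP/(_ (rshift n i)) := zn; rewrite coord_catr.
    apply: ler_pM; rewrite ?normc_ge0//; first exact: hG1.
    exact: hG2.
  rewrite ge0_integralZlR ?mulr_ge0//; last 2 first.
  - apply: measurable_funM; last exact: measurable_normc.
    by apply: measurable_indic; exact: measurable_cube.
  - by move=> z; rewrite mulr_ge0 ?normc_ge0.
  rewrite [x1 w * _]mulrC [leRHS]EFinM; apply: lee_wpmul2l; first by rewrite lee_fin mulr_ge0.
  exact: ha.
have A0 : 0 <= A by have /andP[/le_trans] := alA (floorRn (cstRn _ (0 : R))); apply.
have pinv rho : 0 < rho -> (1 - rho^-1)^-1 = rho / (rho - 1).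
  move=> r0; rewrite (_ : 1 - rho^-1 = (rho - 1) / rho) ?invf_div//.
  by rewrite mulrBl divff ?gt_eqF// mul1r.
have pgt rho : 0 < rho -> 0 < 1 - rho^-1 -> 1 < rho.
  by move=> r0; rewrite subr_gt0 invf_lt1.
have tr (G : Rn R n -> R) (u : Rn R n) (p : R) : measurable_fun setT G -> (forall w, 0 <= G w) ->
    (\int[mu]_w (G (addRn w u) `^ p)%:E = \int[mu]_w (G w `^ p)%:E)%E.
  move=> mG G0; rewrite (integral_addl (F := fun w => (G w `^ p)%:E))//.
    by apply/measurable_EFinP; exact: measurable_funPR.
  by move=> w; rewrite lee_fin powR_ge0.
apply: (@le_trans _ _ (3 * (A * (C1 * Y1 * (C2 * Y2))))%:E); last first.
  by rewrite lee_fin le_eqVlt; apply/orP; left; apply/eqP; ring.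
apply: (@trilinear_holder iq (1 - rho1^-1) (1 - rho2^-1)).
- by [].
- by rewrite subr_ge0 invf_le1.
- by rewrite subr_ge0 invf_le1.
- lra.
- apply: (measurableT_comp (f := fun z => alpha (floorRn z)) (g := fun w => catRn tau w)).
    exact: (measurable_floor (alpha : _ -> measurableTypeR R)).
  exact: measurable_catRn_r.
- exact: (measurableT_comp mG1).
- exact: (measurableT_comp mG2).
- by move=> w; exact: alA.
- by move=> w; exact: bG1.
- by move=> w; exact: bG2.
- by move=> q0; exact: alq.
- move=> ep; rewrite pinv// tr//; last by move=> w; have /andP[] := bG1 w.
  by apply: iG1; exact: pgt ep.
- move=> ep; rewrite pinv// tr//; last by move=> w; have /andP[] := bG2 w.
  by apply: iG2; exact: pgt ep.
Qed.

(** The domination is inserted for both transforms, and Tonelli brings the integral over [z]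
    innermost, where [cell] applies for each pair of displacements. *)
Lemma trilinear_estimate e rho1 rho2 (K : R) a phi1 phi2 (Phi1 Phi2 : Rn R (n + n) -> R) f g :
  0 < e -> e <= 1 -> 1 <= rho1 -> 1 <= rho2 -> 0 <= K -> cmeasurable a ->
  dominated e phi1 Phi1 -> dominated e phi2 Phi2 ->
  locally_bounded rho1 f -> locally_bounded rho2 g ->
  (forall z1 z2, (\int[mu2]_z (normc (a z) *
        (normc (stft (cwindow e) f (posn (addRn z z1)) (freq (addRn z z1))) *
         normc (stft (cwindow e) g (posn (addRn z z2)) (freq (addRn z z2)))))%:E <=
     \int[mu]_tau (K * (psi rho1 f (addRn tau (posn z1)) * psi rho2 g (addRn tau (posn z2))))%:E)%E) ->
  (\int[mu2]_z (normc (localization_integrand a phi1 phi2 f g z))%:E <=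
   \int[mu2]_z1 \int[mu2]_z2 ((Phi1 z1 * Phi2 z2)%:E *
     \int[mu]_tau (K * (psi rho1 f (addRn tau (posn z1)) * psi rho2 g (addRn tau (posn z2))))%:E))%E.
Proof.
move=> e0 e1 r1 r2 K0 ma [mphi1 mP1 P10 d1] [mphi2 mP2 P20 d2] lf lg cell.
have [mf _] := lf; have [mg _] := lg.
have [_ df] := d1 f mf (locally_bounded_window r1 e0 e1 lf).
have [_ dg] := d2 g mg (locally_bounded_window r2 e0 e1 lg).
pose S (h : Rn R n -> R[i]) z z' := normc (stft (cwindow e) h (posn (addRn z z')) (freq (addRn z z'))).
have S0 h z z' : 0 <= S h z z' by exact: normc_ge0.
have mS d (T : measurableType d) (h : Rn R n -> R[i]) (p q : T -> Rn R (n + n)) : cmeasurable h ->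
    measurable_fun setT p -> measurable_fun setT q -> measurable_fun setT (fun x => S h (p x) (q x)).
  move=> mh mp mq; apply: measurable_normc.
  apply: (cmeasurable_comp (cmeasurable_stft_at (cmeasurable_cwindow e) mh)
    (h := fun x => addRn (p x) (q x))).
  exact: measurable_addRn.
pose F z z1 z2 := normc (a z) * (Phi1 z1 * S f z z1 * (Phi2 z2 * S g z z2)).
have F0 z z1 z2 : (0 <= (F z z1 z2)%:E)%E by rewrite lee_fin !mulr_ge0 ?normc_ge0.
have mna := measurable_normc ma.
have mF d (T : measurableType d) (p p1 p2 : T -> Rn R (n + n)) :
    measurable_fun setT p -> measurable_fun setT p1 -> measurable_fun setT p2 ->
    measurable_fun setT (fun x => (F (p x) (p1 x) (p2 x))%:E).
  move=> mp mp1 mp2; apply/measurable_EFinP; apply: measurable_funM.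
    exact: (measurableT_comp mna mp).
  apply: measurable_funM; apply: measurable_funM; [|exact: mS| |exact: mS].
    exact: (measurableT_comp mP1 mp1).
  exact: (measurableT_comp mP2 mp2).
have mcst z' : measurable_fun setT (fun _ : Rn R (n + n) => z') by exact: measurable_cst.
apply: (@le_trans _ _ (\int[mu2]_z \int[mu2]_z1 \int[mu2]_z2 (F z z1 z2)%:E)%E).
  apply: ge0_le_integralT => z; first by rewrite lee_fin normc_ge0.
  rewrite /localization_integrand !Normc.normcM normcJ.
  have E1 z1 : (\int[mu2]_z2 (F z z1 z2)%:E = (normc (a z) * (Phi1 z1 * S f z z1))%:E *
      \int[mu2]_z2 (Phi2 z2 * S g z z2)%:E)%E.
    rewrite -ge0_integralZl//; last 3 first.
    - apply/measurable_EFinP; apply: measurable_funM => //; exact: mS.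
    - by move=> z2 _; rewrite lee_fin mulr_ge0.
    - by rewrite lee_fin !mulr_ge0 ?normc_ge0.
    by apply: eq_integral => z2 _; rewrite -EFinM; congr EFin; rewrite /F; ring.
  under eq_integral do rewrite E1.
  rewrite ge0_integralZr//; last 3 first.
  - apply/measurable_EFinP; apply: measurable_funM => //; apply: measurable_funM => //; exact: mS.
  - by move=> z1 _; rewrite lee_fin !mulr_ge0 ?normc_ge0.
  - by apply: integral_geEFin0 => z2; rewrite mulr_ge0.
  rewrite ge0_integralZlR ?normc_ge0//; last 2 first.
  - by apply: measurable_funM => //; exact: mS.
  - by move=> z1; rewrite mulr_ge0.
  rewrite !EFinM; apply: lee_pmul; rewrite ?mule_ge0 ?lee_fin ?normc_ge0//.
  by apply: lee_wpmul2l; [rewrite lee_fin normc_ge0|exact: df].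
rewrite (@integral_swap _ _ _ _ _ mu2 mu2 (fun z z1 => \int[mu2]_z2 (F z z1 z2)%:E)%E); last 2 first.
- apply: (@measurable_integral _ _ _ _ _ mu2 (fun (q : Rn R (n + n) * Rn R (n + n)) z2 =>
    (F q.1 q.2 z2)%:E)) => //.
  apply: (mF _ _ (fun x : Rn R (n + n) * Rn R (n + n) * Rn R (n + n) => x.1.1)
    (fun x => x.1.2) (fun x => x.2)).
  + exact: (measurableT_comp measurable_fst measurable_fst).
  + exact: (measurableT_comp measurable_snd measurable_fst).
  + exact: measurable_snd.
- by move=> z z1; exact: integral_ge0.
apply: ge0_le_integralT => z1; first by do 2 (apply: integral_ge0 => ? _).
rewrite (@integral_swap _ _ _ _ _ mu2 mu2 (fun z z2 => (F z z1 z2)%:E))//; last first.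
  by apply: (mF _ _ (fun x : Rn R (n + n) * Rn R (n + n) => x.1) (fun=> z1) (fun x => x.2));
    [exact: measurable_fst|exact: measurable_cst|exact: measurable_snd].
apply: ge0_le_integralT => z2; first exact: integral_ge0.
have -> : (\int[mu2]_z (F z z1 z2)%:E = (Phi1 z1 * Phi2 z2)%:E *
    \int[mu2]_z (normc (a z) * (S f z z1 * S g z z2))%:E)%E.
  rewrite -ge0_integralZlR ?mulr_ge0//.
  - by apply: eq_integral => z _; congr EFin; rewrite /F; ring.
  - apply: measurable_funM => //; apply: measurable_funM; exact: mS.
  - by move=> z; rewrite !mulr_ge0 ?normc_ge0.
apply: lee_wpmul2l; first by rewrite lee_fin mulr_ge0.
exact: cell.
Qed.

Lemma measurable_weightV : measurable_fun setT (fun t => (weight t)^-1 : R).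
Proof.
have E t : (weight t)^-1 = \prod_(i < n) (1 + coord t i ^+ 2) :> R.
  by rewrite /weight prodfV invrK.
under eq_fun do rewrite E.
apply: measurable_prod => i _; apply: measurable_funD => //.
by apply: measurable_funX; exact: measurable_coord.
Qed.

(** Dividing by the weight makes this norm strong enough to bound the integral of [psi] over the
    whole space. *)
Definition weighted_L2 (k : R) g := cmeasurable g /\
  (\int[mu]_t (normc (g t) ^+ 2 / weight t)%:E <= (k ^+ 2)%:E)%E.

Lemma local_mass_L2 rho g s (Y : R) : 1 <= rho -> rho <= 2 -> cmeasurable g -> 0 < Y ->
  (local_mass 2 2 g s <= (Y ^+ 2)%:E)%E ->
  (local_mass rho 2 g s <= ((2 * 4 ^+ n * Y) `^ rho)%:E)%E.
Proof.
move=> r1 r2 mg Y0 gY; have r0 : 0 < rho by rewrite (lt_le_trans ltr01).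
have B1 : 1 <= 2 * 4 ^+ n :> R.
  by rewrite (le_trans (_ : 1 <= 2)) ?ler1n// ler_peMr// exprn_ege1// ler1n.
apply: (@le_trans _ _ (2 * 4 ^+ n * Y `^ rho)%:E); last first.
  rewrite lee_fin (powRM _ (le_trans ler01 B1) (ltW Y0)).
  by rewrite ler_wpM2r ?powR_ge0// le1r_powR.
apply: (@weak_jensen _ _ R mu (fun t => ball_ind 2 t s) (fun t => normc (g t) `^ rho)
  _ _ _ _ (4 ^+ n) (Y `^ rho) (2 / rho)) => //.
- by apply: measurable_ball_ind => //; exact: measurable_cst.
- by apply: measurable_funPR; exact: measurable_normc.
- by move=> t; exact: powR_ge0.
- by rewrite ler_pdivlMr// mul1r.
- exact: powR_gt0.
- by rewrite integral_ball// lee_fin (_ : 2 * 2 = 4 :> R)//; lra.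
have E x : (x `^ rho) `^ (2 / rho) = x `^ 2 by rewrite -powRrM mulrCA divff ?gt_eqF// mulr1.
under eq_integral do rewrite E.
rewrite E (powR_mulrn 2 (ltW Y0)); apply: le_trans gY _; rewrite lee_fin.
by rewrite ler_peMl ?sqr_ge0// exprn_ege1// ler1n.
Qed.

(** Cauchy-Schwarz against the weight, in additive form. The weight changes by at most [10 ^+ n]
    over distance 2, so the local L^2 mass at [s] is at most [10 ^+ n * weight s * H s]; its root is
    therefore at most [k * weight s + 10 ^+ n / k * H s]. Both terms have integrals proportional to
    [k], with [4 ^+ n] the volume of the ball of radius 2. *)
Lemma integral_psi_le rho : 1 <= rho -> rho <= 2 -> exists2 C : R, 0 < C &
  forall (k : R) g, 0 < k -> weighted_L2 k g -> locally_bounded rho g /\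
    forall y, (\int[mu]_s (psi rho g (addRn s y))%:E <= (C * k)%:E)%E.
Proof.
move=> r1 r2; have r0 : 0 < rho by rewrite (lt_le_trans ltr01).
have pi0 : 0 < pi ^+ n :> R by rewrite exprn_gt0// pi_gt0.
pose B : R := 2 * 4 ^+ n; have B0 : 0 < B by rewrite mulr_gt0// exprn_gt0.
pose C := B * (pi ^+ n + 10 ^+ n * 4 ^+ n).
exists C; first by rewrite mulr_gt0// addr_gt0// mulr_gt0// exprn_gt0.
move=> k g k0 [mg gk].
pose h t := normc (g t) ^+ 2 / weight t.
have mh : measurable_fun setT h.
  apply: measurable_funM; first exact: measurable_funX (measurable_normc mg).
  exact: measurable_weightV.
have h0 t : 0 <= h t by rewrite divr_ge0 ?sqr_ge0 ?weight_ge0.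
pose q s := local_mass 2 2 g s.
have qE s : (q s <= \int[mu]_t (ball_ind 2 t s * (10 ^+ n * weight s * h t))%:E)%E.
  apply: ge0_le_integralR => t; first by rewrite mulr_ge0 ?powR_ge0.
  rewrite (powR_mulrn 2 (normc_ge0 _)) /ball_ind.
  case: (boolP (near 2 t s)) => [/nearP ts|_]; last by rewrite !mul0r.
  rewrite !mul1r /h; apply: (@le_trans _ _ (weight t * (normc (g t) ^+ 2 / weight t))).
    by rewrite mulrC divfK// gt_eqF// weight_gt0.
  apply: ler_wpM2r; first exact: (h0 t).
  have := @weight_slow R n 2 s t.
  rewrite (_ : 2 + 2 * 2 ^+ 2 = 10 :> R); last by rewrite expr2; lra.
  by apply=> i; rewrite distrC.
have hb s : (\int[mu]_t (ball_ind 2 t s * h t)%:E <= (k ^+ 2)%:E)%E.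
  apply: le_trans gk; apply: ge0_le_integralR => t; first by rewrite mulr_ge0.
  by rewrite ler_piMl ?ball_ind_le1.
pose H s := (\int[mu]_t (ball_ind 2 t s * h t)%:E)%E.
have mb s : measurable_fun setT (fun t => ball_ind 2 t s : R).
  by apply: measurable_ball_ind => //; exact: measurable_cst.
have H0 s : (0 <= H s)%E by apply: integral_geEFin0 => t; rewrite mulr_ge0.
have Hfin s : H s \is a fin_num.
  by rewrite ge0_fin_numE//; apply: le_lt_trans (hb s) _; rewrite ltry.
have qH s : (q s <= (10 ^+ n * weight s * fine (H s))%:E)%E.
  apply: le_trans (qE s) _; rewrite EFinM fineK// /H -ge0_integralZlR.
  - apply: ge0_le_integralR => t.
      apply: mulr_ge0 => //; apply: mulr_ge0; last exact: h0.
      by rewrite mulr_ge0 ?weight_ge0 ?exprn_ge0.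
    by rewrite mulrCA.
  - by rewrite mulr_ge0 ?weight_ge0 ?exprn_ge0.
  - exact: measurable_funM.
  - by move=> t; rewrite mulr_ge0.
have lb : locally_bounded rho g.
  split=> //; exists ((2 * 4 ^+ n * k) `^ rho) => s.
  apply: local_mass_L2 => //; apply: (@le_trans _ _ (\int[mu]_t (h t)%:E)%E) gk.
  apply: ge0_le_integralR => t; first by rewrite mulr_ge0 ?powR_ge0.
  rewrite (powR_mulrn 2 (normc_ge0 _)).
  apply: (@le_trans _ _ (normc (g t) ^+ 2)); first by rewrite ler_piMl ?sqr_ge0 ?ball_ind_le1.
  by rewrite /h ler_peMr ?sqr_ge0// invf_ge1 ?weight_gt0// weight_le1.
split=> // y.
rewrite (integral_addl (F := fun s => (psi rho g s)%:E)); last 2 first.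
- by apply/measurable_EFinP; exact: measurable_psi.
- by move=> s; rewrite lee_fin psi_ge0.
have key s : psi rho g s <= B * (k * weight s + 10 ^+ n / k * fine (H s)).
  have w0 := weight_gt0 s; have fH0 : 0 <= fine (H s) by exact: fine_ge0.
  set Y := k * weight s + _.
  have Y0 : 0 < Y by rewrite ltr_wpDr ?mulr_gt0// mulr_ge0// divr_ge0 ?exprn_ge0// ltW.
  have J : (local_mass rho 2 g s <= ((2 * 4 ^+ n * Y) `^ rho)%:E)%E.
    apply: local_mass_L2 => //; apply: le_trans (qH s) _; rewrite lee_fin /Y sqrrD.
    have -> : k * weight s * (10 ^+ n / k * fine (H s)) = 10 ^+ n * weight s * fine (H s).
      by field; rewrite gt_eqF.
    have := sqr_ge0 (k * weight s); have := sqr_ge0 (10 ^+ n / k * fine (H s)).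
    have : 0 <= 10 ^+ n * weight s * fine (H s) by rewrite !mulr_ge0 ?exprn_ge0// ltW.
    by rewrite mulr2n; lra.
  have BY : 0 <= 2 * 4 ^+ n * Y by rewrite mulr_ge0 ?(ltW Y0)// ltW.
  rewrite -[leRHS](powRVK (r := rho)) ?gt_eqF//; apply: powR_le.
  - by rewrite invr_ge0 ltW.
  - by rewrite fine_ge0// local_mass_ge0.
  - by rewrite -lee_fin fineK// local_mass_fin.
apply: (@le_trans _ _ (\int[mu]_s (B * (k * weight s + 10 ^+ n / k * fine (H s)))%:E)%E).
  by apply: ge0_le_integralR => // s; exact: psi_ge0.
have mJ : measurable_fun setT (fun z : Rn R n * Rn R n => (ball_ind 2 z.2 z.1 * h z.2)%:E).
  apply/measurable_EFinP; apply: measurable_funM.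
    exact: measurable_ball_ind measurable_snd measurable_fst.
  exact: (measurableT_comp mh measurable_snd).
have mH : measurable_fun setT H.
  apply: (@measurable_integral _ _ _ _ _ mu (fun s t => (ball_ind 2 t s * h t)%:E) mJ).
  by move=> s t; rewrite lee_fin mulr_ge0.
have mfH : measurable_fun setT (fun s => fine (H s)).
  exact: (measurableT_comp (f := fine)).
have c10 : 0 <= 10 ^+ n / k by rewrite divr_ge0 ?exprn_ge0// ltW.
have fH0 s : 0 <= fine (H s) by exact: fine_ge0.
rewrite ge0_integralZlR; last 3 first.
- exact: ltW.
- apply: measurable_funD; apply: measurable_funM => //; exact: measurable_weight.
- move=> s; apply: addr_ge0; last by apply: mulr_ge0.
  by rewrite mulr_ge0 ?weight_ge0// ltW.
rewrite ge0_integralDR; last 4 first.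
- by apply: measurable_funM => //; exact: measurable_weight.
- exact: measurable_funM.
- by move=> s; rewrite mulr_ge0 ?weight_ge0// ltW.
- by move=> s; rewrite mulr_ge0.
rewrite !ge0_integralZlR ?(ltW k0)//; last 2 first.
- exact: measurable_weight.
- exact: weight_ge0.
rewrite integral_weight; under [X in (_ + _ * X)%E]eq_integral do rewrite fineK//.
have -> : (\int[mu]_s H s = (4 ^+ n)%:E * \int[mu]_t (h t)%:E)%E.
  rewrite (@integral_swap _ _ _ _ _ mu mu (fun s t => (ball_ind 2 t s * h t)%:E) mJ); last first.
    by move=> s t; rewrite lee_fin mulr_ge0.
  under eq_integral => t _.
    under eq_integral do rewrite mulrC.
    rewrite ge0_integralZlR//; last first.
      by apply: measurable_ball_ind => //; exact: measurable_cst.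
    under eq_integral do rewrite /ball_ind nearC.
    rewrite -/(ball_ind _ _ _) integral_ball// (_ : 2 * 2 = 4 :> R); last by lra.
    rewrite -EFinM mulrC.
    over.
  by rewrite ge0_integralZlR ?exprn_ge0.
apply: (@le_trans _ _ (B%:E * (k%:E * (pi ^+ n)%:E + (10 ^+ n / k)%:E * ((4 ^+ n)%:E * (k ^+ 2)%:E)))%E).
  apply: lee_wpmul2l; first by rewrite lee_fin ltW.
  by rewrite leeD2l//; apply: lee_wpmul2l => //; apply: lee_wpmul2l.
rewrite [leLHS](_ : _ = (B * (k * pi ^+ n + 10 ^+ n / k * (4 ^+ n * k ^+ 2)))%:E).
  rewrite lee_fin /C le_eqVlt; apply/orP; left; apply/eqP.
  by field; rewrite gt_eqF.
by rewrite -!EFinM.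
Qed.

Lemma cmeasurable_localization a phi1 phi2 f g : cmeasurable a -> cmeasurable phi1 ->
  cmeasurable phi2 -> cmeasurable f -> cmeasurable g ->
  cmeasurable (localization_integrand a phi1 phi2 f g).
Proof.
move=> ma m1 m2 mf mg; apply: cmeasurableM; first apply: cmeasurableM => //.
  exact: cmeasurable_stft_at.
by apply: cmeasurableJ; exact: cmeasurable_stft_at.
Qed.

(** Replacing [psi] of [f] by its supremum and integrating that of [g] is crude. What matters is
    that the bound is linear in [k], which is the continuity needed for a density. *)
Lemma form_bound (e rho1 rho2 K Kf Cg k m1 m2 : R) phi1 phi2
    (Phi1 Phi2 : Rn R (n + n) -> R) f g :
  0 <= K -> 0 <= Kf -> 0 <= Cg -> 0 <= m1 -> 0 <= m2 -> 0 <= k ->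
  dominated e phi1 Phi1 -> dominated e phi2 Phi2 ->
  (\int[mu2]_z (Phi1 z)%:E <= m1%:E)%E -> (\int[mu2]_z (Phi2 z)%:E <= m2%:E)%E ->
  cmeasurable f -> cmeasurable g ->
  (forall s, psi rho1 f s <= Kf) ->
  (forall y, (\int[mu]_s (psi rho2 g (addRn s y))%:E <= (Cg * k)%:E)%E) ->
  (\int[mu2]_z1 \int[mu2]_z2 ((Phi1 z1 * Phi2 z2)%:E *
     \int[mu]_tau (K * (psi rho1 f (addRn tau (posn z1)) * psi rho2 g (addRn tau (posn z2))))%:E)
   <= (K * Kf * Cg * m1 * m2 * k)%:E)%E.
Proof.
move=> K0 Kf0 Cg0 m10 m20 k0 [_ mP1 P10 _] [_ mP2 P20 _] i1 i2 mf mg fK gC.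
pose c := K * Kf * Cg * k; have c0 : 0 <= c by rewrite !mulr_ge0.
apply: (@le_trans _ _ (\int[mu2]_z1 \int[mu2]_z2 (c * Phi1 z1 * Phi2 z2)%:E)%E).
  apply: ge0_le_integralT => z1.
    apply: integral_ge0 => z2 _; apply: mule_ge0; first by rewrite lee_fin mulr_ge0.
    by apply: integral_geEFin0 => tau; rewrite !mulr_ge0 ?psi_ge0.
  apply: ge0_le_integralT => z2.
    apply: mule_ge0; first by rewrite lee_fin mulr_ge0.
    by apply: integral_geEFin0 => tau; rewrite !mulr_ge0 ?psi_ge0.
  have -> : (c * Phi1 z1 * Phi2 z2)%:E = ((Phi1 z1 * Phi2 z2)%:E * c%:E)%E.
    by rewrite -EFinM; congr EFin; ring.
  apply: lee_wpmul2l; first by rewrite lee_fin mulr_ge0.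
  apply: (@le_trans _ _ (\int[mu]_tau (K * Kf * psi rho2 g (addRn tau (posn z2)))%:E)%E).
    apply: ge0_le_integralR => tau; first by rewrite !mulr_ge0 ?psi_ge0.
    by rewrite -[leRHS]mulrA; apply: ler_wpM2l => //; rewrite ler_wpM2r ?psi_ge0.
  rewrite ge0_integralZlR ?mulr_ge0//; last 2 first.
  - apply: (measurableT_comp (measurable_psi rho2 mg)).
    by apply: measurable_addRn => //; exact: measurable_cst.
  - by move=> tau; exact: psi_ge0.
  rewrite (_ : c = K * Kf * (Cg * k)) ?EFinM; last by rewrite /c; ring.
  rewrite -EFinM [leRHS]EFinM; apply: lee_wpmul2l => //.
  by rewrite lee_fin mulr_ge0.
under eq_integral => z1 _.
  rewrite ge0_integralZlR//; last by rewrite mulr_ge0.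
  over.
rewrite ge0_integralZr//; last 3 first.
- by apply/measurable_EFinP; exact: measurable_funM.
- by move=> z1 _; rewrite lee_fin mulr_ge0.
- exact: integral_geEFin0.
rewrite ge0_integralZlR//.
apply: (@le_trans _ _ (c%:E * m1%:E * m2%:E)%E).
  apply: lee_pmul => //; first by apply: mule_ge0 => //; exact: integral_geEFin0.
    exact: integral_geEFin0.
  exact: lee_wpmul2l.
by rewrite -!EFinM lee_fin /c le_eqVlt; apply/orP; left; apply/eqP; ring.
Qed.

End trilinear.

(** * Representation and duality *)

Section signed_density.
Context {R : realType} {n : nat}.
Notation mu := (lebesgue_Rn R n).
Variables (N : set (Rn R n) -> R) (D : R).
Hypothesis Nadd : forall A B, measurable A -> measurable B -> A `&` B = set0 ->
  N (A `|` B) = N A + N B.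
Hypothesis Nbound : forall A k, measurable A -> 0 < k ->
  (\int[mu]_(t in A) (weight t)%:E <= (k ^+ 2)%:E)%E -> `|N A| <= D * k.

Let N0 : N set0 = 0.
Proof.
have := Nadd measurable0 measurable0 (setI0 _); rewrite setU0 => /eqP.
by rewrite -subr_eq subrr => /eqP.
Qed.

Let nu (A : set (Rn R n)) : \bar R := (N A)%:E.

Let nu0 : nu set0 = 0%E. Proof. by rewrite /nu N0. Qed.

Let nu_fin A : measurable A -> nu A \is a fin_num. Proof. by []. Qed.

Let small A (e : R) : measurable A -> 0 < e ->
  (\int[mu]_(t in A) (weight t)%:E <= ((e / (`|D| + 1)) ^+ 2)%:E)%E -> `|N A| <= e.
Proof.
move=> mA e0 h; have D1 : 0 < `|D| + 1 by rewrite ltr_wpDl.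
have k0 : 0 < e / (`|D| + 1) by rewrite divr_gt0.
apply: le_trans (Nbound mA k0 h) _; rewrite mulrCA ler_piMr ?(ltW e0)//.
by rewrite ler_pdivrMr// mul1r (le_trans (ler_norm _))// lerDl.
Qed.

(** The weight has finite mass, so its integrals over the tails of a disjoint union tend to zero,
    and [N] with them. *)
Let nu_sigma_additive : semi_sigma_additive nu.
Proof.
move=> F mF tF mU; set U := \bigcup_k F k in mU *.
pose w k : \bar R := (\int[mu]_(t in F k) (weight t)%:E)%E.
have w0 k : (0 <= w k)%E by apply: integral_ge0 => t _; rewrite lee_fin weight_ge0.
have mwE (A : set (Rn R n)) : measurable_fun A (fun t : Rn R n => (weight t)%:E).
  by apply: measurable_funTS; apply/measurable_EFinP; exact: measurable_weight.
have wU : (\sum_(0 <= k <oo) w k < +oo)%E.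
  rewrite -ge0_integral_bigcup//; last by move=> t _; rewrite lee_fin weight_ge0.
  apply: (@le_lt_trans _ _ (\int[mu]_t (weight t)%:E)%E); last by rewrite integral_weight ltry.
  apply: ge0_subset_integral => //.
  by move=> t _; rewrite lee_fin weight_ge0.
have tail := nneseries_tail_cvg wU (fun k _ => w0 k).
pose V k := \bigcup_i F (i + k)%N.
have mV k : measurable (V k) by apply: bigcupT_measurable.
have wV k : (\int[mu]_(t in V k) (weight t)%:E = \sum_(k <= i <oo) w i)%E.
  rewrite -nneseries_addn// ge0_integral_bigcup//.
    by move=> t _; rewrite lee_fin weight_ge0.
  apply/trivIsetP => i j _ _ ij; move/trivIsetP : tF; apply => //.
  by rewrite eqn_add2r.
(* Finite additivity reduces convergence of the partial sums to smallness of [N] on the tail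
   [V k]. *)
have NV k : N U = \sum_(0 <= i < k) N (F i) + N (V k).
  elim: k => [|k IH].
    by rewrite big_nil add0r; congr N; rewrite /V; under eq_bigcupr do rewrite addn0.
  rewrite big_nat_recr//= -addrA -Nadd//.
    rewrite IH; congr (_ + N _); apply/seteqP; split => t.
      by move=> [[|i] _ Fi]; [left; move: Fi; rewrite add0n|right; exists i; rewrite // addnS -addSn].
    by move=> [Fk|[i _ Fi]]; [exists 0%N|exists i.+1; rewrite // addSn -addnS].
  apply/seteqP; split => t // -[Fk [i _ Fi]].
  move/trivIsetP : tF => /(_ k (i + k.+1)%N I I) => h.
  have : (F k `&` F (i + k.+1)%N) t by [].
  by rewrite h// addnS ltn_eqF// ltnS leq_addl.
rewrite (_ : (fun k => _) = fun k => (N U - N (V k))%:E); last first.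
  apply/funext => k; rewrite /nu sumEFin (NV k); congr EFin; ring.
apply/cvg_EFin; first exact: nearW.
apply/cvgrPdist_le => e e0.
have D1 : 0 < `|D| + 1 by rewrite ltr_wpDl.
have k2 : 0 < (e / (`|D| + 1)) ^+ 2 by rewrite exprn_gt0// divr_gt0.
have ev : \forall k \near \oo, (\sum_(k <= i <oo) w i < ((e / (`|D| + 1)) ^+ 2)%:E)%E.
  have /fine_cvgP[f1 f2] := tail; have f3 := (cvgr_lt _ f2 _ k2 : \forall k \near \oo, _).
  apply: filterS2 f1 (f3 _) => k fk lk; by rewrite -[ltLHS]fineK.
near=> k; rewrite /= opprB addrC subrK.
apply: small => //; rewrite wV; apply: ltW; near: k; exact: ev.
Unshelve. all: by end_near. Qed.

HB.instance Definition _ := isCharge.Build _ _ _ nu nu0 nu_fin nu_sigma_additive.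

Let nu_charge : {charge set (Rn R n) -> \bar R} := nu.

(* Continuity at the weighted L^2 norm makes N countably additive and absolutely
   continuous, so that Radon-Nikodym applies. *)
Lemma signed_density : exists2 h : Rn R n -> R, mu.-integrable setT (EFin \o h) &
  forall A, measurable A -> ((N A)%:E = \int[mu]_(t in A) (h t)%:E)%E.
Proof.
have dom : nu_charge `<< mu.
  apply/null_content_dominatesP => A mA muA.
  congr EFin; apply/eqP; rewrite -normr_le0; apply/ler_addgt0Pr => e e0; rewrite add0r.
  apply: small => //.
  rewrite (_ : (\int[mu]_(t in A) (weight t)%:E)%E = 0%E); last first.
    apply: (@null_set_integral _ _ _ mu A (fun t => (weight t)%:E)) => //.
    by apply/measurable_funTS/measurable_EFinP; exact: measurable_weight.
  by rewrite lee_fin sqr_ge0.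
have ih := Radon_Nikodym_integrable dom.
pose f := Radon_Nikodym nu_charge mu.
have ff t : f t \is a fin_num by exact: Radon_Nikodym_fin_num.
exists (fine \o f).
  by apply: eq_integrable ih => // t _ /=; rewrite fineK.
move=> A mA; rewrite -[LHS]/(nu_charge A) (Radon_Nikodym_integral dom mA).
by apply: eq_integral => t _; rewrite /= fineK.
Qed.

End signed_density.

(** * A density for a form continuous in weighted L^2 *)

Section riesz.
Context {R : realType} {n : nat}.
Notation mu := (lebesgue_Rn R n).
Implicit Types (g : Rn R n -> R[i]) (G : Rn R n -> R).

(** This class contains the Schwartz functions and the bounded functions supported in one cube, so
    it serves both the weak definition of the operator and the duality argument. *)
Definition weight_bounded g := cmeasurable g /\
  exists M : R, forall t, normc (g t) <= M * weight t.

Variables (B : (Rn R n -> R[i]) -> R[i]) (D : R).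
Hypothesis Blin : forall c g1 g2, weight_bounded g1 -> weight_bounded g2 ->
  B (fun t => c * g1 t + g2 t) = conjc c * B g1 + B g2.
Hypothesis Bbound : forall k g, 0 < k -> weight_bounded g -> weighted_L2 k g ->
  normc (B g) <= D * k.

Let wt G t : R[i] := (G t * weight t)%:C%C.

Let bounded_meas G := measurable_fun setT G /\ exists M : R, forall t, `|G t| <= M.

Let wt_bounded G : bounded_meas G -> weight_bounded (wt G).
Proof.
move=> [mG [M hM]]; split.
  by apply: cmeasurable_real; apply: measurable_funM => //; exact: measurable_weight.
exists M => t; rewrite normc_real normrM (ger0_norm (weight_ge0 t)).
by rewrite ler_wpM2r ?weight_ge0.
Qed.

Let wt_lin (c : R) G1 G2 : (fun t => c%:C%C * wt G1 t + wt G2 t) = wt (fun t => c * G1 t + G2 t).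
Proof.
by apply/funext => t; rewrite /wt -!(rmorphM, rmorphD)/=; congr (_%:C%C); ring.
Qed.

Let weighted_L2_wt (k : R) G : bounded_meas G ->
  (\int[mu]_t (G t ^+ 2 * weight t)%:E <= (k ^+ 2)%:E)%E -> weighted_L2 k (wt G).
Proof.
move=> bG h; split; first by have [] := wt_bounded bG.
apply: le_trans h; apply: ge0_le_integralR => t.
  by rewrite divr_ge0 ?sqr_ge0 ?weight_ge0.
rewrite normc_real real_normK ?num_real// exprMn le_eqVlt; apply/orP; left; apply/eqP.
by field; rewrite gt_eqF// weight_gt0.
Qed.

Let bounded_indic (A : set (Rn R n)) : measurable A -> bounded_meas (\1_A).
Proof.
move=> mA; split; first exact: measurable_indic.
by exists 1 => t; rewrite ger0_norm ?indic_le1.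
Qed.

Let indicU (A1 A2 : set (Rn R n)) : A1 `&` A2 = set0 ->
  wt (\1_(A1 `|` A2)) = fun t => 1%:C%C * wt (\1_A1) t + wt (\1_A2) t.
Proof.
move=> A0; rewrite wt_lin; congr wt; apply/funext => t; rewrite mul1r !indicE in_setU.
have [t1|t1] := boolP (t \in A1); have [t2|t2] := boolP (t \in A2); rewrite ?addr0 ?add0r//.
by have : (A1 `&` A2) t; [split; exact: set_mem|rewrite A0].
Qed.

Let density_part (q : R[i] -> R) : (forall z1 z2, q (z1 + z2) = q z1 + q z2) ->
  (forall z, `|q z| <= normc z) ->
  exists2 h : Rn R n -> R, mu.-integrable setT (EFin \o h) &
    forall A, measurable A -> ((q (B (wt (\1_A))))%:E = \int[mu]_(t in A) (h t)%:E)%E.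
Proof.
move=> qD qn; apply: (@signed_density _ _ _ D) => [A1 A2 m1 m2 A0|A k mA k0 h].
  rewrite indicU// Blin.
  - by rewrite conjc_real mul1r qD.
  - exact/wt_bounded/bounded_indic.
  - exact/wt_bounded/bounded_indic.
apply: le_trans (qn _) _; apply: Bbound => //; first exact/wt_bounded/bounded_indic.
apply: weighted_L2_wt; first exact: bounded_indic.
apply: le_trans h; rewrite [leRHS]integral_mkcond.
apply: ge0_le_integralT => t; first by rewrite lee_fin mulr_ge0 ?sqr_ge0 ?weight_ge0.
by rewrite /patch indicE; case: ifPn => _; rewrite ?expr1n ?mul1r// expr0n mul0r.
Qed.

(** Radon-Nikodym yields [h] representing [B] on the weight times indicators. Step functions follow
    by linearity and bounded multiples of the weight by uniform approximation; every test function
    is of that kind, so the density is [h] divided by the weight. *)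
Lemma riesz : exists2 F : Rn R n -> R[i], cmeasurable F & forall g, weight_bounded g ->
  cintegrable mu (fun t => F t * conjc (g t)) /\
  B g = cintegral mu (fun t => F t * conjc (g t)).
Proof.
have [h1 i1 e1] := density_part (@ReD R) (@normc_Re R).
have [h2 i2 e2] := density_part (@ImD R) (@normc_Im R).
pose h t : R[i] := Complex (h1 t) (h2 t).
have ih : cintegrable mu h by split.
have mh := cintegrable_meas ih.
pose good G := bounded_meas G /\ B (wt G) = cintegral mu (fun t => h t * (G t)%:C%C).
have ihG G : bounded_meas G -> cintegrable mu (fun t => h t * (G t)%:C%C).
  move=> [mG [M hM]]; apply: (cintegrable_mul_bounded (M := M)) => //.
    by move=> t; rewrite normc_real.
have bounded_lin (c : R) G1 G2 : bounded_meas G1 -> bounded_meas G2 ->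
    bounded_meas (fun t => c * G1 t + G2 t).
  move=> [m1 [M1 hM1]] [m2 [M2 hM2]]; split.
    by apply: measurable_funD => //; exact: measurable_funM.
  exists (`|c| * M1 + M2) => t; rewrite (le_trans (ler_normD _ _))// lerD//.
  by rewrite normrM ler_wpM2l.
have int_lin (c : R) G1 G2 : bounded_meas G1 -> bounded_meas G2 ->
    cintegral mu (fun t => h t * (c * G1 t + G2 t)%:C%C) =
    c%:C%C * cintegral mu (fun t => h t * (G1 t)%:C%C) + cintegral mu (fun t => h t * (G2 t)%:C%C).
  move=> b1 b2; rewrite -cintegralZl; last exact: ihG.
  rewrite -cintegralD; [|exact/cintegrableZl/ihG|exact: ihG].
  by apply: eq_cintegral => t; rewrite rmorphD rmorphM/=; ring.
have good_lin (c : R) G1 G2 : good G1 -> good G2 -> good (fun t => c * G1 t + G2 t).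
  move=> [b1 E1] [b2 E2]; split; first exact: bounded_lin.
  rewrite -wt_lin Blin; [|exact: wt_bounded|exact: wt_bounded].
  by rewrite conjc_real E1 E2 int_lin.
have good_indic (A : set (Rn R n)) : measurable A -> good (\1_A).
  move=> mA; split; first exact: bounded_indic.
  have R1 (k : Rn R n -> R) : mu.-integrable setT (EFin \o k) ->
      (\int[mu]_(t in A) (k t)%:E = (\int[mu]_t (k t * \1_A t))%:E)%E.
    move=> ik; rewrite /Rintegral fineK; last first.
      apply: (integrable_fin_num measurableT).
      apply: (le_integrable measurableT _ _ ik) => [|t _].
        apply/measurable_EFinP; apply: measurable_funM; last exact: measurable_indic.
        by apply/measurable_EFinP; exact: measurable_int ik.
      rewrite !abse_EFin lee_fin normrM ler_piMr// ger0_norm ?indic_le1//.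
    rewrite [LHS]integral_mkcond; apply: eq_integral => t _.
    by rewrite /patch indicE; case: ifP => _; rewrite ?mulr1 ?mulr0.
  apply: complex_eq.
    have := e1 _ mA; rewrite (R1 h1)// => -[->] /=.
    by apply: eq_Rintegral => t _; rewrite /= mulr0 subr0.
  have := e2 _ mA; rewrite (R1 h2)// => -[->] /=.
  by apply: eq_Rintegral => t _; rewrite /= mulr0 add0r.
have good_sum m (c : nat -> R) (A : nat -> set (Rn R n)) : (forall k, measurable (A k)) ->
    good (fun t => \sum_(0 <= k < m) c k * \1_(A k) t).
  move=> mA; elim: m => [|m IH].
    have := good_lin (-1) _ _ (good_indic _ measurable0) (good_indic _ measurable0).
    by congr good; apply/funext => t; rewrite big_nil mulN1r addNr.
  have := good_lin (c m) _ _ (good_indic _ (mA m)) IH.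
  by congr good; apply/funext => t; rewrite big_nat_recr//= addrC.
have good_bounded G : bounded_meas G -> good G.
  move=> bG; split=> //; have [mG [M hM]] := bG.
  have Ioo := cintegrable_lty ih.
  pose I := fine (\int[mu]_t (normc (h t))%:E)%E.
  have IE : (\int[mu]_t (normc (h t))%:E)%E = I%:E.
    by rewrite fineK// ge0_fin_numE// integral_geEFin0// => t; exact: normc_ge0.
  have pi1 : 1 <= pi ^+ n :> R by rewrite exprn_ege1//; have := @pi_ge2 R; lra.
  (* Approximation within [d] costs [d * D * pi ^+ n] on the left, since [d] times the weight has
     weighted norm at most [d * pi ^+ n], and [d * I] in the integral against [h]. *)
  suff key d : 0 < d -> normc (B (wt G) - cintegral mu (fun t => h t * (G t)%:C%C)) <=
      d * (D * pi ^+ n + I).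
    apply/eqP; rewrite -subr_eq0; apply/eqP/Normc.eq0_normc/eqP.
    rewrite eq_le normc_ge0 andbT; apply/ler_addgt0Pr => e e0; rewrite add0r.
    have K0 : 0 < `|D * pi ^+ n + I| + 1 by rewrite ltr_wpDl.
    have := key (e / (`|D * pi ^+ n + I| + 1)) (divr_gt0 e0 K0).
    move=> /le_trans; apply; rewrite mulrAC ler_pdivrMr// ler_wpM2l ?(ltW e0)//.
    by rewrite (le_trans (ler_norm _))// lerDl.
  (* [J] exceeds [M / d] by more than 1, so that [floor (G t / d)], raised by [J], is a natural
     number below [J + J]; the sets [A k] are the level sets of this rounding. *)
  move=> d0; pose J := (Num.truncn (M / d)).+2.
  pose A k : set (Rn R n) := [set t | Num.floor (G t / d) = k%:Z - J%:Z].
  have mA k : measurable (A k).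
    have mGd : measurable_fun setT (fun t => G t / d) by exact: measurable_funM.
    rewrite (_ : A k = setT `&` (fun t => G t / d) @^-1`
        `[(k%:Z - J%:Z)%:~R, (k%:Z - J%:Z + 1)%:~R[%classic).
      by apply: mGd.
    by rewrite setTI; apply/seteqP; split => t /=; rewrite in_itv/= -floor_eq => /eqP.
  pose S t : R := \sum_(0 <= k < J + J) (d * (k%:R - J%:R)) * \1_(A k) t.
  have SE t : S t = d * (Num.floor (G t / d))%:~R.
    have Md : 0 <= M / d by rewrite divr_ge0 ?(ltW d0)// (le_trans _ (hM t)).
    have := hM t; rewrite -(ler_pM2r (x := d^-1)) ?invr_gt0// -[X in _ * X]gtr0_norm ?invr_gt0//.
    rewrite -normrM => hG; have /andP[_ tr] := truncn_itv Md.
    have /andP[l1 l2] : - (J%:R : R) + 1 <= G t / d < J%:R - 1.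
      move: hG; rewrite ler_norml => /andP[g1 g2]; rewrite /J -addn2 natrD.
      by move: tr; rewrite -addn1 natrD => tr; apply/andP; split; lra.
    have [i0 i0E] : exists i0 : nat, Num.floor (G t / d) = i0%:Z - J%:Z.
      exists (absz (Num.floor (G t / d) + J%:Z)); rewrite gez0_abs ?addrK//.
      rewrite -lerBlDr sub0r floor_ge_int rmorphN/=; lra.
    have i0J : (i0 < J + J)%N.
      have : Num.floor (G t / d) < J%:Z by rewrite floor_lt_int; lra.
      by rewrite i0E ltrBlDr -PoszD ltz_nat.
    rewrite /S big_mkord (bigD1 (Ordinal i0J))//= big1 ?addr0.
      rewrite indicE mem_set ?mulr1; last by rewrite /A /= i0E.
      by rewrite i0E intrB.
    move=> i ii0; rewrite indicE memNset ?mulr0// /A /= i0E => /eqP.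
    by rewrite (inj_eq (addIr _)) eqz_nat => /eqP e; move: ii0; rewrite -val_eqE/= e eqxx.
  have gS : good S by exact: good_sum.
  have SG t : `|-1 * S t + G t| <= d.
    rewrite SE mulN1r; have /andP[f1 f2] := floor_itv (G t / d).
    move: f1 f2; rewrite intrD ler_pdivlMr// ltr_pdivrMr// => f1 f2.
    by rewrite ler_norml; apply/andP; split; lra.
  have bD : bounded_meas (fun t => -1 * S t + G t) by apply: bounded_lin => //; exact: gS.1.
  have -> : B (wt G) - cintegral mu (fun t => h t * (G t)%:C%C) =
      B (wt (fun t => -1 * S t + G t)) - cintegral mu (fun t => h t * (-1 * S t + G t)%:C%C).
    rewrite -wt_lin Blin; [|exact/wt_bounded/gS.1|exact: wt_bounded].
    by rewrite int_lin// ?gS.2; [rewrite conjc_real; ring|exact: gS.1].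
  apply: le_trans (le_normcD _ _) _; rewrite normcN mulrDr; apply: lerD.
    rewrite mulrCA; apply: Bbound; first by rewrite mulr_gt0// (lt_le_trans ltr01).
      exact: wt_bounded.
    apply: weighted_L2_wt => //.
    apply: (@le_trans _ _ (\int[mu]_t (d ^+ 2 * weight t)%:E)%E).
      apply: ge0_le_integralR => t; first by rewrite mulr_ge0 ?sqr_ge0 ?weight_ge0.
      rewrite ler_wpM2r ?weight_ge0// -[leLHS]real_normK ?num_real//.
      by rewrite lerXn2r ?nnegrE ?(ltW d0).
    rewrite ge0_integralZlR ?sqr_ge0//; last 2 first.
    + exact: measurable_weight.
    + exact: weight_ge0.
    rewrite integral_weight -EFinM lee_fin exprMn ler_wpM2l ?sqr_ge0//.
    by rewrite expr2 ler_peMl// (le_trans ler01).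
  rewrite -lee_fin; apply: le_trans (normc_cintegral (ihG _ bD)) _.
  apply: (@le_trans _ _ (\int[mu]_t (d * normc (h t))%:E)%E).
    apply: ge0_le_integralR => t; first exact: normc_ge0.
    by rewrite Normc.normcM normc_real mulrC ler_wpM2r ?normc_ge0.
  rewrite ge0_integralZlR ?(ltW d0)//; last 2 first.
  - exact: measurable_normc.
  - by move=> t; exact: normc_ge0.
  by rewrite IE EFinM.
(* The forms were tested on the weight times [G], so the weight has to be divided out of the
   density. *)
exists (fun t => h t * ((weight t)^-1)%:C%C).
  by apply: cmeasurableM => //; apply: cmeasurable_real; exact: measurable_weightV.
move=> g [mg [M hM]].
pose G1 t := complex.Re (g t) / weight t; pose G2 t := complex.Im (g t) / weight t.
have bG (q : R[i] -> R) : (forall z, `|q z| <= normc z) -> measurable_fun setT (fun t => q (g t)) ->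
    bounded_meas (fun t => q (g t) / weight t).
  move=> qn mq; split; first by apply: measurable_funM => //; exact: measurable_weightV.
  exists M => t; rewrite normrM [X in _ * X]ger0_norm ?invr_ge0 ?weight_ge0//.
  by rewrite ler_pdivrMr ?weight_gt0//; exact: le_trans (qn _) (hM t).
have b1 := bG _ (@normc_Re R) mg.1; have b2 := bG _ (@normc_Im R) mg.2.
have [_ E1] := good_bounded _ b1; have [_ E2] := good_bounded _ b2.
have gE : g = fun t => Complex 0 1 * wt G2 t + wt G1 t.
  apply/funext => t; apply: complex_eq; rewrite /= /G1 /G2.
    by rewrite !divfK ?gt_eqF ?weight_gt0//; ring.
  by rewrite !divfK ?gt_eqF ?weight_gt0//; ring.
have FE t : h t * ((weight t)^-1)%:C%C * conjc (g t) =
    conjc (Complex 0 1) * (h t * (G2 t)%:C%C) + h t * (G1 t)%:C%C.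
  by apply: complex_eq; rewrite /= /G1 /G2; case: (g t) => x y /=; ring.
under eq_fun do rewrite FE.
split.
  by apply: cintegrableD; [apply: cintegrableZl|]; exact: ihG.
rewrite {1}gE Blin; [|exact: wt_bounded|exact: wt_bounded].
rewrite E1 E2 cintegralD ?cintegralZl//.
- exact: ihG.
- by apply: cintegrableZl; exact: ihG.
- exact: ihG.
Qed.

End riesz.

(** * Duality on a single cube *)

Section duality.
Context {R : realType} {n : nat}.
Notation mu := (lebesgue_Rn R n).
Implicit Types (g : Rn R n -> R[i]) (h : Rn R n -> R) (t : Rn R n) (k : n.-tuple int).

Lemma indic_cube k t : \1_(cube k) t = (floorRn t == k)%:R :> R.
Proof. by rewrite indicE; case: eqP => tk; [rewrite mem_set// cubeE|rewrite memNset// cubeE]. Qed.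

Definition supported k g := forall t, floorRn t != k -> g t = 0.

Lemma floorRn_surj k : floorRn [tuple (tnth k i)%:~R : measurableTypeR R | i < n] = k.
Proof. by apply: eq_from_tnth => i; rewrite tnth_mktuple coord_mk intrKfloor. Qed.

Lemma bounded_supported k g (M : R) : cmeasurable g -> (forall t, normc (g t) <= M) ->
  supported k g -> weight_bounded g.
Proof.
move=> mg gM gk; split=> //.
pose t0 : Rn R n := [tuple (tnth k i)%:~R : measurableTypeR R | i < n].
have M0 : 0 <= M := le_trans (normc_ge0 _) (gM t0).
have c0 : 0 < (2 + 2 * 1 ^+ 2) ^+ n :> R by rewrite exprn_gt0// expr1n; lra.
exists (M * ((2 + 2 * 1 ^+ 2) ^+ n / weight t0)) => t.
have [tk|tk] := eqVneq (floorRn t) k; last first.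
  by rewrite gk// Normc.normc0 !mulr_ge0 ?invr_ge0 ?weight_ge0 ?(ltW c0).
apply: le_trans (gM t) _; rewrite -mulrA ler_peMr// mulrAC ler_pdivlMr ?weight_gt0// mul1r.
by apply: weight_slow => i; apply: floor_eq_dist; rewrite tk floorRn_surj.
Qed.

(** The phase of [z], with value 0 at [z = 0] because the inverse of 0 is 0. *)
Definition csgn (z : R[i]) : R[i] := (normc z)^-1%:C%C * z.

Lemma mul_conj_csgn z : z * conjc (csgn z) = (normc z)%:C%C.
Proof.
have [->|z0] := eqVneq z 0; first by rewrite mul0r Normc.normc0.
rewrite /csgn conjcM conjc_real mulrCA -normc_sqr_conj -rmorphM/=; congr (_%:C%C).
by rewrite expr2 mulKf//; apply: contra_neq z0 => /Normc.eq0_normc.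
Qed.

Lemma normc_csgn z : normc (csgn z) <= 1.
Proof.
have [->|z0] := eqVneq z 0; first by rewrite /csgn mulr0 Normc.normc0.
rewrite /csgn Normc.normcM normc_real ger0_norm ?invr_ge0 ?normc_ge0// mulVf//.
by apply: contra_neq z0 => /Normc.eq0_normc.
Qed.

Lemma cmeasurable_csgn (F : Rn R n -> R[i]) : cmeasurable F -> cmeasurable (fun t => csgn (F t)).
Proof.
move=> mF; apply: cmeasurableM => //; apply: cmeasurable_real.
have mV : measurable_fun setT (fun y : R => y `^ (-1)) by exact: measurable_powR.
have := measurableT_comp mV (measurable_normc mF).
congr measurable_fun; apply/funext => t /=; rewrite powR_inv1//; exact: normc_ge0.
Qed.

Variables (F : Rn R n -> R[i]) (k : n.-tuple int) (rho X : R).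
Hypotheses (mF : cmeasurable F) (X0 : 0 <= X).
Hypothesis iF : forall g, weight_bounded g -> cintegrable mu (fun t => F t * conjc (g t)).
Hypothesis bF : forall g Y, weight_bounded g -> supported k g -> 0 <= Y ->
  (\int[mu]_t (normc (g t) `^ rho)%:E <= (Y `^ rho)%:E)%E ->
  normc (cintegral mu (fun t => F t * conjc (g t))) <= X * Y.

(** Testing against [h] times the phase of [F] turns the bound on the form into a bound on the
    integral of [h * |F|]. *)
Let dual_real h (M Y : R) : 0 <= rho -> measurable_fun setT h -> (forall t, 0 <= h t <= M) ->
  (forall t, floorRn t != k -> h t = 0) -> 0 <= Y ->
  (\int[mu]_t (h t `^ rho)%:E <= (Y `^ rho)%:E)%E ->
  (\int[mu]_t (h t * normc (F t))%:E <= (X * Y)%:E)%E.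
Proof.
move=> rho0 mh hM hk Y0 hY.
have h0 t : 0 <= h t by have /andP[] := hM t.
pose g t := (h t)%:C%C * csgn (F t).
have gh t : normc (g t) <= h t.
  rewrite /g Normc.normcM normc_real ger0_norm// ler_piMr//; exact: normc_csgn.
have mg : cmeasurable g.
  by apply: cmeasurableM; [exact: cmeasurable_real|exact: cmeasurable_csgn].
have gk : supported k g by move=> t tk; rewrite /g hk// mul0r.
have gw : weight_bounded g.
  apply: (bounded_supported (M := M) mg _ gk) => t.
  by apply: le_trans (gh t) _; have /andP[] := hM t.
have FgE t : F t * conjc (g t) = (h t * normc (F t))%:C%C.
  by rewrite /g conjcM conjc_real mulrCA mul_conj_csgn -rmorphM.
have ig := iF gw.
have mhF : measurable_fun setT (fun t => h t * normc (F t)).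
  by apply: measurable_funM => //; exact: measurable_normc.
have hF0 t : 0 <= h t * normc (F t) by rewrite mulr_ge0 ?normc_ge0.
have lty : (\int[mu]_t (h t * normc (F t))%:E < +oo)%E.
  apply: le_lt_trans (cintegrable_lty ig); apply: ge0_le_integralR => t //.
  by rewrite FgE normc_real ger0_norm.
rewrite (cintegral_ge0 mhF hF0 lty) lee_fin.
under [X in cintegral _ X]eq_fun do rewrite -FgE.
apply: (bF gw gk Y0); apply: le_trans hY; apply: ge0_le_integralR => t; first exact: powR_ge0.
by apply: powR_le; rewrite ?normc_ge0.
Qed.

Let cubeI t : bool := floorRn t == k.

Let measurable_cubeI : measurable_fun setT (fun t : Rn R n => (cubeI t)%:R : R).
Proof. exact: (measurable_floor (fun j => (j == k)%:R : R)). Qed.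

Let level (b : R -> bool) : measurable_fun setT (fun x => (b x)%:R : R) ->
  measurable_fun setT (fun t => (cubeI t && b (normc (F t)))%:R : R).
Proof.
move=> mb; rewrite (_ : (fun t => _) = fun t => (cubeI t)%:R * (b (normc (F t)))%:R).
  apply: measurable_funM => //.
  by have := measurableT_comp mb (measurable_normc mF).
by apply/funext => t; rewrite -natrM mulnb.
Qed.

Let mle (N : R) : measurable_fun setT (fun x : R => (x <= N)%R%:R : R).
Proof.
rewrite (_ : (fun x => _) = \1_(`]-oo, N]%classic)); first exact: measurable_indic.
by apply/funext => x; rewrite indicE mem_setE in_itv.
Qed.

Let mgt (N : R) : measurable_fun setT (fun x : R => (N < x)%R%:R : R).
Proof.
rewrite (_ : (fun x => _) = \1_(`]N, +oo[%classic)); first exact: measurable_indic.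
by apply/funext => x; rewrite indicE mem_setE in_itv/= andbT.
Qed.

(** The extremal test function [|F|^(r - 1)] on the cube, cut off where [|F| > N]. The cut-off makes
    it admissible and its integral [I] finite, so that [I <= X * I^(1 / rho)] can be divided by the
    power of [I]; then [N] tends to infinity by monotone convergence. *)
Lemma duality_powR : 1 < rho ->
  (\int[mu]_t (\1_(cube k) t * normc (F t) `^ (rho / (rho - 1)))%:E <=
     (X `^ (rho / (rho - 1)))%:E)%E.
Proof.
move=> rho1; set r := rho / (rho - 1).
have rm : 0 < rho - 1 by rewrite subr_gt0.
have r1 : 1 < r by rewrite ltr_pdivlMr// mul1r; lra.
have rr : (r - 1) * rho = r by rewrite /r; field; rewrite gt_eqF.
have rV : 1 - rho^-1 = r^-1 by rewrite /r; field; rewrite !gt_eqF//; lra.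
have rho0 : 0 < rho by lra.
have r0 : 0 < r by lra.
have nF t := normc_ge0 (F t).
pose E N t : R := (cubeI t && (normc (F t) <= N%:R))%:R.
have E0 N t : 0 <= E N t by [].
have mE N : measurable_fun setT (E N) by exact: (level (mle _)).
have mFr q : measurable_fun setT (fun t => normc (F t) `^ q).
  exact/measurable_funPR/measurable_normc.
have mG N : measurable_fun setT (fun t => E N t * normc (F t) `^ r).
  exact: measurable_funM.
have step (N : nat) : (\int[mu]_t (E N t * normc (F t) `^ r)%:E <= (X `^ r)%:E)%E.
  pose h t := E N t * normc (F t) `^ (r - 1).
  have hN t : E N t * normc (F t) `^ r <= \1_(cube k) t * N%:R `^ r.
    rewrite /E indic_cube /cubeI; case: (boolP (_ && _)) => [/andP[/eqP-> h1]|_].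
      rewrite eqxx /= !mul1r; apply: powR_le => //; exact: ltW.
    by rewrite mul0r mulr_ge0 ?powR_ge0.
  pose I := fine (\int[mu]_t (E N t * normc (F t) `^ r)%:E)%E.
  have I0 : (0 <= \int[mu]_t (E N t * normc (F t) `^ r)%:E)%E.
    by apply: integral_geEFin0 => t; rewrite mulr_ge0 ?powR_ge0.
  have IE : (\int[mu]_t (E N t * normc (F t) `^ r)%:E)%E = I%:E.
    rewrite fineK// ge0_fin_numE//.
    apply: (@le_lt_trans _ _ (\int[mu]_t (N%:R `^ r * \1_(cube k) t)%:E)%E).
      apply: ge0_le_integralR => t; first by rewrite mulr_ge0 ?powR_ge0.
      by rewrite [leRHS]mulrC.
    rewrite ge0_integralZlR ?powR_ge0//; last by apply: measurable_indic; exact: measurable_cube.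
    by rewrite integral_cube mule1 ltry.
  have Ige : 0 <= I by rewrite -lee_fin -IE.
  have key : I <= X * I `^ rho^-1.
    rewrite -lee_fin -IE.
    have hF t : E N t * normc (F t) `^ r = h t * normc (F t).
      rewrite /h -mulrA; congr (_ * _); have [->|F0] := eqVneq (normc (F t)) 0.
        by rewrite mulr0 powR0// gt_eqF.
      by rewrite -[X in _ * X]powRr1// -powRD ?subrK ?F0 ?implybT.
    under eq_integral do rewrite hF.
    apply: (@dual_real _ (N%:R `^ (r - 1))); rewrite ?(ltW rho0) ?powR_ge0//.
    - exact: measurable_funM.
    - move=> t; rewrite /h mulr_ge0 ?powR_ge0//= /E.
      case: (boolP (_ && _)) => [/andP[_ h1]|_]; rewrite /= ?mul0r ?powR_ge0//.
      by rewrite mul1r powR_le// subr_ge0 ltW.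
    - by move=> t tk; rewrite /h /E /cubeI (negbTE tk) mul0r.
    - rewrite powRK ?gt_eqF// -IE; apply: ge0_le_integralR => t; first exact: powR_ge0.
      rewrite /h /E; case: (_ && _); last by rewrite !mul0r powR0 ?gt_eqF.
      by rewrite /= !mul1r -powRrM rr.
  rewrite IE lee_fin; have [->|Ipos] := eqVneq I 0; first exact: powR_ge0.
  have Igt : 0 < I by rewrite lt_neqAle eq_sym Ipos.
  have : I `^ r^-1 <= X.
    rewrite -rV powRD ?powRr1 ?Ipos ?implybT// powRN ler_pdivrMr ?powR_gt0//.
  by move=> /(powR_le (ltW r0) (powR_ge0 _ _)); rewrite powRK ?gt_eqF.
have lim t : limn (fun N => (E N t * normc (F t) `^ r)%:E) = (\1_(cube k) t * normc (F t) `^ r)%:E.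
  apply: cvg_lim => //; apply: cvg_near_cst.
  exists (Num.truncn (normc (F t))).+1 => // N /= hN.
  have /andP[_ h1] := truncn_itv (nF t).
  rewrite /E (_ : (normc (F t) <= N%:R) = true); last first.
    by apply: ltW; apply: lt_le_trans h1 _; rewrite ler_nat.
  by rewrite andbT /cubeI indic_cube.
under eq_integral do rewrite -lim.
rewrite monotone_convergence//.
- apply: lime_le; last by apply: nearW => N; exact: step.
  apply: ereal_nondecreasing_is_cvgn => N1 N2 N12; apply: ge0_le_integralR => t.
    by rewrite mulr_ge0 ?powR_ge0.
  rewrite ler_wpM2r ?powR_ge0// /E ler_nat; case: (cubeI t) => //=.
  by case: leP => // h1; rewrite (le_trans h1)// ler_nat.
- by move=> N; apply/measurable_EFinP.
- by move=> N t _; rewrite lee_fin mulr_ge0 ?powR_ge0.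
- move=> t _ N1 N2 N12; rewrite lee_fin ler_wpM2r ?powR_ge0// /E ler_nat; case: (cubeI t) => //=.
  by case: leP => // h1; rewrite (le_trans h1)// ler_nat.
Qed.

(** The test function is the indicator of the part of the cube where [|F| > X]: there [|F| - X] is
    positive, yet its integral is at most zero. *)
Lemma duality_sup : rho = 1 -> {ae mu, forall t, \1_(cube k) t * normc (F t) <= X}.
Proof.
move=> rho1; pose h t : R := (cubeI t && (X < normc (F t)))%:R.
have mh : measurable_fun setT h by exact: (level (mgt _)).
have h0 t : 0 <= h t by [].
have h1 t : h t <= 1 by rewrite /h lern1; case: (_ && _).
have hI t : h t <= \1_(cube k) t.
  by rewrite /h indic_cube /cubeI ler_nat; case: eqP; case: ltP.
have hoo : (\int[mu]_t (h t)%:E <= 1)%E.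
  by rewrite -(integral_cube k); apply: ge0_le_integralR.
pose I := fine (\int[mu]_t (h t)%:E)%E.
have IE : (\int[mu]_t (h t)%:E)%E = I%:E.
  rewrite fineK// ge0_fin_numE ?(le_lt_trans hoo) ?ltry//; exact: integral_geEFin0.
have I0 : 0 <= I by rewrite -lee_fin -IE; exact: integral_geEFin0.
have key : (\int[mu]_t (h t * normc (F t))%:E <= (X * I)%:E)%E.
  apply: (@dual_real _ 1) => //; rewrite ?rho1//.
  - by move=> t; rewrite h0 h1.
  - by move=> t tk; rewrite /h /cubeI (negbTE tk).
  - by rewrite powRr1// -IE; under eq_integral do rewrite powRr1//.
have d0 t : 0 <= h t * (normc (F t) - X).
  by rewrite /h; case: (boolP (_ && _)) => [/andP[_ hX]|_]; rewrite /= ?mul1r ?mul0r// subr_ge0 ltW.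
have md : measurable_fun setT (fun t => h t * (normc (F t) - X)).
  apply: measurable_funM => //; apply: measurable_funB => //; exact: measurable_normc.
have : (\int[mu]_t (h t * (normc (F t) - X))%:E = 0)%E.
  (* Adding the finite number [X * I] on both sides avoids subtracting extended reals. *)
  have : (\int[mu]_t (h t * (normc (F t) - X))%:E + (X * I)%:E <= (X * I)%:E)%E.
    apply: le_trans key.
    rewrite EFinM -IE -ge0_integralZlR// -ge0_integralDR//; last 2 first.
    - exact: measurable_funM.
    - by move=> t; rewrite mulr_ge0.
    apply: ge0_le_integralR => t; first exact: addr_ge0 (d0 t) (mulr_ge0 X0 (h0 t)).
    by rewrite [X * _]mulrC -mulrDr subrK.
  rewrite -[leRHS]add0e leeD2rE// => le0; apply/eqP; rewrite eq_le le0.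
  exact: integral_geEFin0.
move=> /(integral_eq0_ae _ _) h2.
have : {ae mu, forall t, (h t * (normc (F t) - X))%:E = 0%E}.
  by apply: h2; [exact/measurable_EFinP|move=> t; rewrite lee_fin].
apply: filterS => t [] /eqP; rewrite mulf_eq0 subr_eq0 => /orP[|/eqP->].
  rewrite /h pnatr_eq0 eqb0 negb_and -leNgt => /orP[tk|?].
    by rewrite indic_cube -[_ == k]/(cubeI t) (negbTE tk) mul0r.
  by apply: le_trans _ (_ : normc (F t) <= X) => //; rewrite ler_piMl ?normc_ge0 ?indic_le1.
by rewrite ler_piMl ?indic_le1.
Qed.

End duality.

(** * The localization form has a density *)

Section localization.
Context {R : realType} {n : nat}.
Notation mu := (lebesgue_Rn R n).
Notation mu2 := (lebesgue_Rn R (n + n)).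
Implicit Types (f g phi : Rn R n -> R[i]) (a : Rn R (n + n) -> R[i]).

Lemma weight_bounded_L2 g : weight_bounded g -> exists2 k : R, 0 < k & weighted_L2 k g.
Proof.
move=> [mg [M gM]].
have pi0 : 0 < (pi : R) ^+ n by rewrite exprn_gt0// pi_gt0.
have pi1 : 1 <= (pi : R) ^+ n by rewrite exprn_ege1//; have := @pi_ge2 R; lra.
exists ((`|M| + 1) * pi ^+ n); first by rewrite mulr_gt0// ltr_wpDl.
split=> //; apply: (@le_trans _ _ (\int[mu]_t ((`|M| + 1) ^+ 2 * weight t)%:E)%E).
  apply: ge0_le_integralR => t; first by rewrite divr_ge0 ?sqr_ge0 ?weight_ge0.
  rewrite ler_pdivrMr ?weight_gt0// -mulrA -expr2 -exprMn ler_sqr ?nnegrE ?normc_ge0//.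
    apply: le_trans (gM t) _; rewrite ler_wpM2r ?weight_ge0//.
    by rewrite (le_trans (ler_norm _))// lerDl.
  by rewrite mulr_ge0 ?weight_ge0// addr_ge0.
rewrite ge0_integralZlR ?sqr_ge0//; last 2 first.
- exact: measurable_weight.
- exact: weight_ge0.
rewrite integral_weight -EFinM lee_fin exprMn ler_wpM2l ?sqr_ge0//.
by rewrite expr2 ler_peMr// ltW.
Qed.

Lemma stft_lin phi (c : R[i]) f1 f2 x w : cintegrable mu (stft_integrand phi f1 x w) ->
  cintegrable mu (stft_integrand phi f2 x w) ->
  stft phi (fun t => c * f1 t + f2 t) x w = c * stft phi f1 x w + stft phi f2 x w.
Proof.
move=> i1 i2; rewrite /stft -cintegralZl// -cintegralD//; last exact: cintegrableZl.
by apply: eq_cintegral => t; rewrite /stft_integrand; ring.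
Qed.

(** The crude bound with [Kf] only secures the existence of [F]. The conclusion retains the finer
    trilinear bound, because the estimate of the amalgam norm of [F] needs its dependence on
    [tau]. *)
Lemma localization_density (e rho1 rho2 iq : R) : 0 < e -> e <= 1 ->
  1 <= rho1 -> rho1 <= 2 -> 1 <= rho2 -> rho2 <= 2 ->
  0 <= iq -> rho1^-1 + rho2^-1 - 1 <= iq ->
  exists2 C : R, 0 < C & forall a A phi1 phi2 (Phi1 Phi2 : Rn R (n + n) -> R) (m1 m2 Kf : R) f,
    symbol_bound iq a A -> dominated e phi1 Phi1 -> dominated e phi2 Phi2 ->
    0 <= A -> 0 <= m1 -> 0 <= m2 ->
    (\int[mu2]_z (Phi1 z)%:E <= m1%:E)%E -> (\int[mu2]_z (Phi2 z)%:E <= m2%:E)%E ->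
    locally_bounded rho1 f -> (forall s, psi rho1 f s <= Kf) ->
    exists2 F : Rn R n -> R[i], cmeasurable F & forall g, weight_bounded g ->
      [/\ cintegrable mu2 (localization_integrand a phi1 phi2 f g),
          cintegrable mu (fun t => F t * conjc (g t)),
          cintegral mu (fun t => F t * conjc (g t)) =
            cintegral mu2 (localization_integrand a phi1 phi2 f g) &
          locally_bounded rho2 g /\ (\int[mu2]_z (normc (localization_integrand a phi1 phi2 f g z))%:E <=
            \int[mu2]_z1 \int[mu2]_z2 ((Phi1 z1 * Phi2 z2)%:E * \int[mu]_tau
              (C * A * (psi rho1 f (addRn tau (posn z1)) * psi rho2 g (addRn tau (posn z2))))%:E))%E].
Proof.
move=> e0 e1 r11 r12 r21 r22 iq0 hq.
have [C C0 cell] := @cell_estimate R n e rho1 rho2 iq e0 e1 r11 r12 r21 r22 iq0 hq.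
have [Cg Cg0 hg] := @integral_psi_le R n rho2 r21 r22.
exists C => // a A phi1 phi2 Phi1 Phi2 m1 m2 Kf f sa d1 d2 A0 m10 m20 hm1 hm2 lf fK.
have Kf0 : 0 <= Kf := le_trans (psi_ge0 _ _ _) (fK (cstRn n 0)).
have CA0 : 0 <= C * A by apply: mulr_ge0 => //; exact: ltW.
have tri g : locally_bounded rho2 g -> _ := fun lg =>
  trilinear_estimate e0 e1 r11 r21 CA0 sa.1 d1 d2 lf lg
    (fun z1 z2 => cell a A f g z1 z2 sa lf lg).
have [mphi1 _ _ dom1] := d1; have [mphi2 _ _ dom2] := d2.
have lb g : weight_bounded g -> locally_bounded rho2 g.
  by move=> /weight_bounded_L2[k k0 hk]; have [] := hg _ _ k0 hk.
have bound (k : R) g : 0 < k -> weighted_L2 k g ->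
    (\int[mu2]_z (normc (localization_integrand a phi1 phi2 f g z))%:E <=
      (C * A * Kf * Cg * m1 * m2 * k)%:E)%E.
  move=> k0 hk; have [lg pg] := hg _ _ k0 hk.
  apply: le_trans (tri g lg) _.
  exact: (form_bound CA0 Kf0 (ltW Cg0) m10 m20 (ltW k0) d1 d2 hm1 hm2 lf.1 lg.1 fK pg).
have iloc g : weight_bounded g -> cintegrable mu2 (localization_integrand a phi1 phi2 f g).
  move=> gw; have [k k0 hk] := weight_bounded_L2 gw.
  apply/cintegrableP; split.
    by apply: cmeasurable_localization => //; [exact: sa.1|exact: lf.1|exact: gw.1].
  by apply: le_lt_trans (bound _ _ k0 hk) _; rewrite ltry.
pose B g := cintegral mu2 (localization_integrand a phi1 phi2 f g).
have wb g : weight_bounded g -> forall x w, cintegrable mu (stft_integrand phi2 g x w).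
  move=> /lb lg; have [+ _] := dom2 g lg.1 (locally_bounded_window r21 e0 e1 lg).
  exact.
have Blin c g1 g2 : weight_bounded g1 -> weight_bounded g2 ->
    B (fun t => c * g1 t + g2 t) = conjc c * B g1 + B g2.
  move=> w1 w2; rewrite /B -cintegralZl; last exact: iloc.
  rewrite -cintegralD; [|exact/cintegrableZl/iloc|exact: iloc].
  apply: eq_cintegral => z; rewrite /localization_integrand.
  have -> : stft phi2 (fun t => c * g1 t + g2 t) (posn z) (freq z) =
      c * stft phi2 g1 (posn z) (freq z) + stft phi2 g2 (posn z) (freq z).
    by apply: stft_lin; exact: wb.
  by rewrite conjcD conjcM; ring.
have Bbound (k : R) g : 0 < k -> weight_bounded g -> weighted_L2 k g ->
    normc (B g) <= C * A * Kf * Cg * m1 * m2 * k.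
  move=> k0 gw hk; rewrite -lee_fin; apply: le_trans (normc_cintegral (iloc _ gw)) _.
  exact: bound.
have [F mF hF] := riesz Blin Bbound.
exists F; first exact: mF.
move=> g gw; have [iF BF] := hF g gw.
split; [exact: iloc|exact: iF|by rewrite -BF|].
by split; [exact: lb|exact: tri (lb _ gw)].
Qed.

End localization.

(** * Amalgam norms *)

Section averaging.
Context {R : realType} {n : nat}.
Notation mu := (lebesgue_Rn R n).
Notation mu2 := (lebesgue_Rn R (n + n)).
Implicit Types (f g : Rn R n -> R[i]) (H : Rn R n -> R) (t y s tau : Rn R n).
Implicit Types (z : Rn R (n + n)) (Phi : Rn R (n + n) -> R).

(** The trilinear majorant after [psi] of the test function has been replaced by the indicator of
    the ball of radius 3 around [t]: a function supported in the cube of [t] has local norms on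
    balls of radius 2 that vanish beyond distance 3. *)
Definition average (K : R) Phi1 Phi2 H t : \bar R :=
  (\int[mu2]_z1 \int[mu2]_z2 ((Phi1 z1 * Phi2 z2)%:E *
     \int[mu]_tau (K * (H (addRn tau (posn z1)) * ball_ind 3 (addRn tau (posn z2)) t))%:E))%E.

Lemma le_double_integral Phi1 Phi2 (h h' : Rn R (n + n) -> Rn R (n + n) -> Rn R n -> R) :
  (forall z, 0 <= Phi1 z) -> (forall z, 0 <= Phi2 z) ->
  (forall z1 z2 tau, 0 <= h z1 z2 tau <= h' z1 z2 tau) ->
  (\int[mu2]_z1 \int[mu2]_z2 ((Phi1 z1 * Phi2 z2)%:E * \int[mu]_tau (h z1 z2 tau)%:E) <=
   \int[mu2]_z1 \int[mu2]_z2 ((Phi1 z1 * Phi2 z2)%:E * \int[mu]_tau (h' z1 z2 tau)%:E))%E.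
Proof.
move=> P1 P2 hh.
have h0 z1 z2 tau : 0 <= h z1 z2 tau by have /andP[] := hh z1 z2 tau.
have term0 z1 z2 : (0 <= (Phi1 z1 * Phi2 z2)%:E * \int[mu]_tau (h z1 z2 tau)%:E)%E.
  by apply: mule_ge0; [rewrite lee_fin mulr_ge0|exact: integral_geEFin0].
apply: ge0_le_integralT => z1; first exact: integral_ge0.
apply: ge0_le_integralT => z2 //; apply: lee_wpmul2l; first by rewrite lee_fin mulr_ge0.
by apply: ge0_le_integralR => tau //; have /andP[] := hh z1 z2 tau.
Qed.

Lemma measurable_addRnl y : measurable_fun setT (fun t => addRn t y).
Proof. by apply: measurable_addRn => //; exact: measurable_cst. Qed.

(** The three integrations collapse to the convolution type average with a single kernel [P], by
    invariance under translation. In its mass, [6 ^+ n] is the volume of the ball of radius 3. *)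
Lemma average_kernel (K m1 m2 : R) Phi1 Phi2 : 0 <= K -> 0 <= m1 -> 0 <= m2 ->
  measurable_fun setT Phi1 -> measurable_fun setT Phi2 ->
  (forall z, 0 <= Phi1 z) -> (forall z, 0 <= Phi2 z) ->
  (\int[mu2]_z (Phi1 z)%:E <= m1%:E)%E -> (\int[mu2]_z (Phi2 z)%:E <= m2%:E)%E ->
  exists P : Rn R n -> R, [/\ measurable_fun setT P, forall y, 0 <= P y,
    (\int[mu]_y (P y)%:E <= (K * 6 ^+ n * m1 * m2)%:E)%E &
    forall H, measurable_fun setT H -> (forall s, 0 <= H s) -> forall t,
      average K Phi1 Phi2 H t = (\int[mu]_y (P y * H (addRn y t))%:E)%E].
Proof.
move=> K0 m10 m20 mP1 mP2 P1 P2 i1 i2.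
pose Q y z1 z2 : R := Phi1 z1 * Phi2 z2 * (K * ball_ind 3 (addRn y (posn z2)) (posn z1)).
have Q0 y z1 z2 : 0 <= Q y z1 z2 by rewrite !mulr_ge0.
have mQ : measurable_fun setT (fun w : (Rn R (n + n) * Rn R n) * Rn R (n + n) =>
    Q w.1.2 w.1.1 w.2).
  have p1 : measurable_fun setT (fun w : (Rn R (n + n) * Rn R n) * Rn R (n + n) => w.1.1).
    by apply: measurableT_comp.
  have p2 : measurable_fun setT (fun w : (Rn R (n + n) * Rn R n) * Rn R (n + n) => w.1.2).
    by apply: measurableT_comp.
  apply: measurable_funM.
    by apply: measurable_funM; [exact: (measurableT_comp mP1 p1)|exact: (measurableT_comp mP2)].
  apply: measurable_funM => //; apply: measurable_ball_ind.
    by apply: measurable_addRn => //; exact: (measurableT_comp (@measurable_posn R n)).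
  exact: (measurableT_comp (@measurable_posn R n) p1).
have mQ1 : measurable_fun setT (fun w : Rn R (n + n) * Rn R n => \int[mu2]_z2 (Q w.2 w.1 z2)%:E)%E.
  apply: (@measurable_integral _ _ _ _ _ mu2 (fun (w : Rn R (n + n) * Rn R n) z2 => (Q w.2 w.1 z2)%:E)).
    exact/measurable_EFinP.
  by move=> w z2; rewrite lee_fin.
pose PE y : \bar R := (\int[mu2]_z1 \int[mu2]_z2 (Q y z1 z2)%:E)%E.
have PE0 y : (0 <= PE y)%E by apply: integral_ge0 => z1 _; exact: integral_geEFin0.
have Qz (c : R) (h : Rn R (n + n) -> Rn R (n + n) -> R) : 0 <= c ->
    (forall z1 z2, h z1 z2 <= c * (Phi1 z1 * Phi2 z2)) -> (forall z1 z2, 0 <= h z1 z2) ->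
    (\int[mu2]_z1 \int[mu2]_z2 (h z1 z2)%:E <= (c * m1 * m2)%:E)%E.
  move=> c0 hc h0.
  apply: (@le_trans _ _ (\int[mu2]_z1 \int[mu2]_z2 (c * Phi1 z1 * Phi2 z2)%:E)%E).
    apply: ge0_le_integralT => z1; first exact: integral_geEFin0.
    by apply: ge0_le_integralR => z2 //; rewrite -mulrA.
  under eq_integral => z1 _.
    rewrite ge0_integralZlR//; last by rewrite mulr_ge0.
    over.
  rewrite ge0_integralZr//; last 3 first.
  - by apply/measurable_EFinP; exact: measurable_funM.
  - by move=> z1 _; rewrite lee_fin mulr_ge0.
  - exact: integral_geEFin0.
  rewrite ge0_integralZlR// -muleA !EFinM -muleA; apply: lee_wpmul2l => //.
  by apply: lee_pmul => //; exact: integral_geEFin0.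
have PEfin y : PE y \is a fin_num.
  rewrite ge0_fin_numE//; apply: (@le_lt_trans _ _ (K * m1 * m2)%:E); last by rewrite ltry.
  apply: Qz => // z1 z2; rewrite /Q mulrC; apply: ler_wpM2r; first by rewrite mulr_ge0.
  by rewrite ler_piMr// ball_ind_le1.
have mPE : measurable_fun setT PE.
  apply: (@measurable_integral _ _ _ _ _ mu2 (fun y z1 => (\int[mu2]_z2 (Q y z1 z2)%:E)%E)).
    have sw : measurable_fun setT (fun w : Rn R n * Rn R (n + n) => (w.2, w.1)).
      by apply: measurable_fun_pair.
    by have := measurableT_comp mQ1 sw.
  by move=> y z1; exact: integral_geEFin0.
have avgE H : measurable_fun setT H -> (forall s, 0 <= H s) -> forall t,
    average K Phi1 Phi2 H t = (\int[mu]_y (fine (PE y) * H (addRn y t))%:E)%E.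
  move=> mH H0 t.
  have mHt : measurable_fun setT (fun y => H (addRn y t)) := measurableT_comp mH (measurable_addRnl t).
  have inner z1 z2 : ((Phi1 z1 * Phi2 z2)%:E *
      \int[mu]_tau (K * (H (addRn tau (posn z1)) * ball_ind 3 (addRn tau (posn z2)) t))%:E =
      \int[mu]_y (Q y z1 z2 * H (addRn y t))%:E)%E.
    pose G tau := K * (H (addRn tau (posn z1)) * ball_ind 3 (addRn tau (posn z2)) t).
    have mG : measurable_fun setT G.
      apply: measurable_funM => //; apply: measurable_funM.
        exact: (measurableT_comp mH (measurable_addRnl _)).
      by apply: measurable_ball_ind; [exact: measurable_addRnl|exact: measurable_cst].
    have G0 tau : 0 <= G tau by rewrite !mulr_ge0.
    (* Substituting [tau = y + t - posn z1] leaves [H] at [y + t], and the ball condition then no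
       longer involves [t]. *)
    rewrite -(@integral_addl _ _ (fun tau => (G tau)%:E) _ _ (subRn t (posn z1))); last 2 first.
    - exact/measurable_EFinP.
    - by move=> tau; rewrite lee_fin.
    rewrite -ge0_integralZlR//; last 2 first.
    - by rewrite mulr_ge0.
    - exact: (measurableT_comp mG (measurable_addRnl _)).
    apply: eq_integral => y _; congr EFin.
    rewrite /G /Q; have -> : addRn (addRn y (subRn t (posn z1))) (posn z1) = addRn y t.
      by apply: coord_ext => i; rewrite !coord_add coord_sub; ring.
    have -> : ball_ind 3 (addRn (addRn y (subRn t (posn z1))) (posn z2)) t =
        ball_ind 3 (addRn y (posn z2)) (posn z1).
      congr (nat_of_bool _)%:R; apply: eq_forallb => i.
      rewrite !coord_add coord_sub; congr (`| _ | <= _); ring.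
    ring.
  rewrite /average; under eq_integral => z1 _ do under eq_integral => z2 _ do rewrite inner.
  have mQH : measurable_fun setT (fun w : (Rn R (n + n) * Rn R n) * Rn R (n + n) =>
      Q w.1.2 w.1.1 w.2 * H (addRn w.1.2 t)).
    apply: measurable_funM => //; apply: (measurableT_comp mHt).
    exact: measurableT_comp.
  under eq_integral => z1 _.
    rewrite (@integral_swap _ _ _ _ _ mu2 mu (fun z2 y => (Q y z1 z2 * H (addRn y t))%:E)); last 2 first.
    - apply/measurable_EFinP.
      have sw : measurable_fun setT (fun w : Rn R (n + n) * Rn R n => ((z1, w.2), w.1)).
        by apply: measurable_fun_pair => //; apply: measurable_fun_pair => //; exact: measurable_cst.
      by have := measurableT_comp mQH sw.
    - by move=> z2 y; rewrite lee_fin mulr_ge0.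
    over.
  rewrite (@integral_swap _ _ _ _ _ mu2 mu
    (fun z1 y => \int[mu2]_z2 (Q y z1 z2 * H (addRn y t))%:E)%E); last 2 first.
  - apply: (@measurable_integral _ _ _ _ _ mu2
        (fun (w : Rn R (n + n) * Rn R n) z2 => (Q w.2 w.1 z2 * H (addRn w.2 t))%:E)).
      exact/measurable_EFinP.
    by move=> w z2; rewrite lee_fin mulr_ge0.
  - by move=> z1 y; apply: integral_geEFin0 => z2; rewrite mulr_ge0.
  apply: eq_integral => y _.
  have mQy z1 : measurable_fun setT (Q y z1).
    have sw : measurable_fun setT (fun z2 : Rn R (n + n) => ((z1, y), z2)).
      by apply: measurable_fun_pair => //; exact: measurable_cst.
    by have := measurableT_comp mQ sw.
  under eq_integral => z1 _.
    under eq_integral => z2 _ do rewrite mulrC.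
    rewrite ge0_integralZlR//; over.
  rewrite ge0_integralZl//; last 3 first.
  - have sw : measurable_fun setT (fun z1 : Rn R (n + n) => (z1, y)).
      by apply: measurable_fun_pair => //; exact: measurable_cst.
    by have := measurableT_comp mQ1 sw.
  - by move=> z1 _; exact: integral_geEFin0.
  - by rewrite lee_fin.
  by rewrite -/(PE y) mulrC EFinM fineK.
exists (fine \o PE); split.
- exact: measurableT_comp.
- by move=> y; exact: fine_ge0.
(* The mass of the kernel is the average of the constant function 1. *)
- have := avgE (fun=> 1) (measurable_cst _) (fun=> ler01) (cstRn n 0).
  rewrite /average; under [X in _ = X -> _]eq_integral do rewrite mulr1.
  move=> /= <-.
  under eq_integral => z1 _.
    under eq_integral => z2 _.
      rewrite (_ : \int[mu]_tau _ = (K * 6 ^+ n)%:E)%E; last first.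
        pose G (tau : Rn R n) : R := ball_ind 3 tau (cstRn n 0).
        have mG : measurable_fun setT G.
          by apply: measurable_ball_ind => //; exact: measurable_cst.
        under eq_integral do rewrite mul1r.
        rewrite ge0_integralZlR//; last exact: (measurableT_comp mG (measurable_addRnl (posn z2))).
        rewrite (@integral_addl _ _ (fun tau => (G tau)%:E) _ _ (posn z2)); last 2 first.
        - exact/measurable_EFinP.
        - by move=> tau; rewrite lee_fin.
        by rewrite integral_ball// -EFinM; congr (_ * _ ^+ _)%:E; ring.
      rewrite -EFinM; over.
    over.
  apply: Qz => [|z1 z2|z1 z2]; first by rewrite mulr_ge0 ?exprn_ge0.
    by rewrite mulrC.
  by rewrite !mulr_ge0 ?exprn_ge0.
- exact: avgE.
Qed.

End averaging.

(** * Global norms of local norms and of their averages *)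

Section lattice.
Context {R : realType} {n : nat}.
Notation mu := (lebesgue_Rn R n).
Notation mu2 := (lebesgue_Rn R (n + n)).
Implicit Types (f g : Rn R n -> R[i]) (H : Rn R n -> R) (t u y s tau : Rn R n).
Implicit Types (z : Rn R (n + n)) (Phi : Rn R (n + n) -> R) (js rho L B : R).

(* js is the reciprocal of the exponent, 0 encoding infinity. *)
Definition lp_bound js H L := (forall t, 0 <= H t <= L) /\
  (0 < js -> (\int[mu]_t (H t `^ js^-1)%:E <= (L `^ js^-1)%:E)%E).

Lemma psi_supported rho g t s (Y : R) : 0 < rho -> 0 <= Y -> supported (floorRn t) g ->
  (\int[mu]_u (normc (g u) `^ rho)%:E <= (Y `^ rho)%:E)%E ->
  psi rho g s <= Y * ball_ind 3 s t.
Proof.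
move=> rho0 Y0 gt hY; rewrite /psi /ball_ind.
have ge0 : (0 <= local_mass rho 2 g s)%E := local_mass_ge0 _ _ _ _.
have hm : (local_mass rho 2 g s <= (Y `^ rho)%:E)%E.
  apply: le_trans hY; apply: ge0_le_integralR => u; first by rewrite mulr_ge0 ?powR_ge0.
  by rewrite ler_piMl ?powR_ge0// ball_ind_le1.
have [st|st] := boolP (near 3 s t).
  rewrite mulr1 -[leRHS](powRVK (r := rho)) ?gt_eqF//.
  apply: powR_le; rewrite ?invr_ge0 ?(ltW rho0) ?fine_ge0//.
  rewrite -lee_fin fineK// ge0_fin_numE//; apply: le_lt_trans hm _; exact: ltry.
rewrite mulr0 (_ : local_mass rho 2 g s = 0%E) ?powR0// ?invr_neq0 ?gt_eqF//.
apply: integral0_eq => u _; rewrite /ball_ind.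
have [ut|ut] := eqVneq (floorRn u) (floorRn t); last first.
  by rewrite gt// Normc.normc0 powR0 ?mulr0// gt_eqF.
have [us|_] := boolP (near 2 u s); last by rewrite mul0r.
case/negP: st; rewrite (_ : 3 = 2 + 1 :> R); last by ring.
by apply: near_trans (same_cube_near ut); rewrite nearC.
Qed.

(* Jensen's inequality does not apply when 1 / js < rho; instead the values of lam
   near s are bounded one by one by the local l^(1/js) sum, since lam is constant
   on cubes of measure one. *)
Lemma psi_lattice rho js : 1 <= rho -> 0 <= js -> js <= 1 ->
  forall f (lam : n.-tuple int -> R) L, cmeasurable f ->
    lp_bound js (fun u => lam (floorRn u)) L ->
    (forall k, \int[mu]_t (\1_(cube k) t * normc (f t) `^ rho)%:E <= (lam k `^ rho)%:E)%E ->
  locally_bounded rho f /\ lp_bound js (psi rho f) (48 ^+ n * L).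
Proof.
move=> r1 js0 js1 f lam L mf [lamL sumL] hf.
have L0 : 0 <= L by have /andP[h1 h2] := lamL (cstRn n 0); exact: le_trans h1 h2.
have r0 : 0 < rho by lra.
pose Lam u := lam (floorRn u).
have mLam : measurable_fun setT Lam by exact: measurable_floor.
have Lam0 u : 0 <= Lam u by have /andP[] := lamL u.
have LamL u : Lam u <= L by have /andP[] := lamL u.
have mb (c : R) s : measurable_fun setT (fun u => ball_ind c u s).
  by apply: measurable_ball_ind => //; exact: measurable_cst.
have mfr : measurable_fun setT (fun t => normc (f t) `^ rho).
  exact/measurable_funPR/measurable_normc.
have mass s : (local_mass rho 2 f s <= \int[mu]_u (ball_ind 3 u s * Lam u `^ rho)%:E)%E.
  (* The cube kernel is inserted so that [f] can be integrated cube by cube, each cube meeting the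
     ball of radius 2 lying in the ball of radius 3. *)
  have -> : local_mass rho 2 f s =
      (\int[mu]_t \int[mu]_u (ball_ind 2 t s * normc (f t) `^ rho * same_cube t u)%:E)%E.
    apply: eq_integral => t _; rewrite ge0_integralZlR.
    - by rewrite integral_same_cube mule1.
    - by rewrite mulr_ge0 ?powR_ge0.
    - by apply: measurable_same_cube => //; exact: measurable_cst.
    - by move=> u; exact: same_cube_ge0.
  rewrite (@integral_swap _ _ _ _ _ mu mu
      (fun t u => (ball_ind 2 t s * normc (f t) `^ rho * same_cube t u)%:E)); last 2 first.
  - apply/measurable_EFinP; apply: measurable_funM; last exact: measurable_same_cube.
    apply: measurable_funM; last exact: (measurableT_comp mfr).
    by apply: measurable_ball_ind => //; exact: measurable_cst.
  - by move=> t u; rewrite lee_fin !mulr_ge0 ?powR_ge0 ?same_cube_ge0.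
  apply: ge0_le_integralT => u.
    by apply: integral_geEFin0 => t; rewrite !mulr_ge0 ?powR_ge0 ?same_cube_ge0.
  apply: (@le_trans _ _ (\int[mu]_t (ball_ind 3 u s * (same_cube t u * normc (f t) `^ rho))%:E)%E).
    apply: ge0_le_integralR => t; first by rewrite !mulr_ge0 ?powR_ge0 ?same_cube_ge0.
    rewrite same_cubeE; have [tu|_] := eqVneq (floorRn t) (floorRn u); last by rewrite mul0r !mulr0.
    rewrite mulr1 mul1r; apply: ler_wpM2r; first exact: powR_ge0.
    rewrite /ball_ind ler_nat; have [ts|//] := boolP (near 2 t s).
    by rewrite (_ : near 3 u s)// (_ : 3 = 1 + 2 :> R);
      [exact: near_trans (same_cube_near (esym tu)) ts|ring].
  rewrite ge0_integralZlR//; last 2 first.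
  - apply: measurable_funM => //; apply: measurable_same_cube => //; exact: measurable_cst.
  - by move=> t; rewrite mulr_ge0 ?powR_ge0 ?same_cube_ge0.
  by rewrite [leRHS]EFinM; apply: lee_wpmul2l; [by rewrite lee_fin|exact: hf (floorRn u)].
(* The factor is the volume [6 ^+ n] of the ball of radius 3; being at least 1 it may be replaced by
   its power [rho], and so taken out of the root whole. *)
have psiB s (B : R) : 0 <= B -> (forall u, near 3 u s -> Lam u <= B) ->
    (local_mass rho 2 f s <= ((6 ^+ n * B) `^ rho)%:E)%E /\ psi rho f s <= 6 ^+ n * B.
  move=> B0 hB.
  have six1 : 1 <= (6 : R) ^+ n by rewrite exprn_ege1//; lra.
  have hm : (local_mass rho 2 f s <= ((6 ^+ n * B) `^ rho)%:E)%E.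
    apply: le_trans (mass s) _.
    apply: (@le_trans _ _ (\int[mu]_u (B `^ rho * ball_ind 3 u s)%:E)%E).
      apply: ge0_le_integralR => u; first by rewrite mulr_ge0 ?powR_ge0.
      rewrite [leRHS]mulrC /ball_ind; have [us|_] := boolP (near 3 u s); last by rewrite !mul0r.
      by rewrite !mul1r; apply: powR_le (ltW r0) (Lam0 u) (hB u us).
    rewrite ge0_integralZlR ?powR_ge0// integral_ball// -EFinM lee_fin.
    rewrite powRM ?exprn_ge0// [leRHS]mulrC ler_wpM2l ?powR_ge0//.
    rewrite (_ : 2 * 3 = 6 :> R); last by ring.
    by rewrite -[leLHS]powRr1 ?exprn_ge0//; exact: ler_powR.
  split=> //; rewrite /psi -[leRHS](powRVK (r := rho)) ?gt_eqF ?mulr_ge0 ?exprn_ge0//.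
  apply: powR_le; rewrite ?invr_ge0 ?(ltW r0) ?fine_ge0 ?local_mass_ge0//.
  rewrite -lee_fin fineK// ge0_fin_numE ?local_mass_ge0//; apply: le_lt_trans hm _; exact: ltry.
have le48 : (6 : R) ^+ n <= 48 ^+ n by rewrite lerXn2r ?nnegrE//; lra.
split; last split.
- split=> //; exists ((6 ^+ n * L) `^ rho) => s.
  by have [] := psiB s L L0 (fun u _ => LamL u).
- move=> s; rewrite psi_ge0/=; have [_ /le_trans] := psiB s L L0 (fun u _ => LamL u); apply.
  exact: ler_wpM2r.
move=> jsp; pose q := js^-1; have q1 : 1 <= q by rewrite invf_ge1.
have q0 : 0 < q by rewrite invr_gt0.
have mLq : measurable_fun setT (fun u => Lam u `^ q) by exact: measurable_funPR.
pose S s : \bar R := (\int[mu]_u (ball_ind 4 u s * Lam u `^ q)%:E)%E.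
have S0 s : (0 <= S s)%E by apply: integral_geEFin0 => u; rewrite mulr_ge0 ?powR_ge0.
have SL s : (S s <= (L `^ q)%:E)%E.
  apply: le_trans (sumL jsp); apply: ge0_le_integralR => u; first by rewrite mulr_ge0 ?powR_ge0.
  by rewrite ler_piMl ?powR_ge0// ball_ind_le1.
have Sfin s : S s \is a fin_num.
  by rewrite ge0_fin_numE//; apply: le_lt_trans (SL s) _; exact: ltry.
have near_S s u0 : near 3 u0 s -> Lam u0 <= fine (S s) `^ js.
  move=> us; rewrite -[Lam u0](powRVK (r := q)) ?gt_eqF// /q invrK.
  apply: powR_le; rewrite ?powR_ge0// -lee_fin fineK//.
  rewrite -[leLHS]mule1 -(integral_same_cube u0) -ge0_integralZlR ?powR_ge0//; last first.
    by apply: measurable_same_cube => //; exact: measurable_cst.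
  apply: ge0_le_integralR => u; first by rewrite mulr_ge0 ?powR_ge0 ?same_cube_ge0.
  rewrite same_cubeE; have [uu|_] := eqVneq (floorRn u0) (floorRn u); last first.
    by rewrite mulr0 mulr_ge0 ?powR_ge0.
  rewrite mulr1 /Lam uu /ball_ind (_ : near 4 u s) ?mul1r//.
  by rewrite (_ : 4 = 1 + 3 :> R); [exact: near_trans (same_cube_near (esym uu)) us|ring].
apply: (@le_trans _ _ (\int[mu]_s ((6 ^+ n) `^ q * fine (S s))%:E)%E).
  apply: ge0_le_integralR => s; first exact: powR_ge0.
  have [_ h] := psiB s _ (powR_ge0 _ _) (near_S s).
  apply: le_trans (powR_le (ltW q0) (psi_ge0 _ _ _) h) _.
  by rewrite powRM ?exprn_ge0 ?powR_ge0// powRVK ?fine_ge0// gt_eqF.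
have mS : measurable_fun setT S.
  apply: (@measurable_integral _ _ _ _ _ mu (fun s u => (ball_ind 4 u s * Lam u `^ q)%:E)).
    apply/measurable_EFinP; apply: measurable_funM; first exact: measurable_ball_ind.
    exact: (measurableT_comp mLq).
  by move=> s u; rewrite lee_fin mulr_ge0 ?powR_ge0.
rewrite ge0_integralZlR ?powR_ge0//; last 2 first.
- exact: measurableT_comp.
- by move=> s; exact: fine_ge0.
have -> : (\int[mu]_s (fine (S s))%:E = \int[mu]_s S s)%E.
  by apply: eq_integral => s _; rewrite fineK.
rewrite (@integral_swap _ _ _ _ _ mu mu (fun s u => (ball_ind 4 u s * Lam u `^ q)%:E)); last 2 first.
- apply/measurable_EFinP; apply: measurable_funM; first exact: measurable_ball_ind.
  exact: (measurableT_comp mLq).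
- by move=> s u; rewrite lee_fin mulr_ge0 ?powR_ge0.
have -> : (\int[mu]_u \int[mu]_s (ball_ind 4 u s * Lam u `^ q)%:E =
    (8 ^+ n)%:E * \int[mu]_u (Lam u `^ q)%:E)%E.
  rewrite -ge0_integralZlR ?exprn_ge0//; last by move=> u; exact: powR_ge0.
  apply: eq_integral => u _.
  under eq_integral => s _ do rewrite mulrC /ball_ind nearC.
  rewrite ge0_integralZlR ?powR_ge0//; last exact: mb.
  rewrite integral_ball// -EFinM mulrC; congr (_ ^+ _ * _)%:E; ring.
apply: (@le_trans _ _ (((6 ^+ n) `^ q)%:E * ((8 ^+ n)%:E * (L `^ q)%:E))%E).
  by do 2 (apply: lee_wpmul2l; first by rewrite lee_fin ?powR_ge0 ?exprn_ge0); exact: sumL.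
(* 48 is the product of the side 6 of the ball of radius 3 and the side 8 of the ball of radius
   4. *)
rewrite -!EFinM lee_fin (_ : 48 = 6 * 8 :> R); last by ring.
rewrite exprMn -mulrA powRM ?mulr_ge0 ?exprn_ge0// ler_wpM2l ?powR_ge0//.
rewrite powRM ?exprn_ge0// ler_wpM2r ?powR_ge0//.
by rewrite -[leLHS]powRr1 ?exprn_ge0//; apply: ler_powR => //; rewrite exprn_ege1//; lra.
Qed.

(** An average against a kernel of mass [m] acts on every L^q with norm at most [2 m]: the q-th
    power is moved inside by the weak form of Jensen's inequality, and Tonelli with translation
    invariance removes the shift. *)
Lemma average_lattice (K m1 m2 js B : R) Phi1 Phi2 H : 0 < K -> 0 < m1 -> 0 < m2 ->
  0 <= js -> js <= 1 ->
  measurable_fun setT Phi1 -> measurable_fun setT Phi2 ->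
  (forall z, 0 <= Phi1 z) -> (forall z, 0 <= Phi2 z) ->
  (\int[mu2]_z (Phi1 z)%:E <= m1%:E)%E -> (\int[mu2]_z (Phi2 z)%:E <= m2%:E)%E ->
  measurable_fun setT H -> lp_bound js H B ->
  [/\ measurable_fun setT (average K Phi1 Phi2 H),
    forall t, average K Phi1 Phi2 H t \is a fin_num &
    lp_bound js (fine \o average K Phi1 Phi2 H) (2 * (K * 6 ^+ n * m1 * m2) * B)].
Proof.
move=> K0 m10 m20 js0 js1 mP1 mP2 P10 P20 i1 i2 mH [HB sumH].
have H0 s : 0 <= H s by have /andP[] := HB s.
have HleB s : H s <= B by have /andP[] := HB s.
have B0 : 0 <= B := le_trans (H0 (cstRn n 0)) (HleB _).
have [P [mP P0 iP avgE]] :=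
  average_kernel (ltW K0) (ltW m10) (ltW m20) mP1 mP2 P10 P20 i1 i2.
set m := K * 6 ^+ n * m1 * m2 in iP *.
have m0 : 0 < m by rewrite !mulr_gt0// exprn_gt0.
have mHt t : measurable_fun setT (fun y => H (addRn y t)) := measurableT_comp mH (measurable_addRnl t).
have mPH (h : R -> R) : measurable_fun setT h ->
    measurable_fun setT (fun w : Rn R n * Rn R n => (P w.2 * h (H (addRn w.2 w.1)))%:E).
  move=> mh; apply/measurable_EFinP; apply: measurable_funM.
    exact: (measurableT_comp mP).
  apply: (measurableT_comp mh); apply: (measurableT_comp mH).
  by apply: measurable_addRn.
have avg0 t : (0 <= average K Phi1 Phi2 H t)%E.
  by rewrite avgE//; apply: integral_geEFin0 => y; rewrite mulr_ge0.
have avgB t : (average K Phi1 Phi2 H t <= (m * B)%:E)%E.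
  rewrite avgE//; apply: (@le_trans _ _ (\int[mu]_y (B * P y)%:E)%E).
    by apply: ge0_le_integralR => y; rewrite ?mulr_ge0// mulrC ler_wpM2r.
  by rewrite ge0_integralZlR// mulrC EFinM; apply: lee_wpmul2l.
have m2B : m * B <= 2 * m * B by rewrite ler_wpM2r// ler_peMl ?(ltW m0)//; lra.
have mavg : measurable_fun setT (average K Phi1 Phi2 H).
  rewrite (_ : average _ _ _ _ = fun t => (\int[mu]_y (P y * H (addRn y t))%:E)%E); last first.
    by apply/funext => t; exact: avgE.
  apply: (@measurable_integral _ _ _ _ _ mu (fun t y => (P y * H (addRn y t))%:E)).
    exact: (mPH id).
  by move=> t y; rewrite lee_fin mulr_ge0.
have afin t : average K Phi1 Phi2 H t \is a fin_num.
  by rewrite ge0_fin_numE//; apply: le_lt_trans (avgB t) _; exact: ltry.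
split=> //; split.
  by move=> t /=; rewrite fine_ge0//= -lee_fin fineK// (le_trans (avgB t))// lee_fin.
move=> jsp; pose q := js^-1; have q1 : 1 <= q by rewrite invf_ge1.
have q0 : 0 < q by rewrite invr_gt0.
have mHq t : measurable_fun setT (fun y => H (addRn y t) `^ q) by exact: measurable_funPR.
pose c := (2 * m) `^ q / m; have c0 : 0 <= c by rewrite divr_ge0 ?powR_ge0 ?(ltW m0).
apply: (@le_trans _ _ (\int[mu]_t (c%:E * \int[mu]_y (P y * H (addRn y t) `^ q)%:E))%E).
  apply: ge0_le_integralT => t; first by rewrite lee_fin powR_ge0.
  apply: (@weak_jensen_powR _ _ _ mu P (fun y => H (addRn y t)) mP P0 (mHt t) _ m) => //.
    exact: fine_ge0.
  by rewrite fineK// avgE.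
rewrite ge0_integralZl//; last 2 first.
- apply: (@measurable_integral _ _ _ _ _ mu (fun t y => (P y * H (addRn y t) `^ q)%:E)).
    by apply: (mPH (fun x => x `^ q)); exact: measurable_powR.
  by move=> t y; rewrite lee_fin mulr_ge0 ?powR_ge0.
- by move=> t _; apply: integral_geEFin0 => y; rewrite mulr_ge0 ?powR_ge0.
rewrite (@integral_swap _ _ _ _ _ mu mu (fun t y => (P y * H (addRn y t) `^ q)%:E)); last 2 first.
- by apply: (mPH (fun x => x `^ q)); exact: measurable_powR.
- by move=> t y; rewrite lee_fin mulr_ge0 ?powR_ge0.
apply: (@le_trans _ _ (c%:E * (m%:E * (B `^ q)%:E))%E); last first.
  rewrite -!EFinM lee_fin mulrA /c divfK ?gt_eqF// -/q -powRM//.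
  by rewrite mulr_ge0 ?(ltW m0).
apply: lee_wpmul2l => //.
apply: (@le_trans _ _ (\int[mu]_y (B `^ q * P y)%:E)%E); last first.
  by rewrite ge0_integralZlR ?powR_ge0// muleC; apply: lee_wpmul2r; rewrite ?lee_fin ?powR_ge0.
apply: ge0_le_integralT => y.
  by apply: integral_geEFin0 => t; rewrite mulr_ge0 ?powR_ge0.
under eq_integral => t _ do rewrite addRnC.
rewrite ge0_integralZlR//; last by move=> t; exact: powR_ge0.
rewrite mulrC EFinM; apply: lee_wpmul2l; first by rewrite lee_fin.
rewrite (@integral_addl _ _ (fun t => (H t `^ q)%:E) _ _ y); first exact: sumH.
- by apply/measurable_EFinP; exact: measurable_funPR.
- by move=> t; rewrite lee_fin powR_ge0.
Qed.

End lattice.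

(** * Amalgam norms as norms over the lattice *)

Section amalgam_norms.
Context {R : realType} {n : nat}.
Notation mu := (lebesgue_Rn R n).
Implicit Types (f F : Rn R n -> R[i]) (t u : Rn R n) (k : n.-tuple int) (p q : \bar R).
Implicit Types (lam : n.-tuple int -> R) (L N : R).

(** Cubes have measure one, so a lattice sum is the integral of a function constant on cubes, and
    the integral estimates apply to it. The proof enumerates the lattice by [pickle]; natural
    numbers that are no code contribute zero. *)
Lemma esum_floor (b : n.-tuple int -> \bar R) : (forall k, 0 <= b k)%E ->
  (\esum_(k in [set: n.-tuple int]) b k = \int[mu]_t b (floorRn t))%E.
Proof.
move=> b0.
pose g (j : nat) (k : n.-tuple int) : \bar R := if pickle k == j then b k else 0%E.
have g0 j k : (0 <= g j k)%E by rewrite /g; case: ifP.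
pose c j : \bar R := (\int[mu]_t g j (floorRn t))%E.
have c0 j : (0 <= c j)%E by apply: integral_ge0.
have -> : (\int[mu]_t b (floorRn t) = \sum_(0 <= j <oo) c j)%E.
  rewrite -integral_nneseries//; last by move=> j; exact: measurable_floor.
  apply: eq_integral => t _; rewrite nneseries_esumT//.
  have -> : (b (floorRn t) = \esum_(j in [set pickle (floorRn t)]) b (floorRn t))%E.
    by rewrite esum_set1.
  rewrite esum_mkcond.
  apply: eq_esum => j _; rewrite /g; case: ifPn.
    by rewrite inE => /eqP; rewrite eq_sym => ->.
  by rewrite notin_setE /=; case: eqP => // <-.
rewrite nneseries_esumT//.
have -> : (\esum_(j in [set: nat]) c j = \esum_(j in [set pickle k | k in [set: n.-tuple int]]) c j)%E.
  rewrite [RHS]esum_mkcond; apply: eq_esum => j _; case: ifPn => //.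
  rewrite notin_setE /= => jn; apply: integral0_eq => t _; rewrite /g.
  by case: eqP => // tj; exfalso; apply: jn; exists (floorRn t).
rewrite esum_image; last by move=> k1 k2 _ _; apply: (pcan_inj pickleK).
apply: eq_esum => k _; rewrite /c.
under eq_integral => t _.
  rewrite (_ : g _ _ = b k * (\1_(cube k) t)%:E)%E; first over.
  rewrite /g indic_cube (inj_eq (pcan_inj pickleK)).
  by case: eqP => [->|_]; rewrite ?mule1 ?mule0.
rewrite ge0_integralZl//; first by rewrite integral_cube mule1.
by apply/measurable_EFinP/measurable_indic; exact: measurable_cube.
Qed.

Lemma normc_cut f k t : normc (f t * (\1_(cube k) t)%:C%C) = \1_(cube k) t * normc (f t).
Proof. by rewrite Normc.normcM normc_indic mulrC. Qed.

Lemma cube_powR k t (x r : R) : r != 0 -> 0 <= x -> (\1_(cube k) t * x) `^ r = \1_(cube k) t * x `^ r.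
Proof. by move=> r0 x0; rewrite indic_cube; case: eqP; rewrite ?mul1r// !mul0r powR0. Qed.

Lemma local_norm_finE f k (r : R) : r != 0 -> local_norm r%:E f k =
  ((\int[mu]_t (\1_(cube k) t * normc (f t) `^ r)%:E) `^ r^-1)%E.
Proof.
move=> r0; rewrite /local_norm /cLnorm unlock; congr (_ `^ _)%E.
apply: eq_integral => t _; rewrite gee0_abs ?lee_fin ?normc_ge0//.
by rewrite poweR_EFin normc_cut cube_powR// normc_ge0.
Qed.

(** The norm at exponent [+oo] first tests whether the whole space has positive measure; this opens
    the branch with the essential supremum. *)
Lemma measure_setT_gt0 : (0 < mu setT)%E.
Proof.
rewrite lt_neqAle measure_ge0 andbT; apply/negP => /eqP m0.
have := @integral_cube R n [tuple 0 | i < n].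
rewrite (negligible_integral measurableT); last 3 first.
- exact: measurableT.
- apply: null_set_integrable => //.
  by apply/measurable_EFinP/measurable_indic; exact: measurable_cube.
- exact: esym.
by rewrite setDv integral_set0 => h; have := @lte01 R; rewrite -h ltxx.
Qed.

Lemma local_norm_sup_le f k N :
  (local_norm +oo%E f k <= N%:E)%E <-> {ae mu, forall t, \1_(cube k) t * normc (f t) <= N}.
Proof.
rewrite /local_norm /cLnorm unlock measure_setT_gt0.
split.
  move=> /ess_sup_inf.ess_supP; apply: filterS => t /=; rewrite normc_cut.
  by rewrite ger0_norm ?lee_fin// mulr_ge0 ?normc_ge0.
move=> h; apply/ess_sup_inf.ess_supP; apply: filterS h => t /=; rewrite normc_cut.
by rewrite ger0_norm ?lee_fin// mulr_ge0 ?normc_ge0.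
Qed.

Lemma le_poweR (x y : \bar R) (r : R) : 0 <= r -> (0 <= x)%E -> (x <= y)%E -> (x `^ r <= y `^ r)%E.
Proof.
move=> r0 x0 xy; apply: gt0_ler_poweR => //; rewrite in_itv /= leey andbT//.
exact: le_trans xy.
Qed.

Lemma local_norm_fin_le f k (r N : R) : 0 < r -> 0 <= N ->
  (local_norm r%:E f k <= N%:E)%E <->
  (\int[mu]_t (\1_(cube k) t * normc (f t) `^ r)%:E <= (N `^ r)%:E)%E.
Proof.
move=> r0 N0; rewrite local_norm_finE ?gt_eqF//; set I := (\int[mu]_t _)%E.
have I0 : (0 <= I)%E by apply: integral_geEFin0 => t; rewrite mulr_ge0 ?powR_ge0.
split=> h.
  have := le_poweR (ltW r0) (poweR_ge0 _ _) h.
  by rewrite -poweRrM mulVf ?gt_eqF// poweRe1// poweR_EFin.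
have := @le_poweR _ _ r^-1 _ I0 h; rewrite invr_ge0 (ltW r0) => /(_ isT).
by rewrite poweR_EFin powRVK// gt_eqF.
Qed.

(** The inclusion of L^p in L^rho on a set of measure one, with a factor 2 from the weak form of
    Jensen's inequality. *)
Lemma local_norm_powR p (rho : R) f k N : 1 <= rho -> (rho%:E <= p)%E -> 0 <= N ->
  cmeasurable f -> (local_norm p f k <= N%:E)%E ->
  (\int[mu]_t (\1_(cube k) t * normc (f t) `^ rho)%:E <= ((2 * N) `^ rho)%:E)%E.
Proof.
move=> r1 rp N0 mf hN; have r0 : 0 < rho by lra.
have mI : measurable_fun setT (\1_(cube k) : Rn R n -> R).
  by apply: measurable_indic; exact: measurable_cube.
have mfr r : measurable_fun setT (fun t => normc (f t) `^ r).
  exact/measurable_funPR/measurable_normc.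
have I0 (h : Rn R n -> R) t : 0 <= h t -> 0 <= \1_(cube k) t * h t by exact: mulr_ge0.
have two : 2 <= 2 `^ rho :> R by rewrite -[leLHS]powRr1//; apply: ler_powR => //; lra.
case: p rp hN => [r rr|_|]//; last first.
  move=> /local_norm_sup_le ae.
  apply: (@le_trans _ _ (\int[mu]_t (N `^ rho * \1_(cube k) t)%:E)%E); last first.
    rewrite ge0_integralZlR ?powR_ge0// integral_cube mule1 lee_fin powRM//.
    by rewrite ler_peMl ?powR_ge0//; lra.
  apply: ae_ge0_le_integral => //.
  - by move=> t _; rewrite lee_fin mulr_ge0 ?powR_ge0.
  - by apply/measurable_EFinP; exact: measurable_funM.
  - by move=> t _; rewrite lee_fin mulr_ge0 ?powR_ge0.
  - by apply/measurable_EFinP; exact: measurable_funM.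
  apply: filterS ae => t ht _; rewrite lee_fin [leRHS]mulrC; move: ht.
  rewrite indic_cube; case: eqP => _; rewrite ?mul0r// !mul1r => ht.
  by apply: powR_le; rewrite ?normc_ge0 ?(ltW r0).
rewrite lee_fin in rr; have rpos : 0 < r by lra.
move=> /(local_norm_fin_le _ _ rpos N0) hN.
have pos M : 0 < M -> (\int[mu]_t (\1_(cube k) t * normc (f t) `^ r)%:E <= (M `^ r)%:E)%E ->
    (\int[mu]_t (\1_(cube k) t * normc (f t) `^ rho)%:E <= ((2 * M) `^ rho)%:E)%E.
  move=> M0 hM.
  apply: (@le_trans _ _ (2 * 1 * M `^ rho)%:E); last first.
    by rewrite mulr1 lee_fin powRM ?(ltW M0)// ler_wpM2r ?powR_ge0.
  apply: (@weak_jensen _ _ R mu _ (fun t => normc (f t) `^ rho) mI _ (mfr rho) _ _ _ (r / rho)) => //.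
  - by move=> t; exact: powR_ge0.
  - by rewrite ler_pdivlMr// mul1r.
  - exact: powR_gt0.
  - by rewrite integral_cube.
  - have rE : rho * (r / rho) = r by field; rewrite gt_eqF.
    by under eq_integral => t _ do rewrite -powRrM rE; rewrite mul1r -powRrM rE.
(* The case [N = 0] is the limit of positive bounds [M], chosen so that [(2 * M)^rho] is the given
   [e]. *)
have [N1|N1] := eqVneq N 0; last by apply: pos => //; rewrite lt_neqAle eq_sym N1.
rewrite N1 mulr0 powR0 ?gt_eqF//; apply/lee_addgt0Pr => e e0; rewrite add0e.
have e2 : 0 < 2^-1 * e `^ rho^-1 by rewrite mulr_gt0 ?powR_gt0.
have := pos _ e2; rewrite mulrA mulfV ?mul1r// powRK ?gt_eqF ?(ltW e0)//; apply.
by apply: le_trans hN _; rewrite N1 powR0 ?gt_eqF// lee_fin powR_ge0.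
Qed.

Lemma amalgam_norm_ge0 p q f : (1 <= q)%E -> (0 <= amalgam_norm p q f)%E.
Proof.
case: q => [q|_|]//=; first by rewrite poweR_ge0.
apply: le_trans (ereal_sup_ubound _); last by exists [tuple 0 | i < n].
exact: Lnorm_ge0.
Qed.

Definition inv_exponent q : R := if q is q'%:E then q'^-1 else 0.

Lemma amalgam_lattice p q f L : (1 <= q)%E -> 0 <= L -> (amalgam_norm p q f <= L%:E)%E ->
  (forall k, (local_norm p f k = (fine (local_norm p f k))%:E)%E) /\
  lp_bound (inv_exponent q) (fun t => fine (local_norm p f (floorRn t))) L.
Proof.
move=> q1 L0 hL.
have n0 k : (0 <= local_norm p f k)%E by exact: Lnorm_ge0.
suff [nL sumL] : (forall k, local_norm p f k <= L%:E)%E /\ (0 < inv_exponent q ->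
    (\int[mu]_t (local_norm p f (floorRn t) `^ (inv_exponent q)^-1) <= (L `^ (inv_exponent q)^-1)%:E)%E).
  have nE k : (local_norm p f k = (fine (local_norm p f k))%:E)%E.
    by rewrite fineK// ge0_fin_numE//; apply: le_lt_trans (nL k) _; exact: ltry.
  split=> //; split=> [t|jq]; first by rewrite fine_ge0//= -lee_fin -nE.
  apply: le_trans (sumL jq); rewrite le_eqVlt; apply/orP; left; apply/eqP.
  by apply: eq_integral => t _; rewrite -poweR_EFin -nE.
case: q q1 hL => [q q1|_|]//=; last first.
  move=> /ereal_supP h; split; last by rewrite ltxx.
  by move=> k; apply: h; exists k.
rewrite lee_fin in q1; have q0 : 0 < q by lra.
set E := (\esum_(_ in _) _)%E => hL.
have E0 : (0 <= E)%E by apply: esum_ge0 => k _; exact: poweR_ge0.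
have EL : (E <= (L `^ q)%:E)%E.
  have := le_poweR (ltW q0) (poweR_ge0 _ _) hL.
  by rewrite -poweRrM mulVf ?gt_eqF// poweRe1// poweR_EFin.
split.
  move=> k; have : (local_norm p f k `^ q <= (L `^ q)%:E)%E.
    apply: le_trans EL; apply: esum_ge; exists [set k]; first by split.
    by rewrite fsbig_set1.
  move=> /(@le_poweR _ _ q^-1 _ (poweR_ge0 _ _)); rewrite invr_ge0 (ltW q0) => /(_ isT).
  by rewrite -poweRrM mulfV ?gt_eqF// poweRe1// poweR_EFin powRVK// gt_eqF.
move=> _; rewrite invrK -(esum_floor (b := fun k => local_norm p f k `^ q)%E)//.
by move=> k; exact: poweR_ge0.
Qed.

Lemma lattice_amalgam p q f lam L : (1 <= q)%E ->
  (forall k, local_norm p f k <= (lam k)%:E)%E ->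
  lp_bound (inv_exponent q) (fun t => lam (floorRn t)) L -> (amalgam_norm p q f <= L%:E)%E.
Proof.
move=> q1 nl [lamL sumL].
have n0 k : (0 <= local_norm p f k)%E by exact: Lnorm_ge0.
have L0 : 0 <= L by have /andP[h1 h2] := lamL (cstRn n 0); exact: le_trans h1 h2.
case: q q1 sumL => [q q1|_ _|]//=; last first.
  apply/ereal_supP => _ [k _ <-]; apply: le_trans (nl k) _.
  have [t tk] : exists t : Rn R n, floorRn t = k by eexists; exact: floorRn_surj.
  by have /andP[_] := lamL t; rewrite tk lee_fin.
rewrite lee_fin in q1; have q0 : 0 < q by lra.
rewrite invr_gt0 q0 invrK => /(_ isT) sumL.
rewrite -[leRHS](_ : ((L `^ q) `^ q^-1)%:E = _); last by rewrite powRVK// gt_eqF.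
rewrite -poweR_EFin; apply: le_poweR; first by rewrite invr_ge0 ltW.
  by apply: esum_ge0 => k _; exact: poweR_ge0.
apply: le_trans sumL; rewrite -(esum_floor (b := fun k => (lam k `^ q)%:E)%E); last first.
  by move=> k; rewrite lee_fin powR_ge0.
apply: le_esum => k _; rewrite -poweR_EFin.
exact: le_poweR (ltW q0) (n0 k) (nl k).
Qed.

End amalgam_norms.

Section lp_bounds.
Context {R : realType} {n : nat}.
Notation mu := (lebesgue_Rn R n).
Implicit Types (H : Rn R n -> R) (js L : R).

Lemma lp_bound_scale js H L (c : R) : 0 <= c -> measurable_fun setT H ->
  lp_bound js H L -> lp_bound js (fun t => c * H t) (c * L).
Proof.
move=> c0 mH [HL sumH].
have H0 t : 0 <= H t by have /andP[] := HL t.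
have L0 : 0 <= L by have /andP[h1 h2] := HL (cstRn n 0); exact: le_trans h1 h2.
split=> [t|js0].
  by rewrite mulr_ge0//= ler_wpM2l//; have /andP[] := HL t.
under eq_integral => t _ do rewrite powRM//.
rewrite ge0_integralZlR ?powR_ge0//; last 2 first.
- exact: measurable_funPR.
- by move=> t; exact: powR_ge0.
by rewrite powRM// EFinM; apply: lee_wpmul2l; rewrite ?lee_fin ?powR_ge0 ?sumH.
Qed.

Lemma lp_bound_le js H H' L : 0 <= js -> (forall t, 0 <= H t <= H' t) ->
  lp_bound js H' L -> lp_bound js H L.
Proof.
move=> js0 HH [HL sumH]; split=> [t|jsp].
  have /andP[h0 h1] := HH t; have /andP[_ h2] := HL t.
  by rewrite h0 (le_trans h1).
apply: le_trans (sumH jsp); apply: ge0_le_integralR => t; first exact: powR_ge0.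
by have /andP[h0 h1] := HH t; apply: powR_le; rewrite ?invr_ge0.
Qed.

End lp_bounds.

(** * Admissible symbols and exponents *)

Section operator_bound.
Context {R : realType} {n : nat}.
Notation mu := (lebesgue_Rn R n).
Notation mu2 := (lebesgue_Rn R (n + n)).
Implicit Types (f g F : Rn R n -> R[i]) (a : Rn R (n + n) -> R[i]) (H : Rn R n -> R).
Implicit Types (t u s tau : Rn R n) (p q r : \bar R) (js L : R).

Lemma floor_cat tau tau' (w : Rn R n) : floorRn tau = floorRn tau' ->
  floorRn (catRn tau w) = floorRn (catRn tau' w).
Proof.
move=> tt; apply: eq_from_tnth => i; rewrite !tnth_mktuple.
case: (split_ordP i) => j ->; rewrite ?coord_catl ?coord_catr//.
by have := congr1 (fun v => tnth v j) tt; rewrite !tnth_mktuple.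
Qed.

Lemma inv_exponent_itv q : (1 <= q)%E -> 0 <= (inv_exponent q : R) <= 1.
Proof.
case: q => [x|_|]//=; last by rewrite lexx ler01.
by rewrite lee_fin invr_ge0 => x1; rewrite invf_le1 ?(le_trans ler01)//; lra.
Qed.

(** The norm in frequency at a fixed position [tau0] is the same throughout its unit cube, so it is
    at most the integral over all positions, which is the full norm. The factor 2 comes from passing
    to L^1 on cubes. *)
Lemma symbol_lattice p q a (A : R) : (1 <= p)%E -> (1 <= q)%E -> 0 <= A -> cmeasurable a ->
  (amalgam_norm p q a <= A%:E)%E -> symbol_bound (inv_exponent q) a (2 * A).
Proof.
move=> p1 q1 A0 ma hA; have [nE hlp] := amalgam_lattice q1 A0 hA.
pose lam k := fine (local_norm p a k).
have lam0 k : 0 <= lam k by rewrite fine_ge0//; exact: Lnorm_ge0.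
have mlam : measurable_fun setT (fun z : Rn R (n + n) => lam (floorRn z)) by exact: measurable_floor.
have [hlam hsum] := lp_bound_scale (ler0n R 2) mlam hlp.
split=> //; exists (fun k => 2 * lam k); split.
- move=> k; have := @local_norm_powR _ _ p 1 a k (lam k) (lexx _) p1 (lam0 k) ma.
  rewrite powRr1 ?mulr_ge0//; under eq_integral do rewrite powRr1 ?normc_ge0//.
  by apply; rewrite {1}nE.
- by move=> k; have := hlam [tuple (tnth k i)%:~R : measurableTypeR R | i < n + n]; rewrite floorRn_surj.
move=> jq tau0; set c := (inv_exponent q)^-1.
pose h tau := (\int[mu]_w ((2 * lam (floorRn (catRn tau w))) `^ c)%:E)%E.
have m2 : measurable_fun setT (fun z : Rn R (n + n) => (2 * lam (floorRn z)) `^ c).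
  exact: (measurable_floor (fun k => (2 * lam k) `^ c)).
have h0 tau : (0 <= h tau)%E by apply: integral_geEFin0 => w; exact: powR_ge0.
have hc tau : floorRn tau = floorRn tau0 -> h tau = h tau0.
  by move=> tt; apply: eq_integral => w _; rewrite (floor_cat w tt).
have mh : measurable_fun setT h.
  apply: (@measurable_integral _ _ _ _ _ mu
    (fun tau w => ((2 * lam (floorRn (catRn tau w))) `^ c)%:E)).
    by apply/measurable_EFinP; have := measurableT_comp m2 (@measurable_catRn R n n).
  by move=> tau w; rewrite lee_fin powR_ge0.
apply: le_trans (hsum jq); rewrite integral_cat//; last 2 first.
- exact/measurable_EFinP.
- by move=> t; rewrite lee_fin powR_ge0.
rewrite -/(h tau0) -[leLHS]mule1 -(integral_same_cube tau0) -ge0_integralZl//; last 2 first.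
- by apply/measurable_EFinP; apply: measurable_same_cube => //; exact: measurable_cst.
- by move=> u _; rewrite lee_fin same_cube_ge0.
apply: ge0_le_integralT => u; first by rewrite mule_ge0 ?lee_fin ?same_cube_ge0.
rewrite same_cubeE; have [uu|_] := eqVneq (floorRn tau0) (floorRn u); last first.
  by rewrite mule0; exact: h0 u.
by rewrite mule1 -(hc u (esym uu)).
Qed.

(** The last clause looks ahead to duality: the conjugate of [rho2] is max(r, 2), so a bound against
    test functions in L^rho2 yields one in L^r on cubes. The value [rho2 = 1] belongs to
    [r = +oo]. *)
Lemma exponents r (iq : R) : (1 <= r)%E -> `|inv_exponent r - 2^-1| <= iq ->
  exists rho1 rho2 : R, [/\ 1 <= rho1, rho1 <= 2, (rho1%:E <= r)%E & 1 <= rho2] /\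
    [/\ rho2 <= 2, rho1^-1 + rho2^-1 - 1 <= iq &
      if r is r'%:E then 1 < rho2 /\ r' <= rho2 / (rho2 - 1) else rho2 = 1].
Proof.
case: r => [r r1|_|]//=; last first.
  rewrite sub0r normrN ger0_norm// => hq; exists 2, 1.
  by split; split; rewrite ?leey ?invr1 ?addrK//; lra.
rewrite lee_fin in r1; rewrite ler_norml => /andP[q1 q2].
have r0 : 0 < r by lra.
have [r2|r2] := leP r 2.
  exists r, 2; split; split; rewrite ?lee_fin//; [lra|lra|split; first lra].
  by rewrite (_ : 2 / (2 - 1) = 2 :> R)//; field; lra.
have rV : r^-1 < 2^-1 by rewrite ltf_pV2 ?posrE//; lra.
have rm : 0 < r - 1 by lra.
exists 2, (r / (r - 1)); split; split; rewrite ?lee_fin; try lra.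
- by rewrite ler_pdivlMr//; lra.
- by rewrite ler_pdivrMr//; lra.
- rewrite invf_div mulrDl mulfV ?gt_eqF//; lra.
split; first by rewrite ltr_pdivlMr//; lra.
rewrite le_eqVlt; apply/orP; left; apply/eqP; field.
by rewrite !gt_eqF//; lra.
Qed.

(** Homogeneity is read off from the convolution form, where a single integral remains. *)
Lemma averageZ (K m1 m2 c : R) (Phi1 Phi2 : Rn R (n + n) -> R) H t : 0 <= K -> 0 <= m1 -> 0 <= m2 ->
  measurable_fun setT Phi1 -> measurable_fun setT Phi2 ->
  (forall z, 0 <= Phi1 z) -> (forall z, 0 <= Phi2 z) ->
  (\int[mu2]_z (Phi1 z)%:E <= m1%:E)%E -> (\int[mu2]_z (Phi2 z)%:E <= m2%:E)%E ->
  measurable_fun setT H -> (forall s, 0 <= H s) -> 0 <= c ->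
  average K Phi1 Phi2 (fun s => c * H s) t = (c%:E * average K Phi1 Phi2 H t)%E.
Proof.
move=> K0 m10 m20 mP1 mP2 P1 P2 i1 i2 mH H0 c0.
have [P [mP P0 _ avgE]] := average_kernel K0 m10 m20 mP1 mP2 P1 P2 i1 i2.
rewrite !avgE//; last 2 first.
- exact: measurable_funM.
- by move=> s; rewrite mulr_ge0.
rewrite -ge0_integralZlR//; last 2 first.
- by apply: measurable_funM => //; exact: (measurableT_comp mH (measurable_addRnl t)).
- by move=> y; rewrite mulr_ge0.
by apply: eq_integral => y _; rewrite mulrCA.
Qed.

Lemma amalgam_local_bound r (s : \bar R) f (rho : R) L :
  1 <= rho -> (rho%:E <= r)%E -> (1 <= s)%E -> 0 <= L ->
  cmeasurable f -> (amalgam_norm r s f <= L%:E)%E ->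
  locally_bounded rho f /\ lp_bound (inv_exponent s) (psi rho f) (48 ^+ n * (2 * L)).
Proof.
move=> r1 rr s1 L0 mf hL; have [nE hlp] := amalgam_lattice s1 L0 hL.
have /andP[js0 js1] := inv_exponent_itv s1.
apply: (psi_lattice r1 js0 js1 (lam := fun k => 2 * fine (local_norm r f k))) => //.
  by apply: lp_bound_scale => //; exact: (measurable_floor (fun k => fine (local_norm r f k))).
move=> k; apply: (local_norm_powR r1 rr) => //; last by rewrite {1}nE.
by rewrite fine_ge0//; exact: Lnorm_ge0.
Qed.

End operator_bound.

Section operator_estimate.
Context {R : realType} {n : nat}.
Notation mu := (lebesgue_Rn R n).
Notation mu2 := (lebesgue_Rn R (n + n)).
Implicit Types (f g F : Rn R n -> R[i]) (a : Rn R (n + n) -> R[i]) (t u tau : Rn R n).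

(* Duality against test functions supported on the cube of t. *)
Lemma local_norm_dual (K m1 m2 rho1 rho2 : R) (r : \bar R) (Phi1 Phi2 : Rn R (n + n) -> R) f F t :
  0 <= K -> 0 <= m1 -> 0 <= m2 ->
  measurable_fun setT Phi1 -> measurable_fun setT Phi2 ->
  (forall z, 0 <= Phi1 z) -> (forall z, 0 <= Phi2 z) ->
  (\int[mu2]_z (Phi1 z)%:E <= m1%:E)%E -> (\int[mu2]_z (Phi2 z)%:E <= m2%:E)%E ->
  1 <= rho2 -> (1 <= r)%E -> cmeasurable f -> cmeasurable F ->
  (if r is r'%:E then 1 < rho2 /\ r' <= rho2 / (rho2 - 1) else rho2 = 1) ->
  average K Phi1 Phi2 (psi rho1 f) t \is a fin_num ->
  (forall g, weight_bounded g -> cintegrable mu (fun u => F u * conjc (g u))) ->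
  (forall g, weight_bounded g -> ((normc (cintegral mu (fun u => F u * conjc (g u))))%:E <=
     \int[mu2]_z1 \int[mu2]_z2 ((Phi1 z1 * Phi2 z2)%:E * \int[mu]_tau
       (K * (psi rho1 f (addRn tau (posn z1)) * psi rho2 g (addRn tau (posn z2))))%:E))%E) ->
  (local_norm r F (floorRn t) <= (2 * fine (average K Phi1 Phi2 (psi rho1 f) t))%:E)%E.
Proof.
move=> K0 m10 m20 mP1 mP2 P1 P2 i1 i2 r21 r1 mf mF hr afin iF bF.
have r20 : 0 < rho2 by lra.
set X := fine _.
have X0 : 0 <= X.
  apply: fine_ge0; apply: integral_ge0 => z1 _; apply: integral_ge0 => z2 _.
  apply: mule_ge0; first by rewrite lee_fin mulr_ge0.
  by apply: integral_geEFin0 => tau; rewrite !mulr_ge0 ?psi_ge0.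
have dual g Y : weight_bounded g -> supported (floorRn t) g -> 0 <= Y ->
    (\int[mu]_u (normc (g u) `^ rho2)%:E <= (Y `^ rho2)%:E)%E ->
    normc (cintegral mu (fun u => F u * conjc (g u))) <= X * Y.
  move=> gw gt Y0 gY; rewrite -lee_fin; apply: le_trans (bF g gw) _.
  have avgZ := @averageZ _ _ K m1 m2 Y Phi1 Phi2 (psi rho1 f) t K0 m10 m20 mP1 mP2 P1 P2 i1 i2
    (measurable_psi rho1 mf) (psi_ge0 rho1 f) Y0.
  have -> : (X * Y)%:E = average K Phi1 Phi2 (fun s => Y * psi rho1 f s) t.
    by rewrite avgZ -(fineK afin) -EFinM mulrC.
  apply: le_double_integral => // z1 z2 tau; apply/andP; split.
    by rewrite !mulr_ge0 ?psi_ge0.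
  apply: ler_wpM2l => //; rewrite -mulrA mulrCA; apply: ler_wpM2l; first exact: psi_ge0.
  exact: psi_supported.
case: r r1 hr => [r r1 [r2 rr]|_ hr|]//; last first.
  apply/local_norm_sup_le.
  have := duality_sup mF X0 iF dual hr; apply: filterS => u /le_trans; apply.
  by rewrite ler_peMl//; lra.
rewrite lee_fin in r1; have rp : 0 < rho2 / (rho2 - 1) by lra.
have := duality_powR mF iF dual r2.
move=> /(local_norm_fin_le _ _ rp X0) h.
apply/local_norm_fin_le; rewrite ?mulr_ge0//; first by lra.
by apply: local_norm_powR h => //; rewrite lee_fin.
Qed.

(** [F] is fixed before the numbers [A], [m1], [m2], [L]. These are allowed to be any positive upper
    bounds, since averaging needs positive masses whereas the symbol or a window may vanish. *)
Lemma operator_bound (e iq : R) (r s : \bar R) : 0 < e -> e <= 1 -> (1 <= r)%E -> (1 <= s)%E ->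
  0 <= iq -> `|inv_exponent r - 2^-1| <= iq ->
  exists2 C : R, 0 < C & forall a (A0 : R) phi1 phi2 (Phi1 Phi2 : Rn R (n + n) -> R) (M1 M2 : R) f,
    symbol_bound iq a A0 -> dominated e phi1 Phi1 -> dominated e phi2 Phi2 ->
    0 <= A0 -> 0 <= M1 -> 0 <= M2 ->
    (\int[mu2]_z (Phi1 z)%:E <= M1%:E)%E -> (\int[mu2]_z (Phi2 z)%:E <= M2%:E)%E ->
    amalgam r s f ->
    exists F : Rn R n -> R[i], [/\ cmeasurable F,
      forall x w, cintegrable mu (stft_integrand phi1 f x w),
      forall g, weight_bounded g ->
        [/\ forall x w, cintegrable mu (stft_integrand phi2 g x w),
            cintegrable mu2 (localization_integrand a phi1 phi2 f g),
            cintegrable mu (fun t => F t * conjc (g t)) &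
            cintegral mu (fun t => F t * conjc (g t)) =
              cintegral mu2 (localization_integrand a phi1 phi2 f g)] &
      forall A m1 m2 L : R, 0 < A -> 0 < m1 -> 0 < m2 -> A0 <= A -> M1 <= m1 -> M2 <= m2 -> 0 <= L ->
        (amalgam_norm r s f <= L%:E)%E -> (amalgam_norm r s F <= (C * (A * m1 * m2) * L)%:E)%E].
Proof.
move=> e0 e1 r1 s1 iq0 hr.
have [rho1 [rho2 [[r11 r12 r1r r21] [r22 hq hrr]]]] := exponents r1 hr.
have [C0 C00 dens] := @localization_density R n e rho1 rho2 iq e0 e1 r11 r12 r21 r22 iq0 hq.
have /andP[js0 js1] := inv_exponent_itv s1.
(* 8 collects three factors 2, from the local norm of [f], from averaging and from duality; [6 ^+ n]
   is the volume in the averaging kernel, and [48 ^+ n] comes from [psi_lattice]. *)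
exists (8 * C0 * 6 ^+ n * 48 ^+ n); first by rewrite !mulr_gt0 ?exprn_gt0.
move=> a A0 phi1 phi2 Phi1 Phi2 M1 M2 f sa d1 d2 A00 M10 M20 hM1 hM2 [mf foo].
have norm0 : (0 <= amalgam_norm r s f)%E by exact: amalgam_norm_ge0.
pose L0 := fine (amalgam_norm r s f).
have L00 : 0 <= L0 by exact: fine_ge0.
have nL0 : (amalgam_norm r s f <= L0%:E)%E by rewrite fineK// ge0_fin_numE.
have [lf [fK _]] := amalgam_local_bound r11 r1r s1 L00 mf nL0.
have fK' t : psi rho1 f t <= 48 ^+ n * (2 * L0) by have /andP[] := fK t.
have [mphi1 mP1 P10 dom1] := d1; have [mphi2 mP2 P20 dom2] := d2.
have [F mF hF] := dens a A0 phi1 phi2 Phi1 Phi2 M1 M2 _ f sa d1 d2 A00 M10 M20 hM1 hM2 lf fK'.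
exists F; split.
- exact: mF.
- by have [] := dom1 f mf (locally_bounded_window r11 e0 e1 lf).
- move=> g gw; have [h1 h2 h3 [lg _]] := hF g gw; split=> //.
  by have [] := dom2 g lg.1 (locally_bounded_window r21 e0 e1 lg).
move=> A m1 m2 L A1 m10 m20 A0A Mm1 Mm2 Lge0 nL.
have [_ hpsi] := amalgam_local_bound r11 r1r s1 Lge0 mf nL.
have K0 : 0 < C0 * A by rewrite mulr_gt0.
have i1 : (\int[mu2]_z (Phi1 z)%:E <= m1%:E)%E by apply: le_trans hM1 _; rewrite lee_fin.
have i2 : (\int[mu2]_z (Phi2 z)%:E <= m2%:E)%E by apply: le_trans hM2 _; rewrite lee_fin.
have [mavg afin hX] := average_lattice K0 m10 m20 js0 js1 mP1 mP2 P10 P20 i1 i2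
  (measurable_psi rho1 mf) hpsi.
set X := fine \o _ in hX.
have mX : measurable_fun setT X by exact: measurableT_comp.
have h2X := lp_bound_scale (ler0n R 2) mX hX.
have nF t : (local_norm r F (floorRn t) <= (2 * X t)%:E)%E.
  apply: (@local_norm_dual _ m1 m2 rho1 rho2) => //; rewrite ?(ltW K0) ?(ltW m10) ?(ltW m20)//.
    by move=> g gw; have [] := hF g gw.
  move=> g gw; have [h1 h2 h3 [_ h4]] := hF g gw.
  rewrite h3; apply: le_trans (normc_cintegral h1) _; apply: le_trans h4 _.
  apply: le_double_integral => // z1 z2 tau; apply/andP; split.
    by rewrite !mulr_ge0 ?psi_ge0 ?(ltW C00).
  apply: ler_wpM2r; first by rewrite mulr_ge0 ?psi_ge0.
  by rewrite ler_wpM2l ?(ltW C00).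
pose lam k := fine (local_norm r F k).
have lamE k : (local_norm r F k <= (lam k)%:E)%E.
  rewrite /lam fineK// ge0_fin_numE ?Lnorm_ge0//.
  by have := nF [tuple (tnth k i)%:~R : measurableTypeR R | i < n];
    rewrite floorRn_surj => /le_lt_trans; apply; exact: ltry.
apply: (lattice_amalgam s1 lamE).
have -> : 8 * C0 * 6 ^+ n * 48 ^+ n * (A * m1 * m2) * L =
    2 * (2 * (C0 * A * 6 ^+ n * m1 * m2) * (48 ^+ n * (2 * L))) by ring.
apply: lp_bound_le h2X => // t; rewrite /lam fine_ge0 ?Lnorm_ge0//=.
have fin : local_norm r F (floorRn t) \is a fin_num.
  by rewrite ge0_fin_numE ?Lnorm_ge0//; apply: le_lt_trans (nF t) _; exact: ltry.
by rewrite -lee_fin fineK.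
Qed.

End operator_estimate.

(** * Amalgam spaces are closed under linear combinations *)

Section linear_combinations.
Context {R : realType} {n : nat}.
Notation mu := (lebesgue_Rn R n).
Implicit Types (f g F : Rn R n -> R[i]) (H : Rn R n -> R) (p : \bar R).

Lemma powR_add_le (x y q : R) : 0 <= q -> 0 <= x -> 0 <= y ->
  (x + y) `^ q <= 2 `^ q * (x `^ q + y `^ q).
Proof.
move=> q0 x0 y0; wlog xy : x y x0 y0 / x <= y.
  move=> h; have [xy|/ltW yx] := leP x y; first exact: h.
  by rewrite addrC [X in _ * X]addrC; exact: h.
apply: (@le_trans _ _ ((2 * y) `^ q)); first by apply: powR_le; rewrite ?addr_ge0//; lra.
by rewrite powRM// ler_wpM2l ?powR_ge0// lerDr powR_ge0.
Qed.

Lemma powR_sum_le (x y q : R) : 1 <= q -> 0 <= x -> 0 <= y ->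
  2 `^ q * (x `^ q + y `^ q) <= (4 * (x + y)) `^ q.
Proof.
move=> q1 x0 y0; have q0 : 0 <= q by lra.
have two : 2 <= 2 `^ q :> R by rewrite -[leLHS]powRr1//; apply: ler_powR => //; lra.
rewrite (_ : 4 * (x + y) = 2 * (2 * (x + y))); last by ring.
rewrite powRM ?mulr_ge0 ?addr_ge0// ler_wpM2l ?powR_ge0// powRM ?addr_ge0//.
apply: (@le_trans _ _ (2 * (x + y) `^ q)); last by rewrite ler_wpM2r ?powR_ge0.
have : x `^ q <= (x + y) `^ q by apply: powR_le; rewrite // lerDl.
have : y `^ q <= (x + y) `^ q by apply: powR_le; rewrite // lerDr.
lra.
Qed.

Lemma lp_boundD (js : R) H1 H2 (L1 L2 : R) : js <= 1 ->
  measurable_fun setT H1 -> measurable_fun setT H2 ->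
  lp_bound js H1 L1 -> lp_bound js H2 L2 -> lp_bound js (fun t => H1 t + H2 t) (4 * (L1 + L2)).
Proof.
move=> js1 m1 m2 [h1 s1] [h2 s2].
have p1 t : 0 <= H1 t by have /andP[] := h1 t.
have p2 t : 0 <= H2 t by have /andP[] := h2 t.
have l1 : 0 <= L1 by have /andP[a1 a2] := h1 (cstRn n 0); exact: le_trans a1 a2.
have l2 : 0 <= L2 by have /andP[a1 a2] := h2 (cstRn n 0); exact: le_trans a1 a2.
split=> [t|jsp].
  by have /andP[a1 a2] := h1 t; have /andP[a3 a4] := h2 t; apply/andP; split; lra.
have q1 : 1 <= js^-1 by rewrite invf_ge1.
have q0 : 0 <= js^-1 by lra.
apply: (@le_trans _ _ (\int[mu]_t (2 `^ js^-1 * (H1 t `^ js^-1 + H2 t `^ js^-1))%:E)%E).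
  by apply: ge0_le_integralR => t; [exact: powR_ge0|exact: powR_add_le].
rewrite ge0_integralZlR ?powR_ge0//; last 2 first.
- by apply: measurable_funD; exact: measurable_funPR.
- by move=> t; rewrite addr_ge0 ?powR_ge0.
rewrite ge0_integralDR; last 4 first.
- exact: measurable_funPR.
- exact: measurable_funPR.
- by move=> t; exact: powR_ge0.
- by move=> t; exact: powR_ge0.
apply: (@le_trans _ _ ((2 `^ js^-1)%:E * ((L1 `^ js^-1)%:E + (L2 `^ js^-1)%:E))%E).
  apply: lee_wpmul2l; first by rewrite lee_fin powR_ge0.
  by apply: leeD; [exact: s1|exact: s2].
by rewrite -EFinD -EFinM lee_fin; exact: powR_sum_le.
Qed.

Lemma local_norm_lin p (c : R[i]) f g k (N1 N2 : R) : (1 <= p)%E -> cmeasurable f -> cmeasurable g ->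
  0 <= N1 -> 0 <= N2 -> (local_norm p f k <= N1%:E)%E -> (local_norm p g k <= N2%:E)%E ->
  (local_norm p (fun t => (c * f t + g t)%R) k <= (4 * (normc c * N1 + N2))%:E)%E.
Proof.
move=> p1 mf mg N10 N20.
have tri t : normc (c * f t + g t) <= normc c * normc (f t) + normc (g t).
  by apply: le_trans (le_normcD _ _) _; rewrite Normc.normcM.
have M0 : 0 <= normc c * N1 + N2 by rewrite addr_ge0// mulr_ge0 ?normc_ge0.
case: p p1 => [r r1|_|]//; last first.
  move=> /local_norm_sup_le h1 /local_norm_sup_le h2; apply/local_norm_sup_le.
  apply: filterS2 h1 h2 => t h1 h2.
  apply: (@le_trans _ _ (normc c * N1 + N2)); last by rewrite ler_peMl//; lra.
  apply: (@le_trans _ _ (\1_(cube k) t * (normc c * normc (f t) + normc (g t)))).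
    by rewrite ler_wpM2l.
  by rewrite mulrDr mulrCA lerD// ler_wpM2l ?normc_ge0.
rewrite lee_fin in r1; have r0 : 0 < r by lra.
move=> /(local_norm_fin_le _ _ r0 N10) h1 /(local_norm_fin_le _ _ r0 N20) h2.
apply/local_norm_fin_le; rewrite ?mulr_ge0//.
have mI : measurable_fun setT (\1_(cube k) : Rn R n -> R).
  by apply: measurable_indic; exact: measurable_cube.
have mIf (h : Rn R n -> R[i]) : cmeasurable h ->
    measurable_fun setT (fun t => \1_(cube k) t * normc (h t) `^ r).
  by move=> mh; apply: measurable_funM => //; exact/measurable_funPR/measurable_normc.
have I0 (h : Rn R n -> R[i]) t : 0 <= \1_(cube k) t * normc (h t) `^ r by rewrite mulr_ge0 ?powR_ge0.
have cr0 : 0 <= normc c `^ r by exact: powR_ge0.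
apply: (@le_trans _ _ (\int[mu]_t (2 `^ r * (normc c `^ r * (\1_(cube k) t * normc (f t) `^ r) +
    \1_(cube k) t * normc (g t) `^ r))%:E)%E).
  apply: ge0_le_integralR => t; first exact: (I0 (fun t => c * f t + g t)).
  rewrite mulrCA -mulrDr mulrCA; apply: ler_wpM2l => //.
  rewrite -powRM ?normc_ge0//.
  apply: le_trans (powR_le (ltW r0) (normc_ge0 _) (tri t)) _.
  by apply: powR_add_le; rewrite ?mulr_ge0 ?normc_ge0// ltW.
rewrite ge0_integralZlR ?powR_ge0//; last 2 first.
- by apply: measurable_funD; [apply: measurable_funM => //|]; exact: mIf.
- by move=> t; rewrite addr_ge0// mulr_ge0.
rewrite ge0_integralDR; last 4 first.
- by apply: measurable_funM => //; exact: mIf.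
- exact: mIf.
- by move=> t; rewrite mulr_ge0.
- by move=> t; exact: I0.
rewrite ge0_integralZlR//; last exact: mIf.
apply: (@le_trans _ _ ((2 `^ r)%:E * ((normc c `^ r)%:E * (N1 `^ r)%:E + (N2 `^ r)%:E))%E).
  apply: lee_wpmul2l; first by rewrite lee_fin powR_ge0.
  by apply: leeD => //; apply: lee_wpmul2l.
rewrite -[leLHS]/((2 `^ r * (normc c `^ r * N1 `^ r + N2 `^ r))%:E) lee_fin -powRM ?normc_ge0//.
by apply: powR_sum_le; rewrite ?mulr_ge0 ?normc_ge0.
Qed.

(** Needed before linearity of the operator can be discussed, since it has to be applied to
    [c f + g]. Only finiteness matters, so a quasi-triangle inequality is enough. *)
Lemma amalgam_lin (p q : \bar R) (c : R[i]) f g : (1 <= p)%E -> (1 <= q)%E ->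
  amalgam p q f -> amalgam p q g -> amalgam p q (fun t => c * f t + g t).
Proof.
move=> p1 q1 [mf nf] [mg ng]; split.
  by apply: cmeasurableD => //; apply: cmeasurableM => //; exact: cmeasurable_cst.
have fin (h : Rn R n -> R[i]) : (amalgam_norm p q h < +oo)%E ->
    exists2 L : R, 0 <= L & (amalgam_norm p q h <= L%:E)%E.
  case: (amalgam_norm p q h) => [L _|//|_]; last by exists 0 => //; rewrite leNye.
  by exists `|L| => //; rewrite lee_fin ler_norm.
have [L1 L10 h1] := fin _ nf; have [L2 L20 h2] := fin _ ng.
have [e1 b1] := amalgam_lattice q1 L10 h1; have [e2 b2] := amalgam_lattice q1 L20 h2.
have /andP[_ js1] := @inv_exponent_itv R q q1.
pose l1 k := fine (local_norm p f k); pose l2 k := fine (local_norm p g k).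
have l10 k : 0 <= l1 k by rewrite fine_ge0 ?Lnorm_ge0.
have l20 k : 0 <= l2 k by rewrite fine_ge0 ?Lnorm_ge0.
have ml l : measurable_fun setT (fun t : Rn R n => l (floorRn t) : R) by exact: measurable_floor.
have nl k : (local_norm p (fun t => (c * f t + g t)%R) k <= (4 * (normc c * l1 k + l2 k))%:E)%E.
  by apply: local_norm_lin => //; rewrite /l1 /l2 -?e1 -?e2.
have b := lp_bound_scale (ler0n R 4) _ (lp_boundD js1 _ _ (lp_bound_scale (normc_ge0 c) (ml l1) b1) b2).
apply: le_lt_trans (lattice_amalgam q1 nl (b _ _ _)) (ltry _).
- apply: measurable_funD; last exact: (ml l2).
  by apply: measurable_funM => //; exact: (ml l1).
- by apply: measurable_funM => //; exact: (ml l1).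
- exact: (ml l2).
Qed.

End linear_combinations.

(** * Uniqueness of the density *)

Section uniqueness.
Context {R : realType} {n : nat}.
Notation mu := (lebesgue_Rn R n).
Implicit Types (f g F D : Rn R n -> R[i]).

Let test (a b : Rn R n) t : R[i] := (\1_(box a b) t * weight t)%:C%C.

Let weight_bounded_test (a b : Rn R n) : weight_bounded (test a b).
Proof.
split.
  apply: cmeasurable_real; apply: measurable_funM; last exact: measurable_weight.
  by apply: measurable_indic; exact: measurable_box.
exists 1 => t; rewrite normc_real ger0_norm ?mulr_ge0 ?weight_ge0//.
by rewrite ler_wpM2r ?weight_ge0 ?indic_le1.
Qed.

Let weight_bounded_weight : weight_bounded (fun t : Rn R n => (weight t)%:C%C : R[i]).
Proof.
split; first by apply: cmeasurable_real; exact: measurable_weight.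
by exists 1 => t; rewrite normc_real mul1r ger0_norm ?weight_ge0.
Qed.

(** Testing against the weight itself makes [D * weight] integrable, and testing against its
    restrictions to boxes makes its box integrals vanish; the weight is positive everywhere. *)
Lemma weak_eq0 D : (forall g, weight_bounded g -> cintegrable mu (fun t => D t * conjc (g t))) ->
  (forall g, weight_bounded g -> cintegral mu (fun t => D t * conjc (g t)) = 0) ->
  {ae mu, forall t, D t = 0}.
Proof.
move=> iD D0; have iw := iD _ weight_bounded_weight.
have part (q : R[i] -> R) : q = (@complex.Re R) \/ q = (@complex.Im R) ->
    {ae mu, forall t, q (D t) = 0}.
  move=> hq.
  have qZ (x : R[i]) (y : R) : q (x * conjc y%:C%C) = q x * y.
    by case: hq => ->; case: x => x1 x2 /=; ring.
  have qint h : cintegrable mu h -> mu.-integrable setT (fun t => (q (h t))%:E).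
    by case: hq => -> -[].
  have iqw : mu.-integrable setT (EFin \o (fun t => q (D t) * weight t)).
    have := qint _ iw; congr (_.-integrable _ _); apply/funext => t /=.
    by rewrite qZ.
  have q0 : {ae mu, forall t, q (D t) * weight t = 0}.
    apply: integral_box_ae0 iqw _ => a b.
    have it := iD _ (weight_bounded_test a b).
    have Et : \int[mu]_t (q (D t * conjc (test a b t))) = 0.
      by have [] := hq => ->; have /(congr1 (@complex.Re R)) := D0 _ (weight_bounded_test a b);
        have /(congr1 (@complex.Im R)) := D0 _ (weight_bounded_test a b).
    apply: (@eq_trans _ _ (\int[mu]_t (q (D t * conjc (test a b t))))%:E); last by rewrite Et.
    rewrite integral_mkcond /Rintegral fineK; last first.
      exact: (integrable_fin_num measurableT (qint _ it)).
    apply: eq_integral => t _; rewrite qZ /patch indicE; case: ifP => _; last by rewrite mul0r mulr0.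
    by rewrite mul1r.
  apply: filterS q0 => t /eqP; rewrite mulf_eq0 [weight t == 0]gt_eqF ?weight_gt0// orbF.
  by move/eqP.
apply: filterS2 (part _ (or_introl erefl)) (part _ (or_intror erefl)) => t.
by case: (D t) => x y /= -> ->.
Qed.

End uniqueness.


(** * From the modulation norm to domination, and the final limit *)

Section modulation_space.
Context {R : realType} {n : nat}.
Notation mu := (lebesgue_Rn R n).
Notation mu2 := (lebesgue_Rn R (n + n)).
Implicit Types (phi gamma : Rn R n -> R[i]) (u : (Rn R n -> R[i]) -> R[i]).

Lemma inv_exponentE (q : \bar R) : (1 <= q)%E -> (q^-1)%E = (inv_exponent q)%:E.
Proof.
case: q => [q|_|]//=.
by rewrite lee_fin => q1; rewrite inver gt_eqF//; lra.
Qed.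

Lemma M1_normE gamma u : M1_norm gamma u = (\int[mu2]_z (normc (stft_dist gamma u z))%:E)%E.
Proof.
rewrite /M1_norm /cLnorm Lnorm1; apply: eq_integral => z _.
by rewrite gee0_abs// lee_fin normc_ge0.
Qed.

Lemma M1_norm_fin gamma u : M1 gamma u -> M1_norm gamma u = (fine (M1_norm gamma u))%:E.
Proof.
move=> [_ h]; rewrite fineK// ge0_fin_numE// M1_normE.
by apply: integral_geEFin0 => z; exact: normc_ge0.
Qed.

Lemma M1_dominated gamma (e : R) b : schwartz gamma -> 0 < e -> pairing e b gamma != 0 ->
  exists2 c : R, 0 < c & forall u phi, M1 gamma u -> represents phi u ->
    exists2 Phi, dominated e phi Phi &
      (\int[mu2]_z (Phi z)%:E <= (c * fine (M1_norm gamma u))%:E)%E.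
Proof.
move=> sg e0 pn0; have p0 : 0 < normc (pairing e b gamma).
  by rewrite lt_neqAle normc_ge0 eq_sym andbT; apply: contra_neq pn0 => /Normc.eq0_normc.
exists (normc (pairing e b gamma))^-1; first by rewrite invr_gt0.
move=> u phi M1u ru.
have oo : (\int[mu2]_z (normc (stft_dist gamma u z))%:E < +oo)%E.
  by rewrite -M1_normE; exact: M1u.2.
have dom := represents_dominated sg ru e0 pn0 oo.
eexists; first exact: dom.
have ms : measurable_fun setT (fun z => normc (stft_dist gamma u z)).
  exact: measurable_normc (cmeasurable_stft_dist sg ru).
rewrite ge0_integralZlR ?invr_ge0 ?(ltW p0)//; last 2 first.
- apply: (measurableT_comp ms); apply: measurable_subRn => //; exact: measurable_cst.
- by move=> z; exact: normc_ge0.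
rewrite (@integral_subl _ _ (fun z => (normc (stft_dist gamma u z))%:E)); last 2 first.
- exact/measurable_EFinP.
- by move=> z; rewrite lee_fin normc_ge0.
by rewrite -M1_normE (M1_norm_fin M1u).
Qed.

Lemma schwartz_weight_bounded g : schwartz g -> @weight_bounded R n g.
Proof.
move=> sg; split; first exact: schwartz_measurable.
by have [M hM] := schwartz_decay 1 [::] sg; exists M => t; have := hM t; rewrite expr1.
Qed.

(** The limit as [e] tends to 0, made explicit: for [e <= 1] the increment of the product is at most
    [e * D], and the summand 1 keeps [D] positive. *)
Lemma le_shifted_product (v : \bar R) (C x y z : R) : 0 <= C -> 0 <= x -> 0 <= y -> 0 <= z ->
  (forall e, 0 < e -> (v <= (C * ((x + e) * (y + e) * (z + e)))%:E)%E) ->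
  (v <= (C * (x * y * z))%:E)%E.
Proof.
move=> C0 x0 y0 z0 h; pose D := C * ((y + 1) * (z + 1) + x * (z + 1) + x * y) + 1.
have D0 : 0 < D by rewrite ltr_wpDl// mulr_ge0// !addr_ge0 ?mulr_ge0 ?addr_ge0.
apply/lee_addgt0Pr => d d0.
pose e := Num.min 1 (d / D).
have e0 : 0 < e by rewrite lt_min ltr01 divr_gt0.
have e1 : e <= 1 by rewrite ge_min lexx.
have eD : e * D <= d by rewrite -ler_pdivlMr// ge_min lexx orbT.
apply: le_trans (h e e0) _; rewrite -EFinD lee_fin.
apply: le_trans (lerD (lexx _) eD).
have h1 : (y + e) * (z + e) <= (y + 1) * (z + 1).
  by apply: ler_pM; rewrite ?addr_ge0 ?(ltW e0)// lerD2l.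
have h2 : x * (z + e) <= x * (z + 1) by rewrite ler_wpM2l// lerD2l.
have h3 : C * ((y + e) * (z + e) + x * (z + e) + x * y) + 1 <= 
   C * ((y + 1) * (z + 1) + x * (z + 1) + x * y) + 1.
  by rewrite lerD2r ler_wpM2l// lerD2r lerD.
have h4 := ler_wpM2l (ltW e0) h3.
apply: le_trans (lerD (lexx _) h4).
rewrite -subr_ge0 (_ : _ - _ = e); first exact: ltW.
by ring.
Qed.

End modulation_space.


(** * Construction of the operator *)

Theorem theorem4p5 (R : realType) (d : nat) (p q r s : \bar R)
    (gamma : Rn R d -> R[i]) :
  (0 < d)%N ->
  (1 <= p)%E -> (1 <= q)%E -> (1 <= r)%E -> (1 <= s)%E ->
  (`|r^-1 - (2^-1)%:E| <= q^-1)%E ->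
  schwartz gamma -> (exists t, gamma t != 0) ->
  exists C : R, 0 < C /\
    forall (a : Rn R (d + d) -> R[i]) (u1 u2 : (Rn R d -> R[i]) -> R[i])
      (phi1 phi2 : Rn R d -> R[i]),
    amalgam p q a ->
    M1 gamma u1 -> represents phi1 u1 ->
    M1 gamma u2 -> represents phi2 u2 ->
    exists A : (Rn R d -> R[i]) -> (Rn R d -> R[i]),
      [/\ is_localization_operator a phi1 phi2 (amalgam r s) A,
          amalgam_bounded_operator r s A &
          (amalgam_opnorm r s A <=
             C%:E * amalgam_norm p q a * M1_norm gamma u1 * M1_norm gamma u2)%E].
Proof.
move=> d0 p1 q1 r1 s1 hr sg [b gb].
have [e [e0 e1 pn0]] := window_pairing_neq0 sg gb.
have [c c0 dom] := M1_dominated sg e0 pn0.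
have /andP[iq0 _] := @inv_exponent_itv R q q1.
have hr' : `|inv_exponent r - 2^-1| <= inv_exponent q :> R.
  by move: hr; rewrite !inv_exponentE// -EFinB abse_EFin lee_fin.
have [C C0 bound] := @operator_bound R d e (inv_exponent q) r s e0 e1 r1 s1 iq0 hr'.
(* The factor 2 comes from the lattice norm of the symbol, one [c] from each of the two windows. *)
exists (C * 2 * c * c); split; first by rewrite !mulr_gt0.
move=> a u1 u2 phi1 phi2 [ma noo] M1u1 ru1 M1u2 ru2.
have na0 : (0 <= amalgam_norm p q a)%E by exact: amalgam_norm_ge0.
pose N := fine (amalgam_norm p q a); pose N1 := fine (M1_norm gamma u1).
pose N2 := fine (M1_norm gamma u2).
have N0 : 0 <= N by exact: fine_ge0.
have N10 : 0 <= N1 by rewrite fine_ge0// M1_normE integral_geEFin0// => z; exact: normc_ge0.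
have N20 : 0 <= N2 by rewrite fine_ge0// M1_normE integral_geEFin0// => z; exact: normc_ge0.
have NE : amalgam_norm p q a = N%:E by rewrite fineK// ge0_fin_numE.
have sa : symbol_bound (inv_exponent q) a (2 * N).
  by apply: symbol_lattice p1 q1 N0 ma _; rewrite NE.
have [Phi1 dPhi1 iPhi1] := dom _ _ M1u1 ru1.
have [Phi2 dPhi2 iPhi2] := dom _ _ M1u2 ru2.
(* The property is made conditional on membership, with value 0 outside the space, so that the axiom
   of choice can be applied over all functions. *)
have spec f : exists F : Rn R d -> R[i], amalgam r s f -> [/\ cmeasurable F,
    forall x w, cintegrable (lebesgue_Rn R d) (stft_integrand phi1 f x w),
    forall g, weight_bounded g ->
      [/\ forall x w, cintegrable (lebesgue_Rn R d) (stft_integrand phi2 g x w),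
          cintegrable (lebesgue_Rn R (d + d)) (localization_integrand a phi1 phi2 f g),
          cintegrable (lebesgue_Rn R d) (fun t => F t * conjc (g t)) &
          cintegral (lebesgue_Rn R d) (fun t => F t * conjc (g t)) =
            cintegral (lebesgue_Rn R (d + d)) (localization_integrand a phi1 phi2 f g)] &
    forall A m1 m2 L : R, 0 < A -> 0 < m1 -> 0 < m2 -> 2 * N <= A -> c * N1 <= m1 -> c * N2 <= m2 ->
      0 <= L -> (amalgam_norm r s f <= L%:E)%E ->
      (amalgam_norm r s F <= (C * (A * m1 * m2) * L)%:E)%E].
  have [Xf|nXf] := pselect (amalgam r s f); last by exists (fun=> 0).
  have [F hF] := bound a (2 * N) phi1 phi2 Phi1 Phi2 (c * N1) (c * N2) f sa dPhi1 dPhi2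
    (mulr_ge0 (ler0n R 2) N0) (mulr_ge0 (ltW c0) N10) (mulr_ge0 (ltW c0) N20) iPhi1 iPhi2 Xf.
  by exists F.
have [A hA] := choice spec.
(* The bound is known for positive majorants of the three norms; letting the shift tend to 0
   includes the case where one of them vanishes. *)
have estimate f (L : R) : amalgam r s f -> 0 <= L -> (amalgam_norm r s f <= L%:E)%E ->
    (amalgam_norm r s (A f) <= (C * L * (2 * N * (c * N1) * (c * N2)))%:E)%E.
  move=> Xf L0 nL; have [_ _ _ bd] := hA f Xf.
  apply: le_shifted_product; rewrite ?mulr_ge0 ?(ltW C0) ?(ltW c0)// => h h0.
  rewrite -mulrA [L * _]mulrC mulrA; apply: bd => //.
  - by rewrite ltr_wpDl ?mulr_ge0.
  - by rewrite ltr_wpDl ?mulr_ge0 ?(ltW c0).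
  - by rewrite ltr_wpDl ?mulr_ge0 ?(ltW c0).
  - by rewrite lerDl ltW.
  - by rewrite lerDl ltW.
  - by rewrite lerDl ltW.
have opbound : (amalgam_opnorm r s A <= (C * 1 * (2 * N * (c * N1) * (c * N2)))%:E)%E.
  by apply/ereal_supP => _ [f [Xf f1] <-]; exact: estimate.
exists A; split.
- move=> f g Xf /schwartz_weight_bounded gw.
  by have [_ h1 /(_ g gw)[h2 h3 h4 h5] _] := hA f Xf.
- split; last exact: le_lt_trans opbound (ltry _).
    move=> f Xf; have [mA _ _ _] := hA f Xf; split=> //.
    have nf0 : (0 <= amalgam_norm r s f)%E by exact: amalgam_norm_ge0.
    apply: le_lt_trans (estimate f (fine (amalgam_norm r s f)) Xf _ _) (ltry _).
      exact: fine_ge0.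
    by rewrite fineK// ge0_fin_numE//; exact: Xf.2.
  (* The images were chosen independently of one another, so linearity is not built in. The defect
     integrates to zero against every test function because the form is linear in [f], and
     uniqueness of densities makes it vanish almost everywhere. *)
  move=> z f g Xf Xg; have Xz := amalgam_lin z r1 s1 Xf Xg.
  have [_ _ hz _] := hA _ Xz; have [_ if1 hf _] := hA f Xf; have [_ ig1 hg _] := hA g Xg.
  have decomp h : weight_bounded h -> forall t,
      (A (fun t => z * f t + g t) t - (z * A f t + A g t)) * conjc (h t) =
      A (fun t => z * f t + g t) t * conjc (h t) +
        (- z * (A f t * conjc (h t)) + -1 * (A g t * conjc (h t))).
    by move=> _ t; ring.
  have := @weak_eq0 R d (fun t => A (fun t => z * f t + g t) t - (z * A f t + A g t)).
  have int h : weight_bounded h -> _ := fun wh =>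
    cintegrableD (cintegrableZl (- z) (let: And4 _ _ i _ := hf h wh in i))
      (cintegrableZl (-1) (let: And4 _ _ i _ := hg h wh in i)).
  move=> weak; have : {ae lebesgue_Rn R d, forall t,
      A (fun t => z * f t + g t) t - (z * A f t + A g t) = 0}.
    apply: weak => h wh; have [_ lz iz ez] := hz h wh;
      have [_ lf iF eF] := hf h wh; have [_ lg iG eG] := hg h wh.
      under eq_fun do rewrite (decomp h wh).
      by apply: cintegrableD => //; exact: int.
    under eq_cintegral do rewrite (decomp h wh).
    rewrite cintegralD//; last exact: int.
    rewrite cintegralD; [|exact: cintegrableZl|exact: cintegrableZl].
    rewrite !cintegralZl// ez eF eG.
    have -> : cintegral (lebesgue_Rn R (d + d))
          (localization_integrand a phi1 phi2 (fun t => z * f t + g t) h) =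
        z * cintegral (lebesgue_Rn R (d + d)) (localization_integrand a phi1 phi2 f h) +
        cintegral (lebesgue_Rn R (d + d)) (localization_integrand a phi1 phi2 g h).
      rewrite -(cintegralZl z lf) -(cintegralD (cintegrableZl z lf) lg).
      apply: eq_cintegral => y; rewrite /localization_integrand.
      rewrite (stft_lin z (if1 (posn y) (freq y)) (ig1 (posn y) (freq y))).
      ring.
    by rewrite mulNr mulN1r -opprD subrr.
  by apply: filterS => t /eqP; rewrite subr_eq0 => /eqP.
- apply: le_trans opbound _.
  rewrite NE (M1_norm_fin M1u1) (M1_norm_fin M1u2) -/N1 -/N2 -!EFinM lee_fin.
  by rewrite le_eqVlt; apply/orP; left; apply/eqP; ring.
Qed.
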